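(* Let $p$ be a prime and let $A$ be an affine algebra over $\overline{\mathbb F}_p$. Let $I_1,I_2\subset A[T]$ be two ideals and $I=I_1\cap I_2$, such that: (1) $I_1$ contains a monic polynomial; (2) $I_1=(f_1,\dots,f_n)+I_1^2$ for some $f_1,\dots,f_n\in I_1$, where $n\ge\max\{\dim(A[T]/I_1)+1,\,2\}$; (3) $I_1+I_2=A[T]$; (4) $I_2=I_2(0)A[T]$ (that is, $I_2$ is extended from $A$). Suppose that there exist $a_1,\dots,a_n\in I(0)$ with $I(0)=(a_1,\dots,a_n)$ and $a_i-f_i(0)\in I_1(0)^2$ for all $i$. Then there exist $h_1,\dots,h_n\in I$ such that $I=(h_1,\dots,h_n)$ and $h_i(0)=a_i$ for all $i$.
   Context: $\overline{\mathbb F}_p$ is the algebraic closure of the field with $p$ elements; an affine algebra over it is a finitely generated commutative algebra. For an ideal $K\subset A[T]$, $K(0)=\{f(0): f\in K\}$, an ideal of $A$. *)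

(* Defs.v *)
From HB Require Import structures.
From mathcomp Require Import all_boot all_order all_algebra.
From mathcomp Require Import generic_quotient ring_quotient.
From mathcomp Require Import boolp classical_sets constructive_ereal.
From mathcomp Require mpoly.

Set Implicit Arguments.
Unset Strict Implicit.
Unset Printing Implicit Defensive.

Import Order.TTheory GRing.Theory Num.Theory.
Local Open Scope ring_scope.
Local Open Scope classical_set_scope.
Local Open Scope quotient_scope.

Section Ideals.
Variable R : comPzRingType.
Implicit Types (I J S : set R).

(* Unlike MathComp's [idealr], the improper ideal is allowed. *)
Definition is_ideal I : Prop :=
  [/\ I 0, forall x y, I x -> I y -> I (x + y) & forall a x, I x -> I (a * x)].

Definition is_prime_ideal I : Prop :=
  [/\ is_ideal I, ~ I 1 & forall x y, I (x * y) -> I x \/ I y].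

Definition ideal_gen S : set R := smallest is_ideal S.

Definition ideal_add I J : set R := [set x + y | x in I & y in J].

Definition ideal_mul I J : set R := ideal_gen [set x * y | x in I & y in J].

End Ideals.

(* [Quotient.quot] only needs an additive subgroup; its ring structure in
   MathComp is restricted to proper ideals and is redone here for all ideals,
   the quotient by the improper ideal being the zero ring. *)
Section QuotientRing.
Variables (R : comPzRingType) (I : set R) (idI : is_ideal I).

(* The proof argument lets [ideal_pred idI] carry a [zmodClosed] instance. *)
Definition ideal_pred of is_ideal I : R -> bool := fun x => `[< I x >].

Lemma ideal_pred_zmod_closed : zmod_closed (ideal_pred idI).
Proof.
have [I0 ID IM] := idI; split=> [|x y]; first exact/asboolP.
move=> /asboolP Ix /asboolP Iy; apply/asboolP.
by rewrite -mulN1r; apply: ID => //; apply: IM.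
Qed.

HB.instance Definition _ :=
  GRing.isZmodClosed.Build R (ideal_pred idI) ideal_pred_zmod_closed.

Definition ideal_zmodClosed : zmodClosed R :=
  GRing.ZmodClosed.clone R (ideal_pred idI) _.

Definition quotient_ring : Type := Quotient.quot ideal_zmodClosed.

HB.instance Definition _ := GRing.Zmodule.on quotient_ring.
HB.instance Definition _ : EqQuotient R (Quotient.equiv ideal_zmodClosed) quotient_ring :=
  EqQuotient.on quotient_ring.

Definition quotient_proj (x : R) : quotient_ring := \pi_quotient_ring x.
Definition quotient_one : quotient_ring := quotient_proj 1.
Definition quotient_mul (x y : quotient_ring) : quotient_ring :=
  quotient_proj (repr x * repr y).

Lemma quotient_projP x y : quotient_proj x = quotient_proj y <-> I (x - y).
Proof.
rewrite /quotient_proj; split.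
  by move=> /eqP; rewrite eqmodE /= Quotient.equivE => /asboolP.
by move=> Ixy; apply/eqP; rewrite eqmodE /= Quotient.equivE; apply/asboolP.
Qed.

Lemma quotient_proj_surj (u : quotient_ring) : exists x, quotient_proj x = u.
Proof. by exists (repr u); apply: reprK. Qed.

Lemma quotient_projD x y :
  quotient_proj (x + y) = quotient_proj x + quotient_proj y.
Proof. exact: Quotient.pi_add. Qed.

Lemma quotient_projB : {morph quotient_proj : x y / x - y}.
Proof.
move=> x y; rewrite quotient_projD; congr (_ + _).
exact: (@Quotient.pi_opp R ideal_zmodClosed).
Qed.

Lemma quotient_projM x y :
  quotient_proj (x * y) = quotient_mul (quotient_proj x) (quotient_proj y).
Proof.
have [_ ID IM] := idI.
have HE z : I (z - repr (quotient_proj z)).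
  by apply/quotient_projP; rewrite /quotient_proj reprK.
apply/quotient_projP; set x' := repr _; set y' := repr _.
have -> : x * y - x' * y' = y * (x - x') + x' * (y - y').
  by rewrite !mulrBr addrA [y * x]mulrC [y * x']mulrC subrK.
by apply: ID; apply: IM; apply: HE.
Qed.

Fact quotient_mulA : associative quotient_mul.
Proof.
move=> u v w; have [x <-] := quotient_proj_surj u.
have [y <-] := quotient_proj_surj v; have [z <-] := quotient_proj_surj w.
by rewrite -!quotient_projM mulrA.
Qed.

Fact quotient_mulC : commutative quotient_mul.
Proof. by move=> u v; rewrite /quotient_mul mulrC. Qed.

Fact quotient_mul1 : left_id quotient_one quotient_mul.
Proof.
move=> u; have [x <-] := quotient_proj_surj u.
by rewrite -quotient_projM mul1r.
Qed.

Fact quotient_mulDl : left_distributive quotient_mul +%R.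
Proof.
move=> u v w; have [x <-] := quotient_proj_surj u.
have [y <-] := quotient_proj_surj v; have [z <-] := quotient_proj_surj w.
by rewrite -quotient_projD -!quotient_projM -quotient_projD mulrDl.
Qed.

HB.instance Definition _ := GRing.Zmodule_isComPzRing.Build quotient_ring
  quotient_mulA quotient_mulC quotient_mul1 quotient_mulDl.

HB.instance Definition _ := GRing.isZmodMorphism.Build R quotient_ring
  quotient_proj quotient_projB.
HB.instance Definition _ := GRing.isMonoidMorphism.Build R quotient_ring
  quotient_proj (conj erefl quotient_projM).

End QuotientRing.

Section KrullDimension.
Variable R : comPzRingType.

Definition prime_chain_length : set nat :=
  [set m | exists P : 'I_m.+1 -> set R,
     (forall i, is_prime_ideal (P i)) /\
     (forall i j : 'I_m.+1, (i < j)%N -> P i `<` P j)].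

(* The dimension of the zero ring is -oo. *)
Definition krull_dim : \bar int :=
  supremum -oo%E [set m%:Z%:E | m in prime_chain_length].

Lemma krull_dim_le (d : nat) :
  (krull_dim <= d%:Z%:E)%E <-> forall m, prime_chain_length m -> (m <= d)%N.
Proof.
rewrite /krull_dim; set S := [set _ | _ in _].
suff [s [Ss sS]] : supremums S !=set0.
  have sE : supremum -oo%E S = s.
    rewrite /supremum; case: ifPn => [/eqP S0|_].
      apply/eqP; rewrite eq_le leNye /=.
      by apply: sS; rewrite S0 => ? [].
    by apply: (is_subset1_supremums _ (conj Ss sS)); apply: xgetPex; exists s.
  rewrite sE; split=> [sd m Pm|Pd]; last first.
    by apply: sS => _ [m /Pd md <-]; rewrite lee_fin lez_nat.
  have : (m%:Z%:E <= s)%E by apply: Ss; exists m.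
  by move=> /le_trans /(_ sd); rewrite lee_fin lez_nat.
have [[b Pb]|nb] := pselect
    (exists b, forall m, prime_chain_length m -> (m <= b)%N); last first.
  exists +oo%E; split=> [? _|u Su]; first exact: leey.
  case: u Su => [z||] Su //.
    exfalso; apply: nb; exists `|z|%N => m Pm.
    have : (m%:Z%:E <= z%:E)%E by apply: Su; exists m.
    rewrite lee_fin -lez_nat => /le_trans; apply.
    by rewrite abszE ler_norm.
  exfalso; apply: nb; exists 0%N => m Pm.
  by have : (m%:Z%:E <= -oo)%E by apply: Su; exists m.
have [[m0 Pm0]|n0] := pselect (exists m, prime_chain_length m); last first.
  exists -oo%E; split=> [u [m Pm]|u _]; last exact: leNye.
  by case: n0; exists m.
have exP : exists m, `[< prime_chain_length m >] by exists m0; apply/asboolP.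
have ubP m : `[< prime_chain_length m >] -> (m <= b)%N by move=> /asboolP/Pb.
case: (ex_maxnP exP ubP) => M /asboolP PM maxM.
exists M%:Z%:E; split=> [u [m Pm <-]|u Su]; last by apply: Su; exists M.
by rewrite lee_fin lez_nat; apply: maxM; apply/asboolP.
Qed.

End KrullDimension.

Definition is_algebraic_closure (F k : fieldType) (iota : {rmorphism F -> k}) :
    Prop :=
  GRing.closed_field_axiom k /\ (forall z : k, algebraicOver iota z).

Definition affine_algebra (k : fieldType) (A : comAlgType k) : Prop :=
  exists (m : nat) (x : 'I_m -> A), forall a : A,
    exists q : mpoly.mpoly m k, a = mpoly.mmap (in_alg A) x q.

Section PolynomialRing.
Variable A : comNzRingType.

Definition eval0 (K : set {poly A}) : set A := [set f.[0] | f in K].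

Definition extension (J : set A) : set {poly A} := ideal_gen (polyC @` J).

End PolynomialRing.

(* Main.v *)
(* Let J be the contraction of I1 to A and B the localization of A at 1 + J.
   Over B, prime avoidance arranges f(0) = a and (f) = I1 K, where I1 + K = (1)
   and B[T]/(K + JB[T]) is zero-dimensional; then K has generators congruent to
   f modulo K^3.

   For n = 2, f generates I1 over one open set of Spec B and a second pair of
   elements does over another; on the overlap the two pairs differ by an
   explicit matrix of determinant 1 that is the identity at T = 0, and Quillen
   patching glues them.

   For n >= 3, one shortens by elementary operations a generating row w of K
   modulo I1 and (J, T), so that all entries but one of w generate an ideal
   comaximal to the intersection of I1 and (T); subtracting K from (f) then
   gives generators of I1 with value a at 0. The ring modulo which w is
   shortened is affine over the algebraic closure of F_p and of dimension < n.
   By avoidance only the surface case (c, a, b) remains: on each curve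
   component of c = 0 the residue class rings are finite, so a power of a
   factors, up to units, into functions g with b constant on g = 0; this makes
   b an even power y^N modulo a, exchanging the two entries gives (y, a^N), and
   y can be moved modulo c to be comaximal to a lift of the product of the g.

   Finally the generators descend from B to A by clearing denominators and
   rescaling T, and on the locus where p vanishes I2 is already generated by
   its values at 0. *)
Require Import Defs.
From HB Require Import structures.
From mathcomp Require Import all_boot all_order all_algebra.
From mathcomp Require Import boolp classical_sets constructive_ereal.
From mathcomp Require Import generic_quotient separable ring zify.

Set Implicit Arguments.
Unset Strict Implicit.
Unset Printing Implicit Defensive.

Import Order.TTheory GRing.Theory Num.Theory.
Local Open Scope ring_scope.
Local Open Scope classical_set_scope.

(** * Ideals, primes and coheight *)

Section IdealBasics.
Variable R : comPzRingType.
Implicit Types (H K P : set R) (x y z : R).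

(** For n >= 3 the obstacle is that the row to be shortened has n entries over a ring of dimension
    up to n - 1, one entry short of Bass's stable range, so that avoidance alone does not suffice.
    The base field supplies the missing entry: finitely many functions on a curve over the algebraic
    closure of F_p lie in an order over a finite field, where residue rings modulo nonzero elements
    are finite, units modulo such elements have finite order, and suitable invertible ideals have
    principal powers. The exponent must be even because the exchange of two entries compares an
    element with the negative of another. Generators of K are wanted modulo K^3, and not K^2,
    because the transition matrix is then 1 modulo K^2 and can be reduced by operations with
    coefficients in K. For n = 2 a shortened row would be a single unit, whence the patching.
    Localness of B is only used in the form that 1 + J consists of units: an ideal with a monic
    member that is comaximal to J contains a constant in 1 + J, hence is everything. *)

Definition ispan n (v : 'I_n -> R) : set R :=
  [set x | exists c : 'I_n -> R, x = \sum_i c i * v i].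

Definition pid x : set R := [set y | exists c, y = c * x].

Lemma idl0 H : is_ideal H -> H 0. Proof. by case. Qed.
Lemma idlD H x y : is_ideal H -> H x -> H y -> H (x + y).
Proof. by case=> _ h _; apply: h. Qed.
Lemma idlM H x y : is_ideal H -> H y -> H (x * y).
Proof. by case=> _ _ h; apply: h. Qed.
Lemma idlMr H x y : is_ideal H -> H x -> H (x * y).
Proof. by rewrite mulrC; apply: idlM. Qed.
Lemma idlN H x : is_ideal H -> H x -> H (- x).
Proof. by move=> iH Hx; rewrite -mulN1r; apply: idlM. Qed.
Lemma idlB H x y : is_ideal H -> H x -> H y -> H (x - y).
Proof. by move=> iH Hx Hy; apply: idlD => //; apply: idlN. Qed.
Lemma idlC H x y : is_ideal H -> H (x - y) -> H (y - x).
Proof. by move=> iH /(idlN iH); rewrite opprB. Qed.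
Lemma idlDl H x y : is_ideal H -> H (x - y) -> H y -> H x.
Proof. by move=> iH h1 h2; rewrite -(subrK y x); apply: idlD. Qed.
Lemma idl_trans H x y z : is_ideal H -> H (x - y) -> H (y - z) -> H (x - z).
Proof. by move=> iH h1 h2; rewrite -(subrKA y); apply: idlD. Qed.
Lemma idl_sum H (I : Type) (r : seq I) (Q : pred I) (F : I -> R) :
  is_ideal H -> (forall i, Q i -> H (F i)) -> H (\sum_(i <- r | Q i) F i).
Proof.
move=> iH h; apply: (big_ind H) => //; first exact: idl0.
by move=> ? ?; apply: idlD.
Qed.
Lemma idl_congM H x y x' y' :
  is_ideal H -> H (x - x') -> H (y - y') -> H (x * y - x' * y').
Proof.
move=> iH h1 h2; have -> : x * y - x' * y' = y * (x - x') + x' * (y - y') by ring.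
by apply: idlD => //; apply: idlM.
Qed.
Lemma idl_congX H x y n : is_ideal H -> H (x - y) -> H (x ^+ n - y ^+ n).
Proof.
move=> iH h; elim: n => [|n IH]; first by rewrite !expr0 subrr; apply: idl0.
by rewrite !exprS; apply: idl_congM.
Qed.
Lemma idl_congD H x y x' y' :
  is_ideal H -> H (x - x') -> H (y - y') -> H ((x + y) - (x' + y')).
Proof. by move=> iH h1 h2; rewrite opprD addrACA; apply: idlD. Qed.
Lemma idl1T H : is_ideal H -> H 1 -> forall x, H x.
Proof. by move=> iH h x; rewrite -(mulr1 x); apply: idlM. Qed.

Lemma span_ideal n (v : 'I_n -> R) : is_ideal (ispan v).
Proof.
split.
- by exists (fun=> 0); rewrite big1 // => i _; rewrite mul0r.
- move=> x y [c ->] [d ->]; exists (fun i => c i + d i).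
  by rewrite -big_split; apply: eq_bigr => i _; rewrite mulrDl.
- move=> a x [c ->]; exists (fun i => a * c i).
  by rewrite mulr_sumr; apply: eq_bigr => i _; rewrite mulrA.
Qed.
Lemma span_mem n (v : 'I_n -> R) i : ispan v (v i).
Proof.
exists (fun j => (j == i)%:R); rewrite (bigD1 i) //= eqxx mul1r big1 ?addr0 //.
by move=> j /negbTE ->; rewrite mul0r.
Qed.
Lemma span_sub n (v : 'I_n -> R) H :
  is_ideal H -> (forall i, H (v i)) -> ispan v `<=` H.
Proof. by move=> iH h x [c ->]; apply: idl_sum => // i _; apply: idlM. Qed.
Lemma span_gen n (v : 'I_n -> R) : ideal_gen (range v) = ispan v.
Proof.
apply/seteqP; split=> x.
  apply; split; first exact: span_ideal.
  by move=> _ [i _ <-]; apply: span_mem.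
move=> h H [iH sH]; apply: span_sub h => // i; apply: sH; by exists i.
Qed.

Lemma pid_ideal x : is_ideal (pid x).
Proof.
split; first by exists 0; rewrite mul0r.
- by move=> ? ? [c ->] [d ->]; exists (c + d); rewrite mulrDl.
- by move=> a ? [c ->]; exists (a * c); rewrite mulrA.
Qed.
Lemma pid_mem x : pid x x. Proof. by exists 1; rewrite mul1r. Qed.
Lemma pid_sub x H : is_ideal H -> H x -> pid x `<=` H.
Proof. by move=> iH h _ [c ->]; apply: idlM. Qed.

Lemma ideal_add_ideal H K : is_ideal H -> is_ideal K -> is_ideal (ideal_add H K).
Proof.
move=> iH iK; split.
- by exists 0; [exact: idl0 | exists 0; [exact: idl0 | rewrite addr0]].
- move=> _ _ [x hx [y hy <-]] [x' hx' [y' hy' <-]]; exists (x + x'); first exact: idlD.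
  by exists (y + y'); [exact: idlD | rewrite addrACA].
- move=> a _ [x hx [y hy <-]]; exists (a * x); first exact: idlM.
  by exists (a * y); [exact: idlM | rewrite mulrDr].
Qed.
Lemma addl H K x : is_ideal K -> H x -> ideal_add H K x.
Proof. by move=> iK h; exists x => //; exists 0; [exact: idl0 | rewrite addr0]. Qed.
Lemma addr_ H K x : is_ideal H -> K x -> ideal_add H K x.
Proof. by move=> iH h; exists 0; [exact: idl0 | exists x => //; rewrite add0r]. Qed.
Lemma add_sub H K L : is_ideal L -> H `<=` L -> K `<=` L -> ideal_add H K `<=` L.
Proof. by move=> iL h1 h2 _ [x hx [y hy <-]]; apply: idlD => //; [exact: h1|exact: h2]. Qed.
Lemma add_pidP H x y : ideal_add H (pid x) y <-> exists c, H (y - c * x).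
Proof.
split; first by move=> [h hh [_ [c ->] <-]]; exists c; rewrite addrK.
by move=> [c hc]; exists (y - c * x) => //; exists (c * x); [exists c|rewrite subrK].
Qed.
Lemma ideal_mul_ideal H K : is_ideal (ideal_mul H K).
Proof.
split.
- by move=> L [iL _]; apply: idl0.
- by move=> x y hx hy L LL; case: (LL) => iL _; apply: idlD => //; [apply: hx|apply: hy].
- by move=> a x hx L LL; case: (LL) => iL _; apply: idlM => //; apply: hx.
Qed.
Lemma ideal_mulP H K x y : H x -> K y -> ideal_mul H K (x * y).
Proof. by move=> hx hy L [iL]; apply; exists x => //; exists y. Qed.
Lemma ideal_mul_sub H K L : is_ideal L ->
  (forall x y, H x -> K y -> L (x * y)) -> ideal_mul H K `<=` L.
Proof. by move=> iL h x; apply; split=> // _ [u hu [v hv <-]]; apply: h. Qed.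
Lemma idlI H K : is_ideal H -> is_ideal K -> is_ideal (H `&` K).
Proof.
move=> iH iK; split; first by split; apply: idl0.
- by move=> x y [? ?] [? ?]; split; apply: idlD.
- by move=> a x [? ?]; split; apply: idlM.
Qed.

Lemma prime_ideal P : is_prime_ideal P -> is_ideal P. Proof. by case. Qed.
Lemma prime_n1 P : is_prime_ideal P -> ~ P 1. Proof. by case. Qed.
Lemma primeM P x y : is_prime_ideal P -> P (x * y) -> P x \/ P y.
Proof. by case=> _ _; apply. Qed.
Lemma primeX P x n : is_prime_ideal P -> P (x ^+ n) -> P x.
Proof.
move=> pP; elim: n => [/(prime_n1 pP) //|n IH].
by rewrite exprS => /(primeM pP) [].
Qed.
Lemma prime_prod P (I : finType) (Q : pred I) (F : I -> R) : is_prime_ideal P ->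
  P (\prod_(i | Q i) F i) -> exists2 i, Q i & P (F i).
Proof.
move=> pP; apply: (big_ind (fun x => P x -> exists2 i, Q i & P (F i))).
- by move/(prime_n1 pP).
- by move=> x y hx hy /(primeM pP) [/hx|/hy].
- by move=> i Qi h; exists i.
Qed.
Lemma prime_comax P x y : is_prime_ideal P -> P x -> P (1 - x * y) -> False.
Proof.
move=> pP h1 h2; apply: (prime_n1 pP); rewrite -(subrK (x * y) 1).
by have iP := prime_ideal pP; apply: idlD => //; apply: idlMr.
Qed.

(* Krull: an ideal maximal among those disjoint from a multiplicative set is prime. *)
Lemma prime_avoiding H (S : set R) : is_ideal H -> S 1 ->
    (forall x y, S x -> S y -> S (x * y)) -> (forall x, S x -> ~ H x) ->
  exists P, [/\ is_prime_ideal P, H `<=` P & forall x, S x -> ~ P x].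
Proof.
move=> iH S1 SM SH.
pose F := [set K : set R | [/\ is_ideal K, H `<=` K & forall x, S x -> ~ K x]].
have [|K [[iK HK SK] Kmax]] := @Zorn_bigcup _ (fun K => F (H `|` K)).
- move=> C CF Ctot.
  have [[C0 CC0]|nC] := pselect (exists C0, C C0); last first.
    have -> : H `|` \bigcup_(X in C) X = H.
      by apply/seteqP; split=> x; [case=> [//|[X CX]]; case: nC; exists X | left].
    by split.
  split=> [||x Sx].
  + split; first by left; apply: idl0.
    * move=> x y.
      have key X Y : C X -> C Y -> exists2 Z, C Z & X `<=` Z /\ Y `<=` Z.
        by move=> CX CY; by case: (Ctot _ _ CX CY) => h; [exists Y => //; split|exists X => //; split].
      move=> hx hy.
      have [X CX hX] : exists2 X, C X & (H `|` X) x.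
        by case: hx => [?|[X CX ?]]; [exists C0 => //; left|exists X => //; right].
      have [Y CY hY] : exists2 X, C X & (H `|` X) y.
        by case: hy => [?|[Y CY ?]]; [exists C0 => //; left|exists Y => //; right].
      have [Z CZ [XZ YZ]] := key _ _ CX CY.
      have [iZ _ _] := CF _ CZ.
      have : (H `|` Z) (x + y).
        apply: idlD => //.
          by case: hX => [?|/XZ ?]; [left|right].
        by case: hY => [?|/YZ ?]; [left|right].
      by case=> [?|?]; [left|right; exists Z].
    * move=> a x [hx|[X CX hx]]; first by left; apply: idlM.
      have [iX _ _] := CF _ CX.
      have : (H `|` X) (a * x) by apply: idlM => //; right.
      by case=> [?|?]; [left|right; exists X].
  + by move=> x; left.
  + move=> [/(SH _ Sx)//|[X CX hx]].
    by have [_ _ h] := CF _ CX; apply: (h _ Sx); right.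
have KHK : H `|` K = K.
  apply/seteqP; split=> x; last by right.
  case=> // hx; apply: contrapT => nKx.
  apply: (Kmax (H `|` K)); last by rewrite /= setUA setUid.
  split; first by move=> y; right.
  by move=> /(_ x (or_introl hx)).
rewrite KHK in iK HK SK.
exists K; split=> //; split=> // [|x y Kxy]; first exact: SK.
apply: contrapT => /not_orP [nx ny].
have big z : ~ K z -> exists2 s, S s & ideal_add K (pid z) s.
  move=> nz; apply: contrapT => h.
  have iL : is_ideal (ideal_add K (pid z)) by apply: ideal_add_ideal => //; apply: pid_ideal.
  have HL : H `|` ideal_add K (pid z) = ideal_add K (pid z).
    apply/seteqP; split=> w; last by right.
    by case=> // hw; apply: addl; [exact: pid_ideal|exact: HK].
  apply: (Kmax (ideal_add K (pid z))).
    split; first by move=> w hw; apply: addl; [exact: pid_ideal|].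
    by move=> /(_ z (addr_ iK (pid_mem z))).
  rewrite HL; split=> //.
    by rewrite -HL; left.
  by move=> s Ss Ls; apply: h; exists s.
have [s Ss /add_pidP [c hc]] := big _ nx.
have [t St /add_pidP [d hd]] := big _ ny.
apply: (SK _ (SM _ _ Ss St)).
apply: (@idlDl _ _ (c * d * (x * y))) => //; last exact: idlM.
have -> : s * t - c * d * (x * y) = s * t - (c * x) * (d * y) by ring.
exact: idl_congM.
Qed.

Lemma primes_one H : is_ideal H ->
  (forall P, is_prime_ideal P -> H `<=` P -> False) -> H 1.
Proof.
move=> iH h; apply: contrapT => n1.
have [|||P [pP HP _]] := @prime_avoiding H [set 1] iH => //.
- by move=> x y /= -> ->; rewrite mulr1.
- by move=> x /= ->.
exact: h pP HP.
Qed.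

Lemma primes_rad H x : is_ideal H ->
  (forall P, is_prime_ideal P -> H `<=` P -> P x) -> exists n, H (x ^+ n).
Proof.
move=> iH h; apply: contrapT => /forallNP nx.
have [|||P [pP HP nP]] := @prime_avoiding H [set y | exists n, y = x ^+ n] iH.
- by exists 0%N.
- by move=> _ _ [m ->] [n ->]; exists (m + n)%N; rewrite exprD.
- by move=> _ [n ->]; apply: nx.
by apply: (nP x); [exists 1%N|exact: h].
Qed.

(** For a prime P this says dim R/P < d: [dlt 1 P] is maximality and [dlt 0 P] is false. Only the
    primes above P are inspected, so that no quotient has to be formed to speak of its dimension. *)
Fixpoint dlt d P : Prop :=
  if d is d'.+1 then forall P', is_prime_ideal P' -> P `<` P' -> dlt d' P' else False.

Lemma dlt_mono d P P' : is_prime_ideal P' -> P `<=` P' -> dlt d P -> dlt d P'.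
Proof.
case: d => //= d pP' PP' h P'' pP'' [h1 h2]; apply: h => //.
by split; [exact: subset_trans h1|move=> h; apply: h2; apply: subset_trans PP'].
Qed.
Lemma dlt1_max P P' : dlt 1 P -> is_prime_ideal P' -> P `<=` P' -> P' `<=` P.
Proof. by move=> h pP' PP'; apply: contrapT => n; apply: (h P'). Qed.

End IdealBasics.

(** * Primes along ring homomorphisms *)

Lemma preim_ideal (R S : comPzRingType) (g : {rmorphism R -> S}) (H : set S) :
  is_ideal H -> is_ideal (g @^-1` H).
Proof.
move=> iH; split; rewrite /preimage /=; first by rewrite rmorph0; apply: idl0.
- by move=> x y hx hy /=; rewrite rmorphD; apply: idlD.
- by move=> a x hx /=; rewrite rmorphM; apply: idlM.
Qed.
Lemma preim_prime (R S : comPzRingType) (g : {rmorphism R -> S}) (H : set S) :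
  is_prime_ideal H -> is_prime_ideal (g @^-1` H).
Proof.
move=> pH; split; first exact/preim_ideal/prime_ideal.
- by rewrite /preimage /= rmorph1; apply: prime_n1.
- by move=> x y; rewrite /preimage /= rmorphM; apply: primeM.
Qed.

Section SurjectiveImage.
Variables (R S : comPzRingType) (g : {rmorphism R -> S}).
Hypothesis gs : forall y, exists x, g x = y.
Lemma image_ideal (H : set R) : is_ideal H -> is_ideal (g @` H).
Proof.
move=> iH; split; first by exists 0; [exact: idl0|exact: rmorph0].
- by move=> _ _ [x hx <-] [y hy <-]; exists (x + y); [exact: idlD|exact: rmorphD].
- by move=> a _ [x hx <-]; have [b <-] := gs a; exists (b * x); [exact: idlM|exact: rmorphM].
Qed.
Lemma image_preim (H : set S) : g @` (g @^-1` H) = H.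
Proof.
apply/seteqP; split=> [_ [x hx <-] //|y hy]; have [x gx] := gs y.
by exists x => //; rewrite /preimage /= gx.
Qed.
Lemma preim_image (H : set R) : is_ideal H -> (forall x, g x = 0 -> H x) ->
  g @^-1` (g @` H) = H.
Proof.
move=> iH h; apply/seteqP; split=> x; last by exists x.
move=> [y hy e]; apply: (@idlDl _ _ _ y) => //.
by apply: h; rewrite rmorphB e subrr.
Qed.
Lemma image_prime (H : set R) : is_prime_ideal H -> (forall x, g x = 0 -> H x) ->
  is_prime_ideal (g @` H).
Proof.
move=> pH h; have iH := prime_ideal pH; have E := preim_image iH h.
split; first exact: image_ideal.
- move=> h1; apply: (prime_n1 pH); rewrite -E /preimage /= rmorph1 //.
- move=> x y; have [x' <-] := gs x; have [y' <-] := gs y; rewrite -rmorphM => hxy.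
  have : H (x' * y') by rewrite -E.
  by move=> /(primeM pH) [?|?]; [left; exists x'|right; exists y'].
Qed.
Lemma dlt_preim d (H : set S) : is_prime_ideal H -> dlt d (g @^-1` H) <-> dlt d H.
Proof.
elim: d H => // d IH H pH; split=> h P' pP' [h1 h2].
  apply/(IH P' pP'); apply: h; first exact: preim_prime.
  split; first by move=> x /h1.
  by move=> h; apply: h2 => y hy; have [x gx] := gs y; rewrite -gx; apply: h; rewrite /preimage /= gx.
have hker x : g x = 0 -> P' x.
  by move=> gx; apply: h1; rewrite /preimage /= gx; exact: (idl0 (prime_ideal pH)).
rewrite -(preim_image (prime_ideal pP') hker); apply/IH; first exact: image_prime.
apply: h; first exact: image_prime.
split; first by rewrite -[H in H `<=` _]image_preim; apply: image_subset.
move=> h; apply: h2 => x hx; rewrite /preimage /=; apply: h; by exists x.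
Qed.
End SurjectiveImage.

(** * Noetherian rings and prime avoidance *)

Section Noetherian.
Variable R : comPzRingType.
Implicit Types (H K P : set R).

Definition fg H := exists n (v : 'I_n -> R), H = ispan v.
Definition noeth := forall H, is_ideal H -> fg H.

Definition fcat T m n (v : 'I_m -> T) (w : 'I_n -> T) (i : 'I_(m + n)) : T :=
  match split i with inl j => v j | inr j => w j end.
Lemma fcatl T m n (v : 'I_m -> T) (w : 'I_n -> T) i : fcat v w (lshift n i) = v i.
Proof. by rewrite /fcat; case: splitP => [j /= /ord_inj -> //|j /= e]; have := ltn_ord i; rewrite e -ltn_subRL subnn. Qed.
Lemma fcatr T m n (v : 'I_m -> T) (w : 'I_n -> T) i : fcat v w (rshift m i) = w i.
Proof.
rewrite /fcat; case: splitP => [j /= e|j /= /addnI /ord_inj -> //].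
by have := ltn_ord j; rewrite -e -ltn_subRL subnn.
Qed.
Lemma fcat_all T m n (v : 'I_m -> T) (w : 'I_n -> T) (Q : T -> Prop) :
  (forall i, Q (v i)) -> (forall i, Q (w i)) -> forall i, Q (fcat v w i).
Proof. by move=> h1 h2 i; rewrite /fcat; case: split. Qed.

Lemma span_cat m n (v : 'I_m -> R) (w : 'I_n -> R) :
  ispan (fcat v w) = ideal_add (ispan v) (ispan w).
Proof.
apply/seteqP; split.
  apply: span_sub; first by apply: ideal_add_ideal; exact: span_ideal.
  apply: (@fcat_all _ _ _ v w (ideal_add (ispan v) (ispan w))) => i.
    by apply: addl; [exact: span_ideal|exact: span_mem].
  by apply: addr_; [exact: span_ideal|exact: span_mem].
apply: add_sub; first exact: span_ideal.
  by apply: span_sub; [exact: span_ideal|move=> i; rewrite -(fcatl v w); exact: span_mem].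
by apply: span_sub; [exact: span_ideal|move=> i; rewrite -(fcatr v w); exact: span_mem].
Qed.
Lemma fg_add H K : fg H -> fg K -> fg (ideal_add H K).
Proof. by move=> [m [v ->]] [n [w ->]]; exists (m + n)%N, (fcat v w); rewrite span_cat. Qed.

(** Otherwise a choice of strictly larger members gives an ascending chain, whose union is finitely
    generated and hence contained in one of its terms. *)
Lemma noeth_max (F : set (set R)) : noeth -> (forall I, F I -> is_ideal I) ->
  F !=set0 -> exists2 I, F I & forall J, F J -> I `<=` J -> J `<=` I.
Proof.
move=> nR Fid [I0 FI0]; apply: contrapT => nmax.
have /choice [next nextP] : forall I, exists J, F I -> [/\ F J, I `<=` J & ~ J `<=` I].
  move=> I; have [FI|nF] := pselect (F I); last by exists I.
  apply: contrapT => h; apply: nmax; exists I => // J FJ IJ.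
  by apply: contrapT => nJI; apply: h; exists J.
pose s n := iter n next I0.
have Fs n : F (s n) by elim: n => //= n /nextP [].
have sS n : s n `<=` s n.+1 by have [] := nextP _ (Fs n).
have smon m n : (m <= n)%N -> s m `<=` s n.
  move=> /subnK <-; elim: (n - m)%N => // e IH.
  by rewrite addSn; apply: subset_trans (sS _).
have iU : is_ideal (\bigcup_n s n).
  split; first by exists 0%N => //; exact: idl0 (Fid _ (Fs 0%N)).
  - move=> x y [m _ hx] [n _ hy]; exists (maxn m n) => //; apply: idlD; first exact: Fid.
      exact: (smon _ _ (leq_maxl m n)).
    exact: (smon _ _ (leq_maxr m n)).
  - by move=> a x [m _ hx]; exists m => //; apply: idlM => //; apply: Fid.
have [n [v Uv]] := nR _ iU.
have /choice [m mP] : forall i, exists m, s m (v i).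
  by move=> i; have : ispan v (v i) by [exact: span_mem]; rewrite -Uv => -[m _ h]; exists m.
pose M := (\max_(i < n) m i)%N.
have UM : \bigcup_n s n `<=` s M.
  rewrite Uv; apply: span_sub => [|i]; first exact: Fid.
  by apply: smon (mP i); apply: leq_bigmax.
have [_ _] := nextP _ (Fs M); apply.
by apply: subset_trans UM => x hx; exists M.+1.
Qed.

(** Noetherian induction: an ideal K maximal among those without such a list is proper and not
    prime, so it contains some xy with x and y outside; the lists of K + (x) and K + (y) concatenate
    to one for K. *)
Lemma finite_primes H : noeth -> is_ideal H ->
  exists n (P : 'I_n -> set R),
    (forall i, is_prime_ideal (P i) /\ H `<=` P i) /\
    (forall Q, is_prime_ideal Q -> H `<=` Q -> exists i, P i `<=` Q).
Proof.
move=> nR iH; apply: contrapT => nH.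
pose good (H : set R) := exists n (P : 'I_n -> set R),
    (forall i, is_prime_ideal (P i) /\ H `<=` P i) /\
    (forall Q, is_prime_ideal Q -> H `<=` Q -> exists i, P i `<=` Q).
have [||K [iK nK] Kmax] := @noeth_max [set K | is_ideal K /\ ~ good K] nR.
- by move=> I [].
- by exists H.
have [K1|nK1] := pselect (K 1).
  apply: nK; exists 0%N, (fun=> setT); split; first by case.
  by move=> Q pQ KQ; case: (prime_n1 pQ); apply: KQ.
have [x [y [Kxy nx ny]]] : exists x y, [/\ K (x * y), ~ K x & ~ K y].
  apply: contrapT => h; apply: nK; exists 1%N, (fun=> K); split; last by exists ord0.
  move=> _; split=> //; split=> // x y hxy; apply: contrapT => /not_orP [nx ny].
  by apply: h; exists x, y.
have big z : ~ K z -> good (ideal_add K (pid z)).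
  move=> nz; apply: contrapT => h.
  have iL : is_ideal (ideal_add K (pid z)) by apply: ideal_add_ideal => //; apply: pid_ideal.
  apply: nz; apply: (Kmax (ideal_add K (pid z))) => //.
    by move=> w hw; apply: addl => //; apply: pid_ideal.
  by apply: addr_ => //; apply: pid_mem.
have [m [P [hP1 hP2]]] := big _ nx; have [n [Q [hQ1 hQ2]]] := big _ ny.
apply: nK; exists (m + n)%N, (fcat P Q); split.
  have sub z : K `<=` ideal_add K (pid z) by move=> w hw; apply: addl => //; apply: pid_ideal.
  apply: (@fcat_all _ _ _ P Q (fun X => is_prime_ideal X /\ K `<=` X)) => i.
    by have [? h] := hP1 i; split=> //; apply: subset_trans h.
  by have [? h] := hQ1 i; split=> //; apply: subset_trans h.
move=> X pX KX; have iX := prime_ideal pX; have [Xx|Xy] := primeM pX (KX _ Kxy).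
  have [|i hi] := hP2 X pX; first by apply: add_sub => //; apply: pid_sub.
  by exists (lshift n i); rewrite fcatl.
have [|i hi] := hQ2 X pX; first by apply: add_sub => //; apply: pid_sub.
by exists (rshift m i); rewrite fcatr.
Qed.

(** In a list of least length no prime contains another one, since the larger could be dropped. *)
Lemma min_primes H : noeth -> is_ideal H ->
  exists n (P : 'I_n -> set R),
    [/\ forall i, is_prime_ideal (P i) /\ H `<=` P i,
     forall Q, is_prime_ideal Q -> H `<=` Q -> exists i, P i `<=` Q &
     forall i j, i != j -> ~ P i `<=` P j].
Proof.
move=> nR iH; pose G n := exists (P : 'I_n -> set R),
    (forall i, is_prime_ideal (P i) /\ H `<=` P i) /\
    (forall Q, is_prime_ideal Q -> H `<=` Q -> exists i, P i `<=` Q).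
have exG : exists n, `[< G n >] by have [n h] := finite_primes nR iH; exists n; apply/asboolP.
case: (ex_minnP exG) => n /asboolP [P [h1 h2]] nmin; exists n, P; split=> // i j ij Pij.
case: n P h1 h2 nmin i j ij Pij => [|n] P h1 h2 nmin; first by case.
move=> i j ij Pij.
suff /nmin : `[< G n >] by rewrite ltnn.
apply/asboolP; exists (fun k => P (lift j k)); split=> // Q pQ HQ.
have [l Pl] := h2 Q pQ HQ.
case: (unliftP j l) Pl => [l' -> ?|-> Pj]; first by exists l'.
case: (unliftP j i) ij Pij => [i' ->|->]; last by rewrite eqxx.
by move=> _ h; exists i'; apply: subset_trans Pj.
Qed.

(** Redundant primes are discarded; otherwise a bad value at the last prime is repaired by an
    element of [b] that lies in all other primes but not in the last. The version for a coset g + b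
    is needed because elements are later changed only within a prescribed ideal. *)
Lemma prime_avoidance n (P : 'I_n -> set R) (b : set R) g :
  (forall i, is_prime_ideal (P i)) -> is_ideal b ->
  (forall i, b `<=` P i -> ~ P i g) ->
  exists2 y, b y & forall i, ~ P i (g + y).
Proof.
move=> pP ib; elim: n P pP => [|n IH] P pP hP; first by exists 0; [exact: idl0|case].
have [[i [j [ij Pij]]]|anti] := pselect (exists i j, i != j /\ P i `<=` P j).
  have [|k|y by_ hy] := IH (fun k => P (lift i k)).
  - by move=> k; apply: pP.
  - exact: hP.
  exists y => // k; case: (unliftP i k) => [k' ->|-> /Pij]; first exact: hy.
  by case: (unliftP i j) ij => [j' -> _|->]; [apply: hy|rewrite eqxx].
have [|k|y by_ hy] := IH (fun k => P (lift ord_max k)).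
- by move=> k; apply: pP.
- exact: hP.
have [Pm|] := pselect (P ord_max (g + y)); last first.
  by move=> h; exists y => // k; case: (unliftP ord_max k) => [k' ->|->]; [exact: hy|].
have im := prime_ideal (pP ord_max).
have [z bz nz] : exists2 z, b z & ~ P ord_max z.
  apply: contrapT => h; have bP : b `<=` P ord_max.
    by move=> z bz; apply: contrapT => nz; apply: h; exists z.
  by apply: (hP _ bP); rewrite -(addrK y g); apply: idlB => //; apply: bP.
have /choice [w wP] : forall k : 'I_n, exists w, P (lift ord_max k) w /\ ~ P ord_max w.
  move=> k; apply: contrapT => h; apply: anti; exists (lift ord_max k), ord_max.
  split; first by rewrite eq_sym neq_lift.
  by move=> w hw; apply: contrapT => nw; apply: h; exists w.
exists (y + z * \prod_k w k); first by apply: idlD => //; apply: idlMr.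
move=> k; rewrite addrA; case: (unliftP ord_max k) => [k' ->|->] h.
  have ik := prime_ideal (pP (lift ord_max k')).
  apply: (hy k'); rewrite -(addrK (z * \prod_k w k) (g + y)); apply: idlB => //.
  by rewrite (bigD1 k') //=; apply: idlM => //; apply: idlMr => //; have [] := wP k'.
have : P ord_max (z * \prod_k w k) by rewrite -(addKr (g + y) (_ * _)); apply: idlD => //; apply: idlN.
by move=> /(primeM (pP _)) [//|/(prime_prod (pP _)) [k' _]]; have [] := wP k'.
Qed.

(** The new element is kept out of the minimal primes of H that do not contain [b]. A prime over H
    that contains g + y but not [b] is then strictly above one of these, which lowers its coheight
    by one. *)
Lemma avoid_step d H (b : set R) g : noeth -> is_ideal H -> is_ideal b ->
  (forall P, is_prime_ideal P -> H `<=` P -> ~ b `<=` P -> dlt d.+1 P) ->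
  exists2 y, b y & forall P, is_prime_ideal P -> H `<=` P -> P (g + y) -> ~ b `<=` P -> dlt d P.
Proof.
move=> nR iH ib hd; have [n [P [h1 h2 _]]] := min_primes nR iH.
have key m (p : 'I_m -> 'I_n) : (forall i, ~ b `<=` P (p i)) ->
    exists2 y, b y & forall i, ~ P (p i) (g + y).
  move=> hp; apply: (@prime_avoidance _ (fun i => P (p i)) b g) => // i.
    by have [] := h1 (p i).
  by move=> /hp.
pose s := [seq i <- enum 'I_n | ~~ `[< b `<=` P i >]].
have [|y yb hy] := key _ (tnth (in_tuple s)).
  by move=> i; have := mem_tnth i (in_tuple s); rewrite mem_filter => /andP [/asboolPn].
exists y => // X pX HX Xy nX; have [i Pi] := h2 X pX HX.
have nb : ~ b `<=` P i by move=> h; apply: nX; apply: subset_trans Pi.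
have /tnthP [j ji] : i \in in_tuple s by rewrite mem_filter mem_enum andbT; apply/asboolPn.
have [pPi HPi] := h1 i; apply: (hd _ pPi HPi nb) => //; split=> // XP.
by apply: (hy j); rewrite -ji; apply: XP.
Qed.

End Noetherian.

Lemma noeth_surj (R S : comPzRingType) (g : {rmorphism R -> S}) :
  (forall y, exists x, g x = y) -> noeth R -> noeth S.
Proof.
move=> gs nR H iH; have [n [v hv]] := nR _ (preim_ideal g iH).
exists n, (g \o v); rewrite -(image_preim gs H) hv; apply/seteqP; split=> [_ [_ [c ->] <-]|_ [c ->]].
  by exists (g \o c); rewrite rmorph_sum; apply: eq_bigr => i _; rewrite rmorphM.
have /choice [d hd] : forall i, exists x, g x = c i by move=> i; apply: gs.
exists (\sum_i d i * v i); first by exists d.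
by rewrite rmorph_sum; apply: eq_bigr => i _; rewrite rmorphM hd.
Qed.

Lemma noeth_field (k : fieldType) : noeth k.
Proof.
move=> H iH; have [[x Hx /eqP x0]|h] := pselect (exists2 x, H x & x <> 0).
  exists 1%N, (fun=> 1); apply/seteqP; split=> y _; first by exists (fun=> y); rewrite big_ord1 mulr1.
  by rewrite -(mulr1 y) -(mulVf x0) mulrA; apply: idlM.
exists 0%N, (fun=> 0); apply/seteqP; split=> y.
  by move=> Hy; exists (fun=> 0); rewrite big_ord0; apply: contrapT => ny; apply: h; exists y.
by move=> [c ->]; rewrite big_ord0; apply: idl0.
Qed.

(** The ideals [L d] of coefficients in degree d increase with d and stabilize at some D. Generators
    for D lower the degree of every member of size above D, and [low] collects generators for the
    rest. *)
Theorem hilbert_basis (R : comNzRingType) : noeth R -> noeth {poly R}.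
Proof.
move=> nR H iH.
pose L d : set R := [set f`_d | f in [set f : {poly R} | H f /\ (size f <= d.+1)%N]].
have iL d : is_ideal (L d).
  split; first by exists 0; rewrite ?coef0 //; split; [exact: idl0|rewrite size_poly0].
  - move=> _ _ [f [Hf sf] <-] [g [Hg sg] <-]; exists (f + g); last by rewrite coefD.
    by split; [exact: idlD|rewrite (leq_trans (size_polyD _ _)) // geq_max sf].
  - move=> a _ [f [Hf sf] <-]; exists (a%:P * f); last by rewrite coefCM.
    by split; [exact: idlM|rewrite mul_polyC (leq_trans (size_scale_leq _ _))].
have shift d e f : L d f -> L (e + d)%N f.
  move=> [h [Hh sh] <-]; exists ('X^e * h); last by rewrite coefXnM ltnNge leq_addr addnC addnK.
  split; first exact: idlM.
  by rewrite (leq_trans (size_polyMleq _ _)) // size_polyXn addSn /= -addnS leq_add2l.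
have [_ [D _ <-] Dmax] : exists2 I, range L I & forall J, range L J -> I `<=` J -> J `<=` I.
  by apply: noeth_max => // [_ [d _ <-]//|]; exists (L 0%N); exists 0%N.
have lift_gen d : exists n (v : 'I_n -> {poly R}),
    (forall i, H (v i) /\ (size (v i) <= d.+1)%N) /\ L d = ispan (fun i => (v i)`_d).
  have [n [v hv]] := nR _ (iL d).
  have /choice [w wP] : forall i, exists w : {poly R}, [/\ H w, (size w <= d.+1)%N & w`_d = v i].
    move=> i; have : L d (v i) by rewrite hv; exact: span_mem.
    by move=> [w [? ?] <-]; exists w.
  exists n, w; split; first by move=> i; have [] := wP i.
  by rewrite hv; congr ispan; apply/funext => i; have [] := wP i.
have reduce d n (v : 'I_n -> {poly R}) (f : {poly R}) e :
    (forall i, H (v i) /\ (size (v i) <= d.+1)%N) -> H f -> (size f <= (e + d).+1)%N ->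
    ispan (fun i => (v i)`_d) f`_(e + d) ->
    exists h, [/\ H h, (size h <= e + d)%N & ispan v (f - h)].
  move=> hv Hf sf [c fc].
  pose g := \sum_i ((c i)%:P * 'X^e) * v i.
  have Hg : H g by apply: idl_sum => // i _; apply: idlM => //; have [] := hv i.
  exists (f - g); split; first exact: idlB.
    apply/leq_sizeP => j; rewrite leq_eqVlt => /orP [/eqP <-|lj].
      rewrite coefB fc coef_sum -sumrB big1 // => i _.
      by rewrite -mulrA coefCM coefXnM ltnNge leq_addr addnC addnK subrr.
    rewrite coefB coef_sum nth_default ?(leq_trans sf) // big1 ?subr0 // => i _.
    rewrite -mulrA coefCM coefXnM; case: ltnP => ej; first by rewrite mulr0.
    by rewrite nth_default ?mulr0 // (leq_trans (hv i).2) // ltn_subRL.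
  by exists (fun i => (c i)%:P * 'X^e); rewrite opprB addrC subrK.
have low d : exists J, [/\ fg J, J `<=` H & forall f, H f -> (size f <= d)%N -> J f].
  elim: d => [|d [J [fJ JH Jd]]].
    exists (ispan (fun _ : 'I_0 => 0)); split; first by exists 0%N, (fun=> 0).
      by apply: span_sub => // -[].
    move=> f _; rewrite leqn0 size_poly_eq0 => /eqP ->; exact: (idl0 (span_ideal _)).
  have [n [v [hv Lv]]] := lift_gen d; exists (ideal_add J (ispan v)); split.
  - by apply: fg_add => //; exists n, v.
  - by apply: add_sub => //; apply: span_sub => // i; have [] := hv i.
  - move=> f Hf sf; have [|h [Hh sh fh]] := @reduce d n v f 0%N hv Hf sf.
      by rewrite -Lv; exists f.
    by exists h; [exact: Jd|exists (f - h) => //; rewrite addrC subrK].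
have [n [v [hv Lv]]] := lift_gen D.
have [J [fJ JH JD]] := low D.
suff -> : H = ideal_add J (ispan v) by apply: fg_add => //; exists n, v.
apply/seteqP; split; last first.
  by apply: add_sub => //; apply: span_sub => // i; have [] := hv i.
have iJv : is_ideal (ideal_add J (ispan v)).
  by have [m [u ->]] := fJ; apply: ideal_add_ideal; exact: span_ideal.
suff key e f : H f -> (size f <= e + D)%N -> ideal_add J (ispan v) f.
  by move=> f Hf; apply: (key (size f)) => //; rewrite leq_addr.
elim: e f => [|e IH] f Hf sf; first by apply: addl; [exact: span_ideal|exact: JD].
have [|h [Hh sh fh]] := @reduce D n v f e hv Hf sf.
  rewrite -Lv; apply: (Dmax (L (e + D)%N)); [by exists (e + D)%N|by move=> x; apply: shift|].
  by exists f.
apply: (@idlDl _ _ f h) => //; last exact: IH.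
by apply: addr_ => //; have [m [u ->]] := fJ; exact: span_ideal.
Qed.

Local Open Scope quotient_scope.

(** * Residue fields of primes *)

Section PrimeQuotient.
Variables (R : comPzRingType) (P : set R) (pP : is_prime_ideal P).

Definition prime_quot : Type := quotient_ring (prime_ideal pP).
HB.instance Definition _ := GRing.ComPzRing.on prime_quot.
Let proj : {rmorphism R -> prime_quot} := @quotient_proj R P (prime_ideal pP).

Let projP x y : proj x = proj y <-> P (x - y).
Proof. exact: quotient_projP. Qed.
Let proj_surj (u : prime_quot) : exists x, proj x = u.
Proof. exact: quotient_proj_surj. Qed.

Fact prime_quot_neq0 : (1 : prime_quot) != 0.
Proof.
by apply/eqP; rewrite -(rmorph1 proj) -(rmorph0 proj) => /projP; rewrite subr0; apply: prime_n1.
Qed.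
HB.instance Definition _ := GRing.PzSemiRing_isNonZero.Build prime_quot prime_quot_neq0.

(** The fraction field is built on an [idomainType], whose structure includes inverses of units;
    they are picked by choice. *)
Let pq_unit : {pred prime_quot} := [pred x | `[< exists y, y * x = 1 >]].
Let pq_inv (x : prime_quot) : prime_quot :=
  if pselect (exists y, y * x = 1) is left h then sval (cid h) else x.
Fact pq_mulV : {in pq_unit, left_inverse 1 pq_inv *%R}.
Proof.
move=> x /asboolP h; rewrite /pq_inv; case: pselect => // h'.
by case: cid.
Qed.
Fact pq_unitP : forall x y, y * x = 1 -> pq_unit x.
Proof. by move=> x y h; apply/asboolP; exists y. Qed.
Fact pq_invr_out : {in [predC pq_unit], pq_inv =1 id}.
Proof. by move=> x /asboolPn nh; rewrite /pq_inv; case: pselect. Qed.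
HB.instance Definition _ :=
  GRing.ComNzRing_hasMulInverse.Build prime_quot pq_mulV pq_unitP pq_invr_out.

Fact prime_quot_integral (x y : prime_quot) : x * y = 0 -> (x == 0) || (y == 0).
Proof.
have [u <-] := proj_surj x; have [v <-] := proj_surj y.
rewrite -rmorphM -(rmorph0 proj) => /projP; rewrite subr0 => /(primeM pP) [h|h].
  by apply/orP; left; apply/eqP/projP; rewrite subr0.
by apply/orP; right; apply/eqP/projP; rewrite subr0.
Qed.
HB.instance Definition _ := GRing.ComUnitRing_isIntegral.Build prime_quot prime_quot_integral.

End PrimeQuotient.

Local Notation "x %:F" := (@FracField.tofrac _ x).

Lemma fraction_div (R : idomainType) (y : {fraction R}) :
  exists n d : R, d%:F != 0 /\ y = n%:F / d%:F.
Proof.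
elim/quotW: y => x; exists \n_x, \d_x; have dn0 : (\d_x)%:F != 0 by rewrite tofrac_eq0 denom_ratioP.
split=> //; apply: (canRL (mulfK dn0)).
rewrite /GRing.mul /= /FracField.tofrac; unlock; rewrite !piE /FracField.mulf.
by apply/eqmodP; rewrite /= FracField.equivfE /= !numden_Ratio ?mulf_neq0 ?oner_eq0 ?denom_ratioP //; apply/eqP; ring.
Qed.

(** The fraction field of R/P, presented by a map with kernel P whose values yield K as fractions;
    later arguments use only these two properties. *)
Lemma residue_field (R : comPzRingType) (P : set R) : is_prime_ideal P ->
  exists (K : fieldType) (g : {rmorphism R -> K}), (forall x, g x = 0 <-> P x) /\
    (forall y, exists u v, g v != 0 /\ y = g u / g v).
Proof.
move=> pP; pose D : idomainType := prime_quot pP.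
pose pr : {rmorphism R -> D} := @quotient_proj R P (prime_ideal pP).
pose g : {rmorphism R -> {fraction D}} := (@FracField.tofrac D \o pr)%FUN.
exists {fraction D}, g; split.
  move=> x; rewrite /g /=; split.
    move=> /eqP; rewrite tofrac_eq0 => /eqP; rewrite -(rmorph0 pr) => /quotient_projP.
    by rewrite subr0.
  move=> h; apply/eqP; rewrite tofrac_eq0; apply/eqP; rewrite -(rmorph0 pr).
  by apply/quotient_projP; rewrite subr0.
move=> y; have [n [d [d0 ->]]] := fraction_div y.
have [u hu] := quotient_proj_surj n; have [v hv] := quotient_proj_surj d.
by exists u, v; rewrite /g /= /pr /= hu hv.
Qed.

(** * Contraction from polynomial rings *)

(** The extension of an ideal q to R[T]. *)
Definition polyI (R : comNzRingType) (q : set R) : set {poly R} := [set f | forall i, q f`_i].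

Section PolyIdeals.
Variable R : comNzRingType.
Implicit Types (H : set {poly R}) (q : set R).

Lemma polyI_ideal q : is_ideal q -> is_ideal (polyI q).
Proof.
move=> iq; split; first by move=> i; rewrite coef0; apply: idl0.
- by move=> f g hf hg i; rewrite coefD; apply: idlD.
- by move=> a f hf i; rewrite coefM; apply: idl_sum => // j _; apply: idlM.
Qed.
Lemma polyI_C q c : is_ideal q -> polyI q c%:P <-> q c.
Proof.
move=> iq; split=> [/(_ 0%N)|h i]; rewrite coefC //=.
by case: ifP => // _; apply: idl0.
Qed.
(** Gauss's argument, with the first coefficients of f and of g that lie outside q. *)
Lemma polyI_prime q : is_prime_ideal q -> is_prime_ideal (polyI q).
Proof.
move=> pq; have iq := prime_ideal pq.
split; first exact: polyI_ideal.
- by move/(polyI_C 1 iq); apply: prime_n1.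
move=> f g fg; apply: contrapT => /not_orP [/existsNP nf /existsNP ng].
have exmin (h : {poly R}) : (exists i, ~ q h`_i) -> exists2 i, ~ q h`_i & forall j, (j < i)%N -> q h`_j.
  move=> [i hi]; have ex : exists i, `[< ~ q h`_i >] by exists i; apply/asboolP.
  case: (ex_minnP ex) => m /asboolP hm mmin; exists m => // j jm; apply: contrapT => hj.
  by have := mmin j; rewrite leqNgt jm /= => h'; apply/notF/h'/asboolP.
have [i ni mi] := exmin f nf; have [j nj mj] := exmin g ng.
have := fg (i + j)%N; rewrite coefM.
have li : (i < (i + j).+1)%N by rewrite ltnS leq_addr.
rewrite (bigD1 (Ordinal li)) //= addKn => h.
suff : q (f`_i * g`_j) by move=> /(primeM pq) [].
rewrite -(addrK (\sum_(l < (i + j).+1 | l != Ordinal li) f`_l * g`_(i + j - l)) (f`_i * _)).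
apply: idlB => //; apply: idl_sum => // l nl.
case: (ltngtP l i) => [/mi|il|/eqP e]; first exact: idlMr.
  by apply: idlM => //; apply: mj; rewrite ltn_subLR ?ltn_add2r // -ltnS ltn_ord.
by case/eqP: nl; apply/val_inj/eqP.
Qed.

Lemma det_congruent n q (A : 'M[R]_n) a : is_ideal q ->
  (forall i j, q (A i j - a *+ (i == j))) -> q (\det A - a ^+ n).
Proof.
move=> iq h; apply/(@quotient_projP R q iq); rewrite -det_scalar.
pose pr : {rmorphism R -> quotient_ring iq} := @quotient_proj R q iq.
change (pr (\det A) = pr (\det (a%:M : 'M_n))).
rewrite -!(det_map_mx pr); congr (\det _); apply/matrixP => i j; rewrite !mxE.
by apply/quotient_projP; apply: h.
Qed.

(* The determinant trick on 1, T, ..., T^(g-1), with pseudo-division by [h]. *)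
Lemma contraction_power H h q x : is_ideal H -> H h -> is_ideal q ->
  ideal_add H (polyI q) x%:P ->
  exists z, H z%:P /\ exists M g, q (z - lead_coef h ^+ M * x ^+ g).
Proof.
move=> iH Hh iq [F HF [Q qQ FQ]]; set c := lead_coef h.
have [s1|s1] := leqP (size h) 1.
  exists c; split; last by exists 1%N, 0%N; rewrite expr0 expr1 mulr1 subrr; apply: idl0.
  suff <- : h = c%:P by [].
  by rewrite {1}(size1_polyC s1) /c lead_coefE; case: (size h) s1 => [|[]].
set g := (size h).-1; have sh : size h = g.+1 by rewrite /g prednK // ltnW.
have pdiv N (f : {poly R}) : polyI q f -> (size f <= g + N)%N ->
    exists r : {poly R}, [/\ polyI q r, (size r <= g)%N & H ((c ^+ N) *: f - r)].
  elim: N f => [|N IH] f qf sf.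
    by exists f; rewrite expr0 scale1r subrr; split=> //; [rewrite -(addn0 g)|exact: idl0].
  pose f' := c *: f - f`_(g + N) *: ('X^N * h).
  have [||r [qr sr hr]] := IH f'.
  - move=> i; rewrite coefB !coefZ; apply: idlB => //; first exact: idlM.
    exact: idlMr.
  - apply/leq_sizeP => j; rewrite leq_eqVlt => /orP [/eqP <-|lj].
      rewrite coefB !coefZ coefXnM ltnNge leq_addl /= addnK /c lead_coefE -/g.
      by rewrite mulrC subrr.
    have fj : f`_j = 0 by rewrite nth_default // (leq_trans sf) // addnS.
    have hj : h`_(j - N) = 0 by rewrite nth_default // sh ltn_subRL addnC.
    by rewrite coefB !coefZ coefXnM fj hj if_same !mulr0 subrr.
  exists r; split=> //; rewrite exprSr -scalerA.
  apply: (idl_trans iH _ hr); rewrite -scalerBr /f' opprB addrC addrNK scalerA -mul_polyC.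
  by rewrite mulrA; apply: idlM.
pose N := size Q.
have /choice [r rP] : forall i : 'I_g, exists r : {poly R},
    [/\ polyI q r, (size r <= g)%N & H ((c ^+ N) *: (Q * 'X^i) - r)].
  move=> i; apply: pdiv; first exact: (idlMr _ (polyI_ideal iq) qQ).
  rewrite (leq_trans (size_polyMleq _ _)) // size_polyXn addnS /= addnC leq_add2r ltnW //.
(* Modulo H this matrix kills the column 1, X, ..., X^(g-1), because F lies in H and r i is c^N Q
   X^i there. Modulo q it is the scalar c^N x, because the r i have coefficients in q. *)
pose A : 'M[R]_g := \matrix_(i, j) ((c ^+ N * x) *+ (i == j) - (r i)`_j).
have AT (i : 'I_g) : H (\sum_j (A i j)%:P * 'X^j).
  have -> : \sum_j (A i j)%:P * 'X^j = (c ^+ N)%:P * (F * 'X^i) + ((c ^+ N) *: (Q * 'X^i) - r i).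
    have [_ sr _] := rP i.
    under eq_bigr => j _ do rewrite mxE polyCB mulrBl.
    rewrite sumrB addrA; congr (_ - _); last first.
      apply/polyP => l; rewrite coef_sum; under eq_bigr => j _ do rewrite coefCM coefXn.
      have [lg|gl] := ltnP l g; last first.
        rewrite [RHS]nth_default ?(leq_trans sr) // big1 // => j _.
        by rewrite gtn_eqF ?mulr0 // (leq_trans (ltn_ord j)).
      rewrite (bigD1 (Ordinal lg)) //= eqxx mulr1 big1 ?addr0 // => j nj.
      by rewrite eq_sym -(inj_eq val_inj) /= in nj *; rewrite (negbTE nj) mulr0.
    rewrite (bigD1 i) //= eqxx mulr1n big1 ?addr0 => [|j /negbTE nj]; last first.
      by rewrite eq_sym nj mulr0n mul0r.
    by rewrite -mul_polyC -mulrDr -mulrDl FQ polyCM mulrA.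
  apply: idlD => //; first by apply: idlM => //; apply: idlMr.
  by have [] := rP i.
exists (\det A); split; last first.
  exists (N * g)%N, g; rewrite exprM -exprMn; apply: det_congruent => // i j.
  by rewrite mxE addrAC subrr sub0r; apply: idlN => //; have [h1 _ _] := rP i; apply: h1.
have g0 : (0 < g)%N by rewrite -ltnS -sh.
have -> : (\det A)%:P = \sum_i (\adj A (Ordinal g0) i)%:P * (\sum_j (A i j)%:P * 'X^j).
  under eq_bigr => i _ do rewrite mulr_sumr.
  rewrite exchange_big /=; under eq_bigr => j _ do under eq_bigr => i _ do rewrite mulrA -polyCM.
  under eq_bigr => j _ do rewrite -mulr_suml -rmorph_sum.
  have E j : \sum_i \adj A (Ordinal g0) i * A i j = (\det A) *+ (Ordinal g0 == j).
    by have /matrixP/(_ (Ordinal g0) j) := mul_adj_mx A; rewrite !mxE.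
  rewrite (bigD1 (Ordinal g0)) //= E eqxx expr0 mulr1 big1 ?addr0 // => j nj.
  by rewrite E eq_sym (negbTE nj) mul0r.
by apply: idl_sum => // i _; apply: idlM.
Qed.

(** The ideal H + q[T] meets no constant s outside q: by [contraction_power] such an s would put c^M
    s^g in q, c being the leading coefficient of h. A prime over this ideal avoiding those constants
    contracts to q. *)
Lemma lying_over H h q : is_ideal H -> H h -> is_prime_ideal q ->
  (forall z, H z%:P -> q z) -> ~ q (lead_coef h) ->
  exists P, [/\ is_prime_ideal P, H `<=` P & forall z, P z%:P <-> q z].
Proof.
move=> iH Hh pq Hq nc; have iq := prime_ideal pq; have iqT := polyI_ideal iq.
have [||||P [pP HP nP]] := @prime_avoiding _ (ideal_add H (polyI q)) [set f | exists2 s, ~ q s & f = s%:P].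
- exact: ideal_add_ideal.
- by exists 1 => //; exact: prime_n1.
- move=> _ _ [s ns ->] [t nt ->]; exists (s * t); last by rewrite polyCM.
  by move=> /(primeM pq) [].
- move=> _ [s ns ->] /(contraction_power iH Hh iq) [z [/Hq qz [M [g hz]]]].
  have : q (lead_coef h ^+ M * s ^+ g) by rewrite -(subKr z (_ * _)); apply: idlB.
  by move=> /(primeM pq) [/(primeX pq)|/(primeX pq)].
exists P; split=> //; first by move=> f Hf; apply: HP; apply: addl.
move=> z; split=> [Pz|qz]; last by apply: HP; apply: addr_ => //; apply/polyI_C.
by apply: contrapT => nz; apply: (nP z%:P) => //; exists z.
Qed.

Lemma contract_prime (P : set {poly R}) : is_prime_ideal P -> is_prime_ideal (polyC @^-1` P).
Proof. exact: (@preim_prime _ _ (@polyC R)). Qed.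

(* If R[T]/P is algebraic over R, any v outside P divides modulo P a constant
   outside P: the constant term of its minimal relation. *)
Lemma divides_constant (P : set {poly R}) h v : is_prime_ideal P -> P h ->
  ~ P (lead_coef h)%:P -> ~ P v -> exists2 w, ~ P w%:P & ideal_add P (pid v) w%:P.
Proof.
move=> pP Ph; have iP := prime_ideal pP; set c := lead_coef h => nc nv.
have [s1|s1] := leqP (size h) 1.
  case: nc; suff <- : h = c%:P by [].
  by rewrite {1}(size1_polyC s1) /c lead_coefE; case: (size h) s1 => [|[]].
set g := (size h).-1; have sh : size h = g.+1 by rewrite /g prednK // ltnW.
have pdiv N (f : {poly R}) : (size f <= g + N)%N ->
    exists2 r : {poly R}, (size r <= g)%N & P ((c ^+ N) *: f - r).
  elim: N f => [|N IH] f sf.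
    by exists f; rewrite ?expr0 ?scale1r ?subrr; [rewrite -(addn0 g)|exact: idl0].
  pose f' := c *: f - f`_(g + N) *: ('X^N * h).
  have [|r sr hr] := IH f'.
    apply/leq_sizeP => j; rewrite leq_eqVlt => /orP [/eqP <-|lj].
      rewrite coefB !coefZ coefXnM ltnNge leq_addl /= addnK /c lead_coefE -/g.
      by rewrite mulrC subrr.
    have fj : f`_j = 0 by rewrite nth_default // (leq_trans sf) // addnS.
    have hj : h`_(j - N) = 0 by rewrite nth_default // sh ltn_subRL addnC.
    by rewrite coefB !coefZ coefXnM fj hj if_same !mulr0 subrr.
  exists r => //; rewrite exprSr -scalerA.
  apply: (idl_trans iP _ hr); rewrite -scalerBr /f' opprB addrC addrNK scalerA -mul_polyC.
  by rewrite mulrA; apply: idlM.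
pose N := size v; pose y := c ^+ N *: v.
have ny : ~ P y.
  by rewrite /y -mul_polyC polyC_exp => /(primeM pP) [/(primeX pP)|].
have yv : pid v y by exists (c ^+ N)%:P; rewrite mul_polyC.
have /choice [r rP] : forall i : 'I_g, exists r : {poly R},
    (size r <= g)%N /\ P (y * 'X^i - r).
  move=> i; have [|r sr hr] := pdiv N (v * 'X^i).
    by rewrite (leq_trans (size_polyMleq _ _)) // size_polyXn addnS /= addnC leq_add2r ltnW.
  by exists r; split=> //; rewrite /y -scalerAl.
pose A : 'M[R]_g := \matrix_(i, j) (r i)`_j.
pose B : 'M[{poly R}]_g := map_mx (comp_poly y) (char_poly_mx A).
have BT (i : 'I_g) : P (\sum_j B i j * 'X^j).
  have [sr hr] := rP i; suff -> : \sum_j B i j * 'X^j = y * 'X^i - r i by [].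
  under eq_bigr => j _ do rewrite !mxE comp_polyB comp_polyC mulrBl.
  rewrite sumrB; congr (_ - _); last first.
    apply/polyP => l; rewrite coef_sum; under eq_bigr => j _ do rewrite coefCM coefXn.
    have [lg|gl] := ltnP l g; last first.
      rewrite [RHS]nth_default ?(leq_trans sr) // big1 // => j _.
      by rewrite gtn_eqF ?mulr0 // (leq_trans (ltn_ord j)).
    rewrite (bigD1 (Ordinal lg)) //= eqxx mulr1 big1 ?addr0 // => j nj.
    by rewrite eq_sym -(inj_eq val_inj) /= in nj *; rewrite (negbTE nj) mulr0.
  rewrite (bigD1 i) //= eqxx mulr1n comp_polyX big1 ?addr0 // => j /negbTE nj.
  by rewrite eq_sym nj mulr0n comp_poly0 mul0r.
have g0 : (0 < g)%N by rewrite -ltnS -sh.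
have PB : P (char_poly A \Po y).
  have -> : char_poly A \Po y = \sum_i \adj B (Ordinal g0) i * (\sum_j B i j * 'X^j).
    under eq_bigr => i _ do rewrite mulr_sumr.
    rewrite exchange_big /=; under eq_bigr => j _ do under eq_bigr => i _ do rewrite mulrA.
    under eq_bigr => j _ do rewrite -mulr_suml.
    have E j : \sum_i \adj B (Ordinal g0) i * B i j = (\det B) *+ (Ordinal g0 == j).
      by have /matrixP/(_ (Ordinal g0) j) := mul_adj_mx B; rewrite !mxE.
    rewrite (bigD1 (Ordinal g0)) //= E eqxx expr0 mulr1 big1 ?addr0 => [|j nj].
      by rewrite /B det_map_mx.
    by rewrite E eq_sym (negbTE nj) mul0r.
  by apply: idl_sum => // i _; apply: idlM.
have {PB} : exists2 p : {poly R}, P (p \Po y) & exists i, ~ P (p`_i)%:P.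
  exists (char_poly A) => //; exists (size (char_poly A)).-1.
  by rewrite -lead_coefE (monicP (char_poly_monic A)) polyC1; exact: (prime_n1 pP).
move=> [p]; elim/poly_ind: p => [|p a IH]; first by move=> _ [i]; rewrite coef0; case; exact: (idl0 iP).
rewrite comp_polyD comp_polyM comp_polyX comp_polyC => h1 [i hi].
have [Pa|na] := pselect (P a%:P).
  apply: IH.
    have /(primeM pP) [//|//] : P ((p \Po y) * y) by rewrite -(addrK a%:P (_ * y)); apply: idlB.
  case: i hi => [|i]; rewrite -cons_poly_def coef_cons /= => hi; last by exists i.
  by case: hi.
exists a => //; have [d yd] := yv; apply/add_pidP; exists (- (p \Po y) * d).
by rewrite -mulrA -yd mulNr opprK addrC.
Qed.

(** Going up: modulo the monic h, a prime above the contraction of P lifts to a prime above P. *)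
Lemma dlt_contract d (P : set {poly R}) h : is_prime_ideal P -> P h -> h \is monic ->
  dlt d P -> dlt d (polyC @^-1` P).
Proof.
elim: d P => // d IH P pP Ph mh hd q pq [h1 h2].
have [||P' [pP' PP' Pq]] := @lying_over P h q (prime_ideal pP) Ph pq.
- by move=> z hz; apply: h1.
- by rewrite (monicP mh); apply: prime_n1.
have -> : q = polyC @^-1` P' by apply/seteqP; split=> z /Pq.
apply: IH => //; first exact: PP'.
apply: hd => //; split=> // P'P; apply: h2 => z /Pq; exact: P'P.
Qed.

(** Incomparability: if P' is strictly above P, an element of P' outside P divides modulo P a
    constant outside P, so the contractions differ as well. *)
Lemma dlt_lift d (P : set {poly R}) h : is_prime_ideal P -> P h -> h \is monic ->
  dlt d (polyC @^-1` P) -> dlt d P.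
Proof.
elim: d P => // d IH P pP Ph mh hd P' pP' [h1 h2].
apply: IH => //; first exact: h1.
apply: hd; first exact: contract_prime.
split; first by move=> z; apply: h1.
move=> h3; apply: h2 => v P'v; apply: contrapT => nv.
have [|w nw] := @divides_constant P h v pP Ph _ nv.
  by rewrite (monicP mh) polyC1; exact: (prime_n1 pP).
move=> /(@add_sub _ P (pid v) P' (prime_ideal pP') h1 (pid_sub (prime_ideal pP') P'v)).
by move=> /h3.
Qed.

(** A form of Chevalley's theorem. If P is the extension of its contraction, w is a coefficient of v
    and q[T] is the lift. Otherwise P contains some h with leading coefficient outside P, and w is
    this coefficient times a constant outside P that v divides modulo P; a lift of a q without w
    then omits v. *)
Lemma generic_lifting (P : set {poly R}) v : is_prime_ideal P -> ~ P v ->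
  exists2 w, ~ P w%:P & forall q, is_prime_ideal q -> polyC @^-1` P `<=` q -> ~ q w ->
    exists P', [/\ is_prime_ideal P', P `<=` P', forall z, P' z%:P <-> q z & ~ P' v].
Proof.
move=> pP nv; have iP := prime_ideal pP; pose q0 : set R := polyC @^-1` P.
have pq0 : is_prime_ideal q0 by apply: contract_prime.
have q0P (f : {poly R}) : polyI q0 f -> P f.
  move=> hf; rewrite -[f]coefK poly_def; apply: idl_sum => // i _.
  by rewrite -mul_polyC; apply: idlMr => //; apply: hf.
have [Pq|/existsNP [h0 /not_implyP [Ph0 nh0]]] := pselect (P `<=` polyI q0).
  have /existsNP [i hi] : ~ polyI q0 v by move=> /q0P.
  exists v`_i => // q pq q0q nq; exists (polyI q); split.
  - exact: polyI_prime.
  - by move=> f /Pq hf j; apply: q0q; apply: hf.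
  - by move=> z; apply: polyI_C; apply: prime_ideal.
  - by move=> /(_ i).
(* Leading terms with coefficient in P are subtracted; this stops because h0 has some coefficient
   outside P. *)
have [h Ph nc] : exists2 h, P h & ~ P (lead_coef h)%:P.
  move: {2}(size h0) (leqnn (size h0)) => n; elim: n h0 Ph0 nh0 => [|n IH] h Ph nh sh.
    case: nh => i; move: sh; rewrite leqn0 size_poly_eq0 => /eqP ->; rewrite coef0.
    by apply: idl0; apply: prime_ideal.
  have [Pc|nc] := pselect (P (lead_coef h)%:P); last by exists h.
  have [h00|hn0] := eqVneq h 0.
    by case: nh => i; rewrite h00 coef0; apply: idl0; apply: prime_ideal.
  pose h1 : {poly R} := h - lead_coef h *: 'X^((size h).-1); apply: (IH h1); rewrite /h1.
  - by apply: idlB => //; rewrite -mul_polyC; apply: (idlMr _ iP Pc).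
  - move=> hh; apply: nh; rewrite -(subrK (lead_coef h *: 'X^((size h).-1)) h).
    apply: (idlD (polyI_ideal (prime_ideal pq0)) hh) => i.
    by rewrite coefZ; apply: (idlMr _ (prime_ideal pq0) Pc).
  - apply/leq_sizeP => j nj; rewrite coefB coefZ coefXn.
    have [->|ne] := eqVneq j (size h).-1; first by rewrite mulr1 lead_coefE subrr.
    rewrite mulr0 subr0 nth_default //; move: sh nj ne.
    by case: (size h) => // l /=; rewrite ltnS => ln nj ne; rewrite ltn_neqAle eq_sym ne (leq_trans ln).
have [w nw hw] := divides_constant pP Ph nc nv.
exists (lead_coef h * w); first by rewrite polyCM => /(primeM pP) [].
move=> q pq q0q nq; have iq := prime_ideal pq.
have [|P' [pP' PP' P'q]] := @lying_over P h q iP Ph pq q0q.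
  by move=> qc; apply: nq; apply: idlMr.
exists P'; split=> // P'v; apply: nq; apply: idlM => //; apply/P'q.
have iP' := prime_ideal pP'.
exact: (@add_sub _ P (pid v) P' iP' PP' (pid_sub iP' P'v)).
Qed.

End PolyIdeals.

(** * Elementary operations on rows *)

Section ElementaryRows.
Variable R : comPzRingType.

Definition eop n (o : 'I_n * 'I_n * R) (v : 'I_n -> R) : 'I_n -> R :=
  fun l => if l == o.1.1 then v l + o.2 * v o.1.2 else v l.
Fixpoint eops n (s : seq ('I_n * 'I_n * R)) v :=
  if s is o :: s' then eops s' (eop o v) else v.
Definition evalid n (s : seq ('I_n * 'I_n * R)) := all (fun o => o.1.1 != o.1.2) s.
Definition req n (v w : 'I_n -> R) := exists2 s, evalid s & eops s v = w.

Lemma eops_cat n s t (v : 'I_n -> R) : eops (s ++ t) v = eops t (eops s v).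
Proof. by elim: s v => //= o s IH v; rewrite IH. Qed.
Lemma evalid_cat n (s t : seq ('I_n * 'I_n * R)) : evalid (s ++ t) = evalid s && evalid t.
Proof. exact: all_cat. Qed.
Lemma req_refl n (v : 'I_n -> R) : req v v. Proof. by exists [::]. Qed.
Lemma req_trans n (u v w : 'I_n -> R) : req u v -> req v w -> req u w.
Proof. by move=> [s hs <-] [t ht <-]; exists (s ++ t); rewrite ?evalid_cat ?hs // eops_cat. Qed.
Lemma req_op n (v : 'I_n -> R) i j x : i != j -> req v (eop (i, j, x) v).
Proof. by move=> h; exists [:: (i, j, x)]; rewrite //= h. Qed.

Definition einv n (s : seq ('I_n * 'I_n * R)) := rev (map (fun o => (o.1, - o.2)) s).
Lemma einv_valid n (s : seq ('I_n * 'I_n * R)) : evalid s -> evalid (einv s).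
Proof. by rewrite /evalid all_rev all_map. Qed.
Lemma eopK n (o : 'I_n * 'I_n * R) v : o.1.1 != o.1.2 -> eop (o.1, - o.2) (eop o v) = v.
Proof.
move=> h; apply/funext => l; rewrite /eop /=; case: eqP => // _.
by rewrite eq_sym (negbTE h) mulNr addrK.
Qed.
Lemma eopsK n s (v : 'I_n -> R) : evalid s -> eops (einv s) (eops s v) = v.
Proof.
elim: s v => //= o s IH v /andP [ho hs].
by rewrite /einv /= rev_cons -cats1 eops_cat IH //= eopK.
Qed.
Lemma req_sym n (v w : 'I_n -> R) : req v w -> req w v.
Proof. by move=> [s hs <-]; exists (einv s); [exact: einv_valid|exact: eopsK]. Qed.

Lemma eops_lin n s (v w : 'I_n -> R) (H : set R) : is_ideal H ->
  (forall i, H (v i - w i)) -> forall i, H (eops s v i - eops s w i).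
Proof.
move=> iH; elim: s v w => //= o s IH v w h i; apply: IH => {}i; rewrite /eop; case: eqP => // _.
by apply: idl_congD => //; rewrite -mulrBr; apply: idlM.
Qed.
Lemma eops_ideal n s (v : 'I_n -> R) (H : set R) : is_ideal H ->
  (forall i, H (v i)) -> forall i, H (eops s v i).
Proof.
move=> iH; elim: s v => //= o s IH v h i; apply: IH => {}i; rewrite /eop.
by case: eqP => // _; apply: idlD => //; apply: idlM.
Qed.
Lemma eops_span n s (v : 'I_n -> R) : evalid s -> ispan (eops s v) = ispan v.
Proof.
move=> hs; apply/seteqP; split; apply: span_sub; try exact: span_ideal.
  by apply: eops_ideal; [exact: span_ideal|exact: span_mem].
move=> i; rewrite -[v in v i](eopsK v hs).
by apply: eops_ideal; [exact: span_ideal|exact: span_mem].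
Qed.

Definition tri (a b c : R) : 'I_3 -> R := fun i => nth 0 [:: a; b; c] i.
Lemma triE (v : 'I_3 -> R) : v = tri (v 0) (v 1) (v 2%:R).
Proof. by apply/funext => -[[|[|[|//]]] h]; congr v; apply/val_inj. Qed.

Definition teq a b c a' b' c' := req (tri a b c) (tri a' b' c').

Lemma teq_trans a b c a1 b1 c1 a2 b2 c2 :
  teq a b c a1 b1 c1 -> teq a1 b1 c1 a2 b2 c2 -> teq a b c a2 b2 c2.
Proof. exact: req_trans. Qed.
Lemma teq_sym a b c a1 b1 c1 : teq a b c a1 b1 c1 -> teq a1 b1 c1 a b c.
Proof. exact: req_sym. Qed.

Lemma req_perm n m (f : 'I_n -> 'I_m) (v : 'I_m -> R) w : injective f ->
  req (fun i => v (f i)) w ->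
  exists w', [/\ req v w', forall i, w' (f i) = w i &
    forall j, (forall i, j != f i) -> w' j = v j].
Proof.
move=> fi [s hs <-] {w}; elim: s v hs => [|[[i j] x] s IH] v /=; first by exists v; split=> //; exact: req_refl.
move=> /andP [/= ij hs].
have fij : f i != f j by rewrite inj_eq.
have E : eop (i, j, x) (fun i => v (f i)) = (fun l => eop (f i, f j, x) v (f l)).
  by apply/funext => l; rewrite /eop /= inj_eq.
rewrite E; have [w' [h1 h2 h3]] := IH (eop (f i, f j, x) v) hs; exists w'; split=> //.
  by apply: req_trans h1; apply: req_op.
by move=> l hl; rewrite h3 // /eop /= (negbTE (hl i)).
Qed.

Lemma teq_perm a b c a1 b1 c1 (f : 'I_3 -> 'I_3) : injective f ->
  teq (tri a b c (f 0)) (tri a b c (f 1)) (tri a b c (f 2%:R))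
      (tri a1 b1 c1 (f 0)) (tri a1 b1 c1 (f 1)) (tri a1 b1 c1 (f 2%:R)) ->
  teq a b c a1 b1 c1.
Proof.
move=> fi; rewrite /teq -(triE (fun i => tri a b c (f i))) -(triE (fun i => tri a1 b1 c1 (f i))).
move=> /(req_perm fi) [w' [h1 h2 _]].
suff -> : tri a1 b1 c1 = w' by [].
by apply/funext => i; have [g _ fg] := injF_bij fi; rewrite -(fg i) h2.
Qed.

Lemma teq_swap12 a b c a1 b1 c1 : teq b a c b1 a1 c1 -> teq a b c a1 b1 c1.
Proof.
move=> h; apply: (@teq_perm _ _ _ _ _ _ (fun i => nth ord0 [:: (1 : 'I_3); 0; 2%:R] i)) => //.
by move=> [[|[|[|//]]] hi] [[|[|[|//]]] hj] // _; apply/val_inj.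
Qed.
Lemma teq_swap23 a b c a1 b1 c1 : teq a c b a1 c1 b1 -> teq a b c a1 b1 c1.
Proof.
move=> h; apply: (@teq_perm _ _ _ _ _ _ (fun i => nth ord0 [:: (0 : 'I_3); 2%:R; 1] i)) => //.
by move=> [[|[|[|//]]] hi] [[|[|[|//]]] hj] // _; apply/val_inj.
Qed.

Lemma teq12 x a b c a' : a' = a + x * b -> teq a b c a' b c.
Proof.
move=> ->; exists [:: ((0 : 'I_3), (1 : 'I_3), x)] => //=.
by apply/funext => -[[|[|[|//]]] h].
Qed.
Lemma teq13 x a b c a' : a' = a + x * c -> teq a b c a' b c.
Proof. by move=> h; apply: teq_swap23; apply: teq12 h. Qed.
Lemma teq21 x a b c b' : b' = b + x * a -> teq a b c a b' c.
Proof. by move=> h; apply: teq_swap12; apply: teq12 h. Qed.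
Lemma teq23 x a b c b' : b' = b + x * c -> teq a b c a b' c.
Proof. by move=> h; apply: teq_swap12; apply: teq13 h. Qed.
Lemma teq31 x a b c c' : c' = c + x * a -> teq a b c a b c'.
Proof. by move=> h; apply: teq_swap23; apply: teq21 h. Qed.
Lemma teq32 x a b c c' : c' = c + x * b -> teq a b c a b c'.
Proof. by move=> h; apply: teq_swap23; apply: teq23 h. Qed.

(** Whitehead's lemma: modulo a the matrix diag(1/t, t) is a product of elementary ones. The
    multiples of a that remain are cleared with the first entry. *)
Lemma teq_whitehead a b c t t' r : t * t' = 1 + r * a -> teq a (t * b) c a b (t * c).
Proof.
move=> h.
apply: (teq_trans (teq23 (x := 1) _ (erefl _))).
apply: (teq_trans (teq32 (x := t - 1) _ (erefl _))).
apply: (teq_trans (teq23 (x := - t') _ (erefl _))).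
apply: (teq_trans (teq21 (x := - r * b + r * (t * b + c)) (b' := b) _ _)).
  by ring: h.
by apply: (teq_trans (teq32 (x := - ((t - 1) * t)) _ (erefl _))); apply: (teq31 (x := 0)); ring.
Qed.

(** The first entry becomes a + s with s = bc' - cb', which is 1 modulo a. Multiples of it move (b,
    c) along (b', c') up to multiples of a; such a move does not change bc' - cb', so the first
    entry can be restored to a. *)
Lemma teq_bottom a b c a' b' c' x : a * a' + b * c' - c * b' = 1 ->
  teq a b c a (b + x * b') (c + x * c').
Proof.
move=> h; have {}h : a * a' = 1 - b * c' + c * b' by rewrite -h; ring.
pose s := b * c' - c * b'.
apply: (teq_trans (teq12 (x := c') _ (erefl _))).
apply: (teq_trans (teq13 (x := - b') (a' := a + s) _ _)); first by rewrite /s; ring.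
apply: (teq_trans (teq21 (x := x * b') _ (erefl _))).
apply: (teq_trans (teq31 (x := x * c') _ (erefl _))).
apply: (teq_trans (teq12 (x := - c') _ (erefl _))).
apply: (teq_trans (teq13 (x := b') (a' := a) _ _)); first by rewrite /s; ring.
apply: (teq_trans (teq21 (x := x * b' * (a' - 1)) (b' := b + x * b') _ _)); first by rewrite /s; ring: h.
by apply: (teq31 (x := x * c' * (a' - 1))); rewrite /s; ring: h.
Qed.

(** Two moves along complements: (b, c) goes to (b + b', c + c'), and for this row the complement
    (b2, c2) is chosen so that the move by -t ends at t(b, c) modulo a. *)
Lemma teq_scale a b c t t' r a' b' c' : t * t' = 1 + r * a -> a * a' + b * c' - c * b' = 1 ->
  teq a b c a (t * b) (t * c).
Proof.
move=> h1 h2.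
apply: (teq_trans (teq_bottom 1 h2)); rewrite !mul1r.
pose b2 := b' + (t' - 1) * (b + b'); pose c2 := c' + (t' - 1) * (c + c').
have h3 : a * a' + (b + b') * c2 - (c + c') * b2 = 1 by rewrite /b2 /c2 -[RHS]h2; ring.
apply: (teq_trans (teq_bottom (- t) h3)).
apply: (teq_trans (teq21 (x := r * (b + b')) (b' := t * b) _ _)); first by rewrite /b2; ring: h1.
by apply: (teq31 (x := r * (c + c'))); rewrite /c2; ring: h1.
Qed.

Definition tunim (a b c : R) := exists u v w, u * a + v * b + w * c = 1.
Lemma tunim_span a b c : tunim a b c <-> ispan (tri a b c) 1.
Proof.
split=> [[u [v [w <-]]]|[c' h]].
  by exists (tri u v w); rewrite !big_ord_recl big_ord0 addr0 addrA.
exists (c' 0), (c' 1), (c' 2%:R); rewrite [RHS]h !big_ord_recl big_ord0 addr0 addrA.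
by do ?congr (_ + _); congr (c' _ * _); apply/val_inj.
Qed.
Lemma tunim_teq a b c a1 b1 c1 : teq a b c a1 b1 c1 -> tunim a b c -> tunim a1 b1 c1.
Proof. by move=> [s hs e]; rewrite !tunim_span -e eops_span. Qed.

(** One factor t moves to the third entry, and then (tb, tc) is scaled back to (b, c). *)
Lemma teq_square a b c t t' r : t * t' = 1 + r * a -> tunim a b c -> teq a (t ^+ 2 * b) c a b c.
Proof.
move=> h1 [u [v [w h2]]]; rewrite expr2 -mulrA.
apply: (teq_trans (teq_whitehead _ _ h1)); apply: teq_sym.
by apply: (@teq_scale a b c t t' r u (- w) v h1); rewrite -h2; ring.
Qed.

(** Modulo (c, a) one has rb = 1, so that b - nu may be replaced by b - nu r^2 b^2 = wb, where w = 1
    - nu r^2 b is a unit modulo c. Then w moves to the entry a, and wa differs from a by a multiple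
    of b. *)
Lemma teq_nilpotent c a b nu s d : tunim c a b -> nu ^+ s = d * c -> teq c a b c a (b - nu).
Proof.
move=> [u [v [r h]]] hs; have {}h : r * b = 1 - u * c - v * a by rewrite -h; ring.
pose x := nu * r ^+ 2 * b; pose w := 1 - x.
have wu : w * (\sum_(i < s) x ^+ i) = 1 + (- (r ^+ 2 * b) ^+ s * d) * c.
  have -> : w * (\sum_(i < s) x ^+ i) = 1 - x ^+ s.
    by rewrite -[1 - x ^+ s]opprB (subrX1 x s) /w; ring.
  by rewrite /x -mulrA exprMn hs; ring.
apply: teq_sym.
apply: (teq_trans (teq31 (x := nu * u * (1 + r * b)) _ (erefl _))).
apply: (teq_trans (teq32 (x := nu * v * (1 + r * b)) (c' := w * b) _ _)).
  by rewrite /w /x; ring: h.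
apply: (teq_trans (teq_sym (teq_whitehead _ _ wu))).
by apply: (teq23 (x := nu * r ^+ 2 * a)); rewrite /w /x; ring.
Qed.

Lemma expr_congr (x y : R) m : exists z, x ^+ m = y ^+ m + z * (x - y).
Proof.
exists (\sum_(i < m) x ^+ (m.-1 - i) * y ^+ i).
by rewrite [_ * (x - y)]mulrC -subrXX addrC subrK.
Qed.

(** A interpolates between the two: it is a modulo (b^m, c) and b modulo a^m. Modulo A one has (1 -
    e)a = -eb, so for even m the m-th powers agree. Passing from e to e', which differ by a multiple
    of c, gives A'. The factors e^m and (1 - e')^m are squares of units modulo A and A', which
    [teq_square] removes. *)
Lemma teq_exchange a b c m : ~~ odd m -> (0 < m)%N -> tunim (a ^+ m) (b ^+ m) c ->
  teq a (b ^+ m) c b (a ^+ m) c.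
Proof.
move=> om m0 [al [be [ga h]]].
have {}h : al * a ^+ m = 1 - be * b ^+ m - ga * c by rewrite -h; ring.
have [l ml] : exists l, m = (l * 2)%N by exists m./2; rewrite muln2 even_halfK.
have am : a ^+ m = a ^+ m.-1 * a by rewrite -exprSr prednK.
have bm : b ^+ m = b ^+ m.-1 * b by rewrite -exprSr prednK.
have sqm (y : R) : y ^+ m = (y ^+ l) ^+ 2 by rewrite -exprM -ml.
pose e := 1 - al * a ^+ m; pose e' := be * b ^+ m.
pose A := a * (1 - e) + b * e; pose A' := a * (1 - e') + b * e'.
have unitX (y z w x : R) : y * z = 1 + x * w -> exists z' x', y ^+ l * z' = 1 + x' * w.
  move=> hy; have [x' hx'] : exists x', (1 + x * w) ^+ l = 1 + x' * w.
    elim: l {ml sqm} => [|i [x' IH]]; first by exists 0; rewrite mul0r addr0.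
    by exists (x' + x + x * x' * w); rewrite exprS IH; ring.
  by exists (z ^+ l), x'; rewrite -exprMn hy.
have s1 : teq a (b ^+ m) c A (b ^+ m) c.
  apply: (teq_trans (teq12 (x := be * (b - a)) _ (erefl _))).
  by apply: (teq13 (x := ga * (b - a))); rewrite /A /e; ring: h.
have U1 : tunim A (b ^+ m) c.
  apply: (tunim_teq s1); exists (al * a ^+ m.-1), be, ga; rewrite -mulrA -am h; ring.
have [z1 [x1 hz1]] : exists z' x', e ^+ l * z' = 1 + x' * A.
  apply: (unitX e (1 - al * a ^+ m.-1 * (b - a)) A (- (al * a ^+ m.-1))).
  by rewrite /A /e am; ring.
have s2 : teq A (b ^+ m) c A ((e * b) ^+ m) c.
  by rewrite exprMn (sqm e); apply: teq_sym; apply: (teq_square hz1 U1).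
have [x2 hx2] : exists x, ((1 - e) * a) ^+ m = (e * b) ^+ m + x * A.
  have [x hx] : exists x, ((1 - e) * a) ^+ m = (- (e * b)) ^+ m + x * A.
    have [x ->] := expr_congr ((1 - e) * a) (- (e * b)) m.
    by exists x; congr (_ + _ * _); rewrite /A; ring.
  by exists x; rewrite hx ml mulnC !exprM sqrrN.
have s3 : teq A ((e * b) ^+ m) c A (((1 - e) * a) ^+ m) c by apply: (teq21 (x := x2)); rewrite hx2.
have s4 : teq A (((1 - e) * a) ^+ m) c A' (((1 - e') * a) ^+ m) c.
  have ee : e = e' + ga * c by rewrite /e /e'; ring: h.
  apply: (teq_trans (teq13 (x := - (ga * (b - a))) (a' := A') _ _)).
    by rewrite /A /A' ee; ring.
  pose X := (1 - e') * a; have -> : (1 - e) * a = X - ga * a * c by rewrite /X ee; ring.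
  have [x ->] := expr_congr (X - ga * a * c) X m.
  by apply: (teq23 (x := x * (ga * a))); ring.
have s5 : teq A' (a ^+ m) c b (a ^+ m) c.
  apply: (teq_trans (teq12 (x := - al * (a - b)) _ (erefl _))).
  by apply: (teq13 (x := - ga * (a - b))); rewrite /A' /e'; ring: h.
have U2 : tunim A' (a ^+ m) c.
  apply: (tunim_teq (teq_sym s5)); exists (be * b ^+ m.-1), al, ga.
  by rewrite -mulrA -bm h; ring.
have [z2 [x3 hz2]] : exists z' x', (1 - e') ^+ l * z' = 1 + x' * A'.
  apply: (unitX (1 - e') (1 - be * b ^+ m.-1 * (a - b)) A' (- (be * b ^+ m.-1))).
  by rewrite /A' /e' bm; ring.
have s6 : teq A' (((1 - e') * a) ^+ m) c A' (a ^+ m) c.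
  by rewrite exprMn (sqm (1 - e')); apply: (teq_square hz2 U2).
exact: (teq_trans s1 (teq_trans s2 (teq_trans s3 (teq_trans s4 (teq_trans s6 s5))))).
Qed.

End ElementaryRows.

(** * Finitely generated algebras and their curves *)

Definition subring (R : pzRingType) (S : set R) : Prop :=
  [/\ S 1, forall x y, S x -> S y -> S (x - y) & forall x y, S x -> S y -> S (x * y)].

Section Subrings.
Variable R : comPzRingType.
Implicit Types S : set R.
Lemma sub0 S : subring S -> S 0. Proof. by case=> h1 h2 _; rewrite -(subrr 1); apply: h2. Qed.
Lemma subB S x y : subring S -> S x -> S y -> S (x - y). Proof. by case=> _ h _; apply: h. Qed.
Lemma subM S x y : subring S -> S x -> S y -> S (x * y). Proof. by case=> _ _ h; apply: h. Qed.
Lemma subN S x : subring S -> S x -> S (- x).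
Proof. by move=> h hx; rewrite -sub0r; apply: subB => //; apply: sub0. Qed.
Lemma subD S x y : subring S -> S x -> S y -> S (x + y).
Proof. by move=> h hx hy; rewrite -(opprK y); apply: subB => //; apply: subN. Qed.
Lemma subX S x n : subring S -> S x -> S (x ^+ n).
Proof.
by move=> h hx; elim: n => [|n IH]; rewrite ?expr0 ?exprS; [case: h|apply: subM].
Qed.
Lemma sub_sum S (I : Type) (r : seq I) (P : pred I) (F : I -> R) :
  subring S -> (forall i, P i -> S (F i)) -> S (\sum_(i <- r | P i) F i).
Proof.
move=> h hF; apply: (big_ind S) => //; first exact: sub0.
by move=> x y; apply: subD.
Qed.
End Subrings.

Lemma range_subring (R S : comPzRingType) (f : {rmorphism R -> S}) : subring (range f).
Proof.
split; first by exists 1 => //; rewrite rmorph1.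
  by move=> _ _ [x _ <-] [y _ <-]; exists (x - y) => //; rewrite rmorphB.
by move=> _ _ [x _ <-] [y _ <-]; exists (x * y) => //; rewrite rmorphM.
Qed.

(** Generation is phrased as an induction principle over subrings containing the constants. *)
Definition alg_gen (k R : comPzRingType) (f : {rmorphism k -> R}) (X : set R) : Prop :=
  forall S : set R, subring S -> (forall c, S (f c)) -> X `<=` S -> forall y, S y.

Definition infinite_type (k : eqType) := forall s : seq k, exists x, x \notin s.

Lemma closed_field_infinite (k : fieldType) : GRing.closed_field_axiom k -> infinite_type k.
Proof.
move=> hk s; pose p : {poly k} := \prod_(a <- s) ('X - a%:P) + 1.
have [->|s0] := eqVneq s [::]; first by exists 0.
have sp : size (\prod_(a <- s) ('X - a%:P)) = (size s).+1 by rewrite size_prod_XsubC.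
have sp' : size p = (size s).+1.
  by rewrite size_polyDl sp // size_poly1 ltnS lt0n size_eq0.
pose P i := - p`_i.
have mp : p \is monic.
  by rewrite monicE lead_coefDl ?sp ?size_poly1 ?ltnS ?lt0n ?size_eq0 //; apply/eqP/monicP/monic_prod_XsubC.
have [|x hx] := hk (size s) P; first by rewrite lt0n size_eq0.
exists x; apply/negP => xs.
have : p.[x] = 0.
  rewrite horner_coef sp' big_ord_recr /=.
  have -> : p`_(size s) = 1 by have := monicP mp; rewrite lead_coefE sp'.
  by rewrite mul1r hx -big_split big1 //= => i _; rewrite /P mulNr subrr.
rewrite /p hornerD hornerC (rootP _) ?add0r ?root_prod_XsubC //.
by move/eqP; rewrite oner_eq0.
Qed.

Lemma nonroot (k : fieldType) (D : idomainType) (f : {rmorphism k -> D}) (p : {poly D}) :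
  infinite_type k -> p != 0 -> exists c, p.[f c] != 0.
Proof.
move=> kinf p0; apply: contrapT => h.
have all0 c : p.[f c] = 0 by apply/eqP; apply: contrapT => n; apply: h; exists c; apply/negP.
have fin n : exists2 s : seq k, uniq s & size s = n.
  elim: n => [|n [s us <-]]; first by exists [::].
  by have [x xs] := kinf s; exists (x :: s); rewrite /= ?xs.
have [s us ss] := fin (size p).
have : all (root p) (map f s) by apply/allP => _ /mapP [c _ ->]; apply/rootP.
move=> /(max_poly_roots p0); rewrite map_inj_uniq ?us ?size_map ?ss ?ltnn; last exact: fmorph_inj.
by move=> /(_ isT).
Qed.

(** * Algebraic dependence in residue fields of curves *)

Definition ev1 (k : comNzRingType) (K : comNzRingType) (f : {rmorphism k -> K}) (t : K) :
  {rmorphism {poly k} -> K} := (horner_eval t \o map_poly f)%FUN.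
(** The outer variable goes to t and the inner one to u. *)
Definition ev2 (k : comNzRingType) (K : comNzRingType) (f : {rmorphism k -> K}) (t u : K) :
  {rmorphism {poly {poly k}} -> K} := ev1 (ev1 f u) t.

Lemma ev1E (k K : comNzRingType) (f : {rmorphism k -> K}) t p : ev1 f t p = (map_poly f p).[t].
Proof. by []. Qed.
Lemma ev1C (k K : comNzRingType) (f : {rmorphism k -> K}) t c : ev1 f t c%:P = f c.
Proof. by rewrite ev1E map_polyC hornerC. Qed.
Lemma ev1X (k K : comNzRingType) (f : {rmorphism k -> K}) t : ev1 f t 'X = t.
Proof. by rewrite ev1E map_polyX hornerX. Qed.

(** B is an iterated polynomial ring over R0 with one variable for each element of X. It maps to K
    without being a subring, so that Hilbert's theorem and [generic_lifting] can be applied one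
    variable at a time. *)
Lemma generated_model (K : comNzRingType) (X : seq K) (R0 : comNzRingType) (h0 : {rmorphism R0 -> K}) :
  exists (B : comNzRingType) (j : {rmorphism R0 -> B}) (h : {rmorphism B -> K}),
  [/\ forall r, h (j r) = h0 r, forall x, x \in X -> exists b, h b = x,
      noeth R0 -> noeth B &
      forall P v, is_prime_ideal P -> ~ P v -> exists2 w, ~ P (j w) &
        forall q, is_prime_ideal q -> j @^-1` P `<=` q -> ~ q w ->
        exists P', [/\ is_prime_ideal P', P `<=` P', forall z, P' (j z) <-> q z & ~ P' v]].
Proof.
elim: X => [|x X [B [j [h [h1 h2 h3 h4]]]]].
  exists R0, idfun, h0; split=> // P v pP nv; exists v => // q pq Pq nq.
  by exists q.
exists {poly B}, (@polyC B \o j)%FUN, (ev1 h x); split.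
- by move=> r; rewrite ev1C h1.
- move=> y; rewrite inE => /orP [/eqP ->|/h2 [b <-]]; first by exists 'X; rewrite ev1X.
  by exists b%:P; rewrite ev1C.
- by move=> /h3; apply: hilbert_basis.
- move=> P v pP nv; have [w nw hw] := generic_lifting pP nv.
  have [w' nw' hw'] := h4 _ w (contract_prime pP) nw; exists w' => //.
  move=> q pq Pq nq; have [P' [pP' PP' P'j nP'w]] := hw' q pq Pq nq.
  have [P'' [? ? P''C ?]] := hw P' pP' PP' nP'w.
  by exists P''; split=> // z; rewrite /= P''C P'j.
Qed.

Lemma noeth_generated (k : fieldType) (A : comNzRingType) (f : {rmorphism k -> A}) (X : seq A) :
  alg_gen f [set` X] -> noeth A.
Proof.
move=> gA; have [B [j [h [h1 h2 h3 _]]]] := generated_model X f.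
apply: (noeth_surj (g := h)); last exact/h3/noeth_field.
move=> y; have [] : (range h) y; last by move=> b _ <-; exists b.
apply: gA => [|c|x /h2 [b <-]]; [exact: range_subring|by exists (j c); rewrite ?h1|by exists b].
Qed.

Section Dependence.
Variables (k : fieldType) (Q : comPzRingType) (kap : {rmorphism k -> Q}) (X : seq Q).
Hypothesis gQ : alg_gen kap [set` X].
Hypothesis kinf : infinite_type k.
Variables (P : set Q) (dP : dlt 2 P).
Variables (K : fieldType) (g : {rmorphism Q -> K}).
Hypothesis gker : forall x, g x = 0 <-> P x.
Hypothesis gfrac : forall y, exists u v, g v != 0 /\ y = g u / g v.
Let io : {rmorphism k -> K} := (g \o kap)%FUN.

(** If t and u were independent, k[t, u] would be a polynomial ring, and for general constants its
    primes (t - la) and (t - la, u - mu) would lift to a model B of Q[1/b], b being a common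
    denominator of t and u. Restricted to Q they would form a chain of length two above P. *)
Lemma algebraically_dependent (t u : K) : exists2 F, F != 0 & ev2 io t u F = 0.
Proof.
apply: contrapT => nF.
have inj F : ev2 io t u F = 0 -> F = 0.
  by move=> h; apply/eqP; apply: contrapT => /negP n; apply: nF; exists F.
have [a [b [a' [b0 tE uE]]]] : exists a b a', [/\ g b != 0, t = g a / g b & u = g a' / g b].
  have [a1 [b1 [n1 e1]]] := gfrac t; have [a2 [b2 [n2 e2]]] := gfrac u.
  exists (a1 * b2), (b1 * b2), (a2 * b1); rewrite !rmorphM mulf_neq0 //; split=> //.
    by rewrite e1 -mulf_div mulfV ?mulr1.
  by rewrite e2 [g b1 * _]mulrC -mulf_div mulfV ?mulr1.
have [B [j [h [h1 h2 _ h4]]]] := generated_model ((g b)^-1 :: map g X) (ev2 io t u).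
have hQ y : exists c, h c = g y.
  apply: (gQ (S := [set y | exists c, h c = g y])) => /= [|c|x xX].
  - split; first by exists 1; rewrite !rmorph1.
      by move=> x z [c hc] [d hd]; exists (c - d); rewrite !rmorphB hc hd.
    by move=> x z [c hc] [d hd]; exists (c * d); rewrite !rmorphM hc hd.
  - by exists (j c%:P%:P); rewrite h1 /ev2 !ev1C.
  - by apply: h2; rewrite inE map_f ?orbT.
have [bi hbi] : exists c, h c = (g b)^-1 by apply: h2; rewrite inE eqxx.
have [bb hbb] := hQ b.
have unit_bb (P' : set B) : is_prime_ideal P' -> (forall c, h c = 0 -> P' c) -> ~ P' bb.
  move=> pP' hP' hb; apply: (prime_comax pP' (y := bi) hb); apply: hP'.
  by rewrite rmorphB rmorph1 rmorphM hbb hbi mulfV // subrr.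
(* There is no map from Q to B, only both map to K; primes of B that contain the kernel of h are
   transported along the relation h c = g r. *)
have pull (P' : set B) : is_prime_ideal P' -> (forall c, h c = 0 -> P' c) ->
    is_prime_ideal [set r | exists2 c, P' c & h c = g r].
  move=> pP' hP'; have iP' := prime_ideal pP'; split; first split.
  - by exists 0; [exact: idl0|rewrite !rmorph0].
  - by move=> x y [c ? hc] [d ? hd]; exists (c + d); [exact: idlD|rewrite !rmorphD hc hd].
  - move=> z x [c ? hc]; have [d hd] := hQ z.
    by exists (d * c); [exact: idlM|rewrite !rmorphM hc hd].
  - move=> [c Pc]; rewrite rmorph1 => hc; apply: (prime_n1 pP'); apply: (idlDl iP' _ Pc).
    by apply: hP'; rewrite rmorphB rmorph1 hc subrr.
  - move=> x y [c Pc hc]; have [d hd] := hQ x; have [e he] := hQ y.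
    have : P' (d * e).
      by apply: (idlDl iP' _ Pc); apply: hP'; rewrite rmorphB rmorphM hd he hc rmorphM subrr.
    by move=> /(primeM pP') [?|?]; [left; exists d|right; exists e].
pose P0 : set B := [set c | h c = 0].
have pP0 : is_prime_ideal P0.
  split; first split; rewrite /P0 /=; first exact: rmorph0.
  - by move=> x y hx hy /=; rewrite rmorphD hx hy addr0.
  - by move=> x y hy /=; rewrite rmorphM hy mulr0.
  - by apply/eqP; rewrite rmorph1 oner_eq0.
  - by move=> x y /= /eqP; rewrite rmorphM mulf_eq0 => /orP [/eqP|/eqP]; [left|right].
have [w1 nw1 hw1] := h4 P0 1 pP0 (prime_n1 pP0).
have [|la hla] := nonroot (p := w1) (@polyC k) kinf.
  by apply: contra_not_neq nw1 => ->; rewrite /P0 /= !rmorph0.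
pose q1 : set {poly {poly k}} := [set F | F.[la%:P] = 0].
have pq1 : is_prime_ideal q1.
  split; first split; rewrite /q1 /=; first by rewrite horner0.
  - by move=> x y hx hy /=; rewrite hornerD hx hy addr0.
  - by move=> x y hy /=; rewrite hornerM hy mulr0.
  - by apply/eqP; rewrite hornerC oner_eq0.
  - by move=> x y /= /eqP; rewrite hornerM mulf_eq0 => /orP [/eqP|/eqP]; [left|right].
have [||P1 [pP1 P01 P1q _]] := hw1 q1 pq1.
- move=> F; rewrite /preimage /P0 /= h1 => /inj ->; exact: (idl0 (prime_ideal pq1)).
- by apply/eqP.
have [w2 nw2 hw2] := h4 P1 1 pP1 (prime_n1 pP1).
have nq2 : w2.[la%:P] != 0 by apply/eqP => e; apply: nw2; apply/P1q.
have [mu hmu] := nonroot (idfun : {rmorphism k -> k}) kinf nq2.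
pose q2 : set {poly {poly k}} := [set F | F.[la%:P].[mu] = 0].
have pq2 : is_prime_ideal q2.
  split; first split; rewrite /q2 /=; first by rewrite !horner0.
  - by move=> x y hx hy /=; rewrite !hornerD hx hy addr0.
  - by move=> x y hy /=; rewrite !hornerM hy mulr0.
  - by apply/eqP; rewrite !hornerC oner_eq0.
  - by move=> x y /= /eqP; rewrite !hornerM mulf_eq0 => /orP [/eqP|/eqP]; [left|right].
have [||P2 [pP2 P12 P2q _]] := hw2 q2 pq2.
- by move=> F /P1q; rewrite /q1 /q2 /= => ->; rewrite horner0.
- by apply/eqP.
have k1 : forall c, h c = 0 -> P1 c by move=> c hc; apply: P01.
have k2 : forall c, h c = 0 -> P2 c by move=> c hc; apply/P12/k1.
pose R1 := [set r | exists2 c, P1 c & h c = g r].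
pose R2 := [set r | exists2 c, P2 c & h c = g r].
have X1 : P1 (j ('X - la%:P%:P)) by apply/P1q; rewrite /q1 /= !hornerE subrr.
have PR1 : P `<` R1.
  split; first by move=> x /gker gx; exists 0; [exact: (idl0 (prime_ideal pP1))|rewrite gx rmorph0].
  move=> /(_ (a - kap la * b)) h5.
  have /gker : P (a - kap la * b).
    apply: h5; exists (bb * j ('X - la%:P%:P)); first exact: (idlM _ (prime_ideal pP1)).
    rewrite rmorphM h1 hbb rmorphB /ev2 ev1X !ev1C /= rmorphB rmorphM tE.
    by rewrite mulrBr mulrC divfK // [_ * g b]mulrC.
  move=> e; have /inj/eqP : ev2 io t u ('X - la%:P%:P) = 0.
    apply: (mulfI b0); rewrite mulr0 rmorphB /ev2 ev1X !ev1C -[RHS]e /= rmorphB rmorphM tE.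
    by rewrite mulrBr mulrC divfK // [_ * g b]mulrC.
  by rewrite polyXsubC_eq0.
have R12 : R1 `<` R2.
  split; first by move=> x [c /P12 ? ?]; exists c.
  move=> /(_ (a' - kap mu * b)) h5.
  have E : h (bb * j ('X - mu%:P)%:P) = g (a' - kap mu * b).
    rewrite rmorphM h1 hbb /ev2 ev1C rmorphB ev1X !ev1C /= rmorphB rmorphM uE.
    by rewrite mulrBr mulrC divfK // [_ * g b]mulrC.
  have [|c P1c hc] := h5.
    exists (bb * j ('X - mu%:P)%:P) => //; apply: (idlM _ (prime_ideal pP2)).
    by apply/P2q; rewrite /q2 /= !hornerE subrr.
  have : P1 (bb * j ('X - mu%:P)%:P).
    by apply: (idlDl (prime_ideal pP1) _ P1c); apply: k1; rewrite rmorphB E hc subrr.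
  move=> /(primeM pP1) [|/P1q]; first exact: unit_bb.
  by rewrite /q1 /= hornerC => /eqP; rewrite polyXsubC_eq0.
exact: (dP (pull _ pP1 k1) PR1 (pull _ pP2 k2) R12).
Qed.
End Dependence.

Lemma pigeonhole_nat (T : finType) (f : nat -> T) : exists i j, (i < j)%N /\ f i = f j.
Proof.
have : ~~ injectiveb (fun i : 'I_#|T|.+1 => f i).
  apply/negP => /injectiveP /leq_card; by rewrite card_ord ltnn.
move=> /injectivePn [i [j nij e]].
case: (ltngtP i j) => [ij|ji|/val_inj /eqP]; [by exists i, j|by exists j, i|by rewrite (negbTE nij)].
Qed.

Definition polyS (R : comNzRingType) (S : set R) : set {poly R} := [set p | forall i, S p`_i].

Lemma polyS_subring (R : comNzRingType) (S : set R) : subring S -> subring (polyS S).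
Proof.
move=> hS; split.
- by move=> i; rewrite coef1; case: eqP => _; [case: hS|apply: sub0].
- by move=> p q hp hq i; rewrite coefB; apply: subB.
- by move=> p q hp hq i; rewrite coefM; apply: sub_sum => // j _; apply: subM.
Qed.
Lemma horner_polyS (R : comNzRingType) (S : set R) p x : subring S -> polyS S p -> S x -> S p.[x].
Proof.
by move=> hS hp hx; rewrite horner_coef; apply: sub_sum => // i _; apply: subM => //; apply: subX.
Qed.

(** * Orders with finite residue rings: a Minkowski bound *)

Definition mult (K : comNzRingType) (D : set K) (x : K) : set K := [set y | exists2 c, D c & y = c * x].
(** This says that D/I has at least N elements; counting is done in this form, without a
    quotient. *)
Definition incong (K : comNzRingType) (D I : set K) N : Prop :=
  exists y : 'I_N -> K, (forall i, D (y i)) /\ forall i j, I (y i - y j) -> i = j.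

Definition fin_index (K : comNzRingType) (D : set K) : Prop :=
  forall x, D x -> x != 0 -> exists N, ~ incong D (mult D x) N.+1.
Definition subideal (K : comNzRingType) (D I : set K) : Prop :=
  [/\ I `<=` D, I 0, forall x y, I x -> I y -> I (x - y) & forall c x, D c -> I x -> I (c * x)].
(** Up to one factor e for all ideals, every nonzero ideal is principal. This takes the place of
    finiteness of the class group. *)
Definition minkowski (K : comNzRingType) (D : set K) : Prop :=
  exists e, [/\ D e, e != 0 & forall I, subideal D I -> (exists2 x, I x & x != 0) ->
    exists h, [/\ I h, h != 0 & forall y, I y -> mult D h (e * y)]].

Lemma incong_mono (K : comNzRingType) (D I J : set K) N : J `<=` I -> incong D I N -> incong D J N.
Proof. by move=> JI [y [h1 h2]]; exists y; split=> // i j /JI /h2. Qed.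
Lemma incong_le (K : comNzRingType) (D I : set K) N M : (N <= M)%N -> incong D I M -> incong D I N.
Proof.
move=> NM [y [h1 h2]]; exists (fun i => y (widen_ord NM i)); split=> // i j /h2 /(congr1 val) /= e.
exact: val_inj.
Qed.
Lemma incong_max (K : comNzRingType) (D I : set K) N0 : ~ incong D I N0.+1 ->
  exists2 N, incong D I N & ~ incong D I N.+1.
Proof.
elim: N0 => [h|N IH h].
  by exists 0%N => //; exists (fun=> 0); split; case.
have [h'|h'] := pselect (incong D I N.+1); [by exists N.+1|exact: IH].
Qed.
Lemma mult_subideal (K : comNzRingType) (D : set K) x : subring D -> D x -> subideal D (mult D x).
Proof.
move=> hD Dx; split.
- by move=> _ [c Dc ->]; apply: subM.
- by exists 0; [exact: sub0|rewrite mul0r].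
- by move=> _ _ [c Dc ->] [d Dd ->]; exists (c - d); [exact: subB|rewrite mulrBl].
- by move=> c _ Dc [d Dd ->]; exists (c * d); [exact: subM|rewrite mulrA].
Qed.

Section Lattice.
Variables (K : fieldType) (Fs : seq K) (D : set K) (u : K) (r : nat) (w : 'I_r -> K) (f : K).
Hypotheses (uFs : uniq Fs) (sFs : subring [set` Fs]).
Hypotheses (sD : subring D) (FD : [set` Fs] `<=` D) (Du : D u) (Dw : forall i, D (w i)).
Hypotheses (Df : D f) (f0 : f != 0).
Hypothesis indep : forall c : 'I_r -> {poly K}, (forall i, polyS [set` Fs] (c i)) ->
  \sum_i (c i).[u] * w i = 0 -> forall i, c i = 0.
Hypothesis fDM : forall y, D y -> exists2 c : 'I_r -> {poly K},
  forall i, polyS [set` Fs] (c i) & f * y = \sum_i (c i).[u] * w i.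

Let q := size Fs.
(** [T l] indexes the set M_{<l} of combinations of the w i whose coefficients are polynomials in u
    of degree below l over the finite field [Fs]; it has q^(r l) elements, and [m] maps it
    injectively to D. *)
Let T l := {ffun 'I_r * 'I_l -> seq_sub Fs}.
Let cf l (t : T l) (i : 'I_r) : {poly K} := \poly_(s < l) (if insub s is Some s' then val (t (i, s')) else 0).
Let m l (t : T l) : K := \sum_i (cf t i).[u] * w i.
Let sP := polyS_subring sFs.

Let card_T l : #|{: T l}| = (q ^ (r * l))%N.
Proof. by rewrite card_ffun card_prod !card_ord card_seq_sub. Qed.

Let cf_Fs l (t : T l) i : polyS [set` Fs] (cf t i).
Proof.
move=> s; rewrite coef_poly; case: ltnP => sl; last exact: (sub0 sFs).
by rewrite insubT /=; apply: valP.
Qed.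
Let cf_size l (t : T l) i : (size (cf t i) <= l)%N.
Proof. exact: size_poly. Qed.
Let cf_onto l (c : 'I_r -> {poly K}) : (forall i, polyS [set` Fs] (c i) /\ (size (c i) <= l)%N) ->
  exists t : T l, forall i, cf t i = c i.
Proof.
move=> hc; have hF i s : (c i)`_s \in Fs by have [h _] := hc i; apply: h.
exists [ffun p : 'I_r * 'I_l => SeqSub (hF p.1 (val p.2))] => i; apply/polyP => s; rewrite coef_poly.
case: ltnP => sl; first by rewrite insubT /= ffunE.
by rewrite nth_default // (leq_trans (hc i).2).
Qed.
Let cf_inj l (t t' : T l) : (forall i, cf t i = cf t' i) -> t = t'.
Proof.
move=> h; apply/ffunP => -[i s]; apply: val_inj.
have /polyP/(_ s) := h i; rewrite !coef_poly ltn_ord (insubT (fun x => x < l)%N (ltn_ord s)) /=.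
by rewrite (_ : Sub _ _ = s) //; apply: val_inj.
Qed.
Let m_diff l (t t' : T l) : m t - m t' = \sum_i (cf t i - cf t' i).[u] * w i.
Proof. by rewrite /m -sumrB; apply: eq_bigr => i _; rewrite hornerD hornerN mulrBl. Qed.
Let m_inj l (t t' : T l) : m t = m t' -> t = t'.
Proof.
move=> e; apply: cf_inj => i; apply/eqP; rewrite -subr_eq0; apply/eqP.
apply: (indep (c := fun i => cf t i - cf t' i)); last by rewrite -m_diff e subrr.
by move=> j; apply: (subB sP); apply: cf_Fs.
Qed.
Let horner_D (p : {poly K}) : polyS [set` Fs] p -> D p.[u].
Proof. by move=> hp; apply: horner_polyS => // i; apply: FD. Qed.
Let m_D l (t : T l) : D (m t).
Proof. by apply: sub_sum => // i _; apply: subM => //; apply: horner_D; apply: cf_Fs. Qed.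

Let structure : exists (e : 'I_r -> 'I_r -> 'I_r -> {poly K}) (c0 : nat),
  (forall i j l, polyS [set` Fs] (e i j l) /\ (size (e i j l) <= c0)%N) /\
  forall i j, f * (w i * w j) = \sum_l (e i j l).[u] * w l.
Proof.
have /choice [e he] : forall ij : 'I_r * 'I_r, exists c : 'I_r -> {poly K},
    (forall i, polyS [set` Fs] (c i)) /\ f * (w ij.1 * w ij.2) = \sum_i (c i).[u] * w i.
  by move=> ij; have [c h1 h2] := fDM (subM sD (Dw ij.1) (Dw ij.2)); exists c.
exists (fun i j => e (i, j)), (\max_ij \max_l size (e ij l))%N; split=> [i j l|i j].
  split; first by have [h _] := he (i, j); apply: h.
  apply: (leq_trans (@leq_bigmax _ (fun l => size (e (i, j) l)) l)).
  exact: (@leq_bigmax _ (fun ij => \max_l0 size (e ij l0))%N (i, j)).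
by have [_ h] := he (i, j).
Qed.

(* Counting the translates f (y_i + h M_{<L}) inside M_{<L + l + c}. *)
Let index_bound : exists c0, forall l (c : 'I_r -> {poly K}) h N,
  (forall i, polyS [set` Fs] (c i) /\ (size (c i) <= l)%N) -> h = \sum_i (c i).[u] * w i -> h != 0 ->
  incong D (mult D h) N -> (N <= q ^ (r * (l + c0)))%N.
Proof.
have [e [c0 [he1 he2]]] := structure; exists c0 => l c h N hc hE h0 [y [Dy yi]].
have /choice [d hd] : forall i, exists c : 'I_r -> {poly K},
    (forall j, polyS [set` Fs] (c j)) /\ f * y i = \sum_j (c j).[u] * w j.
  by move=> i; have [c' h1 h2] := fDM (Dy i); exists c'.
pose L := (\max_i \max_j size (d i j))%N.
have Dh : D h by rewrite hE; apply: sub_sum => // i _; apply: subM => //; apply: horner_D; have [] := hc i.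
have q0 : (0 < q)%N.
  by rewrite /q lt0n size_eq0; apply/eqP => E; have [] := sFs; rewrite /= E.
have /choice [tr htr] : forall z : 'I_N * T L, exists t : T (L + (l + c0)), m t = f * (y z.1 + h * m z.2).
  move=> [i t]; pose C k := d i k + \sum_a \sum_b c a * cf t b * e a b k.
  have [|t' ht'] := @cf_onto (L + (l + c0)) C.
    move=> k; split.
      apply: (subD sP); first by have [h1 _] := hd i; apply: h1.
      apply: (sub_sum _ sP) => a _; apply: (sub_sum _ sP) => b _; apply: (subM sP).
        by apply: (subM sP); [have [] := hc a|exact: cf_Fs].
      by have [] := he1 a b k.
    apply: (leq_trans (size_polyD _ _)); rewrite geq_max; apply/andP; split.
      apply: (leq_trans (@leq_bigmax _ (fun j => size (d i j)) k)); apply: (leq_trans _ (leq_addr _ _)).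
      exact: (@leq_bigmax _ (fun i => \max_j size (d i j))%N i).
    apply: (leq_trans (size_sum _ _ _)); apply/bigmax_leqP => a _.
    apply: (leq_trans (size_sum _ _ _)); apply/bigmax_leqP => b _.
    have [[_ h1] h2 [_ h3]] := And3 (hc a) (cf_size t b) (he1 a b k).
    have := size_polyMleq (c a * cf t b) (e a b k); have := size_polyMleq (c a) (cf t b).
    by move=> g1 g2; lia.
  exists t'; rewrite /m /=; under eq_bigr => k _ do rewrite ht' /C hornerD mulrDl.
  have [_ hdi] := hd i; rewrite big_split /= -hdi mulrDr; congr (_ + _).
  transitivity (\sum_a \sum_b (c a).[u] * (cf t b).[u] * (f * (w a * w b))).
    under eq_bigr => k _ do rewrite horner_sum mulr_suml.
    rewrite exchange_big /=; apply: eq_bigr => a _.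
    under eq_bigr => k _ do rewrite horner_sum mulr_suml.
    rewrite exchange_big /=; apply: eq_bigr => b _.
    by rewrite he2 mulr_sumr; apply: eq_bigr => k _; rewrite !hornerM mulrA.
  rewrite hE /m mulr_suml mulr_sumr; apply: eq_bigr => a _.
  rewrite !mulr_sumr; apply: eq_bigr => b _; ring.
have tr_inj : injective tr.
  move=> [i t] [j t'] E; have : f * (y i + h * m t) = f * (y j + h * m t').
    by rewrite -(htr (i, t)) -(htr (j, t')) E.
  move=> /(mulfI f0) E'; have ij : i = j.
    apply: yi; exists (m t' - m t); first by apply: subB => //; apply: m_D.
    have -> : y i = y j + h * m t' - h * m t by rewrite -E' addrK.
    by ring.
  by move: E'; rewrite ij => /addrI /(mulfI h0) /m_inj ->.
have := leq_card tr tr_inj; rewrite card_prod card_ord !card_T mulnDr expnD mulnC.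
by rewrite leq_pmul2l // expn_gt0 q0.
Qed.

Lemma lattice_fin_index : fin_index D.
Proof.
have [c0 hb] := index_bound; move=> x Dx x0.
have [c hc1 hc2] := fDM Dx; pose l := (\max_i size (c i))%N.
exists (q ^ (r * (l + c0)))%N => h.
suff : (q ^ (r * (l + c0)) < q ^ (r * (l + c0)))%N by rewrite ltnn.
apply: (hb l c (f * x) _ _ hc2); last 2 first.
- by rewrite mulf_neq0.
- by apply: incong_mono h => _ [d Dd ->]; exists (d * f); [exact: subM|rewrite mulrA].
- by move=> i; split; [exact: hc1|exact: (@leq_bigmax _ (fun i => size (c i)) i)].
Qed.

(** Minkowski's argument. Let N = |D/I| and let l be least with q^(r l) > N. Two elements of M_{<l}
    agree modulo I, and their difference h has |D/Dh| at most C N with C independent of I; so Dh has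
    index at most C in I. For y in I, two of the C + 1 elements u^i y agree modulo Dh, and e is the
    product of all the differences u^i - u^j. *)
Lemma lattice_minkowski : minkowski D.
Proof.
have [c0 hb] := index_bound.
have D1 : D 1 by case: sD.
have r0 : (0 < r)%N.
  rewrite lt0n; apply/eqP => r0; have [c _] := fDM D1.
  by rewrite big1 => [|i]; [rewrite mulr1; apply/eqP|have := ltn_ord i; rewrite {2}r0].
have Fs0 : 0 \in Fs by exact: (sub0 sFs).
have Fs1 : 1 \in Fs by case: sFs.
have q1 : (1 < q)%N.
  have : uniq [:: 0; 1 : K] by rewrite /= inE eq_sym oner_eq0.
  move=> /uniq_leq_size; apply => x; rewrite !inE => /orP [/eqP ->|/eqP ->] //.
have trans_u i j : u ^+ i = u ^+ j -> i = j.
  move=> e; have /(_ (Ordinal r0)) : forall k : 'I_r, (if k == Ordinal r0 then 'X^i - 'X^j else 0) = 0 :> {poly K}.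
    apply: indep => [k|].
      case: eqP => _; last exact: (sub0 sP).
      have X1 l : polyS [set` Fs] 'X^l by move=> s; rewrite coefXn /=; case: eqP.
      exact: (subB sP).
    rewrite (bigD1 (Ordinal r0)) //= ?eqxx hornerD hornerN !hornerXn e subrr mul0r add0r big1 // => k /negbTE ->.
    by rewrite horner0 mul0r.
  rewrite ?eqxx => /eqP; rewrite subr_eq0 => /eqP/(congr1 (fun p : {poly K} => size p)).
  by rewrite !size_polyXn => -[].
pose C := (q ^ (r * c0.+1))%N.
pose e := \prod_(ij : 'I_C.+1 * 'I_C.+1 | ij.1 != ij.2) (u ^+ ij.1 - u ^+ ij.2).
have De : D e by apply: (big_ind D) => // [x y|ij _]; [exact: subM|apply: subB => //; exact: subX].
exists e; split=> //.
  apply/prodf_neq0 => -[i j] /= nij; rewrite subr_eq0; apply: contra nij => /eqP /trans_u e'.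
  exact/eqP/val_inj.
move=> I [ID I0 IB IM] [x Ix x0].
have [N1 hN1] := lattice_fin_index (ID _ Ix) x0.
have [N hN nN] : exists2 N, incong D I N & ~ incong D I N.+1.
  apply: (@incong_max _ _ _ N1) => h; apply: hN1; apply: incong_mono h => _ [c Dc ->].
  exact: IM.
have N0 : (0 < N)%N.
  rewrite lt0n; apply/eqP => N0; apply: nN; exists (fun=> 0); rewrite N0.
  by split=> [_|i j _]; [exact: sub0|rewrite !ord1].
have exl : exists l, (N < q ^ (r * l))%N.
  by exists N; rewrite (leq_trans (ltn_expl N q1)) // leq_exp2l // leq_pmull.
case: (ex_minnP exl) => l hl lmin.
have l0 : (0 < l)%N by move: hl; case: l {lmin} => // ; rewrite muln0 expn0 ltnS leqn0 => /eqP N00; rewrite N00 in N0.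
have hl' : (q ^ (r * l.-1) <= N)%N.
  by rewrite leqNgt; apply/negP => /lmin; rewrite leqNgt prednK ?leqnn.
have [t [t' [ntt' Itt']]] : exists t t' : T l, t != t' /\ I (m t - m t').
  apply: contrapT => h; apply: nN; apply: (incong_le (M := #|{: T l}|)); first by rewrite card_T.
  exists (fun i => m (enum_val i)); split=> [i|i j hij]; first exact: m_D.
  apply: enum_val_inj; apply/eqP; apply: contrapT => /negP n; apply: h.
  by exists (enum_val i), (enum_val j).
set h := m t - m t' in Itt'.
have h0 : h != 0 by rewrite subr_eq0; apply: contra ntt' => /eqP /m_inj ->.
exists h; split=> // y Iy; apply: contrapT => nmult.
suff : incong D (mult D h) (N * C.+1).
  move=> /(hb l (fun i => cf t i - cf t' i) h _ _ (m_diff t t') h0) hh.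
  have {hh} : (N * C.+1 <= q ^ (r * (l + c0)))%N.
    apply: hh => i; split; first by apply: (subB sP); apply: cf_Fs.
    by rewrite (leq_trans (size_polyD _ _)) // geq_max size_polyN !cf_size.
  have -> : (l + c0 = l.-1 + c0.+1)%N by rewrite addnS -addSn prednK.
  rewrite mulnDr expnD -/C => hh; have := leq_trans hh (leq_mul hl' (leqnn C)).
  by rewrite leq_pmul2l // ltnn.
have [z [Dz zi]] := hN.
have unm (i : 'I_(N * C.+1)) : (i %/ C.+1 < N)%N by rewrite ltn_divLR.
exists (fun i => z (Ordinal (unm i)) + u ^+ (i %% C.+1) * y); split=> [i|i j hij].
  by apply: subD => //; apply: subM => //; [exact: subX|exact: ID].
have ID' : I (z (Ordinal (unm i)) - z (Ordinal (unm j))).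
  have -> : z (Ordinal (unm i)) - z (Ordinal (unm j)) =
    (z (Ordinal (unm i)) + u ^+ (i %% C.+1) * y - (z (Ordinal (unm j)) + u ^+ (j %% C.+1) * y))
     - (u ^+ (i %% C.+1) - u ^+ (j %% C.+1)) * y by ring.
  apply: IB; first by case: hij => c Dc ->; apply: IM.
  by apply: IM => //; apply: subB => //; apply: subX.
have /(congr1 val) /= ediv := zi _ _ ID'.
have emod : (i %% C.+1 = j %% C.+1)%N.
  apply/eqP; apply: contrapT => /negP nij; apply: nmult.
  have hi k : (k %% C.+1 < C.+1)%N by rewrite ltn_mod.
  have E : z (Ordinal (unm i)) = z (Ordinal (unm j)) by congr z; apply: val_inj.
  move: hij; rewrite E; set Z := z _.
  have -> : Z + u ^+ (i %% C.+1) * y - (Z + u ^+ (j %% C.+1) * y) =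
            (u ^+ (i %% C.+1) - u ^+ (j %% C.+1)) * y by ring.
  move=> [c Dc hc]; rewrite /e (bigD1 (Ordinal (hi i), Ordinal (hi j))) //=.
  set E' := \prod_(_ | _) _; exists (E' * c); last by rewrite -[RHS]mulrA -hc; ring.
  apply: subM => //; apply: (big_ind D) => // [a b|ij _]; [exact: subM|apply: subB => //; exact: subX].
by apply: val_inj; rewrite /= (divn_eq i C.+1) (divn_eq j C.+1) ediv emod.
Qed.
End Lattice.

(** * Principal powers of invertible ideals *)

Section PicardTorsion.
Variables (K : fieldType) (D : set K).
Hypothesis sD : subring D.
Let D1 : D 1. Proof. by case: sD. Qed.

Let cm x y := exists2 st : K * K, D st.1 /\ D st.2 & st.1 * x + st.2 * y = 1.
Let cm_sym x y : cm x y -> cm y x.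
Proof. by move=> [[s t] [h1 h2] h3]; exists (t, s) => //; rewrite addrC. Qed.
Let cmX x y i : D x -> D y -> cm x y -> cm (x ^+ i) y.
Proof.
move=> Dx Dy [[s t] /= [h1 h2] h3]; elim: i => [|i [[s' t'] /= [h4 h5] h6]].
  by exists (1, 0); [split=> //; exact: sub0|rewrite mul1r mul0r addr0].
exists (s * s', t * (s' * x ^+ i + t' * y) + s * x * t').
  split=> /=; first exact: subM.
  by apply: subD => //; do ?[apply: subM => //]; rewrite ?h6.
by rewrite /= -[RHS](mulr1 1) -{1}h3 -h6 exprS; ring.
Qed.
Let cmXX x y i j : D x -> D y -> cm x y -> cm (x ^+ i) (y ^+ j).
Proof. by move=> Dx Dy h; apply/cm_sym/cmX => //; [exact: subX|apply/cm_sym/cmX]. Qed.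

Let mult_cm g z x y : cm x y -> mult D g (z * x) -> mult D g (z * y) -> mult D g z.
Proof.
move=> [[s t] /= [Ds Dt] h] [c Dc hc] [d Dd hd]; exists (s * c + t * d).
  by apply: subD => //; apply: subM.
by rewrite -[LHS]mulr1 -h mulrDl -!mulrA -hc -hd; ring.
Qed.

Section Colon.
Variables (a be be' d : K).
Hypotheses (Da : D a) (a0 : a != 0) (Db : D be) (Db' : D be') (Dd : D d).
Hypotheses (bb : be * be' = a * d) (cb : cm be be').

(** Put J = (a, be). The relations on be' make J invertible with inverse (a, be')/a, and J^i = (a^i,
    be^i). Here [fr i] is J^i, and for g in J^i [colon i g] is the ideal g J^(-i). *)
Let colon i g x := [/\ D x, mult D g (x * a ^+ i) & mult D g (x * be ^+ i)].
Let fr i g := exists2 xy : K * K, D xy.1 /\ D xy.2 & g = xy.1 * a ^+ i + xy.2 * be ^+ i.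

Let bbX i : be ^+ i * be' ^+ i = a ^+ i * d ^+ i.
Proof. by rewrite -!exprMn bb. Qed.

Let colon_self i g : D g -> colon i g g.
Proof.
by move=> Dg; split=> //; [exists (a ^+ i)|exists (be ^+ i)]; rewrite 1?[g * _]mulrC //; apply: subX.
Qed.
Let colon_dual i g : fr i g -> exists2 x, colon i g x & x * a ^+ i = g * be' ^+ i.
Proof.
move=> [[x y] /= [Dx Dy] ->]; exists (x * be' ^+ i + y * d ^+ i); last first.
  have h := bbX i; transitivity (x * a ^+ i * be' ^+ i + y * (a ^+ i * d ^+ i)); first ring.
  by rewrite -h; ring.
have [Da' Db1 Db2 Dd'] := And4 (subX i sD Da) (subX i sD Db) (subX i sD Db') (subX i sD Dd).
split.
- by apply: subD => //; apply: subM.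
- exists (be' ^+ i) => //; transitivity (x * a ^+ i * be' ^+ i + y * (a ^+ i * d ^+ i)); first ring.
  by rewrite -bbX; ring.
- exists (d ^+ i) => //; transitivity (x * (be ^+ i * be' ^+ i) + y * be ^+ i * d ^+ i); first ring.
  by rewrite bbX; ring.
Qed.
Let colon_out i g x : colon i g x ->
  exists2 zt : K * K, D zt.1 /\ D zt.2 & x * a ^+ i = g * (zt.1 * a ^+ i + zt.2 * be' ^+ i).
Proof.
move=> [Dx [t' Dt' ht'] [t Dt ht]]; have [[s s'] /= [Ds Ds'] hs] := cmXX i i Db Db' cb.
exists (s * t, s' * t'); first by split; apply: subM.
rewrite /= -[LHS]mulr1 -hs; transitivity (s * a ^+ i * (x * be ^+ i) + s' * be' ^+ i * (x * a ^+ i)); first ring.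
by rewrite ht' ht; ring.
Qed.

(** If gi J^(-i) = gj J^(-j), then J^(j-i) is generated by h = gj/gi. That h lies in D and in
    J^(j-i), and divides the two generators, is read off from the membership of gi, gj and of the
    elements of [colon_dual] in both colon ideals. *)
Lemma colon_generator i j gi gj : (i < j)%N -> fr i gi -> gi != 0 -> fr j gj -> gj != 0 ->
  (forall x, colon i gi x <-> colon j gj x) ->
  exists h, [/\ D h, fr (j - i) h, mult D h (a ^+ (j - i)) & mult D h (be ^+ (j - i))].
Proof.
move=> ij fi gi0 fj gj0 cij; set m := (j - i)%N; have jE : j = (m + i)%N by rewrite subnK // ltnW.
have frD l g : fr l g -> D g.
  by move=> [[x y] /= [Dx Dy] ->]; apply: subD => //; apply: subM => //; apply: subX.
have Dgi := frD _ _ fi; have Dgj := frD _ _ fj.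
pose h := gj / gi; have hg : gj = h * gi by rewrite divfK.
have h0 : h != 0 by rewrite mulf_neq0 ?invr_eq0.
have DX c l : D c -> D (c ^+ l) by apply: subX.
have aX l : a ^+ l != 0 by rewrite expf_neq0.
have [[al al'] /= [Dal Dal'] e1] := colon_out ((cij gj).2 (colon_self j Dgj)).
have [xj /cij /colon_out [[ga ga'] /= [Dga Dga'] e2] xjE] := colon_dual fj.
have e1' : h * be ^+ i = al * be ^+ i + al' * d ^+ i.
  apply: (mulfI (aX i)); apply: (mulfI gi0).
  transitivity (be ^+ i * (gj * a ^+ i)); first by rewrite hg; ring.
  rewrite e1; transitivity (gi * (al * a ^+ i * be ^+ i + al' * (be ^+ i * be' ^+ i))); first ring.
  by rewrite bbX; ring.
have e2' : h * be' ^+ j = a ^+ m * (ga * a ^+ i + ga' * be' ^+ i).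
  apply: (mulfI gi0); transitivity (gj * be' ^+ j); first by rewrite hg; ring.
  by rewrite -xjE {1}jE exprD; transitivity (a ^+ m * (xj * a ^+ i)); [ring|rewrite e2; ring].
have Dh : D h.
  have [[s s'] /= [Ds Ds'] hs] := cmXX i j Db Db' cb.
  rewrite -[h]mulr1 -hs; have -> : h * (s * be ^+ i + s' * be' ^+ j) = s * (h * be ^+ i) + s' * (h * be' ^+ j) by ring.
  rewrite e1' e2'; apply: subD => //; apply: subM => //.
    by apply: subD => //; apply: subM => //; apply: DX.
  by apply: subM; [|exact: DX|apply: subD => //; apply: subM => //; apply: DX].
have [[ep ep'] /= [Dep Dep'] e3] := colon_out ((cij gi).1 (colon_self i Dgi)).
have [xi /cij /colon_out [[de de'] /= [Dde Dde'] e4] xiE] := colon_dual fi.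
have bj : mult D h (be ^+ j).
  exists (ep * be ^+ j + ep' * d ^+ j).
    by apply: subD => //; apply: subM => //; apply: DX.
  apply: (mulfI (aX j)); apply: (mulfI gi0).
  transitivity (be ^+ j * (gi * a ^+ j)); first ring.
  rewrite e3 hg; transitivity (h * gi * (ep * a ^+ j * be ^+ j + ep' * (be ^+ j * be' ^+ j))); first ring.
  by rewrite bbX; ring.
have am' : mult D h (a ^+ m * be' ^+ i).
  exists (de * a ^+ j + de' * be' ^+ j).
    by apply: subD => //; apply: subM => //; apply: DX.
  apply: (mulfI gi0); transitivity (a ^+ m * (xi * a ^+ i)); first by rewrite xiE; ring.
  by transitivity (xi * a ^+ j); [rewrite jE exprD; ring|rewrite e4 hg; ring].
have am : mult D h (a ^+ m).
  apply: (mult_cm (cmXX i j Db' Db (cm_sym cb))) => //.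
  by case: bj => c Dc ->; exists (a ^+ m * c); [apply: subM => //; exact: DX|rewrite mulrA].
exists h; split=> //.
- have [[s s'] /= [Ds Ds'] hs] := cmXX m j Db Db' cb.
  exists (s' * (ga * a ^+ i + ga' * be' ^+ i), s * h).
    by split=> /=; apply: subM => //; apply: subD => //; apply: subM => //; apply: DX.
  rewrite /= -[LHS]mulr1 -hs; transitivity (s' * (h * be' ^+ j) + s * h * be ^+ m); first ring.
  by rewrite e2'; ring.
- have [c Dc amE] := am.
  apply: (mult_cm (cmXX m j Db' Db (cm_sym cb))).
    by rewrite bbX amE; exists (c * d ^+ m); [apply: subM => //; exact: DX|ring].
  by case: bj => c' Dc' ->; exists (be ^+ m * c'); [apply: subM => //; exact: DX|rewrite mulrA].
Qed.
End Colon.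

Lemma index_reps e : fin_index D -> D e -> e != 0 ->
  exists N (S : 'I_N -> K), (forall i, D (S i)) /\ forall y, D y -> exists i, mult D e (y - S i).
Proof.
move=> fD De e0; have [N0 /incong_max [N [S [DS Si]] nN]] := fD e De e0.
have [_ _ mB _] := mult_subideal sD De.
have mN x : mult D e x -> mult D e (- x) by move=> h; rewrite -sub0r; apply: mB => //; exists 0; rewrite ?mul0r //; apply: sub0.
exists N, S; split=> // y Dy; apply: contrapT => /forallNP ny; apply: nN.
exists (fun i => if unlift ord0 i is Some j then S j else y); split=> [i|i j].
  by case: unliftP.
case: (unliftP ord0 i) => [i' ->|->]; case: (unliftP ord0 j) => [j' ->|->] //.
- by move=> /Si ->.
- by move=> /mN; rewrite opprB => /ny.
- by move=> /ny.
Qed.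

(** With g_l in J^l chosen by [minkowski], the ideal g_l J^(-l) contains e, so it is determined by
    the classes of the finite ring D/De that it meets. By pigeonhole two exponents l < l' give the
    same ideals, for all i at once, and m = l' - l. *)
Lemma principal_powers n (a : K) (be be' d : 'I_n -> K) :
  fin_index D -> minkowski D -> D a -> a != 0 ->
  (forall i, [/\ D (be i), D (be' i), D (d i), be i * be' i = a * d i &
     exists s t, [/\ D s, D t & s * be i + t * be' i = 1]]) ->
  exists2 m, (0 < m)%N & forall i, exists h x y, [/\ D h, D x, D y,
    h = x * a ^+ m + y * be i ^+ m & mult D h (a ^+ m) /\ mult D h (be i ^+ m)].
Proof.
move=> fD [e [De e0 he]] Da a0 hb.
pose fr l i g := exists2 xy : K * K, D xy.1 /\ D xy.2 & g = xy.1 * a ^+ l + xy.2 * be i ^+ l.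
have /choice [g hg] : forall li : nat * 'I_n, exists g, [/\ fr li.1 li.2 g, g != 0 &
    mult D g (e * a ^+ li.1) /\ mult D g (e * be li.2 ^+ li.1)].
  move=> [l i] /=; have [Db Db' Dd _ _] := hb i; have DX c : D c -> D (c ^+ l) by apply: subX.
  have [||g [fg g0 hg]] := he (fr l i).
  - split.
    + by move=> _ [[x y] /= [Dx Dy] ->]; apply: subD => //; apply: subM => //; apply: DX.
    + by exists (0, 0); [split; exact: sub0|rewrite !mul0r addr0].
    + move=> _ _ [[x y] /= [Dx Dy] ->] [[x' y'] /= [Dx' Dy'] ->].
      by exists (x - x', y - y'); [split; apply: subB|rewrite /=; ring].
    + move=> c _ Dc [[x y] /= [Dx Dy] ->].
      by exists (c * x, c * y); [split; apply: subM|rewrite /=; ring].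
  - exists (a ^+ l); last by rewrite expf_neq0.
    by exists (1, 0); [split=> //; exact: sub0|rewrite /=; ring].
  exists g; split=> //; split; apply: hg.
    by exists (1, 0); [split=> //; exact: sub0|rewrite /=; ring].
  by exists (0, 1); [split=> //; exact: sub0|rewrite /=; ring].
have [N [S [DS Sc]]] := index_reps fD De e0.
pose colon l i x := [/\ D x, mult D (g (l, i)) (x * a ^+ l) & mult D (g (l, i)) (x * be i ^+ l)].
have Dg l i : D (g (l, i)).
  have [[[x y] /= [Dx Dy] ->] _ _] := hg (l, i); have [Db _ _ _ _] := hb i.
  by apply: subD => //; apply: subM => //; apply: subX.
have colonB l i x y : colon l i x -> mult D e (x - y) -> D y -> colon l i y.
  move=> [Dx h1 h2] [c Dc hc] Dy; have yE : y = x - c * e by rewrite -hc opprB addrC subrK.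
  have [_ _ [h3 h4]] := hg (l, i).
  have [_ _ mB mM] := mult_subideal sD (Dg l i).
  by split=> //; rewrite yE mulrBl -mulrA; apply: mB => //; apply: mM.
pose f l : {ffun 'I_n -> {set 'I_N}} := [ffun i => [set b | `[< colon l i (S b) >]]%SET].
have [l [l' [ll' /ffunP fE]]] := pigeonhole_nat f.
exists (l' - l)%N => [|i]; first by rewrite subn_gt0.
have cE x : colon l i x <-> colon l' i x.
  have {}fE b : colon l i (S b) <-> colon l' i (S b).
    have /setP/(_ b) := fE i; rewrite !ffunE !inE => E.
    by split=> /asboolP h; apply/asboolP; [rewrite -E|rewrite E].
  have mN y z : mult D e (y - z) -> mult D e (z - y).
    by move=> [c Dc hc]; exists (- c); [exact: subN|rewrite mulNr -hc opprB].
  split=> h; have [Dx _ _] := h; have [b hb'] := Sc x Dx.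
    by apply: (colonB _ _ (S b)) => //; [apply/fE; exact: colonB h _ _|exact: mN].
  by apply: (colonB _ _ (S b)) => //; [apply/fE; exact: colonB h _ _|exact: mN].
have [Db Db' Dd bb [s [t [Ds Dt cb]]]] := hb i.
have [f1 n1 _] := hg (l, i); have [f2 n2 _] := hg (l', i).
have [|h [Dh [[x y] /= [Dx Dy] hE] h1 h2]] :=
  @colon_generator a (be i) (be' i) (d i) Da a0 Db Db' Dd bb _ l l' _ _ ll' f1 n1 f2 n2 cE.
  by exists (s, t).
by exists h, x, y.
Qed.
End PicardTorsion.

(** * Frobenius and finite subfields *)

Lemma frobenius_sub (R : comPzRingType) p s (x y : R) : prime p -> p%:R = 0 :> R ->
  (x - y) ^+ (p ^ s) = x ^+ (p ^ s) - y ^+ (p ^ s).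
Proof.
case: p => [//|p] pp p0; have frobD (a b : R) : (a + b) ^+ p.+1 = a ^+ p.+1 + b ^+ p.+1.
  rewrite exprDn big_ord_recl big_ord_recr /= subn0 expr0 mulr1 bin0 mulr1n.
  rewrite /bump /= add1n subnn expr0 mul1r binn mulr1n big1 ?add0r // => i _.
  have /dvdnP [c ->] : (p.+1 %| 'C(p.+1, 1 + i))%N.
    by apply: prime_dvd_bin => //; have := ltn_ord i; lia.
  by rewrite -mulr_natr natrM p0 !mulr0.
have {}frobD (a b : R) : (a + b) ^+ (p.+1 ^ s) = a ^+ (p.+1 ^ s) + b ^+ (p.+1 ^ s).
  by elim: s => [|s IH]; rewrite ?expr1 // expnSr !exprM IH frobD.
by apply/eqP; rewrite eq_sym subr_eq -frobD subrK.
Qed.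

Lemma monic_splits (k : fieldType) (P : {poly k}) : GRing.closed_field_axiom k -> P \is monic ->
  exists rs : seq k, P = \prod_(r <- rs) ('X - r%:P).
Proof.
move=> hk; move: {2}(size P) (leqnn (size P)) => n; elim: n P => [|n IH] P sP mP.
  by move: sP; rewrite leqn0 size_poly_eq0 => /eqP P0; move: mP; rewrite P0 monicE lead_coef0 eq_sym oner_eq0.
have [s1|s1] := leqP (size P) 1.
  exists [::]; rewrite big_nil; move: mP; rewrite monicE => /eqP mP.
  rewrite {1}(size1_polyC s1) -polyC1 -mP lead_coefE; congr _%:P.
  by case: (size P) s1 => [|[]].
have [|x hx] := hk (size P).-1 (fun i => - P`_i); first by rewrite -ltnS prednK // ltnW.
have /factor_theorem [P' PE] : root P x.
  apply/rootP; rewrite horner_coef; case: (size P) s1 mP hx (lead_coefE P) => // l _ mP hx lE.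
  rewrite big_ord_recr /= -lE (monicP mP) mul1r hx -big_split big1 //= => i _.
  by rewrite mulNr subrr.
have mP' : P' \is monic by move: mP; rewrite PE monicMr ?monicXsubC.
have [|rs E] := IH P' _ mP'.
  by move: sP; rewrite PE size_Mmonic ?monicXsubC ?size_XsubC ?addn2 ?monic_neq0.
by exists (rcons rs x); rewrite PE E -cats1 big_cat big_seq1.
Qed.

Section FiniteSubfields.
Variables (p : nat) (k : fieldType).
Hypotheses (pk : p \in [pchar k]) (kclosed : GRing.closed_field_axiom k).
Hypothesis kfin : forall x : k, exists2 s, (0 < s)%N & x ^+ (p ^ s) = x.

Lemma frobenius_roots s : (0 < s)%N -> exists rs : seq k, [/\ uniq rs,
  forall x, (x \in rs) = (x ^+ (p ^ s) == x) & 'X^(p ^ s) - 'X = \prod_(r <- rs) ('X - r%:P)].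
Proof.
move=> s0; have pp := pcharf_prime pk.
have q1 : (1 < p ^ s)%N by rewrite -(exp1n s) ltn_exp2r // prime_gt1.
have mP : ('X^(p ^ s) - 'X : {poly k}) \is monic.
  by rewrite monicE lead_coefDl ?lead_coefXn // size_polyN size_polyX size_polyXn ltnS.
have [rs hrs] := monic_splits kclosed mP.
exists rs; split=> //.
- rewrite -separable_prod_XsubC -hrs unlock derivB derivXn derivX -mulr_natr.
  have -> : ((p ^ s)%:R : {poly k}) = 0.
    by rewrite -polyC_natr natrX (pcharf0 pk) expr0n eqn0Ngt s0.
  by rewrite mulr0 sub0r -[-1]scaleN1r coprimepZr ?oppr_eq0 ?oner_eq0 ?coprimep1.
- move=> x; have := root_prod_XsubC rs x; rewrite -hrs => <-.
  by rewrite /root !hornerE subr_eq0.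
Qed.

Lemma frobenius_iter (R : pzRingType) (x : R) a b : x ^+ (p ^ a) = x -> x ^+ (p ^ (a * b)) = x.
Proof.
by move=> h; elim: b => [|b IH]; rewrite ?muln0 ?expr1 // mulnS expnD exprM h.
Qed.

Lemma finite_subfield (C : seq k) : exists s (rs : seq k), [/\ (0 < s)%N, uniq rs,
  forall x, (x \in rs) = (x ^+ (p ^ s) == x), {subset C <= rs} &
  'X^(p ^ s) - 'X = \prod_(r <- rs) ('X - r%:P)].
Proof.
have [s s0 hs] : exists2 s, (0 < s)%N & forall x, x \in C -> x ^+ (p ^ s) = x.
  elim: C => [|x C [s s0 hs]]; first by exists 1%N.
  have [t t0 ht] := kfin x; exists (t * s)%N; first by rewrite muln_gt0 t0.
  move=> y; rewrite inE => /orP [/eqP ->|/hs h]; first exact: frobenius_iter.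
  by rewrite mulnC; apply: frobenius_iter.
have [rs [urs rsE hrs]] := frobenius_roots s0; exists s, rs; split=> //.
by move=> x /hs hx; rewrite rsE hx.
Qed.
End FiniteSubfields.

(** * Integral extensions and Nagata's substitution *)

Section IntegralExtension.
Variable K : fieldType.
Implicit Types (A S : set K).

Definition finspan A S := exists (I : finType) (w : I -> K), (forall i, S (w i)) /\
  forall y, S y -> exists2 c : I -> K, forall i, A (c i) & y = \sum_i c i * w i.

(** Powers of x below the degree of m suffice over S. The minimality clause is what later keeps the
    orders inside the image of Q. *)
Lemma adjoin_integral A S x m : subring A -> subring S -> A `<=` S -> finspan A S ->
  polyS A m -> m \is monic -> root m x ->
  exists S', [/\ subring S', S `<=` S', S' x, finspan A S' &
    forall T, subring T -> S `<=` T -> T x -> S' `<=` T].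
Proof.
move=> sA sS AS [I [w [Sw wS]]] Am mm /rootP mx; have sP := polyS_subring sS.
have polySC c : S c -> polyS S c%:P by move=> Sc i; rewrite coefC; case: eqP => // _; exact: sub0.
have polySX : polyS S 'X by move=> i; rewrite coefX; case: eqP => _; [case: sS|exact: sub0].
pose S' : set K := [set q.[x] | q in polyS S].
have S'w q : polyS S q -> S' q.[x] by exists q.
exists S'; split.
- split; first by rewrite -(hornerC 1 x); apply: S'w; apply: polySC; case: sS.
    by move=> _ _ [a ha <-] [b hb <-]; rewrite -hornerN -hornerD; apply: S'w; apply: (subB sP).
  by move=> _ _ [a ha <-] [b hb <-]; rewrite -hornerM; apply: S'w; apply: (subM sP).
- by move=> y Sy; rewrite -(hornerC y x); apply: S'w; apply: polySC.
- by rewrite -[x]hornerX; apply: S'w.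
- pose d := (size m).-1; exists (I * 'I_d)%type, (fun ij : I * 'I_d => w ij.1 * x ^+ (val ij.2)); split.
    move=> [i j] /=; have -> : w i * x ^+ j = ((w i)%:P * 'X^j).[x] by rewrite hornerM hornerXn hornerC.
    by apply: S'w; apply: (subM sP); [exact: polySC|exact: (subX _ sP)].
  have red n (q : {poly K}) : polyS S q -> (size q <= n)%N ->
      exists q', [/\ polyS S q', (size q' <= d)%N & q.[x] = q'.[x]].
    elim: n q => [|n IH] q Sq sq.
      by exists q; split=> //; rewrite (leq_trans sq).
    have [qd|dq] := leqP (size q) d; first by exists q.
    pose q1 := q - q`_n *: ('X^(n - d) * m).
    have sm : size m = d.+1 by rewrite prednK // size_poly_gt0 monic_neq0.
    have md : m`_d = 1 by have := monicP mm; rewrite lead_coefE.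
    have dn : (d <= n)%N by rewrite -ltnS (leq_trans dq).
    have [||q' [Sq' sq' e]] := IH q1.
    - apply: (subB sP) => // i; rewrite coefZ; apply: subM => //.
      by apply: (subM sP); [exact: (subX _ sP)|move=> j; apply: AS].
    - apply/leq_sizeP => j; rewrite leq_eqVlt => /orP [/eqP <-|nj].
        by rewrite coefB coefZ coefXnM ltnNge leq_subr /= subKn // md mulr1 subrr.
      rewrite coefB coefZ coefXnM [q`_j]nth_default ?(leq_trans sq) // sub0r.
      rewrite [m`__]nth_default ?if_same ?mulr0 ?oppr0 // sm; lia.
    exists q'; split=> //; rewrite -e /q1 hornerD hornerN hornerZ hornerM mx !mulr0 subr0 //.
  move=> _ [q Sq <-]; have [q' [Sq' sq' ->]] := red _ q Sq (leqnn _).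
  have /choice [c hc] : forall j : 'I_d, exists c : I -> K, (forall i, A (c i)) /\ q'`_j = \sum_i c i * w i.
    by move=> j; have [c ? ?] := wS _ (Sq' j); exists c.
  exists (fun ij : I * 'I_d => c ij.2 ij.1) => [[i j]|]; first by have [] := hc j.
  rewrite (horner_coef_wide _ sq').
  under eq_bigr => j _ do (rewrite (hc j).2 mulr_suml).
  rewrite exchange_big pair_big /=; apply: eq_bigr => -[i j] _ /=; ring.
- by move=> T sT ST Tx _ [q Sq <-]; apply: horner_polyS => // i; apply: ST.
Qed.

Lemma adjoin_all A (Y : seq K) : subring A ->
  (forall y, y \in Y -> exists m, [/\ polyS A m, m \is monic & root m y]) ->
  exists S, [/\ subring S, A `<=` S, forall y, y \in Y -> S y, finspan A S &
    forall T, subring T -> A `<=` T -> (forall y, y \in Y -> T y) -> S `<=` T].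
Proof.
move=> sA; elim: Y => [|x Y IH] hY.
  exists A; split=> //; exists unit, (fun=> 1); split=> [_|y Ay]; first by case: sA.
  by exists (fun=> y) => //; rewrite (big_pred1 tt) ?mulr1 // => -[].
have [|S [sS AS SY fS minS]] := IH; first by move=> y hy; apply: hY; rewrite inE hy orbT.
have [m [Am mm mx]] := hY x (mem_head _ _).
have [S' [sS' SS' S'x fS' minS']] := adjoin_integral sA sS AS fS Am mm mx.
exists S'; split=> //; first exact: subset_trans SS'.
  by move=> y; rewrite inE => /orP [/eqP ->|/SY /SS'].
move=> T sT AT TY; apply: minS' => //; last by apply: TY; rewrite mem_head.
by apply: minS => // y hy; apply: TY; rewrite inE hy orbT.
Qed.
End IntegralExtension.

Section Integrality.
Variables (R : comNzRingType) (K : fieldType) (f : {rmorphism R -> K}).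
Lemma integral_subring : subring [set z | integralOver f z].
Proof.
split; first exact: integral1.
  by move=> x y; apply: integral_sub.
by move=> x y; apply: integral_mul.
Qed.
Lemma integral_polyS p u : polyS [set z | integralOver f z] p -> p \is monic -> root p u -> integralOver f u.
Proof. by move=> h mp rp; apply: integral_root_monic mp rp _; apply/integral_poly. Qed.
End Integrality.

Lemma integral_trans (R S : comNzRingType) (K : fieldType) (f : {rmorphism R -> K})
    (g : {rmorphism S -> K}) x :
  (forall s, integralOver f (g s)) -> integralOver g x -> integralOver f x.
Proof.
move=> h [m mm mx]; apply: integral_polyS mx; last exact: monic_map.
by move=> i; rewrite coef_map; apply: h.
Qed.

(* Nagata's substitution u = u' + t^r makes a relation between u and t monic in t. *)
Lemma nagata (k : fieldType) (K : fieldType) (io : {rmorphism k -> K}) (t u : K) (F : {poly {poly k}}) :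
  F != 0 -> ev2 io u t F = 0 -> exists r,
  integralOver (ev1 io (u - t ^+ r)) t /\ integralOver (ev1 io (u - t ^+ r)) u.
Proof.
move=> F0 h; pose r := (\max_(i < size F) size (F`_i)%R).+1; exists r.
set u' := u - t ^+ r.
have sizeF i : (size (F`_i)%R < r)%N.
  have [iF|Fi] := ltnP i (size F); last by rewrite nth_default // size_poly0.
  by rewrite ltnS; apply: (@leq_bigmax _ (fun i : 'I_(size F) => size (F`_(val i))%R) (Ordinal iF)).
pose J := [set z : K | integralOver (ev1 io u') z].
have sJ : subring J := integral_subring _; have sP := polyS_subring sJ.
pose M : {poly K} := 'X^r + u'%:P.
have sM : size M = r.+1 by rewrite size_polyDl size_polyXn // size_polyC ltnS; case: eqP.
have mM : M \is monic by rewrite monicE lead_coefDl ?lead_coefXn // size_polyXn size_polyC ltnS; case: eqP.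
have JX : polyS J 'X by move=> i; rewrite coefX; apply: integral_nat.
have JC c : J c -> polyS J c%:P by move=> Jc i; rewrite coefC; case: eqP => // _; apply: integral0.
have Ju' : J u' by have := integral_id (ev1 io u') 'X; rewrite ev1X.
have Jk c : J (io c) by have := integral_id (ev1 io u') c%:P; rewrite ev1C.
have JM : polyS J M by apply: (subD sP); [exact: (subX _ sP)|exact: JC].
pose G i : {poly K} := map_poly io F`_i.
have JG i : polyS J (G i) by move=> j; rewrite coef_map; apply: Jk.
have sG i : size (G i) = size F`_i by rewrite size_map_poly.
pose l := (size F).-1; have sF : size F = l.+1 by rewrite prednK // size_poly_gt0.
(* As r exceeds the degrees of all coefficients of F, the degrees deg (G i) + r i are dominated by
   the one for i = l; so the leading coefficient of Phi is a nonzero constant of k. *)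
pose Phi := \sum_(i < l.+1) G i * M ^+ i.
have sMX i : size (M ^+ i) = (r * i).+1 by rewrite -[LHS]prednK ?size_exp ?sM // size_poly_gt0 expf_neq0 // monic_neq0.
have low : (size (\sum_(i < l) G i * M ^+ i)%R <= r * l)%N.
  apply: (leq_trans (size_sum _ _ _)); apply/bigmax_leqP => i _.
  apply: (leq_trans (size_polyMleq _ _)); rewrite sG sMX addnS /=.
  have : (r * i.+1 <= r * l)%N by rewrite leq_mul2l ltn_ord orbT.
  rewrite mulnS; have := sizeF i; move: (size F`_i)%R (r * i)%N (r * l)%N => x y z; lia.
have Gl0 : G l != 0.
  by rewrite map_poly_eq0 -lead_coefE lead_coef_eq0.
have sTop : size (G l * M ^+ l) = (size (F`_l)%R + r * l)%N.
  by rewrite size_Mmonic ?monic_exp // sG sMX addnS.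
have Fl0 : (0 < size (F`_l)%R)%N by rewrite -sG size_poly_gt0.
have lc0 : lead_coef Phi = lead_coef (G l).
  rewrite /Phi big_ord_recr /= addrC lead_coefDl ?sTop; first by rewrite lead_coef_Mmonic ?monic_exp.
  by apply: (leq_ltn_trans low); lia.
have lcE : lead_coef (G l) = io (lead_coef F`_l) by rewrite lead_coef_map.
have lc_n0 : lead_coef F`_l != 0 by rewrite lead_coef_eq0 -size_poly_gt0.
have It : integralOver (ev1 io u') t.
  apply: (@integral_polyS _ _ _ ((lead_coef Phi)^-1 *: Phi)).
  - rewrite -mul_polyC; apply: (subM sP).
      by apply: JC; rewrite lc0 lcE -fmorphV; apply: Jk.
    by apply: (sub_sum _ sP) => i _; apply: (subM sP) => //; apply: (subX _ sP).
  - by rewrite monicE lead_coefZ mulVf // lc0 lead_coef_eq0.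
  - apply/rootP; rewrite hornerZ horner_sum.
    have -> : \sum_(i < l.+1) (G i * M ^+ i).[t] = ev2 io u t F.
      rewrite /ev2 ev1E -sF (horner_coef_wide _ (size_poly _ _)).
      apply: eq_bigr => i _; rewrite hornerM horner_exp coef_map; congr (_ * _ ^+ _).
      by rewrite /M hornerD hornerXn hornerC addrC subrK.
    by rewrite h mulr0.
split=> //; rewrite -[u](subrK (t ^+ r)) -/u'; apply: (subD sJ) => //.
exact: subX.
Qed.

Lemma sum_enum_val (V : nmodType) (I : finType) (F : I -> V) :
  \sum_i F i = \sum_(j < #|I|) F (enum_val j).
Proof. exact: (@big_enum_val V 0 _ I predT F). Qed.

(** * Affine curves and their orders over finite fields *)

Section CurveOrders.
Variables (k : fieldType) (Q : comPzRingType) (kap : {rmorphism k -> Q}) (X : seq Q).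
Hypothesis gQ : alg_gen kap [set` X].
Hypothesis kclosed : GRing.closed_field_axiom k.
Variables (P : set Q) (pP : is_prime_ideal P) (dP : dlt 2 P).
Variables (K : fieldType) (g : {rmorphism Q -> K}).
Hypothesis gker : forall x, g x = 0 <-> P x.
Hypothesis gfrac : forall y, exists u v, g v != 0 /\ y = g u / g v.
Let io : {rmorphism k -> K} := (g \o kap)%FUN.

Lemma curve_dependent (t u : K) : exists2 F, F != 0 & ev2 io t u F = 0.
Proof.
have [F F0 hF] := algebraically_dependent gQ (closed_field_infinite kclosed) dP gker gfrac t u.
by exists F.
Qed.

(** One generator y at a time: it depends algebraically on the current u, and [nagata] makes both
    integral over u - y^r. *)
Lemma noether_normalization : exists u : Q, forall x, x \in X -> integralOver (ev1 io (g u)) (g x).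
Proof.
suff key (Y : seq Q) : exists u : Q, forall x, x \in Y -> integralOver (ev1 io (g u)) (g x) by exact: key.
elim: Y => [|y Y [u hu]]; first by exists 0.
have [F F0 hF] := curve_dependent (g u) (g y).
have [r [h1 h2]] := nagata F0 hF; exists (u - y ^+ r); rewrite rmorphB rmorphXn => x.
rewrite inE => /orP [/eqP -> //|/hu]; apply: integral_trans => s.
rewrite ev1E; apply: (horner_polyS (integral_subring _)) => // i; rewrite coef_map /=.
by have := integral_id (ev1 io (g u - g y ^+ r)) (s`_i)%:P; rewrite ev1C.
Qed.

Lemma range_integral (R : comNzRingType) (f : {rmorphism R -> K}) :
  (forall c, integralOver f (io c)) -> (forall x, x \in X -> integralOver f (g x)) ->
  forall y, integralOver f (g y).
Proof.
move=> hk hX; apply: (gQ (S := [set y | integralOver f (g y)])) => //=.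
split=> /=; first by rewrite rmorph1; apply: integral1.
  by move=> x y hx hy; rewrite rmorphB; apply: integral_sub.
by move=> x y hx hy; rewrite rmorphM; apply: integral_mul.
Qed.

(* [c] is the constant term of a minimal equation of [y]. *)
Lemma integral_divides (R : idomainType) (f : {rmorphism R -> K}) y : injective f ->
  integralOver f y -> y != 0 -> exists c (q : {poly R}), c != 0 /\ f c = y * (map_poly f q).[y].
Proof.
move=> fi [m mm my] y0; have m0 : m != 0 by rewrite monic_neq0.
elim/poly_ind: m my m0 {mm} => [|m c IH] my m0; first by rewrite eqxx in m0.
have [c0|c0] := eqVneq c 0.
  rewrite c0 addr0 in my m0; apply: IH.
    by move: my; rewrite rmorphM /= map_polyX rootM /root hornerX (negbTE y0) orbF.
  by apply: contra m0 => /eqP ->; rewrite mul0r.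
exists c, (- m); split=> //; move: my => /rootP.
rewrite rmorphD rmorphM /= map_polyX map_polyC hornerD hornerM hornerX hornerC => /eqP.
by rewrite addrC addr_eq0 => /eqP ->; rewrite rmorphN hornerN mulrN mulrC.
Qed.

Hypothesis nmP : ~ dlt 1 P.

(** P is not maximal, so some y outside P lies in a larger prime; were its image integral over k, it
    would divide modulo P a nonzero constant, which is a unit. *)
Lemma not_all_algebraic : ~ forall y, integralOver io (g y).
Proof.
move=> h; apply: nmP => P' pP' [PP' nP].
have [y P'y nPy] : exists2 y, P' y & ~ P y.
  by apply: contrapT => n; apply: nP => y P'y; apply: contrapT => ny; apply: n; exists y.
have [|c [q [c0 hc]]] := integral_divides (fmorph_inj io) (h y).
  by apply/eqP => /gker.
have iP' := prime_ideal pP'; apply: (prime_n1 pP').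
pose z := \sum_(i < size q) kap q`_i * y ^+ i.
have zE : g z = (map_poly io q).[g y].
  rewrite (horner_coef_wide _ (size_poly _ _)) rmorph_sum; apply: eq_bigr => i _.
  by rewrite rmorphM rmorphXn coef_map.
have : P' (kap c).
  apply: (idlDl iP' _ (idlMr z iP' P'y)); apply: PP'; apply/gker.
  by rewrite rmorphB rmorphM zE -hc subrr.

by move=> /(idlM (kap c^-1) iP'); rewrite -rmorphM mulVf // rmorph1.
Qed.

Lemma normalization_transcendental u : (forall x, x \in X -> integralOver (ev1 io (g u)) (g x)) ->
  forall p : {poly k}, ev1 io (g u) p = 0 -> p = 0.
Proof.
move=> hu p hp; apply/eqP; apply: contrapT => /negP p0; apply: not_all_algebraic.
have hgu : integralOver io (g u).
  by apply/integral_algebraic; exists p => //; apply/rootP.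
apply: range_integral => [c|x /hu]; first exact: integral_id.
apply: integral_trans => s; rewrite ev1E; apply: (horner_polyS (integral_subring _)) => // i.
by rewrite coef_map /=; apply: integral_id.
Qed.

(** The image of Q lies in a finite module S over k[u]. Every v is y/c with y in S and c in k[u],
    and the characteristic polynomial of multiplication by y, its coefficients multiplied by powers
    of c, gives an equation for v whose size depends on S only. *)
Lemma bounded_degree u : (forall x, x \in X -> integralOver (ev1 io (g u)) (g x)) ->
  exists N, forall v : K, exists F : {poly {poly k}},
    [/\ F != 0, (size F <= N)%N & ev2 io v (g u) F = 0].
Proof.
move=> hu; have tr := normalization_transcendental hu.
have fi : injective (ev1 io (g u)).
  by move=> a b e; apply/eqP; rewrite -subr_eq0; apply/eqP/tr; rewrite rmorphB e subrr.
have [|Y hY|S [sS AS SY [I [w [Sw wS]]] _]] := @adjoin_all _ (range (ev1 io (g u))) (map g X).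
- exact: range_subring.
- move: hY => /mapP [x /hu [m mm mx] ->]; exists (map_poly (ev1 io (g u)) m); split=> //; last exact: monic_map.
  by move=> i; rewrite coef_map; exists m`_i.
have Sg y : S (g y).
  apply: (gQ (S := [set y | S (g y)])) => //=.
  - split=> /=; first by rewrite rmorph1; case: sS.
      by move=> a b ha hb; rewrite rmorphB; apply: subB.
    by move=> a b ha hb; rewrite rmorphM; apply: subM.
  - by move=> c; apply: AS; exists c%:P => //; rewrite ev1C.
  - by move=> x hx; apply: SY; apply: map_f.
pose r := #|I|.
exists r.+1 => v; have [a [b [b0 ->]]] := gfrac v.
have Ib : integralOver (ev1 io (g u)) (g b).
  apply: range_integral hu _ => c.
  by have := integral_id (ev1 io (g u)) c%:P; rewrite ev1C.
have [c [qb [c0 hc]]] := integral_divides fi Ib b0.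
pose y := g a * (map_poly (ev1 io (g u)) qb).[g b].
have Sy : S y by apply: subM => //; apply: horner_polyS => // i; rewrite coef_map; apply: AS; exists qb`_i.
have vE : g a / g b * ev1 io (g u) c = y by rewrite hc mulrA divfK.
have /choice [e he] : forall i : I, exists e : I -> {poly k}, y * w i = \sum_j ev1 io (g u) (e j) * w j.
  move=> i; have [e eA ->] := wS _ (subM sS Sy (Sw i)).
  have /choice [e' he'] : forall j, exists e', ev1 io (g u) e' = e j by move=> j; have [e' _ <-] := eA j; exists e'.
  by exists e'; apply: eq_bigr => j _; rewrite he'.
pose B : 'M[{poly k}]_r := \matrix_(j, i) e (enum_val i) (enum_val j).
pose G := char_poly B.
have Gy : (map_poly (ev1 io (g u)) G).[y] = 0.
  apply/rootP; rewrite map_char_poly -eigenvalue_root_char; apply/eigenvalueP.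
  exists (\row_i w (enum_val i)).
    by apply/rowP => i; rewrite !mxE he [RHS]sum_enum_val; apply: eq_bigr => j _; rewrite !mxE mulrC.
  apply/eqP => /rowP w0; have [c1 _] := wS 1 (let: And3 h _ _ := sS in h).
  rewrite big1 => [/eqP|i _]; first by rewrite oner_eq0.
  by have := w0 (enum_rank i); rewrite !mxE enum_rankK => ->; rewrite mulr0.
have sG : size G = r.+1 by exact: size_char_poly.
exists (\poly_(i < r.+1) (G`_i * c ^+ i)); split.
- apply/eqP => /polyP/(_ r)/eqP; rewrite coef_poly ltnSn coef0 mulf_eq0 expf_eq0 (negbTE c0) andbF orbF.
  have := monicP (char_poly_monic B); rewrite -/G lead_coefE sG /= => ->.
  by rewrite oner_eq0.
- exact: size_poly.
- rewrite /ev2 ev1E (horner_coef_wide _ (leq_trans (size_poly _ _) (size_poly _ _))).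
  rewrite -[RHS]Gy (horner_coef_wide _ (size_poly _ _)) sG; apply: eq_bigr => i _.
  rewrite coef_map coef_poly ltn_ord coef_poly ltn_ord.
  change (ev1 io (g u) (G`_i * c ^+ i) * (g a / g b) ^+ i = ev1 io (g u) G`_i * y ^+ i).
  by rewrite rmorphM rmorphXn -mulrA -exprMn [_ * (g a / _)]mulrC vE.
Qed.

Variable p : nat.
Hypotheses (pk : p \in [pchar k]).
Hypothesis kfin : forall x : k, exists2 s, (0 < s)%N & x ^+ (p ^ s) = x.

(** Were K perfect, u would be v^q with q = p^N, N being the bound of [bounded_degree]. In a
    relation F(v, u) = 0 with at most N powers of v, replacing u by v^q gives a nonzero polynomial
    in v over k, because the exponents qj + i with i < q do not collide. Then v, and with it u,
    would be algebraic over k. *)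
Lemma imperfect : exists x : Q, forall y : K, y ^+ p != g x.
Proof.
have [u hu] := noether_normalization; have [N hN] := bounded_degree hu.
have tr := normalization_transcendental hu.
have p1 : (1 < p)%N := prime_gt1 (pcharf_prime pk).
apply: contrapT => h.
have perf (v : K) : exists w, w ^+ p = v.
  have root x : exists y, y ^+ p = g x.
    apply: contrapT => /forallNP n; apply: h; exists x => y; apply/eqP; exact: n.
  have [a [b [_ ->]]] := gfrac v; have [a' <-] := root a; have [b' <-] := root b.
  by exists (a' / b'); rewrite expr_div_n.
have [v hv] : exists v, v ^+ (p ^ N) = g u.
  elim: N {hN} => [|N [v <-]]; first by exists (g u).
  by have [w <-] := perf v; exists w; rewrite -exprM expnS.
set q := (p ^ N)%N in hv; have Nq : (N < q)%N by exact: ltn_expl.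
have q0 : (0 < q)%N by apply: leq_trans Nq.
clearbody q.
have [F [F0 sF hF]] := hN v.
pose Psi : {poly k} := \sum_(i < size F) (F`_i \Po 'X^q) * 'X^i.
have Psi0 : Psi != 0.
  apply/eqP => /polyP E; have l0 : lead_coef F != 0 by rewrite lead_coef_eq0.
  have sF0 : ((size F).-1 < size F)%N by rewrite prednK // size_poly_gt0.
  pose i0 := Ordinal sF0; have {}l0 : F`_i0 != 0 by rewrite -lead_coefE.
  set j := (size (F`_i0)%R).-1.
  have := E (q * j + i0)%N; rewrite coef0 /Psi coef_sum (bigD1 i0) //= big1 => [|i ni].
    rewrite addr0 coefMXn ltnNge leq_addl /= addnK coef_comp_poly_Xn // dvdn_mulr // mulKn // => /eqP.
    by rewrite -lead_coefE lead_coef_eq0 (negbTE l0).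
  rewrite coefMXn; case: ltnP => // le_i; rewrite coef_comp_poly_Xn //.
  case: ifP => // /dvdnP [c hc]; case/negP: ni; apply/eqP/val_inj => /=.
  have h1 := ltn_ord i; rewrite [(q * j)%N]mulnC in hc le_i.
  have sq : ((size F).-1 < q)%N := leq_trans sF0 (leq_trans sF (ltnW Nq)).
  have i_le : (i <= (size F).-1)%N by rewrite -ltnS prednK ?(leq_ltn_trans _ h1).
  move: (size F).-1 (nat_of_ord i) i_le sq hc {h1 le_i} => a b ba aq hc.
  have cj : (c < j.+1)%N by rewrite -(ltn_pmul2r q0) mulSn -hc; move: (j * q)%N => z; lia.
  have jc : (j < c.+1)%N by rewrite -(ltn_pmul2r q0) mulSn -hc; move: (j * q)%N => z; lia.
  have {cj jc} cj : c = j by apply/eqP; rewrite eqn_leq -ltnS cj -ltnS.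
  move: hc; rewrite cj; move: (j * q)%N => z; lia.
have hPsi : (map_poly io Psi).[v] = 0.
  rewrite -[RHS]hF /ev2 ev1E rmorph_sum horner_sum (horner_coef_wide _ (size_poly _ _)).
  apply: eq_bigr => i _; rewrite rmorphM /= map_polyXn hornerM hornerXn coef_poly ltn_ord; congr (_ * _).
  by rewrite map_comp_poly horner_comp map_polyXn hornerXn hv.
have Iv : integralOver io v by apply/integral_algebraic; exists Psi => //; apply/rootP.
have Iu : integralOver io (g u) by rewrite -hv; apply: (subX _ (integral_subring _)).
have /integral_algebraic [m m0 /rootP hm] := Iu.
by move/eqP: m0; apply; apply: tr.
Qed.

Lemma generated_coefs (y : Q) : exists C : seq k, forall S : set K, subring S ->
  (forall c, c \in C -> S (io c)) -> (forall x, x \in X -> S (g x)) -> S (g y).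
Proof.
apply: (gQ (S := [set y | exists C : seq k, forall S : set K, subring S ->
  (forall c, c \in C -> S (io c)) -> (forall x, x \in X -> S (g x)) -> S (g y)])) => /=.
- split=> /=; first by exists [::] => S sS _ _; rewrite rmorph1; case: sS.
    move=> a b [C hC] [C' hC']; exists (C ++ C') => S sS SC SX; rewrite rmorphB; apply: subB => //.
      by apply: hC => // c cC; apply: SC; rewrite mem_cat cC.
    by apply: hC' => // c cC; apply: SC; rewrite mem_cat cC orbT.
  move=> a b [C hC] [C' hC']; exists (C ++ C') => S sS SC SX; rewrite rmorphM; apply: subM => //.
    by apply: hC => // c cC; apply: SC; rewrite mem_cat cC.
  by apply: hC' => // c cC; apply: SC; rewrite mem_cat cC orbT.
- by move=> c; exists [:: c] => S _ SC _; apply: SC; rewrite mem_head.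
- by move=> x xX; exists [::] => S _ _; apply.
Qed.

(** D is generated by u and the images of X over a finite field, taken large enough to contain the
    constants that occur in the elements of L and in the integral equations of X over k[u]. So D is
    finite over [Fs][u], and the counting arguments apply to it. *)
Lemma finite_order (L : seq Q) : exists D : set K, [/\ subring D, D `<=` range g,
  forall y, y \in L -> D (g y), fin_index D & minkowski D].
Proof.
have [u hu] := noether_normalization; have tr := normalization_transcendental hu.
have /choice [CL hCL] := generated_coefs.
have /choice [m hm] : forall x, exists m : {poly {poly k}}, x \in X -> m \is monic /\ root (map_poly (ev1 io (g u)) m) (g x).
  move=> x; have [/hu [m mm mx]|nx] := boolP (x \in X); first by exists m.
  by exists 0.
pose C := flatten [seq CL y | y <- L] ++ flatten [seq flatten (map (@polyseq k) (m x)) | x <- X].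
have [s [rs [s0 urs rsE Crs _]]] := finite_subfield pk kclosed kfin C.
pose Fs := map io rs.
have sFs : subring [set` Fs].
  have Fs1 : 1 \in Fs by apply/mapP; exists 1; rewrite ?rmorph1 // rsE expr1n.
  have p0 : p%:R = 0 :> k := pcharf0 pk; have pp := pcharf_prime pk.
  split=> //= _ _ /mapP [a ha ->] /mapP [b hb ->]; rewrite -1?rmorphB -1?rmorphM; apply: map_f;
    move: ha hb; rewrite !rsE => /eqP ha /eqP hb.
    by rewrite frobenius_sub // ha hb.
  by rewrite exprMn ha hb.
pose A0 : set K := [set q.[g u] | q in polyS [set` Fs]].
have sP := polyS_subring sFs.
have A0q q : polyS [set` Fs] q -> A0 q.[g u] by exists q.
have FsC c : c \in Fs -> polyS [set` Fs] c%:P by move=> hc i; rewrite coefC; case: eqP => // _; exact: (sub0 sFs).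
have FsX : polyS [set` Fs] 'X.
  by move=> i; rewrite coefX; case: eqP => _; [case: sFs|exact: (sub0 sFs)].
have sA0 : subring A0.
  split; first by rewrite -(hornerC 1 (g u)); apply: A0q; apply: FsC; case: sFs.
    by move=> _ _ [a ha <-] [b hb <-]; rewrite -hornerN -hornerD; apply: A0q; apply: (subB sP).
  by move=> _ _ [a ha <-] [b hb <-]; rewrite -hornerM; apply: A0q; apply: (subM sP).
have [Y hY|D [sD AD DX [I [w [Dw wD]]] Dmin]] := @adjoin_all _ A0 (map g X) sA0.
  move: hY => /mapP [x xX ->]; have [mm mx] := hm x xX; exists (map_poly (ev1 io (g u)) (m x)).
  split=> //; last exact: monic_map.
  move=> i; rewrite coef_map; change (A0 (map_poly io (m x)`_i).[g u]).
  apply: A0q => j; rewrite coef_map; apply: map_f.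
  have [hij|] := boolP ((m x)`_i`_j == 0).
    by rewrite (eqP hij) rsE expr0n expn_eq0 (gtn_eqF (prime_gt0 (pcharf_prime pk))) eqxx.
  move=> nij; apply: Crs; rewrite mem_cat; apply/orP; right.
  have ji : (j < size ((m x)`_i)%R)%N by rewrite ltnNge; apply: contra nij => /(nth_default 0) ->.
  have ix : (i < size (m x))%N.
    by rewrite ltnNge; apply: contra nij => h; rewrite [(m x)`_i](nth_default 0 h) coef0.
  apply/flattenP; exists (flatten (map (@polyseq k) (m x))); first by apply/mapP; exists x.
  apply/flattenP; exists ((m x)`_i : seq k); last exact: mem_nth.
  by apply/mapP; exists (m x)`_i => //; exact: mem_nth.
have FD : [set` Fs] `<=` D by move=> c hc; apply: AD; rewrite -(hornerC c (g u)); apply: A0q; apply: FsC.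
have Du : D (g u) by apply: AD; rewrite -[X in A0 X]hornerX; apply: A0q.
exists D; have subD : D `<=` range g.
  apply: Dmin; first exact: range_subring.
    move=> _ [q hq <-]; apply: horner_polyS; [exact: range_subring| |by exists u].
    by move=> i; have /mapP [c _ ->] := hq i; exists (kap c).
  by move=> _ /mapP [x _ ->]; exists x.
have DL y : y \in L -> D (g y).
  move=> yL; apply: hCL => // [c cC|x xX]; last by apply: DX; apply: map_f.
  apply: FD; apply: map_f; apply: Crs; rewrite mem_cat; apply/orP; left.
  by apply/flattenP; exists (CL y) => //; apply: map_f.
(* A shortest family that spans D up to a denominator f is independent: a relation would eliminate
   one member at the cost of a larger denominator. *)
pose G r := exists (w : 'I_r -> K) f, [/\ forall i, D (w i), D f, f != 0 &
  forall y, D y -> exists2 c : 'I_r -> {poly K}, forall i, polyS [set` Fs] (c i) & f * y = \sum_i (c i).[g u] * w i].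
have exG : exists r, `[< G r >].
  exists #|I|; apply/asboolP; exists (fun i => w (enum_val i)), 1; split=> //; [by case: sD|exact: oner_neq0|].
  move=> y /wD [c cA ->].
  have /choice [c' hc'] : forall i, exists c' : {poly K}, polyS [set` Fs] c' /\ c'.[g u] = c i.
    by move=> i; have [c' ? <-] := cA i; exists c'.
  exists (fun i => c' (enum_val i)) => [i|]; first by have [] := hc' (enum_val i).
  by rewrite mul1r [LHS]sum_enum_val; apply: eq_bigr => j _; rewrite (hc' _).2.
case: (ex_minnP exG) => r /asboolP [w' [f [Dw' Df f0 fDM]]] rmin.
have trF (c : {poly K}) : polyS [set` Fs] c -> c.[g u] = 0 -> c = 0.
  move=> hc e; have /choice [c' hc'] : forall i, exists c', c`_i = io c'.
    by move=> i; have /mapP [c' _ ->] := hc i; exists c'.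
  have cE : c = map_poly io (\poly_(i < size c) c' i).
    apply/polyP => i; rewrite coef_map coef_poly; case: ltnP => h; first exact: hc'.
    by rewrite nth_default //; exact: (esym (rmorph0 io)).
  by rewrite cE (tr (\poly_(i < size c) c' i)) ?rmorph0 // ev1E -cE.
have indep (c : 'I_r -> {poly K}) : (forall i, polyS [set` Fs] (c i)) ->
    \sum_i (c i).[g u] * w' i = 0 -> forall i, c i = 0.
  move=> hc e i0; apply/eqP; apply: contrapT => /negP ci0.
  case: r w' c i0 Dw' fDM hc e ci0 rmin => [|r] w' c i0 Dw' fDM hc e ci0 rmin; first by have := ltn_ord i0.
  suff /rmin : `[< G r >] by rewrite ltnn.
  pose ci := (c i0).[g u]; have Dci : D ci by apply: AD; apply: A0q.
  apply/asboolP; exists (fun i => w' (lift i0 i)), (ci * f); split=> //; first exact: subM.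
    by rewrite mulf_neq0 //; apply: contra ci0 => /eqP /(trF _ (hc i0)) ->.
  move=> y /fDM [d hd dE]; exists (fun i => c i0 * d (lift i0 i) - d i0 * c (lift i0 i)).
    by move=> i; apply: (subB sP); apply: (subM sP).
  rewrite -mulrA dE (bigD1_ord i0) //= mulrDr mulr_sumr; move: e; rewrite (bigD1_ord i0) //= => /eqP.
  rewrite addr_eq0 => /eqP e; rewrite mulrCA e mulrN mulr_sumr -sumrN -big_split /=.
  by apply: eq_bigr => i _; rewrite hornerD hornerN !hornerM /ci; ring.
have uFs : uniq Fs by rewrite map_inj_uniq //; exact: fmorph_inj.
split=> //.
  exact: (lattice_fin_index (Fs := Fs) (u := g u) (w := w') (f := f)).
exact: (lattice_minkowski (Fs := Fs) (u := g u) (w := w') (f := f)).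
Qed.
End CurveOrders.

(** * Separability over k(tau) *)

Section Imperfect.
Variables (p : nat) (K : fieldType) (pK : p \in [pchar K]) (tau : K).
Hypothesis ntau : forall y : K, y ^+ p != tau.
Local Notation fr := (pFrobenius_aut pK).

(* The minimal equation of tau over K^p divides (X - tau)^p, and its degree is
   prime to p unless it is p. *)
Lemma pbasis_power (e : 'I_p -> K) : \sum_(r < p) e r ^+ p * tau ^+ r = 0 -> forall r, e r = 0.
Proof.
move=> h0; have pp := pcharf_prime pK; have p0 := prime_gt0 pp.
(* A relation for tau over K^p is the image under Frobenius of some g over K, so that division by g
   can be carried out before Frobenius is applied. *)
pose bad n := exists g : {poly K}, [/\ g != 0, (size g <= p)%N, (map_poly fr g).[tau] = 0 & size g = n].
suff nbad n : ~ bad n.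
  move=> r; apply/eqP; apply: contrapT => /negP er.
  pose g := \poly_(i < p) (if insub i is Some i' then e i' else 0).
  have gE (i : 'I_p) : g`_i = e i.
    by rewrite coef_poly ltn_ord (insubT (fun x => x < p)%N (ltn_ord i)) /=; congr e; apply: val_inj.
  apply: (nbad (size g)); exists g; split=> //.
  - by apply/eqP => g0; rewrite -gE g0 coef0 eqxx in er.
  - exact: size_poly.
  rewrite -[RHS]h0 (horner_coef_wide _ (leq_trans (size_poly _ _) (size_poly _ _))).
  by apply: eq_bigr => i _; rewrite coef_map gE.
move=> hb; have exb : exists n, `[< bad n >] by exists n; apply/asboolP.
case: (ex_minnP exb) => {hb} {}n /asboolP [g [g0 sg hg sgn]] nmin.
have gmin (g' : {poly K}) : (map_poly fr g').[tau] = 0 -> (size g' < size g)%N -> g' = 0.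
  move=> h1 h2; apply/eqP; apply: contrapT => /negP h3.
  suff /nmin : `[< bad (size g') >] by rewrite -sgn leqNgt h2.
  by apply/asboolP; exists g'; split=> //; apply: leq_trans (ltnW h2) sg.
have sg1 : (1 < size g)%N.
  rewrite ltnNge; apply/negP => s1; move: hg g0; rewrite (size1_polyC s1) map_polyC hornerC /=.
  by rewrite pFrobenius_autE polyC_eq0 => /eqP; rewrite expf_eq0 p0 /= => ->.
have dg : (map_poly fr g)^`().[tau] != 0.
  rewrite deriv_map; apply/eqP => /gmin; rewrite lt_size_deriv // => /(_ isT) /polyP /(_ (size g).-2)/eqP.
  rewrite coef_deriv coef0 prednK ?ltn_predRL // -mulr_natr mulf_eq0 -lead_coefE lead_coef_eq0 (negbTE g0) /=.
  rewrite -(dvdn_pcharf pK) => /dvdn_leq; rewrite ltn_predRL sg1 => /(_ isT).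
  by rewrite leqNgt prednK ?(leq_trans _ sg1) // => /negP; apply; rewrite (leq_trans _ sg) // ltnW.
pose m0 : {poly K} := 'X^p - tau%:P.
have m0E : map_poly fr m0 = ('X - tau%:P) ^+ p.
  have pKX : p \in [pchar {poly K}] by rewrite pchar_poly.
  by rewrite rmorphB /= map_polyXn map_polyC /= -!(pFrobenius_autE pKX) rmorphB /= !pFrobenius_autE polyC_exp.
have r0 : m0 %% g = 0.
  apply: gmin; last by rewrite ltn_modp.
  have -> : m0 %% g = m0 - m0 %/ g * g by rewrite {2}(divp_eq m0 g) addrC addKr.
  by rewrite rmorphB rmorphM /= m0E hornerD hornerN hornerM hg mulr0 subr0 horner_exp !hornerE subrr expr0n eqn0Ngt p0.
have : map_poly fr g %| ('X - tau%:P) ^+ p.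
  by rewrite -m0E dvdp_map /dvdp r0 eqxx.
move=> /dvdp_exp_XsubCP [d dp gE].
have sgd : size g = d.+1 by rewrite -(size_map_poly fr) (eqp_size gE) size_exp_XsubC.
have d1 : d = 1%N.
  case: d gE sgd {dp} => [|[|d]] gE sgd //; first by rewrite sgd in sg1.
  move: gE => /eqpf_eq [c c0 gE]; case/eqP: dg.
  by rewrite gE !exprSr !derivE !hornerE /= subrr !(mulr0, mul0r, addr0).
have g1 : g`_1 != 0 by move: g0; rewrite -lead_coef_eq0 lead_coefE sgd d1.
move: hg; rewrite horner_coef size_map_poly sgd d1 big_ord_recl big_ord1 !coef_map /= expr0 mulr1 expr1 => h.
case/negP: (ntau (- g`_0 / g`_1)); rewrite -(pFrobenius_autE pK) rmorphM fmorphV rmorphN /=.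
rewrite -(inj_eq (mulfI (_ : fr g`_1 != 0))) ?fmorph_eq0 //.
by rewrite mulrC divfK ?fmorph_eq0 // eq_sym -addr_eq0 addrC h.
Qed.
End Imperfect.

Lemma poly_residues (R : comNzRingType) (c : {poly R}) p : (0 < p)%N ->
  c = \sum_(r < p) ((\poly_(j < size c) c`_(p * j + r)) \Po 'X^p) * 'X^r.
Proof.
move=> p0; apply/polyP => l; rewrite coef_sum.
pose r0 := Ordinal (ltn_pmod l p0); rewrite (bigD1 r0) //= big1 => [|r nr].
  rewrite addr0 coefMXn ltnNge leq_mod /= coef_comp_poly_Xn //.
  have E : (l - l %% p = p * (l %/ p))%N by rewrite {1}(divn_eq l p) addnK mulnC.
  rewrite E dvdn_mulr // mulKn // coef_poly [(p * _)%N]mulnC -divn_eq.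
  case: ltnP => // h; rewrite nth_default //; apply: leq_trans h (leq_div _ _).
rewrite coefMXn; case: ltnP => // rl; rewrite coef_comp_poly_Xn //.
case: ifP => // /dvdnP [c' hc]; case/eqP: nr; apply: val_inj => /=.
by rewrite -(subnK rl) hc modnMDl modn_small.
Qed.

Section SeparableRelation.
Variables (p : nat) (k K : fieldType) (pk : p \in [pchar k]) (io : {rmorphism k -> K}).
Hypothesis kclosed : GRing.closed_field_axiom k.
Hypothesis kroot : forall x : k, exists y, y ^+ p = x.
Hypothesis dep : forall t u : K, exists2 F, F != 0 & ev2 io t u F = 0.
Variable tau : K.
Hypothesis ntau : forall y : K, y ^+ p != tau.

Let pK : p \in [pchar K]. Proof. exact: (rmorph_pchar io). Qed.
Let p0 : (0 < p)%N := prime_gt0 (pcharf_prime pk).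

(** An algebraic tau would lie in the closed field k, hence be a p-th power. *)
Lemma imperfect_transcendental c : ev1 io tau c = 0 -> c = 0.
Proof.
move=> h; apply/eqP; apply: contrapT => /negP c0.
have mc : (lead_coef c)^-1 *: c \is monic by rewrite monicE lead_coefZ mulVf // lead_coef_eq0.
have [rs E] := monic_splits kclosed mc.
have : ev1 io tau ((lead_coef c)^-1 *: c) = 0 by rewrite -mul_polyC rmorphM h mulr0.
rewrite E rmorph_prod => /eqP; rewrite prodf_seq_eq0 => /hasP [r _ e].
have : ev1 io tau ('X - r%:P) == 0 := e; rewrite rmorphB ev1X ev1C subr_eq0 => /eqP tr.
by have [y yr] := kroot r; case/negP: (ntau (io y)); rewrite -rmorphXn yr tr.
Qed.

Let root_poly (c : {poly k}) : exists c' : {poly k}, forall t, ev1 io t (c \Po 'X^p) = ev1 io t c' ^+ p.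
Proof.
have /choice [rt hrt] := kroot.
exists (\poly_(j < size c) rt c`_j) => t.
have E : ev1 io t (\poly_(j < size c) rt c`_j) = \sum_(i < size c) io (rt c`_i) * t ^+ i.
  rewrite ev1E (horner_coef_wide _ (leq_trans (size_poly _ _) (size_poly _ _))).
  by apply: eq_bigr => i _; rewrite coef_map coef_poly ltn_ord.
rewrite E ev1E map_comp_poly map_polyXn horner_comp hornerXn (horner_coef_wide _ (size_poly _ _)).
rewrite -[RHS](pFrobenius_autE pK) rmorph_sum; apply: eq_bigr => i _.
rewrite rmorphM /= !pFrobenius_autE coef_poly ltn_ord -rmorphXn hrt; congr (_ * _).
by rewrite -!exprM mulnC.
Qed.

(** F is a relation of least degree in z over k[tau]. If F' = 0, then F = G(X^p), and sorting the
    powers of tau by residues modulo p writes F(z, tau) as a sum of p-th powers times tau^r, r < p.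
    By [pbasis_power] each of these p-th powers vanishes, which gives relations of smaller degree
    and forces F = 0. So F' is not 0, and by minimality F and F' have no common factor of positive
    degree. *)
Lemma separable_relation (z : K) : exists F U V rho : _,
  [/\ ev2 io z tau F = 0, rho != 0 & U * F + V * F^`() = rho%:P].
Proof.
have tr := imperfect_transcendental.
pose ok n := exists F, [/\ F != 0, ev2 io z tau F = 0 & size F = n].
have exn : exists n, `[< ok n >].
  by have [F F0 hF] := dep z tau; exists (size F); apply/asboolP; exists F.
case: (ex_minnP exn) => n /asboolP [F [F0 hF sF]] nmin.
have Fmin G : ev2 io z tau G = 0 -> (size G < size F)%N -> G = 0.
  move=> h1 h2; apply/eqP; apply: contrapT => /negP h3.
  suff /nmin : `[< ok (size G) >] by rewrite -sF leqNgt h2.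
  by apply/asboolP; exists G.
have s1 : (1 < size F)%N.
  rewrite ltnNge; apply/negP => s1; move: hF F0; rewrite (size1_polyC s1) /ev2 ev1C => /tr ->.
  by rewrite eqxx.
have dF0 : F^`() != 0.
  apply/eqP => dF; have Fp i : ~~ (p %| i)%N -> F`_i = 0.
    case: i => [|i]; first by rewrite dvdn0.
    move=> npi; have /polyP/(_ i)/eqP := dF; rewrite coef_deriv coef0 -mulr_natr mulf_eq0.
    move=> /orP [/eqP -> //|]; rewrite -polyC_natr polyC_eq0 -(dvdn_pcharf pk) => h.
    by rewrite h in npi.
  pose G i := F`_(p * i).
  have /choice [C hC] : forall ir : nat * 'I_p, exists c', forall t,
      ev1 io t ((\poly_(j < size (G ir.1)) (G ir.1)`_(p * j + ir.2)) \Po 'X^p) = ev1 io t c' ^+ p.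
    by move=> ir; apply: root_poly.
  have {}hC i (r : 'I_p) t : ev1 io t ((\poly_(j < size (G i)) (G i)`_(p * j + r)) \Po 'X^p) =
      ev1 io t (C (i, r)) ^+ p := hC (i, r) t.
  have G0C i (r : 'I_p) : G i = 0 -> ev1 io tau (C (i, r)) = 0.
    move=> Gi; have := hC i r tau.
    rewrite Gi size_poly0 poly_def big_ord0 comp_poly0 (rmorph0 (ev1 io tau)) => /esym/eqP.
    by rewrite expf_eq0 p0 => /eqP.
  have GE i : ev1 io tau (G i) = \sum_(r < p) (ev1 io tau (C (i, r))) ^+ p * tau ^+ r.
    rewrite {1}(poly_residues (G i) p0) rmorph_sum; apply: eq_bigr => r _.
    by rewrite rmorphM hC rmorphXn ev1X.
  have FG : F = (\poly_(i < size F) G i) \Po 'X^p.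
    apply/polyP => l; rewrite coef_comp_poly_Xn //; case: ifP => [/dvdnP [l' ->]|/negbT /Fp //].
    rewrite mulnK // coef_poly /G mulnC; case: ltnP => // h; rewrite nth_default //.
    by rewrite (leq_trans h) // leq_pmull.
  have FE : \sum_(r < p) (\sum_(i < size F) ev1 io tau (C (val i, r)) * z ^+ i) ^+ p * tau ^+ r = 0.
    transitivity (ev2 io z tau ((\poly_(i < size F) G i) \Po 'X^p)); last by rewrite -FG hF.
    rewrite /ev2 ev1E map_comp_poly map_polyXn horner_comp hornerXn.
    rewrite (horner_coef_wide _ (leq_trans (size_poly _ _) (size_poly _ _))).
    transitivity (\sum_(i < size F) \sum_(r < p) (ev1 io tau (C (val i, r))) ^+ p * tau ^+ r * (z ^+ p) ^+ i).
      rewrite exchange_big; apply: eq_bigr => r _ /=.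
      rewrite -(pFrobenius_autE pK) rmorph_sum mulr_suml; apply: eq_bigr => i _.
      by rewrite /= pFrobenius_autE exprMn -!exprM mulnC mulrAC.
    apply: eq_bigr => i _; rewrite -mulr_suml -GE; congr (_ * _).
    by rewrite coef_map coef_poly ltn_ord.
  have sp : (1 < p)%N := prime_gt1 (pcharf_prime pk).
  have C0 i r : C (i, r) = 0.
    have [iF|Fi] := ltnP (p * i) (size F); last first.
      by apply: tr; apply: G0C; rewrite /G nth_default.
    pose H := \poly_(i < ((size F).-1 %/ p).+1) C (i, r).
    suff /polyP/(_ i) : H = 0.
      rewrite coef_poly coef0 ltnS leq_divRL // mulnC -ltnS prednK ?iF // ltnW //.
    apply: Fmin; last first.
      apply: (leq_ltn_trans (size_poly _ _)); rewrite -[X in (_ < X)%N](prednK (ltnW s1)) ltnS.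
      by rewrite ltn_Pdiv // -ltnS prednK // ltnW.
    have := pbasis_power pK ntau FE r; rewrite /ev2 ev1E => e.
    rewrite (horner_coef_wide _ (leq_trans (size_poly _ _) (size_poly _ _))) -[RHS]e.
    have le : (((size F).-1 %/ p).+1 <= size F)%N.
      by rewrite -[X in (_ <= X)%N](prednK (ltnW s1)) ltnS leq_div.
    rewrite (big_ord_widen _ (fun i => (map_poly (ev1 io tau) H)`_i * z ^+ i) le) big_mkcond.
    apply: eq_bigr => j _; case: ifP => [jl|/negbT]; first by rewrite coef_map coef_poly jl.
    rewrite -leqNgt => jl; have -> : ev1 io tau (C (val j, r)) = 0; last by rewrite mul0r.
    apply: G0C; rewrite /G nth_default // mulnC.
    by rewrite -[X in (X <= _)%N](prednK (ltnW s1)) -ltn_divLR.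
  case/eqP: F0; rewrite FG; suff -> : \poly_(i < size F) G i = 0 by rewrite comp_poly0.
  apply/polyP => i; rewrite coef_poly coef0; case: ltnP => // _; apply: tr.
  by rewrite GE big1 // => r _; rewrite C0 rmorph0 expr0n eqn0Ngt p0 mul0r.
have sdF : (size F^`() < size F)%N by rewrite lt_size_deriv.
(* A constant F' is itself rho; otherwise both degrees are positive and rho is the resultant. *)
have [sd1|sd1] := leqP (size F^`()) 1.
  exists F, 0, 1, F^`()`_0; split=> //; last by rewrite mul0r add0r mul1r -size1_polyC.
  by move: dF0; rewrite {1}(size1_polyC sd1) polyC_eq0.
have res0 : resultant F F^`() != 0.
  rewrite resultant_eq0 -leqNgt; set G := gcdp _ _.
  have [[c H] /= c0 cF] := @Pdiv.WeakIdomain.dvdpP _ G F (dvdp_gcdl _ _).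
  have G0 : G != 0 by rewrite gcdp_eq0 negb_and F0.
  have H0 : H != 0.
    by apply/eqP => H0; move: cF; rewrite H0 mul0r -mul_polyC => /eqP; rewrite mulf_eq0 polyC_eq0 (negbTE c0) (negbTE F0).
  have sGd : (size G < size F)%N by apply: leq_ltn_trans sdF; apply: dvdp_leq => //; exact: dvdp_gcdr.
  have : ev2 io z tau H * ev2 io z tau G = 0.
    by rewrite -rmorphM -cF -mul_polyC rmorphM hF mulr0.
  have sHG : size F = (size H + size G).-1 by rewrite -(size_scale F c0) cF size_mul.
  move=> /eqP; rewrite mulf_eq0 => /orP [/eqP h|/eqP /Fmin /(_ sGd) G00]; last by rewrite G00 eqxx in G0.
  rewrite leqNgt; apply/negP => sG; have sH : (0 < size H)%N by rewrite size_poly_gt0.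
  case/eqP: H0; apply: Fmin h _; rewrite sHG; move: (size H) (size G) sG sH => x y; lia.
have [[U V] /= _ E] := resultant_in_ideal s1 sd1.
by exists F, U, V, (resultant F F^`()).
Qed.
End SeparableRelation.

(** * Reduced fibres on a curve *)

Section RadicalTranslate.
Variables (k : fieldType) (Q : comPzRingType) (kap : {rmorphism k -> Q}) (X : seq Q).
Hypothesis gQ : alg_gen kap [set` X].
Hypothesis kclosed : GRing.closed_field_axiom k.
Variable p : nat.
Hypotheses (pk : p \in [pchar k]).
Hypothesis kfin : forall x : k, exists2 s, (0 < s)%N & x ^+ (p ^ s) = x.
Variables (P : set Q) (pP : is_prime_ideal P) (dP : dlt 2 P) (nmP : ~ dlt 1 P).

Let pp : prime p := pcharf_prime pk.
Lemma pchar_image : p%:R = 0 :> Q.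
Proof. by rewrite -(rmorph_nat kap) (pcharf0 pk) rmorph0. Qed.

Lemma perfect_root (x : k) : exists y, y ^+ p = x.
Proof.
have [[|s] // s0 hs] := kfin x; exists (x ^+ (p ^ s)).
by rewrite -exprM -expnSr.
Qed.

Lemma lift_eval (K : fieldType) (g : {rmorphism Q -> K}) (R : {poly k}) x : exists y,
  g y = ev1 (g \o kap)%FUN (g x) R.
Proof.
exists (\sum_(i < size R) kap R`_i * x ^+ i).
rewrite ev1E (horner_coef_wide _ (size_poly _ _)) rmorph_sum; apply: eq_bigr => i _.
by rewrite rmorphM rmorphXn coef_poly ltn_ord.
Qed.

Lemma frobenius_fixed_all (H : set Q) : is_ideal H ->
  (forall x, x \in X -> exists2 s, (0 < s)%N & H (x ^+ (p ^ s) - x)) ->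
  forall y, exists2 s, (0 < s)%N & H (y ^+ (p ^ s) - y).
Proof.
move=> iH hX; have p0 := pchar_image.
have iter x a b : H (x ^+ (p ^ a) - x) -> H (x ^+ (p ^ (a * b)) - x).
  move=> h; elim: b => [|b IH]; first by rewrite muln0 expr1 subrr; apply: idl0.
  by rewrite mulnS expnD exprM; apply: (idl_trans iH _ IH); apply: idl_congX.
apply: (gQ (S := [set y | exists2 s, (0 < s)%N & H (y ^+ (p ^ s) - y)])) => [|c|x /hX //] /=.
  split=> /=.
  - by exists 1%N => //; rewrite expr1n subrr; apply: idl0.
  - move=> x y [s s0 hs] [t t0 ht]; exists (s * t)%N; first by rewrite muln_gt0 s0.
    rewrite frobenius_sub //; have -> : x ^+ (p ^ (s * t)) - y ^+ (p ^ (s * t)) - (x - y) =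
      (x ^+ (p ^ (s * t)) - x) - (y ^+ (p ^ (s * t)) - y) by ring.
    by apply: idlB => //; [exact: iter|rewrite mulnC; exact: iter].
  - move=> x y [s s0 hs] [t t0 ht]; exists (s * t)%N; first by rewrite muln_gt0 s0.
    by rewrite exprMn; apply: idl_congM => //; [exact: iter|rewrite mulnC; exact: iter].
by have [s s0 hs] := kfin c; exists s => //; rewrite -rmorphXn hs subrr; apply: idl0.
Qed.

(* For tau = -a/b outside K^p and a generic constant la, the points of the curve
   where tau = la are reduced. *)
Lemma radical_translate (a b : Q) : (exists r s, P (1 - r * a - s * b)) -> ~ P b ->
  exists t, ~ P (a + b * t) /\
    forall y, exists2 s, (0 < s)%N & exists c, P (y ^+ (p ^ s) - y - c * (a + b * t)).
Proof.
move=> [r [s hrs]] nb; have [K [g [gker gfrac]]] := residue_field pP.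
pose io : {rmorphism k -> K} := (g \o kap)%FUN.
have iP := prime_ideal pP.
have b0 : g b != 0 by apply/eqP => /gker.
have dep t u : exists2 F, F != 0 & ev2 io t u F = 0 := curve_dependent gQ kclosed dP gker gfrac t u.
have pK : p \in [pchar K] := rmorph_pchar io pk.
(* If -a/b and -a/b - x were both p-th powers, so would be x. *)
have [x1 ntau] : exists x1, forall y : K, y ^+ p != - (g a / g b) - g x1.
  have [x hx] := imperfect gQ kclosed dP gker gfrac nmP pk.
  have [h|/existsNP [w /negP/negPn/eqP hw]] := pselect (forall y : K, y ^+ p != - (g a / g b)).
    by exists 0 => y; rewrite rmorph0 subr0.
  exists x => y; apply/eqP => hy; case/eqP: (hx (w - y)).
  have -> : (w - y) ^+ p = w ^+ p - y ^+ p.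
    by have := frobenius_sub 1 w y pp (pcharf0 pK); rewrite expn1.
  by rewrite hw hy opprB addrCA subrr addr0.
set tau := (X in forall y, y ^+ p != X) in ntau.
have /choice [F hF] : forall x : Q, exists FUVr : {poly {poly k}} * {poly {poly k}} * {poly {poly k}} * {poly k},
  [/\ ev2 io (g x) tau FUVr.1.1.1 = 0, FUVr.2 != 0 &
    FUVr.1.1.2 * FUVr.1.1.1 + FUVr.1.2 * FUVr.1.1.1^`() = FUVr.2%:P].
  move=> x; have [F [U [V [rho h]]]] := separable_relation pk kclosed perfect_root dep ntau (g x).
  by exists (F, U, V, rho).
have prod0 : \prod_(x <- X) (F x).2 != 0.
  by elim: (X) => [|x Y IH]; rewrite ?big_nil ?oner_eq0 // big_cons mulf_neq0 //; have [] := hF x.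
have [la hla] := nonroot (idfun : {rmorphism k -> k}) (closed_field_infinite kclosed) prod0.
(* With this t, tau = la - a'/b for a' = a + bt, so that tau becomes la modulo a'. *)
pose t := kap la + x1; have [a' a'E] : exists a', a' = a + b * t by exists (a + b * t).
have tauE : tau = io la - g a' / g b.
  rewrite a'E /t /tau /io /= !rmorphD rmorphM rmorphD mulrDl [g b * _]mulrC mulfK //; ring.
have a'0 : g a' != 0.
  apply/eqP => e; have [y hy] := perfect_root la; case/eqP: (ntau (io y)).
  by rewrite tauE e mul0r subr0 -rmorphXn hy.
exists t; rewrite -a'E; split; first by move/gker/eqP; rewrite (negbTE a'0).
(* [good y] says that y lies in a'Q[1/b]. Since b is a unit modulo a' and P, [unitb] brings such
   statements back to Q. *)
pose good (y : K) := exists N w, g b ^+ N * y = g (a' * w).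
have goodD y z : good y -> good z -> good (y + z).
  move=> [N [w hw]] [M [v hv]]; exists (N + M)%N, (b ^+ M * w + b ^+ N * v).
  transitivity (g b ^+ M * (g b ^+ N * y) + g b ^+ N * (g b ^+ M * z)); first by rewrite exprD; ring.
  by rewrite hw hv !(rmorphM, rmorphD, rmorphXn) /=; ring.
have goodM y z N v : good y -> g b ^+ N * z = g v -> good (y * z).
  move=> [M [w hw]] hz; exists (M + N)%N, (w * v).
  by rewrite exprD mulrACA hw hz !rmorphM mulrA.
have good0 : good 0 by exists 0%N, 0; rewrite !mulr0 rmorph0.
have goodtau : good (tau - io la).
  exists 1%N, (-1); rewrite tauE addrAC subrr sub0r mulrN expr1 mulrC divfK //.
  by rewrite mulrN1 rmorphN.
have tauN : g b ^+ 1 * tau = g (kap la * b - a').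
  by rewrite tauE expr1 mulrBr [g b * (_ / _)]mulrC divfK // rmorphB rmorphM mulrC.
have goodX j : good (tau ^+ j - io la ^+ j).
  elim: j => [|j IH]; first by rewrite !expr0 subrr.
  have -> : tau ^+ j.+1 - io la ^+ j.+1 = (tau ^+ j - io la ^+ j) * tau + (tau - io la) * io la ^+ j.
    by rewrite !exprS; ring.
  apply: goodD; first exact: goodM IH tauN.
  by apply: (goodM _ _ 0%N (kap la ^+ j)) => //; rewrite expr0 mul1r rmorphXn.
have good_sum (I : Type) (rr : seq I) (f : I -> K) : (forall i, good (f i)) -> good (\sum_(i <- rr) f i).
  by move=> h; apply: (big_ind good).
have goodC (c : {poly k}) : good (ev1 io tau c - io c.[la]).
  have -> : ev1 io tau c - io c.[la] = \sum_(i < size c) (tau ^+ i - io la ^+ i) * io c`_i.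
    rewrite ev1E (horner_coef_wide _ (size_poly _ _)) horner_coef rmorph_sum -sumrB.
    by apply: eq_bigr => i _; rewrite coef_poly ltn_ord rmorphM rmorphXn; ring.
  apply: good_sum => i; apply: (goodM _ _ 0%N (kap c`_i)); first exact: goodX.
  by rewrite expr0 mul1r.
pose H := ideal_add P (pid a').
have iH : is_ideal H by apply: ideal_add_ideal => //; exact: pid_ideal.
have Hg y w : g y = g (a' * w) -> H y.
  by move=> e; apply/add_pidP; exists w; apply/gker; rewrite rmorphB e [w * _]mulrC subrr.
have unitb y N w : g b ^+ N * g y = g (a' * w) -> H y.
  elim: N w => [|N IH] w e; first by apply: (Hg _ w); rewrite -e expr0 mul1r.
  apply: (IH (r * b ^+ N * y + (s - r * t) * w)).
  have /gker := hrs; rewrite !rmorphB rmorph1 !rmorphM => /eqP; rewrite -addrA -opprD subr_eq0 => /eqP h1.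
  transitivity (g b ^+ N * g y * (g r * g a + g s * g b)); first by rewrite -h1 mulr1.
  transitivity (g r * g b ^+ N * g y * g a' + (g s - g r * g t) * (g b ^+ N.+1 * g y)).
    by rewrite a'E rmorphD rmorphM exprS; ring.
  by rewrite e !(rmorphM, rmorphD, rmorphN, rmorphXn) /=; ring.
(* Modulo a' the relation of x over k[tau] specializes to the polynomial R over k. As rho(la) is not
   0, R has simple roots, and these lie in a finite field; so R divides some X^(p^s) - X. *)
have red x : x \in X -> exists2 s, (0 < s)%N & H (x ^+ (p ^ s) - x).
  move=> xX; have [Fz rho0 UV] := hF x; set Fx := (F x).1.1.1 in Fz UV.
  pose R : {poly k} := map_poly (horner_eval la) Fx.
  have rhola : (F x).2.[la] != 0.
    by move: hla; rewrite horner_prod prodf_seq_neq0 => /allP/(_ x xX).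
  have UVR : map_poly (horner_eval la) (F x).1.1.2 * R + map_poly (horner_eval la) (F x).1.2 * R^`()
      = (F x).2.[la]%:P.
    by rewrite deriv_map -!rmorphM -rmorphD UV /= map_polyC.
  have R0 : R != 0.
    by apply: contraNneq rhola => R0; move: UVR; rewrite R0 deriv0 !mulr0 addr0 => /esym/eqP; rewrite polyC_eq0.
  have mR : (lead_coef R)^-1 *: R \is monic by rewrite monicE lead_coefZ mulVf // lead_coef_eq0.
  have [rs RE] := monic_splits kclosed mR.
  have urs : uniq rs.
    rewrite -separable_prod_XsubC -RE unlock derivZ coprimepZl ?coprimepZr ?invr_eq0 ?lead_coef_eq0 //.
    apply/Bezout_coprimepP; exists (map_poly (horner_eval la) (F x).1.1.2, map_poly (horner_eval la) (F x).1.2).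
    by rewrite /= UVR -[_%:P]mul1r mulrC mul_polyC eqp_scale.
  have [s' [rs' [s0 urs' rs'E sub E]]] := finite_subfield pk kclosed kfin rs.
  exists s' => //.
  have /Pdiv.Field.dvdpP [W hW] : R %| 'X^(p ^ s') - 'X.
    rewrite -(dvdpZl _ _ (_ : (lead_coef R)^-1 != 0)) ?invr_eq0 ?lead_coef_eq0 // RE E.
    apply: uniq_roots_dvdp; last by rewrite uniq_rootsE.
    by apply/allP => z /sub; rewrite root_prod_XsubC.
  have [Rx hRx] := lift_eval g R x; have [Wx hWx] := lift_eval g W x.
  have HR : H Rx.
    have [N [w hw]] : good (- g Rx).
      have -> : - g Rx = \sum_(i < size Fx) (ev1 io tau Fx`_i - io (Fx`_i).[la]) * g x ^+ i.
        under eq_bigr => i _ do rewrite mulrBl.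
        rewrite sumrB; have -> : \sum_(i < size Fx) ev1 io tau Fx`_i * g x ^+ i = 0.
          rewrite -[RHS]Fz /ev2 ev1E (horner_coef_wide _ (size_poly _ _)).
          by apply: eq_bigr => i _; rewrite coef_poly ltn_ord.
        rewrite sub0r; congr (- _); rewrite hRx ev1E.
        rewrite (horner_coef_wide _ (leq_trans (size_poly _ _) (size_poly _ _))).
        by apply: eq_bigr => i _; rewrite coef_map coef_poly ltn_ord.
      apply: good_sum => i; apply: (goodM _ _ 0%N (x ^+ i)); first exact: goodC.
      by rewrite expr0 mul1r rmorphXn.
    by apply: (unitb _ N (- w)); rewrite mulrN rmorphN -hw mulrN opprK.
  have : H (Wx * Rx) by apply: idlM.
  apply: idlDl => //; apply: addl; first exact: pid_ideal.
  have e1 : ev1 (g \o kap)%FUN (g x) ('X^(p ^ s') - 'X) = g (x ^+ (p ^ s') - x).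
    by rewrite !rmorphB !rmorphXn ev1X.
  by apply/gker; rewrite rmorphB rmorphM hWx hRx -rmorphM -hW e1 subrr.
move=> y; have [s' s0 /add_pidP [c hc]] := frobenius_fixed_all iH red y.
by exists s' => //; exists c.
Qed.
End RadicalTranslate.

(** * Factorization on a curve *)

Section ComaximalProducts.
Variables (K : fieldType) (D : set K).
Hypothesis sD : subring D.

Definition comax (x y : K) := exists s t, [/\ D s, D t & s * x + t * y = 1].

Lemma comax_sym x y : comax x y -> comax y x.
Proof. by move=> [s [t [hs ht e]]]; exists t, s; split=> //; rewrite addrC. Qed.

Lemma comaxM x y z : D x -> D y -> D z -> comax x y -> comax x z -> comax x (y * z).
Proof.
move=> Dx Dy Dz [s [t [hs ht e]]] [s' [t' [hs' ht' e']]].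
exists (s + t * y * s'), (t * t'); split; [|exact: subM|].
  by apply: subD => //; apply: subM => //; apply: subM.
by rewrite -[RHS]e -[X in _ = _ + X]mulr1 -e'; ring.
Qed.

Lemma comax_prod (I : Type) (r : seq I) (R : pred I) x (y : I -> K) : D x ->
  (forall i, D (y i)) -> (forall i, R i -> comax x (y i)) -> comax x (\prod_(i <- r | R i) y i).
Proof.
move=> Dx Dy h; have [D1 _ _] := sD.
elim: r => [|i r IH]; first by rewrite big_nil; exists 0, 1; split=> //; [exact: sub0|ring].
rewrite big_cons; case: ifP => // Ri; apply: comaxM => //; last exact: h.
by apply: (big_ind D) => // u v; apply: subM.
Qed.

Lemma comaxX x y m : D x -> D y -> comax x y -> comax (x ^+ m) (y ^+ m).
Proof.
move=> Dx Dy h.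
have step u v n : D u -> D v -> comax u v -> comax u (v ^+ n).
  by move=> Du Dv huv; rewrite -(card_ord n) -prodr_const; apply: comax_prod.
by apply: (step) => //; [exact: subX|apply: comax_sym; apply: (step) => //; exact: comax_sym].
Qed.

Lemma comax_dvd x y x' y' : comax x' y' -> mult D x x' -> mult D y y' -> comax x y.
Proof.
move=> [s [t [Ds Dt e]]] [c Dc cE] [d Dd dE]; exists (s * c), (t * d); split; [exact: subM|exact: subM|].
by rewrite -e cE dE !mulrA.
Qed.

Lemma mult_prod (I : eqType) (r : seq I) (h : I -> K) A : uniq r -> D A -> (forall i, D (h i)) ->
  (forall i, mult D (h i) A) -> (forall i j, i != j -> comax (h i) (h j)) ->
  mult D (\prod_(i <- r) h i) A.
Proof.
move=> ur DA Dh hA hc; elim: r ur => [_|i r IH /= /andP [ni /IH [z Dz hz]]].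
  by rewrite big_nil; exists A; rewrite ?mulr1.
have Dr : D (\prod_(j <- r) h j) by apply: (big_ind D) => // [|u v]; [case: sD|exact: subM].
have [s [t [Ds Dt e]]] : comax (h i) (\prod_(j <- r) h j).
  rewrite big_seq; apply: comax_prod => // j jr; apply: hc; apply: contra ni => /eqP -> //.
have [c Dc hcA] := hA i; rewrite big_cons; exists (s * z + t * c).
  by apply: subD => //; apply: subM.
transitivity (z * (\prod_(j <- r) h j) * (s * h i) + c * h i * (t * \prod_(j <- r) h j)).
  by rewrite -hz -hcA -mulrDr e mulr1.
by ring.
Qed.

(** Two powers of h agree modulo phi because D/(phi) is finite, and the inverse z cancels the
    smaller one. *)
Lemma unit_finite_order phi h z : fin_index D -> D phi -> phi != 0 -> D h -> D z ->
  mult D phi (z * h - 1) -> exists2 e, (0 < e)%N & mult D phi (h ^+ e - 1).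
Proof.
move=> fD Dphi phi0 Dh Dz [c Dc hc]; have [N hN] := fD phi Dphi phi0.
have [_ _ mB mM] := mult_subideal sD Dphi.
have D1 : D 1 by case: sD.
have m0 : mult D phi 0 by exists 0; [exact: sub0|rewrite mul0r].
have [i [j [ij hij]]] : exists i j, (i < j)%N /\ mult D phi (h ^+ i - h ^+ j).
  apply: contrapT => n; apply: hN; exists (fun i => h ^+ i); split=> [i|i j hij]; first exact: subX.
  apply: val_inj => /=; case: (ltngtP i j) => // ij; case: n; first by exists i, j.
  by exists j, i; split=> //; rewrite -opprB -sub0r; apply: (mB).
exists (j - i)%N; first by rewrite subn_gt0.
have key l : mult D phi ((z * h) ^+ l - 1).
  elim: l => [|l IH]; first by rewrite expr0 subrr.
  have -> : (z * h) ^+ l.+1 - 1 = z * h * ((z * h) ^+ l - 1) - (0 - (z * h - 1)) by rewrite exprS; ring.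
  apply: (mB); first by apply: (mM) => //; exact: subM.
  by apply: (mB) => //; exists c.
have -> : h ^+ (j - i) - 1 = 0 - z ^+ i * (h ^+ i - h ^+ j) - (h ^+ (j - i) - 1) * ((z * h) ^+ i - 1).
  by rewrite -{2}(subnK (ltnW ij)) exprD exprMn; ring.
by do 2?apply: (mB) => //; apply: (mM) => //; [exact: subX|apply: subB => //; exact: subX].
Qed.
End ComaximalProducts.

Section CurveFactorization.
Variables (k : fieldType) (Q : comPzRingType) (kap : {rmorphism k -> Q}) (X : seq Q).
Hypothesis gQ : alg_gen kap [set` X].
Hypothesis kclosed : GRing.closed_field_axiom k.
Variable p : nat.
Hypotheses (pk : p \in [pchar k]).
Hypothesis kfin : forall x : k, exists2 s, (0 < s)%N & x ^+ (p ^ s) = x.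
Variables (P : set Q) (pP : is_prime_ideal P) (dP : dlt 2 P) (nmP : ~ dlt 1 P).

(* The factors of a power of [a] are powers of generators of powers of the
   ideals (a, b - la), which are invertible because b^q = b modulo a. *)
Lemma curve_factorization (a b phi rho sig s0 c0 : Q) s : ~ P a -> ~ P phi ->
  P (1 - rho * b - sig * a) -> P (a - 1 - phi * s0) -> (0 < s)%N -> P (b ^+ (p ^ s) - b - c0 * a) ->
  exists n (lam : 'I_n -> k) (t : 'I_n -> Q) (w w' : Q) (N : nat),
  [/\ [/\ (0 < N)%N, forall i, lam i != 0 & injective lam],
   P ((1 + phi * w) * (1 + phi * w') - 1),
   P (a ^+ N - (1 + phi * w) * \prod_i (1 + phi * t i)) &
   forall i, exists c, P ((b - kap (lam i)) ^+ N - c * (1 + phi * t i))].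
Proof.
move=> na nphi hrho ha s_gt0 hb; have [K [g [gker gfrac]]] := residue_field pP.
pose io : {rmorphism k -> K} := (g \o kap)%FUN.
have [rs [urs rsE hrs]] := frobenius_roots pk kclosed s_gt0.
have [D [sD Dg DL fD mD]] := finite_order gQ kclosed dP gker gfrac nmP pk kfin
  ([:: a; b; phi; rho; sig; s0; c0] ++ map kap rs).
have D1 : D 1 by case: sD.
have Dio x : x \in rs -> D (io x) by move=> h; apply: DL; rewrite mem_cat map_f ?orbT.
pose A := g a; pose B := g b; pose Phi := g phi.
have [DA DB DPhi] : [/\ D A, D B & D Phi] by split; apply: DL; rewrite !inE eqxx ?orbT.
have [Drho Dsig Ds0 Dc0] : [/\ D (g rho), D (g sig), D (g s0) & D (g c0)].
  by split; apply: DL; rewrite !inE eqxx ?orbT.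
have A0 : A != 0 by apply/eqP => /gker.
have Phi0 : Phi != 0 by apply/eqP => /gker.
have E1 : g rho * B + g sig * A = 1.
  apply/eqP; rewrite eq_sym -subr_eq0 opprD addrA; apply/eqP.
  by have /gker := hrho; rewrite !rmorphB rmorph1 !rmorphM.
have EA : A = 1 + Phi * g s0.
  apply/eqP; rewrite -subr_eq0 opprD addrA; apply/eqP.
  by have /gker := ha; rewrite !rmorphB rmorph1 rmorphM.
have EB : B ^+ (p ^ s) - B = g c0 * A.
  apply/eqP; rewrite -subr_eq0; apply/eqP.
  by have /gker := hb; rewrite !rmorphB rmorphXn rmorphM.
pose rs' := [seq x <- rs | x != 0]; pose n := size rs'; pose lam (i : 'I_n) := rs'`_i.
have lam_rs i : lam i \in rs' by exact: mem_nth.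
have lam0 i : lam i != 0 by have := lam_rs i; rewrite mem_filter => /andP [].
have lamr i : lam i \in rs by have := lam_rs i; rewrite mem_filter => /andP [].
have lam_inj : injective lam.
  by move=> i j /eqP; rewrite nth_uniq ?filter_uniq // => /eqP /val_inj.
(* The be i are pairwise comaximal, their differences being nonzero constants. B times their product
   is B^q - B, a multiple of A, and B is a unit modulo A; so the product is a multiple A d0, as
   [principal_powers] requires. *)
pose be i := B - io (lam i); pose be' i := \prod_(j | j != i) be j.
have Dbe i : D (be i) by apply: subB => //; apply: Dio.
have Dprod (R : pred 'I_n) (F : 'I_n -> K) : (forall i, D (F i)) -> D (\prod_(i | R i) F i).
  by move=> h; apply: (big_ind D) => // u v; apply: subM.
have cmbe i j : i != j -> comax D (be i) (be j).
  move=> ij; pose d := lam j - lam i.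
  have d0 : d != 0 by rewrite subr_eq0 (inj_eq lam_inj) eq_sym.
  have dr : d^-1 \in rs.
    rewrite rsE exprVn /d frobenius_sub ?(pcharf_prime pk) ?(pcharf0 pk) //.
    by have := lamr i; have := lamr j; rewrite !rsE => /eqP -> /eqP ->.
  exists (io d^-1), (- io d^-1); split; [exact: Dio|apply: subN => //; exact: Dio|].
  have -> : io d^-1 * be i + - io d^-1 * be j = io d^-1 * (io (lam j) - io (lam i)) by rewrite /be; ring.
  by rewrite -rmorphB -rmorphM mulVf // rmorph1.
have Eprod : B * \prod_i be i = B ^+ (p ^ s) - B.
  have -> : \prod_i be i = \prod_(x <- rs | x != 0) (B - io x).
    by rewrite -[RHS]big_filter (big_nth 0) big_mkord.
  have r0 : 0 \in rs by rewrite rsE expr0n expn_eq0 (gtn_eqF (prime_gt0 (pcharf_prime pk))) eqxx.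
  have := congr1 (ev1 io B) hrs; rewrite rmorphB rmorphXn ev1X => ->; rewrite rmorph_prod.
  rewrite (bigD1_seq 0) //=; congr (_ * _).
    by rewrite -[RHS]/(ev1 io B _) rmorphB ev1X ev1C rmorph0 subr0.
  by apply: eq_bigr => x _; rewrite -[RHS]/(ev1 io B _) rmorphB ev1X ev1C.
pose Pi := \prod_i be i; have DPi : D Pi by exact: Dprod.
pose d0 := g rho * g c0 + g sig * Pi; have Dd0 : D d0 by apply: subD => //; apply: subM.
have EPi : Pi = A * d0.
  rewrite -[LHS]mul1r -E1 mulrDl -mulrA Eprod EB /d0; ring.
have Epi i : be i * be' i = Pi by rewrite /Pi (bigD1 i).
have [i|m m0 hm] := principal_powers (be := be) (be' := be') (d := fun=> d0) sD fD mD DA A0.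
  split=> //; [exact: Dprod|by rewrite Epi EPi|].
  by apply: comax_prod => // j ji; apply: cmbe; rewrite eq_sym.
have /choice [h hh] := hm.
have Dh i : D (h i) by have [x [y []]] := hh i.
have hA i : mult D (h i) (A ^+ m) by have [x [y [_ _ _ _ []]]] := hh i.
have hB i : mult D (h i) (be i ^+ m) by have [x [y [_ _ _ _ []]]] := hh i.
have DX x l : D x -> D (x ^+ l) by exact: subX.
have cmh i j : i != j -> comax D (h i) (h j).
  by move=> ij; apply: comax_dvd (hB i) (hB j) => //; apply: comaxX => //; exact: cmbe.
(* The h i are pairwise comaximal divisors of A^m, and their product is also a multiple of A^m; the
   two differ by the unit z'. *)
have [z' Dz' hz'] : mult D (\prod_i h i) (A ^+ m) by apply: mult_prod => //; [exact: index_enum_uniq|exact: DX].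
have [y' Dy' hy'] : mult D (A ^+ m) (\prod_i h i).
  have /choice [xy hxy] : forall i, exists xy : K * K, [/\ D xy.1, D xy.2 &
      h i = xy.1 * A ^+ m + xy.2 * be i ^+ m].
    by move=> i; have [x [y [_ Dx Dy hE _]]] := hh i; exists (x, y).
  have [e De he] : exists2 e, D e & \prod_i h i = e * A ^+ m + \prod_i ((xy i).2 * be i ^+ m).
    suff [] : D (\prod_i ((xy i).2 * be i ^+ m)) /\ exists2 e, D e & \prod_i h i = e * A ^+ m + \prod_i ((xy i).2 * be i ^+ m) by [].
    apply: (big_ind2 (fun u v => D v /\ exists2 e, D e & u = e * A ^+ m + v)).
    - by split=> //; exists 0; [exact: sub0|rewrite mul0r add0r].
    - move=> u1 v1 u2 v2 [Dv1 [e1 De1 ->]] [Dv2 [e2 De2 ->]]; split; first exact: subM.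
      exists (e1 * e2 * A ^+ m + e1 * v2 + v1 * e2); last ring.
      by do ?[apply: subD => //]; do ?[apply: subM => //]; apply: DX.
    - move=> i _; have [D1' D2' ->] := hxy i; split; first by apply: subM => //; exact: DX.
      by exists (xy i).1.
  exists (e + \prod_i (xy i).2 * d0 ^+ m).
    by apply: subD => //; apply: subM; [|apply: Dprod => i; have [] := hxy i|exact: DX].
  by rewrite he big_split /= prodrXl -/Pi EPi exprMn; ring.
have zy : z' * y' = 1.
  by apply: (mulIf (expf_neq0 m A0)); rewrite mul1r {2}hz' hy'; ring.
have Amod l : mult D Phi (A ^+ l - 1).
  have [_ _ mB mM] := mult_subideal sD DPhi.
  elim: l => [|l [c Dc IH]]; first by rewrite expr0 subrr; exists 0; [exact: sub0|rewrite mul0r].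
  exists (A * c + g s0); first by apply: subD => //; apply: subM.
  have A1 : A - 1 = Phi * g s0 by rewrite {1}EA addrAC subrr add0r.
  have -> : A ^+ l.+1 - 1 = A * (A ^+ l - 1) + (A - 1) by rewrite exprS; ring.
  by rewrite IH A1; ring.
have /choice [e he] : forall i, exists e, (0 < e)%N /\ mult D Phi (h i ^+ e - 1).
  move=> i; have [z Dz hz] := hA i.
  have [|e e0 ?] := unit_finite_order sD fD DPhi Phi0 (Dh i) Dz; last by exists e.
  by rewrite -hz; apply: Amod.
(* This exponent makes every factor 1 modulo phi. On other components of the ambient curve, where
   phi will vanish, the factors are then 1. *)
pose E := (\prod_i e i)%N; have E0 : (0 < E)%N by rewrite prodn_gt0 // => i; have [] := he i.
have powE x l : D x -> mult D Phi (x - 1) -> mult D Phi (x ^+ l - 1).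
  move=> Dx [c Dc hc]; elim: l => [|l [c' Dc' IH]].
    by rewrite expr0 subrr; exists 0; [exact: sub0|rewrite mul0r].
  exists (x * c' + c); first by apply: subD => //; apply: subM.
  have -> : x ^+ l.+1 - 1 = x * (x ^+ l - 1) + (x - 1) by rewrite exprS; ring.
  by rewrite IH hc; ring.
have hE i : mult D Phi (h i ^+ E - 1).
  rewrite /E (bigD1 i) //= exprM; apply: powE; [exact: DX|by have [] := he i].
have lift1 x : D x -> mult D Phi (x - 1) -> exists t, g (1 + phi * t) = x.
  move=> Dx [c /Dg [t _ <-] hc]; exists t; rewrite rmorphD rmorph1 rmorphM mulrC -hc; ring.
have /choice [t ht] : forall i, exists t, g (1 + phi * t) = h i ^+ E.
  by move=> i; apply: lift1; [exact: DX|exact: hE].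
pose H := \prod_i h i.
have HE : mult D Phi (H ^+ E - 1).
  rewrite /H -prodrXl; suff [] : D (\prod_i h i ^+ E) /\ mult D Phi (\prod_i h i ^+ E - 1) by [].
  apply: (big_ind (fun x => D x /\ mult D Phi (x - 1))).
  - by split=> //; rewrite subrr; exists 0; [exact: sub0|rewrite mul0r].
  - move=> x y [Dx [c Dc hc]] [Dy [d Dd hd]]; split; first exact: subM.
    exists (x * d + c); first by apply: subD => //; apply: subM.
    have -> : x * y - 1 = x * (y - 1) + (x - 1) by ring.
    by rewrite hc hd; ring.
  - by move=> i _; split; [exact: DX|exact: hE].
have DH : D H by exact: Dprod.
have zE : mult D Phi (z' ^+ E - 1).
  have [c Dc hc] := HE; have [d Dd hd] := Amod (m * E)%N.
  exists (d - z' ^+ E * c); first by apply: subB => //; apply: subM => //; exact: DX.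
  have -> : z' ^+ E - 1 = (A ^+ (m * E) - 1) - z' ^+ E * (H ^+ E - 1) by rewrite exprM hz' exprMn /H; ring.
  by rewrite hc hd; ring.
have yE : mult D Phi (y' ^+ E - 1).
  have [c Dc hc] := HE; have [d Dd hd] := Amod (m * E)%N.
  exists (c - y' ^+ E * d); first by apply: subB => //; apply: subM => //; exact: DX.
  have -> : y' ^+ E - 1 = (H ^+ E - 1) - y' ^+ E * (A ^+ (m * E) - 1) by rewrite exprM /H hy' exprMn; ring.
  by rewrite hc hd; ring.
have [w hw] := lift1 _ (DX _ E Dz') zE; have [w' hw'] := lift1 _ (DX _ E Dy') yE.
exists n, lam, t, w, w', (m * E)%N; split.
- by split=> //; rewrite muln_gt0 m0.
- by apply/gker; rewrite rmorphB rmorphM hw hw' -exprMn zy expr1n rmorph1 subrr.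
- apply/gker; rewrite rmorphB rmorphM hw rmorph_prod rmorphXn.
  under eq_bigr => i _ do rewrite ht.
  by rewrite prodrXl exprM -/A hz' exprMn subrr.
- move=> i; have [c Dc hc] := hB i; have [c' _ cE] := Dg _ (DX _ E Dc).
  exists c'; apply/gker; rewrite rmorphB [g (c' * _)]rmorphM ht cE -exprMn -hc -exprM rmorphXn rmorphB.
  by rewrite subrr.
Qed.
End CurveFactorization.

(** * The exchange argument for a row of length three *)

Section Comaximality.
Variable R : comPzRingType.
Implicit Types (x y z : R).

Lemma unit2 x y : (forall P : set R, is_prime_ideal P -> P x -> P y -> False) ->
  exists u v, u * x + v * y = 1.
Proof.
move=> h; have [_ [u ->] [_ [v ->] <-]] : ideal_add (pid x) (pid y) 1; last by exists u, v.
apply: (@primes_one _ (ideal_add (pid x) (pid y))).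
  by apply: ideal_add_ideal; exact: pid_ideal.
move=> P pP h'; apply: (h P pP); apply: h'.
  by apply: addl; [exact: pid_ideal|exact: pid_mem].
by apply: addr_; [exact: pid_ideal|exact: pid_mem].
Qed.

Lemma tunimP x y z : tunim x y z <-> (forall P : set R, is_prime_ideal P -> P x -> P y -> P z -> False).
Proof.
split=> [[u [v [w h]]] P pP Px Py Pz|h].
  have iP := prime_ideal pP; apply: (prime_n1 pP); rewrite -h.
  by apply: idlD => //; [apply: idlD => //|]; apply: idlM.
pose H := ideal_add (ideal_add (pid x) (pid y)) (pid z).
have iH : is_ideal H by apply: ideal_add_ideal; [apply: ideal_add_ideal|]; exact: pid_ideal.
have H1 : H 1.
  apply: primes_one => // P pP HP; apply: (h P pP); apply: HP.
  - by apply: addl; [exact: pid_ideal|apply: addl; [exact: pid_ideal|exact: pid_mem]].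
  - by apply: addl; [exact: pid_ideal|apply: addr_; [exact: pid_ideal|exact: pid_mem]].
  - by apply: addr_; [apply: ideal_add_ideal; exact: pid_ideal|exact: pid_mem].
by have [_ [_ [u ->] [_ [v ->] <-]] [_ [w ->] e]] := H1; exists u, v, w.
Qed.

Lemma prime_congr (P : set R) x y : is_prime_ideal P -> P (x - y) -> (P x <-> P y).
Proof.
move=> pP h; have iP := prime_ideal pP; split=> h'; last exact: (idlDl iP h).
by apply: (idlDl iP (idlC iP h)).
Qed.

Lemma chinese_remainder (I : finType) (rho : I -> R) :
  (forall (P : set R) (x y : I), is_prime_ideal P -> P (rho x) -> P (rho y) -> x = y) ->
  forall v : I -> R, exists y, forall x : I, pid (rho x) (y - v x).
Proof.
move=> hc v.
have /choice [e he] : forall x : I, exists e : R, pid (rho x) (1 - e) /\ forall y : I, y != x -> pid (rho y) e.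
  move=> x; have [P pP P1 P2|u [w uw]] := @unit2 (rho x) (\prod_(y | y != x) rho y).
    by have [y nyx Py] := prime_prod pP P2; move/eqP: nyx; apply; apply: hc P1.
  exists (w * \prod_(y | y != x) rho y); split; first by exists u; apply/eqP; rewrite subr_eq uw.
  move=> y nyx; exists (w * \prod_(z | (z != x) && (z != y)) rho z).
  by rewrite (bigD1 y) //= mulrCA mulrC.
exists (\sum_x v x * e x) => x; have ix := pid_ideal (rho x).
rewrite (bigD1 x) //= addrAC; apply: idlD => //.
  have [h _] := he x; have -> : v x * e x - v x = - v x * (1 - e x) by ring.
  exact: idlM.
apply: idl_sum => // y nyx; apply: idlM => //; have [_ h] := he y.
by apply: h; rewrite eq_sym.
Qed.
End Comaximality.

Section SurfaceCore.
Variables (k : fieldType) (Q : comPzRingType) (kap : {rmorphism k -> Q}).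
Hypothesis kclosed : GRing.closed_field_axiom k.
Variable p : nat.
Hypotheses (pp : prime p) (p0 : p%:R = 0 :> Q).
Variables (c a b : Q) (I : finType) (G : I -> Q) (lam : I -> k) (N : nat).
Hypothesis cab : tunim c a b.
Hypothesis N0 : (0 < N)%N.
Hypothesis lam0 : forall x, lam x != 0.
Hypothesis G_value : forall P x, is_prime_ideal P -> P c -> P (G x) -> P (b - kap (lam x)).
Hypothesis G_disjoint : forall P x y, is_prime_ideal P -> P c -> P (G x) -> P (G y) -> x = y.
Hypothesis G_prod : forall P, is_prime_ideal P -> P c -> P (a ^+ N - \prod_x G x).
Hypothesis a_reduced : forall z, (forall P, is_prime_ideal P -> P c -> P a -> P z) ->
  exists d, forall P, is_prime_ideal P -> P c -> P (z - d * a).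
Hypothesis G_order : forall x y, x != y -> exists2 e, (0 < e)%N &
  forall P, is_prime_ideal P -> P c -> P (G y) -> P (G x ^+ e - 1).

Let frob s (x y : Q) : (x - y) ^+ (p ^ s) = x ^+ (p ^ s) - y ^+ (p ^ s).
Proof. exact: frobenius_sub. Qed.

(** Exponents are powers of p, so that a difference that is nilpotent modulo H turns into a
    congruence between powers of its terms. *)
Let rad_frob (H : set Q) x : is_ideal H -> (forall P, is_prime_ideal P -> H `<=` P -> P x) ->
  exists s, H (x ^+ (p ^ s)).
Proof.
move=> iH /(primes_rad iH) [n Hn]; exists n.
have np : (n <= p ^ n)%N by apply/ltnW/ltn_expl/prime_gt1.
by rewrite -(subnK np) exprD; apply: idlM.
Qed.

(* Each lift is corrected by a multiple of [c] to be 1 modulo the previous ones. *)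
Let comaximal_lifts (s : seq I) : uniq s -> exists (e : I -> nat) (rho : I -> Q),
  [/\ forall x, (0 < e x)%N, forall x, x \in s -> pid c (rho x - G x ^+ e x) &
   forall P x y, is_prime_ideal P -> x \in s -> y \in s -> P (rho x) -> P (rho y) -> x = y].
Proof.
elim: s => [|x s IH]; first by exists (fun=> 1%N), (fun=> 0); split.
move=> /= /andP [xs /IH [e [rho [e0 hrho disj]]]].
pose Pi := \prod_(y <- s) rho y.
have PiP P : is_prime_ideal P -> P Pi -> exists2 y, y \in s & P (rho y).
  move=> pP; rewrite /Pi; elim: (s) => [|y r IHr]; first by rewrite big_nil => /(prime_n1 pP).
  rewrite big_cons => /(primeM pP) [|/IHr [z zr Pz]]; first by exists y; rewrite ?mem_head.
  by exists z; rewrite // inE zr orbT.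
have /choice [f hf] : forall y, exists f, (0 < f)%N /\ (y != x -> forall P, is_prime_ideal P -> P c -> P (G y) -> P (G x ^+ f - 1)).
  move=> y; have [->|nyx] := eqVneq y x; first by exists 1%N.
  by rewrite eq_sym in nyx; have [f f0 hf] := G_order nyx; exists f.
pose F := (\prod_(y <- s) f y)%N.
have F0 : (0 < F)%N by rewrite prodn_gt0 // => y; have [] := hf y.
pose H := ideal_add (pid c) (pid Pi).
have iH : is_ideal H by apply: ideal_add_ideal; exact: pid_ideal.
have [P pP HP|t [_ [r1 ->] [_ [r2 ->] er]]] := @rad_frob H (G x ^+ F - 1) iH.
  have iP := prime_ideal pP.
  have Pc : P c by apply: HP; apply: addl; [exact: pid_ideal|exact: pid_mem].
  have [y ys Py] := PiP P pP (HP _ (addr_ (pid_ideal c) (pid_mem Pi))).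
  have nyx : y != x by apply: contraNneq xs => <-.
  have PGy : P (G y).
    apply: (primeX (n := e y) pP).
    exact: ((prime_congr pP (pid_sub iP Pc (hrho y ys))).1 Py).
  have [_ /(_ nyx P pP Pc PGy) h] := hf y.
  have [m ->] : exists m, F = (f y * m)%N.
    by exists (\prod_(z <- rem y s) f z)%N; rewrite /F (big_rem y).
  rewrite exprM -(expr1n _ m); exact: idl_congX.
pose ex := (F * p ^ t)%N.
exists (fun y => if y == x then ex else e y), (fun y => if y == x then 1 + r2 * Pi else rho y).
have D1 P : is_prime_ideal P -> P (1 + r2 * Pi) -> forall y, y \in s -> P (rho y) -> False.
  move=> pP h y ys Py; have iP := prime_ideal pP; apply: (prime_n1 pP).
  rewrite -(addrK (r2 * Pi) 1); apply: idlB => //; apply: idlM => //.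
  by rewrite /Pi (big_rem y) //=; apply: idlMr.
have nx y : y \in s -> (y == x) = false by move=> ys; apply: contraNF xs => /eqP <-.
split.
- by move=> y; case: eqP => // _; rewrite muln_gt0 F0 expn_gt0 prime_gt0.
- move=> y; rewrite inE; case: eqP => [-> _|_ /= /hrho //].
  exists (- r1); rewrite mulNr /ex exprM -[X in _ - X](subrK 1).
  rewrite -[1 in X in _ - X](expr1n _ (p ^ t)) -[X in _ - (X + _)](frob t) -er expr1n; ring.
- move=> P y z pP; rewrite !inE; have [->|/= nyx ys] := eqVneq y x; have [->|/= nzx zs] := eqVneq z x => //.
  + by move=> /= zs' h1 h2; case: (D1 P pP h1 z zs' h2).
  + by move=> _ h1 h2; case: (D1 P pP h2 y ys h1).
  + exact: disj.
Qed.

(* Modulo [c] and [a], [b] is an even power of some [y] up to a nilpotent; [teq_exchange] then replaces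
   ([a], [b]) by ([y], a power of [a]), which factors into the lifts [rho]. *)
Lemma surface_core : exists c' a' b', teq c a b c' a' b' /\ exists u v, u * c' + v * a' = 1.
Proof.
have ic := pid_ideal c.
have Pc P : is_prime_ideal P -> pid c `<=` P -> P c by move=> _ h; apply: h; exact: pid_mem.
have [e [rho [e0 hrho disj]]] := comaximal_lifts (enum_uniq I).
have {}hrho x : pid c (rho x - G x ^+ e x) by apply: hrho; rewrite mem_enum.
have {}disj P x y : is_prime_ideal P -> P (rho x) -> P (rho y) -> x = y.
  by move=> pP; apply: disj => //; rewrite mem_enum.
have [P pP /(Pc _ pP)|t ht] := @rad_frob (pid c) (a ^+ N - \prod_x G x) ic; first exact: G_prod.
pose E := (\prod_x e x)%N; have E0 : (0 < E)%N by rewrite prodn_gt0.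
(* N p^t brings a to a power of the product of the G x modulo c, E turns the factors into powers of
   G x ^+ e x and so of the lifts rho x, and 2 makes the exponent even. *)
pose N' := (N * p ^ t * E * 2)%N.
have N'0 : (0 < N')%N by rewrite !muln_gt0 N0 E0 expn_gt0 prime_gt0.
pose m x := (\prod_(y | y != x) e y * p ^ t * 2)%N.
pose Pi := \prod_x rho x ^+ m x.
have hPi : pid c (a ^+ N' - Pi).
  have -> : N' = (N * p ^ t * (E * 2))%N by rewrite /N'; ring.
  rewrite exprM; apply: (@idl_trans _ _ _ (\prod_x (G x ^+ e x) ^+ m x)) => //.
    have -> : \prod_x (G x ^+ e x) ^+ m x = ((\prod_x G x) ^+ (p ^ t)) ^+ (E * 2).
      rewrite -exprM -prodrXl; apply: eq_bigr => x _; rewrite -exprM; congr (_ ^+ _).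
      have -> : E = (e x * \prod_(y | y != x) e y)%N by rewrite /E (bigD1 x).
      by rewrite /m; ring.
    by apply: idl_congX => //; rewrite exprM -frob.
  rewrite /Pi; apply: (big_ind2 (fun u v => pid c (u - v))).
  - by rewrite subrr; apply: idl0.
  - by move=> u1 v1 u2 v2; apply: idl_congM.
  - by move=> x _; apply: idl_congX => //; apply: idlC.
(* The y interpolating these roots of the values lam x will satisfy y^N' = b at the zeros of a on c
   = 0; it is a unit modulo each rho x since the roots are nonzero. *)
have /choice [mu hmu] : forall x, exists mu : k, mu ^+ N' = lam x.
  move=> x; have [mu hmu] := kclosed (fun i => if i == 0%N then lam x else 0) N'0; exists mu; rewrite hmu.
  case: (N') N'0 => // n _; rewrite big_ord_recl /= expr0 mulr1 big1 ?addr0 // => i _.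
  by rewrite mul0r.
have mu0 x : mu x != 0 by have := lam0 x; rewrite -hmu expf_eq0 N'0.
have [y hy] := chinese_remainder disj (fun x => kap (mu x)).
have yval P x : is_prime_ideal P -> P (rho x) -> P (y - kap (mu x)).
  by move=> pP Px; apply: (pid_sub (prime_ideal pP) Px); apply: hy.
have yunit P x : is_prime_ideal P -> P (rho x) -> P y -> False.
  move=> pP Px Py; have iP := prime_ideal pP.
  have /(idlM (kap (mu x)^-1) iP) : P (kap (mu x)) by apply/(prime_congr pP (yval P x pP Px)).
  by rewrite -rmorphM mulVf // rmorph1; apply: prime_n1.
have [P pP /prime_prod [] // x _ /(primeX pP) Px Py|u [v uv]] := @unit2 _ Pi y; first exact: yunit Px Py.
have rhoG P x : is_prime_ideal P -> P c -> P (G x) -> P (rho x).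
  move=> pP Pc' PG; apply/(prime_congr pP (pid_sub (prime_ideal pP) Pc' (hrho x))).
  by have := e0 x; case: (e x) => // n _; rewrite exprS; apply: idlMr => //; exact: prime_ideal.
(* The difference b - y^N' vanishes at all common zeros of c and a, so it is a multiple of a up to
   an element nilpotent modulo c, which [teq_nilpotent] discards. *)
have [P pP Pc' Pa|d hd] := a_reduced (z := b - y ^+ N').
  have iP := prime_ideal pP.
  have /(prime_prod pP) [x _ PG] : P (\prod_x G x).
    apply/(prime_congr pP (G_prod pP Pc')); case: (N) N0 => // n _.
    by rewrite exprS; apply: idlMr.
  have := G_value pP Pc' PG; rewrite -hmu rmorphXn => h.
  apply: (idl_trans iP h); apply: idlC => //; apply: idl_congX => //.
  by apply: yval => //; exact: rhoG.
have [P pP /(Pc _ pP) Pc'|s [w hw]] := @rad_frob (pid c) (b - y ^+ N' - d * a) ic; first exact: hd.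
have s1 : teq c a b c a (b - d * a) by apply: (teq32 (x := - d)); ring.
have s2 : teq c a (b - d * a) c a (y ^+ N').
  have := teq_nilpotent (tunim_teq s1 cab) hw.
  by have -> : b - d * a - (b - y ^+ N' - d * a) = y ^+ N' by ring.
have U2 := tunim_teq (teq_trans s1 s2) cab.
have s3 : teq a (y ^+ N') c y (a ^+ N') c.
  apply: teq_exchange => //; first by rewrite /N' oddM andbF.
  apply/tunimP => P pP /(primeX pP) Pa Py Pc'.
  by move/tunimP: U2 => /(_ P pP Pc' Pa Py).
have [w' hw'] := hPi.
have s4 : teq y (a ^+ N') c y Pi c by apply: (teq23 (x := - w')); rewrite mulNr -hw'; ring.
have s5 : teq y Pi c y Pi 1.
  apply: (teq_trans (teq31 (x := (1 - c) * v) _ (erefl _))).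
  by apply: (teq32 (x := (1 - c) * u)); rewrite -[LHS](subrK c) -{1}[1 - c]mulr1 -uv; ring.
exists 1, y, Pi; split; last by exists 1, 0; rewrite mul1r mul0r addr0.
apply: (teq_trans (teq_trans s1 s2)); apply: teq_swap12; apply: teq_swap23.
exact: (teq_trans s3 (teq_trans s4 s5)).
Qed.
End SurfaceCore.

(** * Shortening unimodular rows *)

Lemma unit2_mod (R : comPzRingType) (H : set R) x y : is_ideal H ->
  (forall P, is_prime_ideal P -> H `<=` P -> P x -> P y -> False) ->
  exists r s, H (1 - r * x - s * y).
Proof.
move=> iH h; pose L := ideal_add H (ideal_add (pid x) (pid y)).
have ixy : is_ideal (ideal_add (pid x) (pid y)) by apply: ideal_add_ideal; exact: pid_ideal.
have [t Ht [_ [_ [r ->] [_ [s ->] <-]] e]] : L 1.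
  apply: (@primes_one _ L) => [|P pP LP]; first exact: ideal_add_ideal.
  apply: (h P pP); [by move=> z Hz; apply: LP; apply: addl| |].
    by apply: LP; apply: addr_ => //; apply: addl; [exact: pid_ideal|exact: pid_mem].
  by apply: LP; apply: addr_ => //; apply: addr_; [exact: pid_ideal|exact: pid_mem].
by exists r, s; rewrite -e -addrA -opprD addrK.
Qed.

Lemma big_option (R : Type) (idx : R) (op : Monoid.com_law idx) (I : finType) (F : option I -> R) :
  \big[op/idx]_x F x = op (F None) (\big[op/idx]_i F (Some i)).
Proof.
rewrite (bigD1 None) //=; congr (op _ _).
rewrite (reindex_omap Some id) //=; last by case.
by apply: eq_bigl => i; rewrite eqxx.
Qed.

(** * Rows of length three *)

Section SurfaceShortening.
Variables (k : fieldType) (Q : comPzRingType) (kap : {rmorphism k -> Q}) (X : seq Q).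
Hypothesis gQ : alg_gen kap [set` X].
Hypothesis kclosed : GRing.closed_field_axiom k.
Variable p : nat.
Hypotheses (pk : p \in [pchar k]).
Hypothesis kfin : forall x : k, exists2 s, (0 < s)%N & x ^+ (p ^ s) = x.
Hypothesis nQ : noeth Q.

Lemma finite_unit_order (P : set Q) y h z w : is_prime_ideal P -> dlt 2 P -> ~ dlt 1 P -> ~ P y ->
  P (z * h - 1 - w * y) -> exists2 e, (0 < e)%N & exists w', P (h ^+ e - 1 - w' * y).
Proof.
move=> pP dP nmP ny hP; have [K [g [gker gfrac]]] := residue_field pP.
have [D [sD Dg DL fD mD]] := finite_order gQ kclosed dP gker gfrac nmP pk kfin [:: y; h; z; w].
have [Dy Dh Dz Dw] : [/\ D (g y), D (g h), D (g z) & D (g w)].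
  by split; apply: DL; rewrite !inE eqxx ?orbT.
have y0 : g y != 0 by apply/eqP => /gker.
have [|e e0 [c /Dg [c' _ <-] hc]] := unit_finite_order sD fD Dy y0 Dh Dz.
  exists (g w) => //; have /gker := hP; rewrite !rmorphB !rmorphM rmorph1 => /eqP.
  by rewrite subr_eq0 => /eqP.
by exists e => //; exists c'; apply/gker; rewrite !rmorphB rmorphXn rmorph1 rmorphM hc subrr.
Qed.

Variables (c a b : Q).
Hypothesis cab : tunim c a b.
Hypothesis dc : forall P, is_prime_ideal P -> P c -> dlt 2 P.

(** The zeros of c have components Pf i, those with [J i] being curves and the others closed points.
    Data are prescribed on each curve separately by means of phi i, which vanishes on the other
    components: an element 1 + phi i x is 1 there. This is why a is first made 1 modulo all the phi
    i. Closed points carry phi i = 0 and a = 1. *)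
Lemma surface_shorten : exists c' a' b', teq c a b c' a' b' /\ exists u v, u * c' + v * a' = 1.
Proof.
have ic := pid_ideal c; have pp := pcharf_prime pk.
have p0 : p%:R = 0 :> Q := pchar_image kap pk.
have [n0 [Pf [Pf1 Pf2 Pf3]]] := min_primes nQ ic.
have pf i : is_prime_ideal (Pf i) by have [] := Pf1 i.
have ipf i : is_ideal (Pf i) := prime_ideal (pf i).
have cf i : Pf i c by have [_] := Pf1 i; apply; exact: pid_mem.
have cover P : is_prime_ideal P -> P c -> exists i, Pf i `<=` P.
  by move=> pP Pc; apply: Pf2 => //; apply: pid_sub => //; exact: prime_ideal.
have dpf i : dlt 2 (Pf i) by apply: dc.
pose J i := ~ dlt 1 (Pf i).
have /choice [phi hphi] : forall i, exists x, [/\ J i -> ~ Pf i x, ~ J i -> x = 0 & forall j, j != i -> Pf j x].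
  move=> i; have [Ji|nJ] := pselect (J i); last by exists 0; split=> // j _; exact: idl0.
  have /choice [w hw] : forall j, exists w, j != i -> Pf j w /\ ~ Pf i w.
    move=> j; have [->|ji] := eqVneq j i; first by exists 0.
    apply: contrapT => n; apply: (Pf3 j i ji) => w Pw; apply: contrapT => nw; apply: n.
    by exists w.
  exists (\prod_(j | j != i) w j); split=> // [_ /(prime_prod (pf i)) [j ji]|j ji].
    by have [] := hw j ji.
  by rewrite (bigD1 j) //=; apply: idlMr => //; have [] := hw j ji.
have phiJ i : J i -> ~ Pf i (phi i) by have [] := hphi i.
have phin i : ~ J i -> phi i = 0 by have [_] := hphi i.
have phio i j : j != i -> Pf j (phi i) by have [_ _] := hphi i; apply.
have psum (x : 'I_n0 -> Q) i : Pf i (\sum_j phi j * x j - phi i * x i).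
  rewrite (bigD1 i) //= addrAC subrr add0r; apply: idl_sum => // j ji; apply: idlMr => //.
  by apply: phio; rewrite eq_sym.
(* Its zeros on c = 0 are closed points of Spec Q, including the points where components meet. *)
pose Phi := \sum_i phi i * 1.
have hPhi i : Pf i (Phi - phi i) by have := psum (fun=> 1) i; rewrite mulr1.
have dim1 P : is_prime_ideal P -> P c -> P Phi -> dlt 1 P.
  move=> pP Pc PPhi; have [i iP] := cover P pP Pc.
  have [Ji|/contrapT hd] := pselect (J i); last exact: dlt_mono hd.
  apply: (dpf i) => //; split=> // Pi; apply: (phiJ i Ji); apply: Pi.
  by apply/(prime_congr pP (iP _ (hPhi i))).
have icP : is_ideal (ideal_add (pid c) (pid Phi)) by apply: ideal_add_ideal => //; exact: pid_ideal.
have [n1 [R1 [hR1 hR2]]] := finite_primes nQ icP.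
have R1c j : R1 j c by have [_] := hR1 j; apply; apply: addl; [exact: pid_ideal|exact: pid_mem].
have R1P j : R1 j Phi by have [_] := hR1 j; apply; apply: addr_ => //; exact: pid_mem.
(* A multiple of a moves b off the components and off the zeros of Phi on them. *)
have [||y0 [s ->] hy] := @prime_avoidance _ _ (fcat R1 Pf) (pid a) b _ (pid_ideal a).
- by apply: (@fcat_all _ _ _ R1 Pf (fun X => is_prime_ideal X)) => i; [have [] := hR1 i|exact: pf].
- apply: (@fcat_all _ _ _ R1 Pf (fun X => pid a `<=` X -> ~ X b)) => i ha hb; move/tunimP: cab.
    by move/(_ (R1 i)); apply=> //; [have [] := hR1 i|apply: ha; exact: pid_mem].
  by move/(_ (Pf i)); apply=> //; apply: ha; exact: pid_mem.
pose b1 := b + s * a.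
have s1 : teq c a b c a b1 by apply: (teq32 (x := s)).
have U1 := tunim_teq s1 cab.
have nb1 i : ~ Pf i b1 by have := hy (rshift n1 i); rewrite fcatr.
have nb1R P : is_prime_ideal P -> P c -> P Phi -> ~ P b1.
  move=> pP Pc PPhi; have [|j jP] := hR2 P pP.
    by apply: add_sub; [exact: prime_ideal| |]; apply: pid_sub => //; exact: prime_ideal.
  have [pR _] := hR1 j; have := hy (lshift n0 j); rewrite fcatl => nR Pb; apply: nR.
  by apply: (dlt1_max (dim1 _ pR (R1c j) (R1P j)) pP jP).
have [u [v [r huvr]]] : tunim c Phi b1 by apply/tunimP => P pP Pc PPhi; exact: nb1R.
(* Modulo (c, Phi) the element r is an inverse of b1, so that a1 is 1 there. *)
pose a1 := a + r * (1 - a) * b1.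
have s2 : teq c a b1 c a1 b1 by apply: (teq23 (x := r * (1 - a))).
have U2 := tunim_teq s2 U1.
have a1E : a1 - 1 = Phi * (- (1 - a) * v) + c * (- (1 - a) * u).
  have -> : a1 - 1 = - (1 - a) * (1 - r * b1) by rewrite /a1; ring.
  by rewrite -huvr; ring.
pose s0 := - (1 - a) * v.
have a1i i : Pf i (a1 - 1 - phi i * s0).
  rewrite a1E -/s0; have -> : Phi * s0 + c * (- (1 - a) * u) - phi i * s0 = (Phi - phi i) * s0 + c * (- (1 - a) * u) by ring.
  by apply: idlD => //; apply: idlMr.
(* [radical_translate] is applied to a1 and b1 phi i, and not to b1, so that the correction vanishes
   on the other components and preserves a1 = 1 modulo phi i. *)
have /choice [t ht] : forall i, exists t, J i -> ~ Pf i (a1 + b1 * phi i * t) /\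
    forall y, exists2 s, (0 < s)%N & exists c', Pf i (y ^+ (p ^ s) - y - c' * (a1 + b1 * phi i * t)).
  move=> i; have [Ji|nJ] := pselect (J i); last by exists 0.
  have [||t ht] := @radical_translate _ _ _ _ gQ kclosed _ pk kfin _ (pf i) (dpf i) Ji a1 (b1 * phi i).
  - apply: unit2_mod => // P pP iP Pa1 /(primeM pP) [Pb1|Pphi].
      by move/tunimP: U2 => /(_ P pP (iP _ (cf i)) Pa1 Pb1).
    apply: (prime_n1 pP); have iP' := prime_ideal pP.
    have -> : 1 = a1 - phi i * s0 - (a1 - 1 - phi i * s0) by ring.
    apply: idlB => //; last exact: iP; apply: idlB => //; exact: idlMr.
  - by move=> /(primeM (pf i)) [|]; [exact: nb1|exact: phiJ].
  by exists t.
pose T := \sum_i phi i * t i; pose a2 := a1 + T * b1.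
have s3 : teq c a1 b1 c a2 b1 by apply: (teq23 (x := T)).
have U3 := tunim_teq s3 U2.
have a2i i : Pf i (a2 - (a1 + b1 * phi i * t i)).
  have -> : a2 - (a1 + b1 * phi i * t i) = b1 * (T - phi i * t i) by rewrite /a2; ring.
  by apply: idlM => //; exact: psum.
pose si i := s0 + b1 * t i.
have a2s i : Pf i (a2 - 1 - phi i * si i).
  have -> : a2 - 1 - phi i * si i = (a2 - (a1 + b1 * phi i * t i)) + (a1 - 1 - phi i * s0) by rewrite /si; ring.
  exact: idlD.
have na2 i : J i -> ~ Pf i a2.
  by move=> Ji; have [h _] := ht i Ji; move/(prime_congr (pf i) (a2i i)).
have red i y : J i -> exists2 s, (0 < s)%N & exists c', Pf i (y ^+ (p ^ s) - y - c' * a2).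
  move=> Ji; have [_ h] := ht i Ji; have [s' s'0 [c' hc']] := h y; exists s' => //; exists c'.
  have -> : y ^+ (p ^ s') - y - c' * a2 =
    y ^+ (p ^ s') - y - c' * (a1 + b1 * phi i * t i) - c' * (a2 - (a1 + b1 * phi i * t i)) by ring.
  by apply: idlB => //; apply: idlM.
have a2n i : ~ J i -> Pf i (a2 - 1) by move=> nJ; have := a2s i; rewrite phin // mul0r subr0.
pose one i l (ts : nat -> Q) := 1 + phi i * ts l.
(* The factorizations of all components are chosen at once. Their lengths differ, so indices are
   natural numbers with default values past the end; a closed point gets the empty factorization. *)
have /choice [dat hdat] : forall i, exists d : (nat * nat) * ((nat -> k) * (nat -> Q)) * (Q * Q),
    let: ((n, N), (lam, ts), (w, w')) := d in
    [/\ (0 < N)%N /\ (forall l, lam l != 0),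
        (forall l l', (l < n)%N -> (l' < n)%N -> lam l = lam l' -> l = l') /\ (~ J i -> n = 0%N),
        Pf i ((1 + phi i * w) * (1 + phi i * w') - 1),
        Pf i (a2 ^+ N - (1 + phi i * w) * \prod_(l < n) one i l ts) &
        forall l, (l < n)%N -> exists c', Pf i ((b1 - kap (lam l)) ^+ N - c' * one i l ts)].
  move=> i; have [Ji|nJ] := pselect (J i); last first.
    exists ((0%N, 1%N), (fun=> 1, fun=> 0), (0, 0)); split=> //.
    - by split=> // l; exact: oner_neq0.
    - by rewrite mulr0 addr0 mulr1 subrr; exact: idl0.
    - by rewrite big_ord0 mulr0 addr0 mulr1 expr1; exact: a2n.
  have [s' s'0 [c' hc']] := red i b1 Ji.
  have [u' [v' [w0 h0]]] := U3.
  have h1 : Pf i (1 - w0 * b1 - v' * a2).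
    have -> : 1 - w0 * b1 - v' * a2 = u' * c by rewrite -h0; ring.
    exact: idlM.
  have [n [lam [ts [w [w' [N [[N0 lam0 lami] d1 d2 d3]]]]]]] :=
    curve_factorization gQ kclosed pk kfin (pf i) (dpf i) Ji (na2 i Ji) (phiJ i Ji) h1 (a2s i) s'0 hc'.
  pose lam' (l : nat) := if insub l is Some l' then lam l' else 1.
  pose ts' (l : nat) := if insub l is Some l' then ts l' else 0.
  exists ((n, N), (lam', ts'), (w, w')); split=> //.
  - by split=> // l; rewrite /lam'; case: insubP => [l' _ _|_]; rewrite ?oner_neq0.
  - split=> // l l' ln ln'; rewrite /lam' (insubT (fun x => x < n)%N ln) (insubT (fun x => x < n)%N ln') /=.
    by move=> /lami /(congr1 val).
  - by under eq_bigr => l _ do rewrite /one /ts' valK.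
  - move=> l ln; have [c'' h] := d3 (Ordinal ln); exists c''.
    by rewrite /one /ts' /lam' (insubT (fun x => x < n)%N ln).
pose nn i := (dat i).1.1.1; pose NN i := (dat i).1.1.2; pose la i := (dat i).1.2.1.
pose ts i := (dat i).1.2.2; pose ww i := (dat i).2.1; pose ww' i := (dat i).2.2.
have d0 i : (0 < NN i)%N /\ forall l, la i l != 0.
  by have := hdat i; rewrite /NN /la; case: (dat i) => [[[? ?] [? ?]] [? ?]] [].
have d1 i : (forall l l', (l < nn i)%N -> (l' < nn i)%N -> la i l = la i l' -> l = l') /\ (~ J i -> nn i = 0%N).
  by have := hdat i; rewrite /nn /la; case: (dat i) => [[[? ?] [? ?]] [? ?]] [].
have d2 i : Pf i ((1 + phi i * ww i) * (1 + phi i * ww' i) - 1).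
  by have := hdat i; rewrite /ww /ww'; case: (dat i) => [[[? ?] [? ?]] [? ?]] [].
have d3 i : Pf i (a2 ^+ NN i - (1 + phi i * ww i) * \prod_(l < nn i) one i l (ts i)).
  by have := hdat i; rewrite /ww /NN /nn /ts; case: (dat i) => [[[? ?] [? ?]] [? ?]] [].
have d4 i l : (l < nn i)%N -> exists c', Pf i ((b1 - kap (la i l)) ^+ NN i - c' * one i l (ts i)).
  by have := hdat i; rewrite /la /NN /nn /ts; case: (dat i) => [[[? ?] [? ?]] [? ?]] [_ _ _ _ h] /h.
move: nn NN la ts ww ww' d0 d1 d2 d3 d4 => nn NN la ts ww ww' d0 d1 d2 d3 d4 {dat hdat}.
pose M := (\max_i nn i)%N.
pose ee i := (\prod_(j | j != i) NN j)%N.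
have ee0 i : (0 < ee i)%N by rewrite prodn_gt0 // => j; have [] := d0 j.
pose Nt := (\prod_j NN j)%N.
have NtE i : Nt = (NN i * ee i)%N by rewrite /Nt (bigD1 i).
(* [None] carries the product of the units, and pairs with l beyond [nn i] carry the factor 1. The
   powers [ee i] bring the exponents [NN i] to the common value [Nt]. *)
pose I := option ('I_n0 * 'I_M).
pose G (x : I) : Q := match x with
  | Some (i, l) => if (l < nn i)%N then one i l (ts i) ^+ ee i else 1
  | None => \prod_i (1 + phi i * ww i) ^+ ee i end.
pose lam (x : I) : k := if x is Some (i, l) then la i l else 1.
have sub1 P i x : is_prime_ideal P -> P (phi i) -> P (1 + phi i * x) -> False.
  move=> pP Pphi h; have iP := prime_ideal pP; apply: (prime_n1 pP).
  by rewrite -(addrK (phi i * x) 1); apply: idlB => //; apply: idlMr.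
have GNone P : is_prime_ideal P -> P c -> P (G None) -> False.
  move=> pP Pc /(prime_prod pP) [i _ /(primeX pP) h]; have [j jP] := cover P pP Pc.
  have [ij|ij] := eqVneq j i; last by apply: (sub1 P i _ pP _ h); apply: jP; exact: phio.
  apply: (prime_comax pP (y := 1 + phi i * ww' i) h); apply: idlC; first exact: prime_ideal.
  by apply: jP; rewrite ij.
have GSome P i (l : 'I_M) : is_prime_ideal P -> P c -> P (G (Some (i, l))) ->
    [/\ (l < nn i)%N, Pf i `<=` P & P (one i l (ts i))].
  move=> pP Pc /=; case: ifP => [ln /(primeX pP) h|_ /(prime_n1 pP)] //; split=> //.
  have [j jP] := cover P pP Pc; have [<-//|ij] := eqVneq j i.
  by case: (sub1 P i _ pP _ h); apply: jP; exact: phio.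
have Gval P (x : I) : is_prime_ideal P -> P c -> P (G x) -> P (b1 - kap (lam x)).
  case: x => [[i l]|] pP Pc h; last by case: (GNone P pP Pc h).
  have [ln iP Pone] := GSome P i l pP Pc h; have [c' hc'] := d4 i l ln.
  apply: (primeX (n := NN i) pP); apply: (idlDl (prime_ideal pP) (iP _ hc')).
  by apply: idlM => //; exact: prime_ideal.
have Gdis P (x y : I) : is_prime_ideal P -> P c -> P (G x) -> P (G y) -> x = y.
  move=> pP Pc; case: x => [[i l]|] hx; last by case: (GNone P pP Pc hx).
  case: y => [[i' l']|] hy'; last by case: (GNone P pP Pc hy').
  have iP' := prime_ideal pP.
  have [ln iP Po] := GSome P i l pP Pc hx; have [ln' iP1 Po'] := GSome P i' l' pP Pc hy'.
  have ii : i = i'.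
    apply/eqP; apply: contrapT => /negP ii; apply: (sub1 P i' _ pP _ Po').
    by apply: iP; exact: phio.
  move: hy' ln' iP1 Po'; rewrite -ii => hy' ln' iP1 Po'.
  have h1 := Gval P _ pP Pc hx; have h2 := Gval P _ pP Pc hy'; rewrite /= in h1 h2.
  suff : la i l = la i l' by move=> /(proj1 (d1 i) _ _ ln ln') /val_inj ->.
  apply/eqP; rewrite -subr_eq0; apply: contrapT => /negP n; apply: (prime_n1 pP).
  have : P (kap (la i l) - kap (la i l')).
    have -> : kap (la i l) - kap (la i l') = (b1 - kap (la i l')) - (b1 - kap (la i l)) by ring.
    exact: idlB.
  by move=> /(idlM (kap (la i l - la i l')^-1) iP'); rewrite -rmorphB -rmorphM mulVf // rmorph1.
have Gone i x : (forall l, x != Some (i, l)) -> x != None -> Pf i (G x - 1).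
  case: x => [[j l]|//] hx _; have ij : i != j by apply/eqP => ij; case/eqP: (hx l); rewrite ij.
  rewrite /=; case: ifP => _; last by rewrite subrr; exact: idl0.
  rewrite -(expr1n _ (ee j)); apply: idl_congX => //; rewrite /one addrAC subrr add0r.
  by apply: idlMr => //; exact: phio.
have Gprod P : is_prime_ideal P -> P c -> P (a2 ^+ Nt - \prod_x G x).
  move=> pP Pc; have [i iP] := cover P pP Pc; apply: iP; apply/(quotient_projP (ipf i)).
  pose pr : {rmorphism Q -> quotient_ring (ipf i)} := @quotient_proj Q _ (ipf i).
  change (pr (a2 ^+ Nt) = pr (\prod_x G x)).
  have pr1 j x : j != i -> pr (1 + phi j * x) = 1.
    move=> ji; rewrite rmorphD rmorph1 rmorphM; have -> : pr (phi j) = 0; last by rewrite mul0r addr0.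
    by rewrite -(rmorph0 pr); apply/quotient_projP; rewrite subr0; apply: phio; rewrite eq_sym.
  have d3' : pr (a2 ^+ NN i) = pr ((1 + phi i * ww i) * \prod_(l < nn i) one i l (ts i)) by apply/quotient_projP.
  rewrite (NtE i) exprM rmorphXn d3' -rmorphXn big_option rmorphM exprMn rmorphM /G; congr (_ * _).
    rewrite rmorph_prod (bigD1 i) //= big1 ?mulr1 // => j ji.
    by rewrite rmorphXn pr1 // expr1n.
  have GE : \prod_x G (Some x) = \prod_j \prod_l G (Some (j, l)).
    by rewrite (pair_bigA _ (fun j l => G (Some (j, l)))); apply: eq_bigr => -[].
  rewrite -[RHS]/(pr (\prod_x G (Some x))) GE rmorph_prod (bigD1 i) //= [X in _ * X]big1 => [|j ji].
    rewrite mulr1 rmorph_prod -prodrXl rmorph_prod.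
    have le : (nn i <= M)%N by exact: (@leq_bigmax _ (fun i => nn i) i).
    rewrite (big_ord_widen _ (fun l => pr (one i l (ts i) ^+ ee i)) le) big_mkcond.
    by apply: eq_bigr => l _; rewrite /G; case: ifP => // _; rewrite rmorph1.
  rewrite rmorph_prod big1 // => l _; rewrite /G; case: ifP => _; last exact: rmorph1.
  by rewrite rmorphXn pr1 // expr1n.
(* On a curve Pf i every element is fixed by a power of Frobenius modulo a2, so an element nilpotent
   modulo a2 is a multiple d i a2. As a2 - 1 = phi i si i on Pf i, the element z minus the sum of
   the phi j si j d j serves as d on all components. *)
have ared z : (forall P, is_prime_ideal P -> P c -> P a2 -> P z) ->
    exists d, forall P, is_prime_ideal P -> P c -> P (z - d * a2).
  move=> hz; have /choice [d hd] : forall i, exists d, Pf i (z - d * a2).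
    move=> i; pose H := ideal_add (Pf i) (pid a2).
    have iH : is_ideal H by apply: ideal_add_ideal => //; exact: pid_ideal.
    suff /add_pidP : H z by [].
    have HP P : H `<=` P -> Pf i `<=` P /\ P a2.
      move=> h; split; first by move=> x hx; apply: h; apply: addl => //; exact: pid_ideal.
      by apply: h; apply: addr_ => //; exact: pid_mem.
    have [Ji|nJ] := pselect (J i); last first.
      apply: (idl1T iH); apply/add_pidP; exists 1; rewrite mul1r; apply: idlC => //; exact: a2n.
    have [P pP /HP [iP Pa]|m Hm] := primes_rad iH (x := z); first by apply: hz => //; exact: iP.
    have [s' s'0 /add_pidP hs] := red i z Ji.
    have it j : H (z ^+ (p ^ (s' * j)) - z).
      elim: j => [|j IH]; first by rewrite muln0 expr1 subrr; exact: idl0.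
      by rewrite mulnS expnD exprM; apply: (idl_trans iH _ IH); apply: idl_congX.
    apply: (idlDl iH (idlC iH (it m))).
    have mp : (m <= p ^ (s' * m))%N.
      by apply: (leq_trans (ltnW (ltn_expl m (prime_gt1 pp)))); rewrite leq_exp2l ?prime_gt1 // leq_pmull.
    by rewrite -(subnK mp) exprD; apply: idlM.
  exists (z - \sum_j phi j * (si j * d j)) => P pP Pc; have [i iP] := cover P pP Pc; apply: iP.
  set S := \sum_j _.
  have -> : z - (z - S) * a2 = (S - phi i * (si i * d i)) * a2 - phi i * si i * (z - d i * a2)
     - z * (a2 - 1 - phi i * si i) by ring.
  apply: idlB => //; last exact: idlM; apply: idlB => //; last exact: idlM.
  by apply: idlMr => //; exact: psum.
have Gord (x y : I) : x != y -> exists2 e, (0 < e)%N &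
    forall P, is_prime_ideal P -> P c -> P (G y) -> P (G x ^+ e - 1).
  case: y => [[i l]|] xy; last by exists 1%N => // P pP Pc h; case: (GNone P pP Pc h).
  have [ln|nl] := ltnP l (nn i); last first.
    by exists 1%N => // P pP Pc /(GSome P i l pP Pc) [h]; rewrite ltnNge nl in h.
  have Ji : J i by apply: contrapT => nJ; move: ln; rewrite (d1 i).2.
  set Gy := G (Some (i, l)).
  have nGy : ~ Pf i Gy.
    move=> h; apply: (na2 i Ji); apply: (primeX (n := Nt) (pf i)).
    apply/(prime_congr (pf i) (Gprod _ (pf i) (cf i))).
    by rewrite (bigD1 (Some (i, l))) //=; apply: idlMr.
  have [P pP iP P1 P2|z [w hzw]] := @unit2_mod _ (Pf i) (G x) Gy (ipf i).
    by move/eqP: xy; apply; exact: (Gdis P x _ pP (iP _ (cf i)) P1 P2).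
  have [|e e0 [w' hw']] := @finite_unit_order (Pf i) Gy (G x) z (- w) (pf i) (dpf i) Ji nGy.
    have -> : z * G x - 1 - - w * Gy = - (1 - z * G x - w * Gy) by ring.
    exact: idlN.
  exists e => // P pP Pc PG; have [_ iP _] := GSome P i l pP Pc PG.
  by apply: (idlDl (prime_ideal pP) (iP _ hw')); apply: idlM => //; exact: prime_ideal.
have Nt0 : (0 < Nt)%N by rewrite prodn_gt0 // => j; have [] := d0 j.
have lam0 x : lam x != 0.
  by case: x => [[i l]|] /=; [have [_] := d0 i; apply|exact: oner_neq0].
have [c' [a' [b' [h1 h2]]]] := surface_core kclosed pp p0 U3 Nt0 lam0 Gval Gprod ared Gord.
by exists c', a', b'; split=> //; apply: (teq_trans s1 (teq_trans s2 (teq_trans s3 h1))).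
Qed.
End SurfaceShortening.

Lemma alg_gen_surj (k R S : comPzRingType) (f : {rmorphism k -> R}) (g : {rmorphism R -> S})
    (h : {rmorphism k -> S}) X : (forall y, exists x, g x = y) -> (forall c, h c = g (f c)) ->
  alg_gen f [set` X] -> alg_gen h [set` map g X].
Proof.
move=> gs hE gX B sB Bh BX y; have [x <-] := gs y.
apply: (gX (g @^-1` B)) => [|c|z zX] /=.
- by case: sB => h1 h2 h3; split=> [|u v ? ?|u v ? ?] /=; rewrite ?rmorph1 ?rmorphB ?rmorphM; [|apply: h2|apply: h3].
- by rewrite -hE.
- by apply: BX => /=; exact: map_f.
Qed.

Lemma eops_lift (R S : comPzRingType) (g : {rmorphism R -> S}) n (s : seq ('I_n * 'I_n * S)) :
  (forall y, exists x, g x = y) -> evalid s ->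
  exists2 t : seq ('I_n * 'I_n * R), evalid t & forall v i, g (eops t v i) = eops s (g \o v)%FUN i.
Proof.
move=> gs; elim: s => [|[[i j] x] s IH] /=; first by exists [::].
move=> /andP [ij /IH [t vt ht]]; have [y hy] := gs x; exists ((i, j, y) :: t); first by rewrite /= ij.
move=> v l; rewrite /= ht; congr (eops s _ l); apply/funext => q /=.
by rewrite /eop /=; case: eqP => // _; rewrite rmorphD rmorphM hy.
Qed.

(** * Rows of arbitrary length *)

Section Shortening.
Variables (k : fieldType) (Q : comPzRingType) (kap : {rmorphism k -> Q}) (X : seq Q).
Hypothesis gQ : alg_gen kap [set` X].
Hypothesis kclosed : GRing.closed_field_axiom k.
Variable p : nat.
Hypotheses (pk : p \in [pchar k]).
Hypothesis kfin : forall x : k, exists2 s, (0 < s)%N & x ^+ (p ^ s) = x.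
Hypothesis nQ : noeth Q.
Variable m : nat.
Hypothesis dQ : forall P : set Q, is_prime_ideal P -> dlt m.+3 P.
Implicit Types v w : 'I_m.+3 -> Q.

(** Entry i + 2 is moved within the ideal of entries 0 and 1 by [avoid_step]. Each entry thus lowers
    by one the coheight of the primes that contain the treated entries but not both of the entries 0
    and 1. *)
Lemma lower_tail v i : (i <= m.+1)%N -> exists2 w, req v w &
  forall P, is_prime_ideal P -> ~ (P (w ord0) /\ P (w (inord 1))) ->
    (forall j : 'I_m.+3, (2 <= j < i.+2)%N -> P (w j)) -> dlt (m.+3 - i) P.
Proof.
elim: i => [|i IH] im; first by exists v; [exact: req_refl|move=> P pP _ _; rewrite subn0; exact: dQ].
have [w vw hw] := IH (ltnW im).
pose H := ispan (fun j : 'I_m.+3 => if (2 <= j < i.+2)%N then w j else 0).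
have iH : is_ideal H by exact: span_ideal.
pose b := ideal_add (pid (w ord0)) (pid (w (inord 1))).
have ib : is_ideal b by apply: ideal_add_ideal; exact: pid_ideal.
have bE P : is_prime_ideal P -> P (w ord0) /\ P (w (inord 1)) -> b `<=` P.
  by move=> pP [h1 h2]; have iP := prime_ideal pP; apply: add_sub => //; exact: pid_sub.
have [P pP HP nb|y [_ [x0 ->] [_ [x1 ->] <-]] hy] := @avoid_step _ (m.+2 - i) H b (w (inord i.+2)) nQ iH ib.
  rewrite -subSn ?(leq_trans (ltnW im)) //; apply: hw => // [h|j hj]; first by apply: nb; exact: bE.
  by have := HP _ (span_mem _ j); rewrite hj.
pose l : 'I_m.+3 := inord i.+2.
have lE : l = i.+2 :> nat by rewrite inordK // !ltnS.
have l0 : l != ord0 by rewrite -val_eqE /= lE.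
have l1 : l != inord 1 by rewrite -val_eqE /= lE inordK.
pose w' := eop (l, inord 1, x1) (eop (l, ord0, x0) w).
have w'E j : j != l -> w' j = w j by move=> jl; rewrite /w' /eop /= (negbTE jl).
have w'l : w' l = w l + (x0 * w ord0 + x1 * w (inord 1)).
  by rewrite /w' /eop /= !eqxx eq_sym (negbTE l1) addrA.
exists w'; first by apply: (req_trans vw); apply: (req_trans (req_op _ x0 l0)); apply: req_op.
move=> P pP; rewrite !w'E 1?eq_sym // => n hP; rewrite subSS; apply: hy => //.
- apply: span_sub; first exact: prime_ideal.
  move=> j; case: ifP => hj; last exact: (idl0 (prime_ideal pP)).
  rewrite -w'E; first by apply: hP; move: hj => /andP [-> /= h]; exact: ltnW.
  by rewrite -val_eqE /= lE; apply: contraTneq hj => ->; rewrite ltnn andbF.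
- by rewrite -w'l; apply: hP; rewrite lE !ltnS leqnn.
- move=> h; apply: n; split; apply: h; first by apply: addl; [exact: pid_ideal|exact: pid_mem].
  by apply: addr_; [exact: pid_ideal|exact: pid_mem].
Qed.

(** After [lower_tail] the entries from 2 on cut out a locus of dimension at most 1. Modulo those
    beyond 2, entries 2, 1, 0 form a row (c, a, b) as in the surface case, which makes entries 2 and
    1 comaximal; entry 0 is the one that is dispensed with. *)
Lemma shorten_row v : ispan v 1 -> exists2 w, req v w & ispan (fun j => w (lift ord0 j)) 1.
Proof.
move=> v1; have [w vw hw] := @lower_tail v m.+1 (leqnn _).
have w1 : ispan w 1 by case: vw => s hs <-; rewrite eops_span.
have {}hw P : is_prime_ideal P -> (forall j : 'I_m.+3, (2 <= j)%N -> P (w j)) -> dlt 2 P.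
  move=> pP h; have := hw P pP; rewrite (_ : m.+3 - m.+1 = 2)%N; last by lia.
  apply=> [[h0 h1]|j /andP [j2 _]]; last exact: h.
  apply: (prime_n1 pP); have : ispan w `<=` P; last by apply.
  apply: span_sub; [exact: prime_ideal|move=> -[[|[|j]] hj]; last exact: h].
    by rewrite (_ : Ordinal hj = ord0) //; apply: val_inj.
  by rewrite (_ : Ordinal hj = inord 1) //; apply: val_inj; rewrite /= inordK.
pose E := ispan (fun j : 'I_m.+3 => if (2 < j)%N then w j else 0).
have iE : is_ideal E by exact: span_ideal.
have EP P : is_ideal P -> (forall j : 'I_m.+3, (2 < j)%N -> P (w j)) -> E `<=` P.
  by move=> iP h; apply: span_sub => // j; case: ifP => [|_]; [exact: h|exact: idl0].
have Ej (j : 'I_m.+3) : (2 < j)%N -> E (w j) by move=> hj; have := span_mem (fun j : 'I_m.+3 => if (2 < j)%N then w j else 0) j; rewrite hj.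
pose g : {rmorphism Q -> quotient_ring iE} := @quotient_proj Q _ iE.
have gs : forall y, exists x, g x = y by exact: quotient_proj_surj.
have gE x : g x = 0 <-> E x by rewrite -(rmorph0 g) -[E x]/(E x); split=> [/quotient_projP|h]; rewrite ?subr0 //; apply/quotient_projP; rewrite subr0.
have gen : alg_gen (g \o kap)%FUN [set` map g X] by apply: (alg_gen_surj gs _ gQ).
pose q2 : 'I_m.+3 := inord 2; pose q1 : 'I_m.+3 := inord 1.
have q2E : q2 = 2%N :> nat by rewrite inordK.
have q1E : q1 = 1%N :> nat by rewrite inordK.
have U : tunim (g (w q2)) (g (w q1)) (g (w ord0)).
  apply/tunimP => P pP P2 P1 P0; have pP' := preim_prime g pP; apply: (prime_n1 pP').
  have : ispan w `<=` g @^-1` P; last by apply.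
  apply: span_sub; first exact: prime_ideal.
  move=> j; have [j3|] := ltnP 2 j; first by rewrite /= (gE _).2; [exact: (idl0 (prime_ideal pP))|exact: Ej].
  case: j => [[|[|[|//]]] hj] _ /=; move: P2 P1 P0; rewrite /q2 /q1.
  - by rewrite (_ : Ordinal hj = ord0) //; apply: val_inj.
  - by rewrite (_ : Ordinal hj = inord 1) //; apply: val_inj; rewrite /= inordK.
  - by rewrite (_ : Ordinal hj = inord 2) //; apply: val_inj; rewrite /= inordK.
have dd P : is_prime_ideal P -> P (g (w q2)) -> dlt 2 P.
  move=> pP Pw; apply/(dlt_preim gs _ pP); apply: hw; first exact: preim_prime.
  move=> j; rewrite leq_eqVlt => /orP [/eqP j2|/Ej /gE /= ->]; last exact: (idl0 (prime_ideal pP)).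
  by rewrite /= (_ : j = q2) //; apply: val_inj; rewrite /= -j2 q2E.
have [c' [a' [b' [[s vs hs] [r1 [r2 hr]]]]]] := surface_shorten gen kclosed pk kfin (noeth_surj gs nQ) U dd.
have [t vt ht] := eops_lift gs vs.
pose f (i : 'I_3) : 'I_m.+3 := tnth [tuple q2; q1; ord0] i.
have fi : injective f.
  move=> [[|[|[|//]]] h] [[|[|[|//]]] h'] //= /(congr1 val); rewrite /f !(tnth_nth ord0) /= ?q1E ?q2E // => _; exact: val_inj.
have [w' [h1 h2 h3]] := req_perm fi (ex_intro2 _ _ t vt (erefl (eops t (fun i => w (f i))))).
exists w'; first exact: req_trans h1.
have ht' i : g (w' (f i)) = tri c' a' b' i.
  rewrite h2 ht -hs; congr (eops s _ i); apply/funext => -[[|[|[|//]]] h] /=; congr (g (w _)); exact: val_inj.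
have S2 : ispan (fun j => w' (lift ord0 j)) (w' q2).
  rewrite (_ : q2 = lift ord0 (inord 1)); first exact: (span_mem (fun j => w' (lift ord0 j))).
  by apply: val_inj; rewrite /= q2E inordK.
have S1 : ispan (fun j => w' (lift ord0 j)) (w' q1).
  rewrite (_ : q1 = lift ord0 ord0); first exact: (span_mem (fun j => w' (lift ord0 j))).
  by apply: val_inj; rewrite /= q1E.
have iS := span_ideal (fun j => w' (lift ord0 j)).
have ES : E `<=` ispan (fun j => w' (lift ord0 j)).
  apply: EP => // j hj; have jf i : j != f i.
    rewrite -val_eqE /=; case: i => [[|[|[|//]]] h]; rewrite /f (tnth_nth ord0) /= ?q1E ?q2E; move: hj; case: (val j) => [|[|[|]]] //.
  rewrite -(h3 j jf); case: (unliftP ord0 j) => [l ->|j0]; first exact: (span_mem (fun j => w' (lift ord0 j))).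
  by rewrite j0 in hj.
have [r1' hr1] := gs r1; have [r2' hr2] := gs r2.
have : E (1 - (r1' * w' q2 + r2' * w' q1)).
  apply/gE; rewrite rmorphB rmorph1 rmorphD !rmorphM hr1 hr2.
  have := ht' 0; have := ht' 1; rewrite /f !(tnth_nth ord0) /= => -> ->.
  by rewrite /tri /= hr subrr.
move=> /ES h; apply: (idlDl iS h); by apply: idlD => //; apply: idlM.
Qed.
End Shortening.

(** * The theorem over a local base *)

Section MoreIdeals.
Variable R : comNzRingType.
Implicit Types (H D F b : set R).

Lemma ideal_mul_span D n (v : 'I_n -> R) x : is_ideal D ->
  ideal_mul D (ispan v) x -> exists2 d : 'I_n -> R, forall j, D (d j) & x = \sum_j d j * v j.
Proof.
move=> iD; pose L := [set x | exists2 d : 'I_n -> R, forall j, D (d j) & x = \sum_j d j * v j].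
suff /(_ x) h : ideal_mul D (ispan v) `<=` L by exact: h.
apply: ideal_mul_sub => [|d _ Dd [c ->]].
  split; first by exists (fun=> 0) => [j|]; [exact: idl0|rewrite big1 // => j _; rewrite mul0r].
    move=> _ _ [d Dd ->] [d' Dd' ->]; exists (fun j => d j + d' j) => [j|]; first exact: idlD.
    by rewrite -big_split; apply: eq_bigr => j _; rewrite mulrDl.
  move=> r _ [d Dd ->]; exists (fun j => r * d j) => [j|]; first exact: idlM.
  by rewrite mulr_sumr; apply: eq_bigr => j _; rewrite mulrA.
exists (fun j => d * c j) => [j|]; first exact: idlMr.
by rewrite mulr_sumr; apply: eq_bigr => j _; rewrite mulrA.
Qed.

(** Determinant trick: the determinant of e - (d i j) kills the v i modulo F, and it is e^n up to an
    element t of D. *)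
Lemma nakayama n (v : 'I_n -> R) F D e : is_ideal F -> is_ideal D ->
  (forall i, ideal_add F (ideal_mul D (ispan v)) (e * v i)) ->
  exists t N, D t /\ forall x, ispan v x -> F ((e ^+ N - t) * x).
Proof.
move=> iF iD h.
have /choice [d hd] : forall i, exists d : 'I_n -> R, (forall j, D (d j)) /\ F (e * v i - \sum_j d j * v j).
  move=> i; have [f Ff [_ /(ideal_mul_span iD) [d Dd ->] <-]] := h i.
  by exists d; split=> //; rewrite addrK.
pose A : 'M[R]_n := \matrix_(i, j) (e *+ (i == j) - d i j).
have AF i : F (\sum_j A i j * v j).
  have [_] := hd i; congr F; under [RHS]eq_bigr => j _ do rewrite mxE mulrBl.
  rewrite sumrB; congr (_ - _); rewrite (bigD1 i) //= eqxx mulr1n big1 ?addr0 // => j /negbTE ji.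
  by rewrite eq_sym ji mulr0n mul0r.
exists (e ^+ n - \det A), n; split.
  apply: (idlC iD); apply: det_congruent => // i j; rewrite mxE addrAC subrr sub0r.
  by apply: idlN => //; have [] := hd i.
rewrite opprB addrC subrK => x [c ->]; rewrite mulr_sumr; apply: idl_sum => // l _.
rewrite mulrCA; apply: idlM => //.
have -> : \det A * v l = \sum_i \adj A l i * (\sum_j A i j * v j).
  under eq_bigr => i _ do rewrite mulr_sumr.
  rewrite exchange_big /=; under eq_bigr => j _ do under eq_bigr => i _ do rewrite mulrA.
  under eq_bigr => j _ do rewrite -mulr_suml.
  have E j : \sum_i \adj A l i * A i j = (\det A) *+ (l == j).
    by have /matrixP/(_ l j) := mul_adj_mx A; rewrite !mxE.
  rewrite (bigD1 l) //= E eqxx big1 ?addr0 // => j nj.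
  by rewrite E eq_sym (negbTE nj) mul0r.
by apply: idl_sum => // i _; apply: idlM.
Qed.

Lemma avoid_many d m H b (v : 'I_m -> R) : noeth R -> is_ideal H -> is_ideal b ->
  (forall P, is_prime_ideal P -> H `<=` P -> ~ b `<=` P -> dlt (d + m) P) ->
  exists2 y : 'I_m -> R, forall j, b (y j) &
    forall P, is_prime_ideal P -> H `<=` P -> (forall j, P (v j + y j)) -> ~ b `<=` P -> dlt d P.
Proof.
move=> nR; elim: m H v => [|m IH] H v iH ib hd.
  by exists (fun=> 0) => [[]|P pP HP _ nb] //; have := hd P pP HP nb; rewrite addn0.
have [|x bx hx] := @avoid_step _ (d + m) H b (v ord0) nR iH ib; first by move=> P; rewrite -addnS; exact: hd.
pose H' := ideal_add H (pid (v ord0 + x)).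
have [|P pP HP nb|y by_ hy] := IH H' (fun j => v (lift ord0 j)) _ ib.
- by apply: ideal_add_ideal => //; exact: pid_ideal.
- apply: hx => // [z Hz|]; apply: HP; first by apply: addl => //; exact: pid_ideal.
  by apply: addr_ => //; exact: pid_mem.
exists (fun i => if unlift ord0 i is Some j then y j else x) => [i|P pP HP hP nb].
  by case: unlift.
apply: hy => // [|j]; last by have := hP (lift ord0 j); rewrite liftK.
apply: add_sub => //; first exact: prime_ideal.
by apply: pid_sub; [exact: prime_ideal|have := hP ord0; rewrite unlift_none].
Qed.

Lemma span_congr n (v w : 'I_n -> R) D : is_ideal D -> (forall i, D (v i - w i)) ->
  ispan v `<=` ideal_add (ispan w) D.
Proof.
move=> iD h; have iw := span_ideal w; apply: span_sub; first exact: ideal_add_ideal.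
move=> i; exists (w i); first exact: span_mem.
by exists (v i - w i) => //; rewrite addrC subrK.
Qed.

Lemma mul_ideal x b : is_ideal b -> is_ideal [set z | exists2 y, b y & z = x * y].
Proof.
move=> ib; split; first by exists 0; rewrite ?mulr0 //; exact: idl0.
  by move=> _ _ [y hy ->] [z hz ->]; exists (y + z); rewrite ?mulrDr //; exact: idlD.
by move=> r _ [y hy ->]; exists (r * y); [exact: idlM|rewrite mulrCA].
Qed.
End MoreIdeals.

Lemma monic_add (R : comNzRingType) (f g : {poly R}) : g \is monic ->
  f + 'X^((size f).+1) * g \is monic.
Proof.
move=> mg; have mX : 'X^((size f).+1) * g \is monic by rewrite monicMl ?monicXn.
rewrite monicE lead_coefDr ?(monicP mX) //.
rewrite size_monicM ?monicXn ?monic_neq0 // size_polyXn /=.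
have : (0 < size g)%N by rewrite size_poly_gt0 monic_neq0.
by case: (size g) => // s _; rewrite addnS /= ltnS (leq_trans _ (leq_addr _ _)).
Qed.

Lemma poly_at0 (R : comNzRingType) (f : {poly R}) : exists q, f = f.[0]%:P + q * 'X.
Proof.
have /factor_theorem [q hq] : root (f - f.[0]%:P) 0 by rewrite rootE !hornerE subrr.
by exists q; move: hq; rewrite subr0 => <-; rewrite addrC subrK.
Qed.

(** * Avoidance over a base that is local along J *)

Section Local.
Variable B : comNzRingType.
Hypothesis nB : noeth B.
Variable I : set {poly B}.
Hypotheses (iI : is_ideal I) (gI : exists2 g, I g & g \is monic).
Hypothesis jac : forall x, I x%:P -> exists y, (1 - x) * y = 1.
Variable m : nat.
Hypothesis dJ : forall q : set B, is_prime_ideal q -> (forall c, I c%:P -> q c) -> dlt m.+1 q.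
Implicit Types (P H : set {poly B}).

Let nR : noeth {poly B}. Proof. exact: hilbert_basis. Qed.
Let J : set B := [set c | I c%:P].
Let iJ : is_ideal J. Proof. exact: (preim_ideal polyC iI). Qed.

(** Primes over the closed set of J in Spec B. By [jac_comax] they are the only ones that have to be
    inspected for an ideal with a monic member. *)
Definition over_J P := forall c, I c%:P -> P c%:P.

Lemma overJ P : is_ideal P -> over_J P -> polyI J `<=` P.
Proof.
move=> iP h x hx; rewrite -(coefK x) poly_def; apply: idl_sum => // i _.
by rewrite -mul_polyC; apply: idlMr => //; apply: h; exact: hx.
Qed.

Lemma polyI_over P : polyI J `<=` P -> over_J P.
Proof. by move=> h c Ic; apply: h; exact: (polyI_C c iJ).2. Qed.

Lemma dlt_over P h : is_prime_ideal P -> over_J P -> P h -> h \is monic -> dlt m.+1 P.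
Proof.
by move=> pP oP Ph mh; apply: (dlt_lift pP Ph mh); apply: dJ => //; exact: contract_prime.
Qed.

(** H is comaximal to J[X]; since it contains a monic polynomial, [contraction_power] gives a
    constant in H that is 1 modulo J, and this is a unit. *)
Lemma jac_comax H h : is_ideal H -> H h -> h \is monic ->
  (forall P, is_prime_ideal P -> H `<=` P -> over_J P -> False) -> H 1.
Proof.
move=> iH Hh mh hP; have iJT := polyI_ideal iJ.
have H1 : ideal_add H (polyI J) 1.
  apply: primes_one => [|P pP HP]; first exact: ideal_add_ideal.
  apply: (hP P pP); first by move=> x Hx; apply: HP; exact: addl.
  by apply: polyI_over => x Hx; apply: HP; exact: addr_.
have [z [Hz [M [g]]]] := contraction_power iH Hh iJ H1.
rewrite (monicP mh) !expr1n mulr1 => /(idlC iJ) /jac [y]; rewrite opprB addrC subrK => zy.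
by rewrite -[1]/(1%:P) -zy polyCM; apply: idlMr.
Qed.

Variables (f : 'I_m.+1 -> {poly B}) (a : 'I_m.+1 -> B).
Hypothesis aI : forall x, I x -> ispan a x.[0].
Hypothesis f0 : forall i, (f i).[0] = a i.
Hypothesis fI : forall i, I (f i).
Hypothesis f2 : forall x, I x -> ideal_add (ispan f) (ideal_mul I I) x.

(** Modulo X an element of I is its value at 0, a combination of the a i, which are the f i modulo
    X. *)
Lemma over_X P : is_ideal P -> P 'X -> (forall i, P (f i)) -> I `<=` P.
Proof.
move=> iP PX Pf x Ix; have [q ->] := poly_at0 x; apply: idlD => //; last exact: idlM.
have [c ->] := aI Ix; rewrite rmorph_sum; apply: idl_sum => // i _; rewrite rmorphM; apply: idlM => //.
suff : P (a i)%:P by [].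
have [r fr] := poly_at0 (f i); have -> : (a i)%:P = f i - r * 'X by rewrite {1}fr f0 addrK.
by apply: idlB => //; exact: idlM.
Qed.
End Local.

Section LocalFirst.
Variable B : comNzRingType.
Hypothesis nB : noeth B.
Variable I : set {poly B}.
Hypotheses (iI : is_ideal I) (gI : exists2 g, I g & g \is monic).
Variable m : nat.
Hypothesis dJ : forall q : set B, is_prime_ideal q -> (forall c, I c%:P -> q c) -> dlt m.+1 q.
Variables (f : 'I_m.+1 -> {poly B}) (a : 'I_m.+1 -> B).
Hypothesis aI : forall x, I x -> ispan a x.[0].
Hypothesis f0 : forall i, (f i).[0] = a i.
Hypothesis fI : forall i, I (f i).
Hypothesis f2 : forall x, I x -> ideal_add (ispan f) (ideal_mul I I) x.
Implicit Types (P H : set {poly B}).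

(** The first entry is made monic by a multiple of g^2 and of X, and the m others are corrected in X
    I^2, so that values at 0 and classes modulo I^2 persist. A prime over J containing all f' and X
    I^2 contains I by [over_X]; for the others avoidance lowers the coheight bound from m + 1 to
    1. *)
Lemma general_generators : exists f' : 'I_m.+1 -> {poly B},
  [/\ forall i, I (f' i), forall i, (f' i).[0] = a i, f' ord0 \is monic,
      forall x, I x -> ideal_add (ispan f') (ideal_mul I I) x &
      forall P, is_prime_ideal P -> (forall i, P (f' i)) -> over_J I P -> I `<=` P \/ dlt 1 P].
Proof.
have nR : noeth {poly B} by exact: hilbert_basis.
pose J : set B := [set c | I c%:P].
have iJ : is_ideal J := preim_ideal polyC iI.
have [g Ig mg] := gI; have mg2 : g * g \is monic by rewrite monicMl.
pose h := f ord0 + 'X^((size (f ord0)).+1) * (g * g).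
have mh : h \is monic by exact: monic_add.
pose I2 := ideal_mul I I; have iI2 : is_ideal I2 by exact: ideal_mul_ideal.
pose b := [set z | exists2 y, I2 y & z = 'X * y].
have ib : is_ideal b by exact: mul_ideal.
have iJT : is_ideal (polyI J) by exact: polyI_ideal.
pose H := ideal_add (pid h) (polyI J).
have iH : is_ideal H by apply: ideal_add_ideal => //; exact: pid_ideal.
have [P pP HP _|y hy hyP] := @avoid_many _ 1 m H b (fun j => f (lift ord0 j)) nR iH ib.
  have oP : over_J I P by apply: polyI_over => // x Hx; apply: HP; apply: addr_ => //; exact: pid_ideal.
  have Ph : P h by apply: HP; apply: addl => //; exact: pid_mem.
  exact: (@dlt_over _ _ _ dJ _ _ pP oP Ph mh).
pose f' i := if unlift ord0 i is Some j then f i + y j else h.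
have bI2 x : b x -> I2 x by move=> [z hz ->]; exact: (idlM _ iI2 hz).
have ff' i : I2 (f' i - f i) /\ (f' i).[0] = (f i).[0].
  rewrite /f'; case: unliftP => [j|] ->.
    rewrite addrAC subrr add0r; split; first exact: bI2.
    by have [z _ ->] := hy j; rewrite !hornerE.
  split; last by rewrite /h hornerD hornerM hornerXn expr0n /= mul0r addr0.
  by rewrite /h addrAC subrr add0r; apply: (idlM _ iI2); exact: (ideal_mulP Ig Ig).
have I2I : I2 `<=` I by apply: ideal_mul_sub => // x z Ix _; exact: idlMr.
exists f'; split.
- by move=> i; apply: (idlDl iI (I2I _ (proj1 (ff' i)))).
- by move=> i; rewrite (proj2 (ff' i)).
- by rewrite /f' unlift_none.
- move=> x Ix; have [s' hs [t It <-]] := f2 Ix; have if' := span_ideal f'.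
  apply: (idlD (ideal_add_ideal if' iI2)); last exact: addr_.
  by apply: (span_congr iI2 _ hs) => i; apply: (idlC iI2); exact: (proj1 (ff' i)).
move=> P pP Pf oP; have iP := prime_ideal pP.
have [bP|nb] := pselect (b `<=` P); last first.
  right; apply: hyP => //.
    apply: add_sub => //; last exact: overJ.
    by apply: pid_sub => //; have := Pf ord0; rewrite /f' unlift_none.
  by move=> j; have := Pf (lift ord0 j); rewrite /f' liftK.
left; have [PX|nX] := pselect (P 'X).
  by apply: (over_X aI _ iP PX Pf) => i; rewrite (proj2 (ff' i)).
move=> x Ix; have : P ('X * (x * x)) by apply: bP; exists (x * x) => //; exact: ideal_mulP.
by move=> /(primeM pP) [//|/(primeM pP) []].
Qed.

(** Nakayama gives t in I with (1 - t)I inside (f). Subtracting the combination of the f i with the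
    same value at 0 preserves this and makes the value 0; modulo (f) the result is idempotent. *)
Lemma local_idempotent : exists e, [/\ I e, e.[0] = 0 & forall x, I x -> ispan f ((1 - e) * x)].
Proof.
have nR : noeth {poly B} by exact: hilbert_basis.
have [r [v Iv]] := nR I iI; have iff := span_ideal f.
have [i|t [N [It ht]]] := @nakayama _ r v (ispan f) I 1 iff iI.
  by rewrite mul1r -Iv; apply: f2; rewrite Iv; exact: span_mem.
have [c hc] := aI It; exists (t - \sum_i (c i)%:P * f i); split.
- by apply: idlB => //; apply: idl_sum => // i _; exact: idlM.
- rewrite hornerD hornerN horner_sum hc; under [X in _ - X]eq_bigr => i _ do rewrite hornerM hornerC f0.
  by rewrite subrr.
move=> x Ix; set s := \sum_i _; have -> : (1 - (t - s)) * x = (1 ^+ N - t) * x + x * s by rewrite expr1n; ring.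
apply: idlD => //; first by apply: ht; rewrite -Iv.
by apply: idlM => //; apply: idl_sum => // i _; apply: idlM => //; exact: span_mem.
Qed.
End LocalFirst.

Lemma comp_congr (R : comNzRingType) (H : set {poly R}) (p u v : {poly R}) : is_ideal H ->
  H (u - v) -> H ((p \Po u) - (p \Po v)).
Proof.
move=> iH huv; elim/poly_ind: p => [|p c IH]; first by rewrite !comp_poly0 subrr; exact: (idl0 iH).
rewrite !comp_poly_MXaddC; apply: (idl_congD iH); last by rewrite subrr; exact: (idl0 iH).
exact: idl_congM.
Qed.

Definition cube (R : comPzRingType) (K : set R) := ideal_mul K (ideal_mul K K).

Lemma cube_ideal (R : comPzRingType) (K : set R) : is_ideal (cube K).
Proof. exact: ideal_mul_ideal. Qed.

Lemma square_sub (R : comPzRingType) (K : set R) : is_ideal K -> ideal_mul K K `<=` K.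
Proof. by move=> iK; apply: ideal_mul_sub => // x y Kx _; exact: idlMr. Qed.

Lemma cube_square (R : comPzRingType) (K : set R) : is_ideal K -> cube K `<=` ideal_mul K K.
Proof.
move=> iK; apply: ideal_mul_sub => [|x y Kx Ky]; first exact: ideal_mul_ideal.
by apply: ideal_mulP => //; exact: (square_sub iK).
Qed.

Lemma cubeP (R : comPzRingType) (K : set R) x y z : K x -> K y -> K z -> cube K (x * (y * z)).
Proof. by move=> Kx Ky Kz; apply: ideal_mulP => //; exact: ideal_mulP. Qed.

Lemma cube_preim (R S : comPzRingType) (g : {rmorphism R -> S}) (K : set S) x :
  is_ideal K -> cube (g @^-1` K) x -> cube K (g x).
Proof.
move=> iK; suff : cube (g @^-1` K) `<=` g @^-1` (cube K) by apply.
apply: ideal_mul_sub => [|u v Ku Kv]; first exact: preim_ideal (cube_ideal K).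
rewrite /= rmorphM; apply: ideal_mulP => //.
have : ideal_mul (g @^-1` K) (g @^-1` K) `<=` g @^-1` (ideal_mul K K); last by apply.
apply: ideal_mul_sub => [|s t Ks Kt]; first exact: preim_ideal (ideal_mul_ideal K K).
by rewrite /= rmorphM; exact: ideal_mulP.
Qed.

(** By lying over, P has the same contraction as some prime above K. That prime is maximal, and
    maximality passes down and up again through the contraction, both primes containing monic
    polynomials. *)
Lemma dlt_residual (B : comNzRingType) (I K P : set {poly B}) g h : is_ideal K -> K g -> g \is monic ->
  (forall P, is_prime_ideal P -> K `<=` P -> over_J I P -> dlt 1 P) ->
  is_prime_ideal P -> P h -> h \is monic -> (forall c, K c%:P -> P c%:P) -> over_J I P -> dlt 1 P.
Proof.
move=> iK Kg mg dK pP Ph mh PK PJ; have pq := contract_prime pP.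
have [||P' [pP' KP' P'q]] := lying_over iK Kg pq; first exact: PK.
  by rewrite (monicP mg); exact: (prime_n1 pq).
apply: (dlt_lift pP Ph mh); have := dlt_contract pP' (KP' _ Kg) mg (dK P' pP' KP' _).
have -> : polyC @^-1` P' = polyC @^-1` P by apply/seteqP; split=> z /P'q.
by apply=> c Ic; apply/P'q; exact: PJ.
Qed.

Lemma over_sum (B : comNzRingType) (L J : set B) (P : set {poly B}) : is_ideal P ->
  (forall c, L c -> P c%:P) -> (forall c, J c -> P c%:P) -> polyI (ideal_add L J) `<=` P.
Proof.
move=> iP PL PJ x hx; rewrite -(coefK x) poly_def; apply: (idl_sum _ iP) => i _.
rewrite -mul_polyC; apply: (idlMr _ iP); have [u Lu [v Jv <-]] := hx i.
by rewrite polyCD; apply: (idlD iP); [exact: PL|exact: PJ].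
Qed.

Lemma sum_over (B : comNzRingType) (L J : set B) (P : set {poly B}) : is_ideal L -> is_ideal J ->
  polyI (ideal_add L J) `<=` P -> (forall c, L c -> P c%:P) /\ (forall c, J c -> P c%:P).
Proof.
move=> iL iJ hP; have iLJ := ideal_add_ideal iL iJ.
have hc c : ideal_add L J c -> P c%:P by move=> hc; apply: hP; exact: (polyI_C c iLJ).2.
by split=> c hc'; apply: hc; [exact: (addl iJ)|exact: (addr_ iL)].
Qed.

(** * Generators of the residual ideal *)

Section Complement.
Variable B : comNzRingType.
Hypothesis nB : noeth B.
Variables I K : set {poly B}.
Hypotheses (iI : is_ideal I) (iK : is_ideal K).
Hypothesis jac : forall x, I x%:P -> exists y, (1 - x) * y = 1.
Variable m : nat.
Variables (f : 'I_m.+2 -> {poly B}) (e : {poly B}).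
Hypotheses (Kf : forall i, K (f i)) (mf : f ord0 \is monic).
Hypotheses (Ie : I e) (Ke : K (1 - e)) (e0 : e.[0] = 0).
Hypothesis KI : forall x y, K x -> I y -> ispan f (x * y).
Hypothesis dK : forall P, is_prime_ideal P -> K `<=` P -> over_J I P -> dlt 1 P.

(* [f] generates K locally along K, hence so do [f2] over an element [z] of B near 1;
   as [f2 ord0] is 1 at 0, substituting zX for X leaves no other zeros. *)
Lemma complement_generators : exists2 k : 'I_m.+2 -> {poly B},
  K = ispan k & forall i, cube K (k i - f i).
Proof.
have nR : noeth {poly B} by exact: hilbert_basis.
have iK3 := cube_ideal K; have K2K := square_sub iK; have K32 := cube_square iK.
(* The cube of 1 - e lies in K^3 and is 1 at 0: it adjusts the value at 0 to 1. The multiple of f0^3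
   then makes h monic. *)
pose d := f ord0 + (1 - (f ord0).[0])%:P * ((1 - e) * ((1 - e) * (1 - e))).
pose h := d + 'X^((size d).+1) * (f ord0 * (f ord0 * f ord0)).
have mh : h \is monic by apply: monic_add; rewrite !monicMl.
have h0 : h.[0] = 1 by rewrite /h /d !hornerE e0 /= !expr0n /=; ring.
have hf : cube K (h - f ord0).
  have -> : h - f ord0 = (1 - (f ord0).[0])%:P * ((1 - e) * ((1 - e) * (1 - e))) + 'X^((size d).+1) * (f ord0 * (f ord0 * f ord0)).
    by rewrite /h {1}/d; ring.
  by apply: (idlD iK3); apply: (idlM _ iK3); exact: cubeP.
have Kh : K h by apply: (idlDl iK (K2K _ (K32 _ hf))).
pose L := polyC @^-1` K; have iL : is_ideal L := preim_ideal polyC iK.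
pose J := polyC @^-1` I; have iJ : is_ideal J := preim_ideal polyC iI.
have iLJ := ideal_add_ideal iL iJ.
pose H := ideal_add (pid h) (polyI (ideal_add L J)).
have iH : is_ideal H by apply: ideal_add_ideal; [exact: pid_ideal|exact: polyI_ideal].
have HP P : is_ideal P -> P h -> (forall c, L c -> P c%:P) -> over_J I P -> H `<=` P.
  by move=> iP Ph PL PJ; apply: add_sub => //; [exact: pid_sub|exact: over_sum].
have PH P : H `<=` P -> [/\ P h, forall c, L c -> P c%:P & over_J I P].
  move=> HP'; have [|PL PJ] := @sum_over _ L J P iL iJ; last split=> //.
    by move=> x hx; apply: HP'; apply: addr_ => //; exact: pid_ideal.
  by apply: HP'; apply: addl; [exact: polyI_ideal|exact: pid_mem].
have [P pP /PH [Ph PL PJ] _|x K3x hx] := @avoid_step _ 0 H (cube K) (f (lift ord0 ord0)) nR iH iK3.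
  exact: (@dlt_residual _ I K P _ _ iK (Kf ord0) mf dK pP Ph mh PL PJ).
pose f2 i := if i == ord0 then h else if i == lift ord0 ord0 then f i + x else f i.
have f20 : f2 ord0 = h by rewrite /f2 eqxx.
have ff2 i : cube K (f2 i - f i).
  rewrite /f2; case: eqP => [-> //|_]; case: eqP => _; last by rewrite subrr; exact: idl0.
  by rewrite addrAC subrr add0r.
have Kf2 i : K (f2 i) by apply: (idlDl iK (K2K _ (K32 _ (ff2 i)))).
have f2P P : is_prime_ideal P -> (forall i, P (f2 i)) -> (forall c, L c -> P c%:P) -> over_J I P -> K `<=` P.
  move=> pP Pf PL PJ; have iP := prime_ideal pP.
  have [h3|n3] := pselect (cube K `<=` P).
    by move=> y Ky; have := h3 _ (cubeP Ky Ky Ky) => /(primeM pP) [//|/(primeM pP) []].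
  exfalso; apply: (hx P pP) => //; first by apply: HP => //; rewrite -f20.
  by have := Pf (lift ord0 ord0); rewrite /f2 eqxx.
(* The colon ideal ((f2) : K). It contains the monic h, and it will turn out comaximal to L^3, where
   L is the contraction of K. *)
pose a := [set y | forall x, K x -> ispan f2 (y * x)].
have is2 := span_ideal f2.
have ia : is_ideal a.
  split=> [y _|u v au av y Ky|u v av y Ky]; first by rewrite mul0r; exact: idl0.
    by rewrite mulrDl; apply: idlD => //; [exact: au|exact: av].
  by rewrite -mulrA; apply: idlM => //; exact: av.
have ah : a h by move=> y _; apply: idlMr => //; rewrite -f20; exact: span_mem.
have [r [v Kv]] := nR K iK.
have [i|t [N [Kt ht]]] := @nakayama _ r v (ispan f2) K e is2 iK.
  have Ki : K (v i) by rewrite Kv; exact: span_mem.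
  rewrite -Kv mulrC; have := span_congr (w := f2) (ideal_mul_ideal K K) _ (KI Ki Ie); apply=> j.
  by apply: (idlC (ideal_mul_ideal K K)); exact: K32.
have at_ : a (e ^+ N - t) by move=> y Ky; apply: ht; rewrite -Kv.
have iL3 : is_ideal (cube L) := cube_ideal L.
pose H3 := ideal_add a (polyI (cube L)).
have iH3 : is_ideal H3 by apply: ideal_add_ideal => //; exact: polyI_ideal.
have aH3 : a `<=` H3 by move=> y ay; apply: addl => //; exact: polyI_ideal.
have H31 : H3 1.
  apply: (jac_comax iI jac iH3 (aH3 _ ah) mh) => P pP HP3 PJ; have iP := prime_ideal pP.
  have KP : K `<=` P.
    apply: f2P => // [i|c Lc].
      by apply: HP3; apply: aH3 => y _; apply: idlMr => //; exact: span_mem.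
    have : P (c%:P ^+ 3); last exact: primeX.
    rewrite -rmorphXn; apply: HP3; apply: addr_ => //; apply: (polyI_C _ iL3).2.
    by rewrite !exprS expr0 mulr1; exact: cubeP.
  apply: (prime_n1 pP); have -> : 1 = (1 - e) + e by rewrite subrK.
  apply: idlD => //; first exact: KP.
  apply: (primeX (n := N) pP); apply: (idlDl iP (HP3 _ (aH3 _ at_))); exact: KP.
(* So zK lies in (f2) while z is 1 modulo K^3. Substituting zX for X changes a polynomial only by
   multiples of z - 1, hence by elements of K^3. *)
have [z [az [M [g]]]] := contraction_power ia ah iL3 H31.
rewrite (monicP mh) !expr1n mulr1 => zL3.
have zK3 : cube K (z%:P - 1) by rewrite -[1]/(1%:P) -polyCB; exact: (cube_preim iK).
pose u := z%:P * 'X : {poly B}.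
have sgB p (D : set {poly B}) : is_ideal D -> D (z%:P - 1) -> D ((p \Po u) - p).
  move=> iD Dz; rewrite -[X in _ - X]comp_polyXr; apply: comp_congr => //.
  by rewrite /u -[X in _ - X]mul1r -mulrBl; exact: idlMr.
exists (fun i => f2 i \Po u) => [|i]; last first.
  by apply: (idl_trans iK3 _ (ff2 i)); exact: (sgB (f2 i) _ iK3 zK3).
set k := fun i => _; have ik := span_ideal k.
have sgK y : ispan f2 y -> ispan k (y \Po u).
  move=> [c ->]; rewrite rmorph_sum; apply: idl_sum => // i _; rewrite rmorphM; apply: idlM => //.
  exact: (span_mem k i).
have [q hq] := poly_at0 h; rewrite h0 in hq.
have k0 : k ord0 = 1 + (q \Po u) * 'X * z%:P.
  by rewrite /k f20 {1}hq comp_polyD comp_polyC comp_polyM comp_polyX /u; ring.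
(* Since k ord0 is 1 up to a multiple of z, y(zX) is a multiple of k ord0 minus a multiple of the
   substituted zy, and zy is in (f2). *)
have Ksg y : K y -> ispan k (y \Po u).
  move=> Ky; have -> : y \Po u = (y \Po u) * k ord0 - (q \Po u) * 'X * ((z%:P * y) \Po u).
    by rewrite k0 comp_polyM comp_polyC; ring.
  apply: idlB => //; first by apply: idlM => //; exact: span_mem.
  by apply: idlM => //; apply: sgK; exact: az.
have kz : ispan k (z%:P - 1).
  have -> : z%:P - 1 = (z%:P - 1) \Po u by rewrite -[1]/(1%:P) -polyCB comp_polyC.
  by apply: Ksg; apply: K2K; exact: K32.
apply/seteqP; split=> [y Ky|]; last first.
  apply: span_sub => // i; apply: (idlDl iK _ (Kf2 i)).
  by apply: (sgB (f2 i) _ iK); apply: K2K; exact: K32.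
by rewrite -(subKr (y \Po u) y); apply: (idlB ik); [exact: Ksg|exact: (sgB y _ ik kz)].
Qed.
End Complement.

(** * Row operations that keep entries monic *)

Section RowOperations.
Variables (R : comPzRingType) (n : nat).
Implicit Types (v w c : 'I_n -> R) (s : seq ('I_n * 'I_n * R)).

Lemma eops_sum (I : finType) s (r : I -> R) (M : I -> 'I_n -> R) i :
  eops s (fun j => \sum_l r l * M l j) i = \sum_l r l * eops s (M l) i.
Proof.
elim: s M i => //= -[[i0 j0] x] s IH M i; rewrite -IH; congr (eops s _ i); apply/funext => j.
rewrite /eop /=; case: eqP => [->|_ //]; rewrite mulr_sumr -big_split.
by apply: eq_bigr => l _; rewrite mulrDr mulrCA.
Qed.

Lemma eops_coef s v (K : set R) i : is_ideal K -> (forall o, o \in s -> K o.2) -> K (eops s v i - v i).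
Proof.
move=> iK; elim: s v => [v _|o s IH v h] /=; first by rewrite subrr; exact: idl0.
apply: (idl_trans iK (IH _ _)) => [o' o's|]; first by apply: h; rewrite inE o's orbT.
rewrite /eop; case: eqP => [->|_]; last by rewrite subrr; exact: idl0.
by rewrite addrAC subrr add0r; apply: idlMr => //; apply: h; rewrite mem_head.
Qed.

Definition fanout (i : 'I_n) c : seq ('I_n * 'I_n * R) := [seq (j, i, c j) | j <- enum (predC1 i)].
Definition gather (i : 'I_n) c : seq ('I_n * 'I_n * R) := [seq (i, j, c j) | j <- enum (predC1 i)].

Lemma fanout_valid i c : evalid (fanout i c).
Proof. by rewrite /evalid all_map; apply/allP => j /=; rewrite mem_enum. Qed.
Lemma gather_valid i c : evalid (gather i c).
Proof. by rewrite /evalid all_map; apply/allP => j /=; rewrite mem_enum eq_sym. Qed.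

Lemma fanoutE i c v l : eops (fanout i c) v l = if l == i then v l else v l + c l * v i.
Proof.
have -> : (l == i) = (l \notin enum (predC1 i)) by rewrite mem_enum inE negbK.
rewrite /fanout; have : i \notin enum (predC1 i) by rewrite mem_enum inE eqxx.
elim: (enum _) (enum_uniq (predC1 i)) v => //= j r IH /andP [jr ur] v.
rewrite !inE !negb_or => /andP [ij ir]; rewrite IH // /eop /= (negbTE ij).
by case: (eqVneq l j) => [->|_] /=; rewrite ?jr.
Qed.

Lemma gatherE i c v l : eops (gather i c) v l = if l == i then v i + \sum_(j | j != i) c j * v j else v l.
Proof.
have -> : \sum_(j | j != i) c j * v j = \sum_(j <- enum (predC1 i)) c j * v j.
  by rewrite big_enum; apply: eq_bigl.
rewrite /gather; have : i \notin enum (predC1 i) by rewrite mem_enum inE eqxx.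
elim: (enum _) v => [|j r IH] v /=; first by rewrite big_nil addr0; case: eqP => [->|].
rewrite !inE negb_or big_cons => /andP [ij ir]; rewrite IH // /eop /= eqxx.
case: eqP => // _; rewrite -addrA; congr (_ + (_ + _)).
by apply: eq_big_seq => l' lr; case: eqP lr ir => // -> ->.
Qed.
End RowOperations.

(** The coefficient of a lifted operation may be changed by any multiple of h, which g does not see.
    The multiple by a high power of X makes the new entry monic. *)
Lemma monic_lift (B : comNzRingType) (Q : comPzRingType) (g : {rmorphism {poly B} -> Q}) n
    (s : seq ('I_n * 'I_n * Q)) h (f : 'I_n -> {poly B}) :
  (forall y, exists x, g x = y) -> g h = 0 -> h \is monic -> evalid s -> (forall i, f i \is monic) ->
  exists2 t : seq ('I_n * 'I_n * {poly B}), evalid t &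
    (forall v i, g (eops t v i) = eops s (g \o v)%FUN i) /\ forall i, eops t f i \is monic.
Proof.
move=> gs gh mh; elim: s f => [|[[i j] x] s IH] f /=; first by exists [::].
move=> /andP [/= ij vs] mf; have [y hy] := gs x.
pose d := f i + y * f j; pose y' := y + 'X^((size d).+1) * h.
have mf' l : eop (i, j, y') f l \is monic.
  rewrite /eop /=; case: eqP => [->|_] //.
  by rewrite /y' mulrDl addrA -/d -mulrA; apply: monic_add; rewrite monicMl.
have [t vt [ht mt]] := IH _ vs mf'; exists ((i, j, y') :: t); first by rewrite /= ij.
split=> // v l; rewrite /= ht; congr (eops s _ l); apply/funext => q /=.
rewrite /eop /=; case: eqP => // _.
by rewrite rmorphD rmorphM /y' rmorphD rmorphM gh mulr0 addr0 hy.
Qed.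

Lemma all_monic (B : comNzRingType) n (f : 'I_n.+1 -> {poly B}) : f ord0 \is monic ->
  exists2 t, evalid t & forall i, eops t f i \is monic.
Proof.
move=> mf; exists (fanout ord0 (fun j => 'X^((size (f j)).+1))); first exact: fanout_valid.
by move=> i; rewrite fanoutE; case: eqP => [->|_] //; exact: monic_add.
Qed.

Lemma poly_gen (k A : comNzRingType) (kap : {rmorphism k -> A}) X : alg_gen kap [set` X] ->
  alg_gen (polyC \o kap)%FUN [set` 'X :: map polyC X].
Proof.
move=> gX S sS Sc SX p; have SC a : S a%:P.
  apply: (gX (polyC @^-1` S)) => [|c|x Xx] /=; last by apply: SX; rewrite /= inE map_f ?orbT.
    case: sS => h1 h2 h3; split=> [|u v ? ?|u v ? ?] /=; rewrite ?polyCB ?polyCM //; [exact: h2|exact: h3].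
  exact: Sc.
rewrite -(coefK p) poly_def; apply: (@sub_sum {poly A} S _ _ _ _ sS) => i _; rewrite -mul_polyC; apply: (subM sS) => //.
by apply: subX => //; apply: SX; rewrite /= mem_head.
Qed.

Definition tail (R : Type) n (v : 'I_n.+1 -> R) (j : 'I_n) := v (lift ord0 j).

(** * Removing the residual ideal *)

Section Subtraction.
Variable B : comNzRingType.
Hypothesis nB : noeth B.
Variable I : set {poly B}.
Hypotheses (iI : is_ideal I) (gI : exists2 g, I g & g \is monic).
Hypothesis jac : forall x, I x%:P -> exists y, (1 - x) * y = 1.
Variable m : nat.
Implicit Types (P : set {poly B}) (w f : 'I_m.+3 -> {poly B}).

Section Shorten.
Hypothesis dJ : forall q : set B, is_prime_ideal q -> (forall c, I c%:P -> q c) -> dlt m.+3 q.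
Variables (A : comNzRingType) (lam : {rmorphism A -> B}).
Hypothesis lam_surj : forall b, exists x, I (b - lam x)%:P.
Variables (k : fieldType) (kap : {rmorphism k -> A}) (X : seq A) (p : nat).
Hypotheses (gA : alg_gen kap [set` X]) (kclosed : GRing.closed_field_axiom k) (pk : p \in [pchar k]).
Hypothesis kfin : forall x : k, exists2 s, (0 < s)%N & x ^+ (p ^ s) = x.

(** The row is shortened modulo D, the intersection of I and (J, X). D contains the monic Xg, which
    bounds the coheight of primes over D, and A[X] maps onto the quotient because B is the image of
    A up to J; hence [shorten_row] applies. *)
Lemma shorten_local w f e : (forall i, f i \is monic) -> I e -> e.[0] = 0 -> ispan w (1 - e) ->
  exists2 t, evalid t & (forall i, eops t f i \is monic) /\
    exists z, [/\ ispan (tail (eops t w)) z, I (1 - z) & (1 - z).[0] = 0].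
Proof.
move=> mf Ie e0 we; have [g Ig mg] := gI.
have mXg : 'X * g \is monic by rewrite monicMl ?monicX.
pose D := [set x | I x /\ I x.[0]%:P].
have iD : is_ideal D.
  split; first by split; rewrite ?horner0; exact: (idl0 iI).
    by move=> x y [h1 h2] [h3 h4]; split; rewrite ?hornerD ?polyCD; exact: (idlD iI).
  by move=> r x [h1 h2]; split; rewrite ?hornerM ?polyCM; exact: (idlM _ iI).
have DX : D ('X * g) by split; [exact: (idlM _ iI)|rewrite hornerM hornerX mul0r; exact: (idl0 iI)].
pose pr : {rmorphism {poly B} -> quotient_ring iD} := @quotient_proj {poly B} _ iD.
have prs : forall y, exists x, pr x = y by exact: quotient_proj_surj.
have pr0 x : pr x = 0 <-> D x.
  by rewrite -(rmorph0 pr); split=> [/quotient_projP|h]; rewrite ?subr0 //; apply/quotient_projP; rewrite subr0.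
have nR : noeth {poly B} by exact: hilbert_basis.
pose ga : {rmorphism {poly A} -> quotient_ring iD} := (pr \o map_poly lam)%FUN.
have gas y : exists x, ga x = y.
  have [b hb] := prs y; have /choice [c hc] := lam_surj.
  exists (\poly_(i < size b) c b`_i); rewrite -hb /ga /=; apply/quotient_projP.
  apply: (idlC iD); have Db (x : {poly B}) : (forall i, I (x`_i)%:P) -> D x.
    move=> h; split; last by rewrite horner_coef0; exact: h.
    by rewrite -(coefK x) poly_def; apply: (idl_sum _ iI) => i _; rewrite -mul_polyC; apply: (idlMr _ iI); exact: h.
  apply: Db => i; rewrite coefB coef_map coef_poly; case: ltnP => hi; first exact: hc.
  by rewrite nth_default // raddf0 subr0; exact: (idl0 iI).
have gen := @alg_gen_surj _ _ _ _ ga (ga \o (polyC \o kap))%FUN _ gas (fun c => erefl) (poly_gen gA).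
have dQ (P : set (quotient_ring iD)) : is_prime_ideal P -> dlt m.+3 P.
  move=> pP; apply/(dlt_preim prs _ pP); have pP' := preim_prime pr pP.
  have DP x : D x -> (pr @^-1` P) x by move=> /pr0 /= ->; exact: (idl0 (prime_ideal pP)).
  have oP : over_J I (pr @^-1` P) by move=> c Ic; apply: DP; split; rewrite ?hornerC.
  exact: (@dlt_over _ _ _ dJ _ _ pP' oP (DP _ DX) mXg).
have w1 : ispan (pr \o w)%FUN 1.
  have [c hc] := we; exists (pr \o c)%FUN.
  have -> : 1 = pr (1 - e) :> quotient_ring iD.
    have /pr0 he : D e by split=> //; rewrite e0; exact: (idl0 iI).
    by rewrite rmorphB rmorph1 he subr0.
  by rewrite hc rmorph_sum; apply: eq_bigr => i _; rewrite rmorphM.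
have [w' [s vs hs] w1'] := shorten_row gen kclosed pk kfin (noeth_surj prs nR) dQ w1.
have [t vt [ht mt]] := monic_lift prs ((pr0 _).2 DX) mXg vs mf.
exists t => //; split=> //.
have [c hc] := w1'; have /choice [c' hc'] : forall j, exists c', pr c' = c j by move=> j; exact: prs.
pose y := \sum_j c' j * tail (eops t w) j.
have sy : ispan (tail (eops t w)) y by exists c'.
have [Iy Iy0] : D (1 - y).
  apply/pr0; rewrite rmorphB rmorph1 hc rmorph_sum -sumrB big1 // => j _.
  by rewrite rmorphM hc' /tail ht -hs subrr.
(* The value y(0) is 1 modulo J, hence a unit with inverse u. With 1 - z = (1 - y)(1 - yu) the
   second factor vanishes at 0 while the first lies in I. *)
have [u hu] := jac Iy0; rewrite hornerD hornerN hornerC subKr in hu.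
have it := span_ideal (tail (eops t w)).
exists (y + y * u%:P - y * (y * u%:P)); split.
- by apply: (idlB it); [apply: (idlD it) => //|]; exact: (idlMr _ it).
- have -> : 1 - (y + y * u%:P - y * (y * u%:P)) = (1 - y) * (1 - y * u%:P) by ring.
  exact: (idlMr _ iI).
have -> : 1 - (y + y * u%:P - y * (y * u%:P)) = (1 - y) * (1 - y * u%:P) by ring.
by rewrite !hornerE hu subrr mulr0.
Qed.
End Shorten.

Section Rows.
Variables (K : set {poly B}) (w f : 'I_m.+3 -> {poly B}).
Hypotheses (Kw : K = ispan w) (wf : forall i, cube K (f i - w i)).
Hypothesis KI : forall x y, K x -> I y -> ispan f (x * y).
Hypothesis fI : forall i, I (f i).

Let i1 : 'I_m.+3 := lift ord0 ord0.
Let i2 : 'I_m.+3 := lift ord0 (lift ord0 ord0).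
Hypothesis mf : f i1 \is monic.

(** The tail is corrected by w0 times elements of K^2 that lie in I and vanish at 0: this keeps K,
    the classes modulo K^3 and the property of z. A prime containing the new tail and all such
    corrections contains w0, since otherwise it would contain both z' and 1 - z'; then it contains
    K. *)
Lemma general_tail z :
    (forall q : set B, is_prime_ideal q -> (forall c, I c%:P -> q c) -> dlt m.+3 q) ->
    (forall P, is_prime_ideal P -> K `<=` P -> over_J I P -> dlt 1 P) ->
    ispan (tail w) z -> I (1 - z) -> (1 - z).[0] = 0 ->
  exists w', [/\ K = ispan w', forall i, cube K (w' i - w i),
    exists z', [/\ ispan (tail w') z', I (1 - z') & (1 - z').[0] = 0] &
    forall P, is_prime_ideal P -> P (f i1) -> over_J I P -> (forall j, P (tail w' j)) -> dlt 1 P].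
Proof.
move=> dJ dK wz Iz z0; have nR : noeth {poly B} by exact: hilbert_basis.
have iK : is_ideal K by rewrite Kw; exact: span_ideal.
have Kwi i : K (w i) by rewrite Kw; exact: span_mem.
pose J := polyC @^-1` I; have iJ : is_ideal J := preim_ideal polyC iI.
have iJT := polyI_ideal iJ.
pose C := [set x | [/\ ideal_mul K K x, I x & x.[0] = 0]].
have iC : is_ideal C.
  have i2' := ideal_mul_ideal K K; split; first by split; [exact: (idl0 i2')|exact: (idl0 iI)|exact: horner0].
    by move=> x y [h1 h2 h3] [h4 h5 h6]; split; [exact: (idlD i2')|exact: (idlD iI)|rewrite hornerD h3 h6 addr0].
  by move=> r x [h1 h2 h3]; split; [exact: (idlM _ i2')|exact: (idlM _ iI)|rewrite hornerM h3 mulr0].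
pose b := [set x | exists2 y, C y & x = w ord0 * y].
have ib : is_ideal b by exact: mul_ideal.
pose H := ideal_add (pid (f i1)) (polyI J).
have iH : is_ideal H by apply: ideal_add_ideal => //; exact: pid_ideal.
have [P pP HP _|y hy hyP] := @avoid_many _ 1 m.+2 H b (tail w) nR iH ib.
  have oP : over_J I P by apply: polyI_over => // x Hx; apply: HP; apply: addr_ => //; exact: pid_ideal.
  have Ph : P (f i1) by apply: HP; apply: addl => //; exact: pid_mem.
  exact: (@dlt_over _ _ _ dJ _ _ pP oP Ph mf).
pose w' i := if unlift ord0 i is Some j then w i + y j else w i.
have tw' j : tail w' j = tail w j + y j by rewrite /tail /w' liftK.
have ww' i : exists2 c, C c & w' i - w i = w ord0 * c.
  rewrite /w'; case: unliftP => [j|] ->; last by exists 0; rewrite ?subrr ?mulr0 //; exact: (idl0 iC).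
  by rewrite addrAC subrr add0r; exact: hy.
have w'0 : w' ord0 = w ord0 by rewrite /w' unlift_none.
have K' : K = ispan w'.
  apply/seteqP; split.
    rewrite Kw; apply: (span_sub (span_ideal w')) => i.
    have [c _ hc] := ww' i; have -> : w i = w' i - c * w' ord0 by rewrite w'0 -[w' i](subrK (w i)) hc; ring.
    have i' := span_ideal w'.
    by apply: (idlB i'); [|apply: (idlM _ i')]; exact: span_mem.
  apply: span_sub => // i; have [c _ hc] := ww' i; rewrite -[w' i](subrK (w i)) hc.
  by apply: (idlD iK) => //; exact: (idlMr _ iK).
exists w'; split=> //.
- move=> i; have [c [c2 _ _] ->] := ww' i; exact: ideal_mulP.
- have iC0 : is_ideal [set x | I x /\ x.[0] = 0].
    split; first by split; [exact: (idl0 iI)|exact: horner0].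
      by move=> x x' [h1 h2] [h3 h4]; split; [exact: (idlD iI)|rewrite hornerD h2 h4 addr0].
    by move=> r x [h1 h2]; split; [exact: (idlM _ iI)|rewrite hornerM h2 mulr0].
  have [|z' hz' [c [Ic c0] hzz]] := span_congr (v := tail w) (w := tail w') iC0 _ wz.
    move=> j; apply: (idlC iC0); rewrite tw' addrAC subrr add0r.
    by have [c [_ Ic c0] ->] := hy j; split; [exact: (idlM _ iI)|rewrite hornerM c0 mulr0].
  exists z'; split=> //; have -> : 1 - z' = (1 - z) + c by rewrite -hzz; ring.
    exact: (idlD iI).
  by rewrite hornerD z0 c0 addr0.
move=> P pP Pf oP Pw; have iP := prime_ideal pP.
have [P0|n0] := pselect (P (w ord0)).
  apply: dK => //; rewrite K'; apply: span_sub => // i.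
  by case: (unliftP ord0 i) => [j ->|->]; [exact: Pw|rewrite w'0].
apply: hyP => // [|j|bP].
- by apply: add_sub => //; [exact: pid_sub|exact: overJ].
- by rewrite -tw'.
have [|z' hz' [c [_ Ic c0] hzz]] := span_congr (v := tail w) (w := tail w') iC _ wz.
  move=> j; apply: (idlC iC); rewrite tw' addrAC subrr add0r.
  by have [c Cc ->] := hy j; apply: (idlM _ iC).
have Pz' : P z' by move: hz'; apply: span_sub.
apply: n0; pose u := 1 - z'.
have Iu : I u by rewrite /u; have -> : 1 - z' = (1 - z) + c; [rewrite -hzz; ring|exact: (idlD iI)].
have u0 : u.[0] = 0 by rewrite /u; have -> : 1 - z' = (1 - z) + c; [rewrite -hzz; ring|rewrite hornerD z0 c0 addr0].
have : P (w ord0 * ((w ord0 * w ord0) * u)).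
  apply: bP; exists ((w ord0 * w ord0) * u) => //; split; last by rewrite hornerM u0 mulr0.
    by apply: (idlMr _ (ideal_mul_ideal K K)); exact: ideal_mulP.
  exact: (idlM _ iI).
move=> /(primeM pP) [//|/(primeM pP) [/(primeM pP) []|Pu]] //.
by case: (prime_n1 pP); rewrite -(subrK z' 1); apply: (idlD iP).
Qed.
End Rows.
End Subtraction.

Section RowReduction.
Variable B : comNzRingType.
Hypothesis nB : noeth B.
Variable I : set {poly B}.
Hypothesis iI : is_ideal I.
Hypothesis jac : forall x, I x%:P -> exists y, (1 - x) * y = 1.
Variables (m : nat) (K : set {poly B}) (w f : 'I_m.+3 -> {poly B}).
Hypotheses (Kw : K = ispan w) (wf : forall i, cube K (f i - w i)).
Hypothesis KI : forall x y, K x -> I y -> ispan f (x * y).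
Let i1 : 'I_m.+3 := lift ord0 ord0.
Let i2 : 'I_m.+3 := lift ord0 (lift ord0 ord0).
Hypothesis mf : f i1 \is monic.
Variable z : {poly B}.
Hypotheses (wz : ispan (tail w) z) (Iz : I (1 - z)).
Hypothesis dw : forall P, is_prime_ideal P -> P (f i1) -> over_J I P -> (forall j, P (tail w j)) -> dlt 1 P.

Let L := ispan (tail w).
Let iL : is_ideal L. Proof. exact: span_ideal. Qed.
Let iK : is_ideal K. Proof. rewrite Kw; exact: span_ideal. Qed.
Let om := w ord0.
Let Kom : K om. Proof. rewrite Kw; exact: span_mem. Qed.
Let LK : L `<=` K.
Proof. by apply: (span_sub iK) => j; rewrite Kw; exact: span_mem. Qed.
Let LP (P : set {poly B}) : is_ideal P -> (forall j, P (tail w j)) -> L `<=` P.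
Proof. by move=> iP; apply: span_sub. Qed.

Let K_mod x : K x -> exists r, L (x - r * om).
Proof.
rewrite Kw => -[c ->]; exists (c ord0); rewrite big_ord_recl addrAC subrr add0r.
by apply: (idl_sum _ iL) => j _; apply: (idlM _ iL); exact: (span_mem (tail w)).
Qed.

Let K2_mod x : ideal_mul K K x -> exists r, L (x - r * om ^+ 2).
Proof.
move=> h; apply/add_pidP; move: h; apply: ideal_mul_sub => [|u v Ku Kv].
  exact: (ideal_add_ideal iL (pid_ideal _)).
have [r hr] := K_mod Ku; have [s hs] := K_mod Kv; apply/add_pidP; exists (r * s).
have -> : u * v - r * s * om ^+ 2 = (u - r * om) * v + r * om * (v - s * om) by ring.
by apply: (idlD iL); [exact: (idlMr _ iL)|exact: (idlM _ iL)].
Qed.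

(* With f = w M, operations with coefficients in K bring the row [ord0] of M to
   (1, 0, ..., 0) modulo [tail w]. *)
Lemma reduce_row : exists2 t, evalid t &
  L (eops t f ord0 - om) /\ forall j, ideal_mul L L (eops t f (lift ord0 j) - tail w j).
Proof.
have iK2 := ideal_mul_ideal K K; have K2K := square_sub iK.
have /choice [d hd] : forall j, exists d : 'I_m.+3 -> {poly B},
    (forall i, ideal_mul K K (d i)) /\ f j - w j = \sum_i d i * w i.
  move=> j; have [|d Kd hd] := @ideal_mul_span _ (ideal_mul K K) _ w (f j - w j) iK2; last by exists d.
  rewrite -Kw; move: (wf j); apply: ideal_mul_sub => [|x y Kx Ky]; first exact: ideal_mul_ideal.
  by rewrite mulrC; exact: ideal_mulP.
(* As f - w has entries in K^2 (w), one gets f = w M with M equal to 1 modulo K^2. *)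
pose M i j := (i == j)%:R + d j i.
have fM : f = fun j => \sum_i w i * M i j.
  apply/funext => j; have [_ h] := hd j; rewrite -(subrK (w j) (f j)) h addrC.
  under [RHS]eq_bigr => i _ do rewrite /M mulrDr.
  rewrite big_split /=; congr (_ + _); last by apply: eq_bigr => i _; rewrite mulrC.
  by rewrite (bigD1 j) //= eqxx mulr1 big1 ?addr0 // => i /negbTE ->; rewrite mulr0.
(* Modulo L, which contains the tail of w, only the row [ord0] of M contributes to f. *)
have fmod t j : L (eops t f j - om * eops t (M ord0) j).
  rewrite fM eops_sum big_ord_recl addrAC subrr add0r.
  by apply: (idl_sum _ iL) => i _; apply: (idlMr _ iL); exact: (span_mem (tail w)).
pose r := M ord0.
have rK2 j : j != ord0 -> ideal_mul K K (r j).
  by move=> j0; rewrite /r /M eq_sym (negbTE j0) add0r; have [] := hd j.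
have r0 : ideal_mul K K (r ord0 - 1) by rewrite /r /M eqxx addrAC subrr add0r; have [] := hd ord0.
have [mu0 hmu0] := K2_mod r0; have [mu2 hmu2] := K2_mod (rK2 i2 isT).
pose H := ideal_add L (pid (r i1)); pose J := polyC @^-1` I.
have iJ : is_ideal J := preim_ideal polyC iI; have iJT := polyI_ideal iJ.
have iH : is_ideal H := ideal_add_ideal iL (pid_ideal _).
have iHJ : is_ideal (ideal_add H (polyI J)) := ideal_add_ideal iH iJT.
have Hf : H (f i1).
  apply/add_pidP; exists om; have := fmod [::] i1; by [].
have LH : L `<=` H by move=> x Lx; apply: addl => //; exact: pid_ideal.
pose rr (l : 'I_m.+1) := r (lift ord0 (lift ord0 l)).
(* The first entry of the row is moved by om times the entries from i2 on. This makes it comaximal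
   to r i1 modulo L. *)
pose b := [set x | exists2 y, ispan rr y & x = om * y].
have ib : is_ideal b by apply: mul_ideal; exact: span_ideal.
have nR : noeth {poly B} by exact: hilbert_basis.
have HJ P : ideal_add H (polyI J) `<=` P -> H `<=` P /\ over_J I P.
  move=> hP; split; first by move=> x Hx; apply: hP; exact: addl.
  by apply: polyI_over => // x Hx; apply: hP; exact: addr_.
have Ltail P : H `<=` P -> forall j, P (tail w j).
  by move=> HP j; apply: HP; apply: LH; exact: (span_mem (tail w)).
have [P pP /HJ [HP oP] _|y0 [_ [c ->] ->] hy] := @avoid_step _ 0 (ideal_add H (polyI J)) b (r ord0) nR iHJ ib.
  by apply: dw => //; [exact: HP|exact: Ltail].
set y := om * _ in hy; pose r0' := r ord0 + y.
have H1 : ideal_add H (pid r0') 1.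
  have ipr := pid_ideal r0'.
  apply: (jac_comax iI jac (ideal_add_ideal iH ipr) (addl ipr Hf) mf) => P pP HP oP.
  have iP := prime_ideal pP.
  have HP' : H `<=` P by move=> x Hx; apply: HP; exact: addl.
  have Pr0' : P r0' by apply: HP; apply: (addr_ iH); exact: pid_mem.
  apply: (hy P pP) => // [|bP]; first by apply: add_sub => //; exact: overJ.
  have Pr0 : P (r ord0).
    rewrite -(addrK y (r ord0)); apply: (idlB iP) => //; apply: bP; rewrite /y.
    by eexists; [exists c|].
  have LP' : L `<=` P by move=> x Lx; apply: HP'; exact: LH.
  have nom : ~ P om.
    move=> Pom; apply: (prime_n1 pP); rewrite -(subKr (r ord0) 1); apply: (idlB iP) => //.
    apply: (idlDl iP (LP' _ hmu0)); rewrite expr2; do 2!apply: (idlM _ iP); exact: Pom.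
  have Pr j : P (r j).
    case: (unliftP ord0 j) => [j' ->|-> //]; case: (unliftP ord0 j') => [l ->|->].
      have : P (om * rr l) by apply: bP; exists (rr l) => //; exact: span_mem.
      by case/(primeM pP) => // /nom.
    by apply: HP'; apply: (addr_ iL); exact: pid_mem.
  have Pf : ispan f `<=` P.
    apply: span_sub => // j; apply: (idlDl iP (LP' _ (fmod [::] j))) => /=; exact: (idlM _ iP).
  apply: nom; have -> : om = om * z + om * (1 - z) by ring.
  by apply: (idlD iP); [apply: (idlM _ iP); exact: LP'|apply: Pf; exact: KI].
have [q' [q Lq]] : exists q' q, L (1 - q * r0' - q' * r i1).
  by have /add_pidP [q /add_pidP [q' h]] := H1; exists q', q.
pose t1 := gather ord0 (fun j => if unlift ord0 j is Some j' then
  if unlift ord0 j' is Some l then om * c l else 0 else 0).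
(* Modulo L the entry i2 is mu2 om^2, so adding s2(q r0' + q' r i1) makes it om. Subtracting nu
   times it brings the entry [ord0] to 1, and t4 clears the rest of the row. All coefficients lie in
   K, so the other rows of M stay those of the identity modulo K. *)
pose s2 := om * (1 - mu2 * om).
pose t2 := [:: (i2, (ord0 : 'I_m.+3), s2 * q); (i2, i1, s2 * q')].
pose nu := mu0 * om + \sum_l c l * rr l.
pose t3 := [:: ((ord0 : 'I_m.+3), i2, - nu)].
pose r1 := eops t1 r.
have r1E l : r1 l = if l == ord0 then r0' else r l.
  rewrite /r1 gatherE; case: eqP => // _; rewrite /r0' /y; congr (_ + _).
  rewrite big_mkcond big_ord_recl /= add0r big_ord_recl /= liftK unlift_none mul0r add0r mulr_sumr.
  by apply: eq_bigr => l' _; rewrite !liftK mulrA.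
pose r2 := eops t2 r1.
have r2E l : r2 l = if l == i2 then r i2 + s2 * q * r0' + s2 * q' * r i1 else r1 l.
  by rewrite /r2 /= /eop /=; case: eqP => // ->; rewrite !r1E.
pose r3 := eops t3 r2.
have r3E l : r3 l = if l == ord0 then r0' - nu * r2 i2 else r2 l.
  by rewrite /r3 /= /eop /=; case: eqP => // ->; rewrite !r2E r1E /= mulNr.
have L2 : L (r2 i2 - om).
  rewrite r2E eqxx; have -> : r i2 + s2 * q * r0' + s2 * q' * r i1 - om =
    (r i2 - mu2 * om ^+ 2) - s2 * (1 - q * r0' - q' * r i1) by rewrite /s2; ring.
  by apply: (idlB iL) => //; exact: (idlM _ iL).
have L3 : L (r3 ord0 - 1).
  rewrite r3E eqxx.
  have -> : r0' - nu * r2 i2 - 1 = (r ord0 - 1 - mu0 * om ^+ 2) - nu * (r2 i2 - om).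
    by rewrite /r0' /y /nu /rr; ring.
  by apply: (idlB iL) => //; exact: (idlM _ iL).
pose t4 := fanout ord0 (fun j => - r3 j).
pose t0 := t1 ++ t2 ++ t3 ++ t4.
have r3K j : j != ord0 -> K (r3 j).
  move=> j0; rewrite r3E (negbTE j0) r2E; case: eqP => _.
    by have := L2; rewrite r2E eqxx => /LK h; exact: (idlDl iK h Kom).
  by rewrite r1E (negbTE j0); apply: K2K; exact: rK2.
have nuK : K nu.
  apply: (idlD iK); first exact: (idlM _ iK).
  apply: (idl_sum _ iK) => l _; apply: (idlM _ iK); apply: K2K; exact: rK2.
have s2K : K s2 by exact: (idlMr _ iK).
have v0 : evalid t0.
  by rewrite /t0 !evalid_cat gather_valid fanout_valid.
have K0 o : o \in t0 -> K o.2.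
  rewrite /t0 !mem_cat => /or4P [/mapP [j _ ->]| | |/mapP [j]].
  - case: unlift => [j'|] /=; last exact: (idl0 iK).
    by case: unlift => [l|] /=; [exact: (idlMr _ iK)|exact: (idl0 iK)].
  - by rewrite !inE => /orP [/eqP ->|/eqP ->] /=; exact: (idlMr _ iK).
  - by rewrite inE => /eqP -> /=; exact: (idlN iK).
  - by rewrite mem_enum => /= j0 ->; apply: (idlN iK); exact: r3K.
have N0 j : L (eops t0 r j - (j == ord0)%:R).
  rewrite /t0 !eops_cat -/r1 -/r2 -/r3 fanoutE; case: eqP => [->|_] //.
  have -> : r3 j + - r3 j * r3 ord0 - 0 = - r3 j * (r3 ord0 - 1) by ring.
  exact: (idlM _ iL).
have NK i j : K (eops t0 (M i) j - (i == j)%:R).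
  apply: (idl_trans iK (eops_coef (M i) j iK K0)).
  rewrite /M addrAC subrr add0r; have [Kd _] := hd j; exact: K2K.
have iLK := ideal_mul_ideal L K.
have F0 : L (eops t0 f ord0 - om).
  apply: (idl_trans iL (fmod t0 ord0)); rewrite -{2}[om]mulr1 -mulrBr.
  by apply: (idlM _ iL); have := N0 ord0; rewrite eqxx.
have F1 j : ideal_mul L K (eops t0 f (lift ord0 j) - tail w j).
  rewrite fM eops_sum big_ord_recl -addrA; apply: (idlD iLK).
    by rewrite mulrC; apply: ideal_mulP => //; have := N0 (lift ord0 j); rewrite subr0.
  have -> : tail w j = \sum_(i < m.+2) w (lift ord0 i) * (lift ord0 i == lift ord0 j)%:R.
    rewrite (bigD1 j) //= eqxx mulr1 big1 ?addr0 // => i ij.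
    by rewrite (inj_eq lift_inj) (negbTE ij) mulr0.
  rewrite -sumrB; apply: (idl_sum _ iLK) => i _; rewrite -mulrBr; apply: ideal_mulP => //.
  exact: (span_mem (tail w)).
have iLL := ideal_mul_ideal L L.
(* As K = L + (om), an error in LK is om ze modulo L^2 with ze in L. It is removed by ze times the
   entry [ord0], which is om modulo L. *)
have /choice [ze hze] : forall j, exists ze, L ze /\ ideal_mul L L (eops t0 f (lift ord0 j) - tail w j - om * ze).
  move=> j; pose S := [set x | exists ze, L ze /\ ideal_mul L L (x - om * ze)].
  suff : ideal_mul L K `<=` S by apply; exact: F1.
  apply: ideal_mul_sub => [|x y' Lx Ky].
    split; first by exists 0; split; [exact: (idl0 iL)|rewrite mulr0 subr0; exact: (idl0 iLL)].
      move=> u v [u' [h1 h2]] [v' [h3 h4]]; exists (u' + v'); split; first exact: (idlD iL).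
      by rewrite mulrDr; apply: (idl_congD iLL h2 h4).
    move=> s u [u' [h1 h2]]; exists (s * u'); split; first exact: (idlM _ iL).
    by rewrite mulrCA -mulrBr; apply: (idlM _ iLL).
  have [s hs] := K_mod Ky; exists (x * s); split; first exact: (idlMr _ iL).
  by have -> : x * y' - om * (x * s) = x * (y' - s * om); [ring|exact: ideal_mulP].
pose t5 := fanout ord0 (fun j => if unlift ord0 j is Some j' then - ze j' else 0).
exists (t0 ++ t5); first by rewrite evalid_cat v0 fanout_valid.
rewrite eops_cat; split; first by rewrite fanoutE eqxx.
move=> j; rewrite fanoutE eq_sym (negbTE (neq_lift _ _)) liftK.
have [Lz hz] := hze j.
have -> : eops t0 f (lift ord0 j) + - ze j * eops t0 f ord0 - tail w j =
  (eops t0 f (lift ord0 j) - tail w j - om * ze j) - ze j * (eops t0 f ord0 - om) by ring.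
by apply: (idlB iLL) => //; exact: ideal_mulP.
Qed.

(** Nakayama gives de in L with (1 - de)L inside (tail g), so de is idempotent modulo (tail g).
    Where de = 0 also z = 0, and the new first entry g0 + va is 1; where de = 1 it is g0. Thus the
    zeros of L, among them those of K, are removed from (g). The factor 1 - z keeps va in I and
    makes it vanish at 0. *)
Lemma subtract g : ispan g = ispan f -> (forall i, I (g i)) -> (1 - z).[0] = 0 ->
    L (g ord0 - om) -> (forall j, ideal_mul L L (tail g j - tail w j)) ->
  exists h, [/\ I = ispan h & forall i, (h i).[0] = (g i).[0]].
Proof.
move=> gf Ig z0 L0 L1; have ig := span_ideal (tail g).
have [i|de [N [Lde hde]]] := @nakayama _ _ (tail w) (ispan (tail g)) L 1 ig iL.
  rewrite mul1r -[tail w i](subrK (tail g i)) addrC.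
  exists (tail g i); first exact: span_mem.
  by exists (tail w i - tail g i) => //; apply: (idlC (ideal_mul_ideal L L)); exact: L1.
rewrite expr1n -/L in hde; pose va := (1 - de) * (1 - z) * (1 - g ord0).
pose h i := if i == ord0 then g ord0 + va else g i.
have hE j : h (lift ord0 j) = tail g j by [].
have h0E : h ord0 = g ord0 + va by [].
have Iva : I va by rewrite /va mulrAC; exact: (idlM _ iI).
exists h; split; last first.
  move=> i; rewrite /h; case: eqP => [->|] //.
  by rewrite /va hornerD !hornerM z0 mulr0 mul0r addr0.
have ih := span_ideal h.
have gh : ispan (tail g) `<=` ispan h by apply: span_sub => // j; rewrite -hE; exact: span_mem.
apply/seteqP; split; last first.
  apply: span_sub => // i; rewrite /h; case: eqP => // _; exact: (idlD iI).
have h1 : ispan h (1 - de + de * g ord0).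
  have -> : 1 - de + de * g ord0 = h ord0 + (1 - de) * z * (1 - g ord0) by rewrite h0E /va; ring.
  by apply: (idlD ih); [exact: span_mem|apply: (idlMr _ ih); apply: gh; exact: hde].
have h2 : ispan h ((1 - de) * de) by apply: gh; exact: hde.
have h3 : ispan h (1 - de).
  have -> : 1 - de = (1 - de) * (1 - de + de * g ord0) + (1 - de) * de * (1 - g ord0) by ring.
  by apply: (idlD ih); [exact: (idlM _ ih)|exact: (idlMr _ ih)].
have h4 : ispan h (g ord0).
  have -> : g ord0 = (1 - de + de * g ord0) - (1 - de) * (1 - g ord0) by ring.
  by apply: (idlB ih) => //; exact: (idlMr _ ih).
have gh' : ispan g `<=` ispan h.
  by apply: span_sub => // i; case: (unliftP ord0 i) => [j ->|-> //]; apply: gh; exact: (span_mem (tail g)).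
move=> x Ix; have -> : x = de * x + (1 - de) * x by ring.
apply: (idlD ih); last exact: (idlMr _ ih).
by apply: gh'; rewrite gf; apply: KI => //; exact: LK.
Qed.
End RowReduction.

Section LocalTheorem.
Variable B : comNzRingType.
Hypothesis nB : noeth B.
Variable I : set {poly B}.
Hypotheses (iI : is_ideal I) (gI : exists2 g, I g & g \is monic).
Hypothesis jac : forall x, I x%:P -> exists y, (1 - x) * y = 1.
Variable m : nat.
Hypothesis dJ : forall q : set B, is_prime_ideal q -> (forall c, I c%:P -> q c) -> dlt m.+2 q.
Variables (f : 'I_m.+2 -> {poly B}) (a : 'I_m.+2 -> B).
Hypothesis aI : forall x, I x -> ispan a x.[0].
Hypothesis f0 : forall i, (f i).[0] = a i.
Hypothesis fI : forall i, I (f i).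
Hypothesis f2 : forall x, I x -> ideal_add (ispan f) (ideal_mul I I) x.

(** K = (f', 1 - e). As (1 - e)I lies in (f'), so does KI; and a prime over K cannot contain I,
    which contains e, so over J it is maximal by [general_generators]. *)
Lemma residual_ideal : exists f' (K : set {poly B}) e,
  [/\ [/\ forall i, I (f' i), forall i, (f' i).[0] = a i, f' ord0 \is monic &
        forall x, I x -> ideal_add (ispan f') (ideal_mul I I) x],
      is_ideal K /\ forall i, K (f' i), [/\ I e, K (1 - e) & e.[0] = 0],
      forall x y, K x -> I y -> ispan f' (x * y) &
      forall P, is_prime_ideal P -> K `<=` P -> over_J I P -> dlt 1 P].
Proof.
have [f' [If' f'0 mf' f'2 dP]] := general_generators nB iI gI dJ aI f0 fI f2.
have [e [Ie e0 he]] := local_idempotent nB iI aI f'0 If' f'2.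
have iff := span_ideal f'; have ie := pid_ideal (1 - e).
pose K := ideal_add (ispan f') (pid (1 - e)).
have Ke : K (1 - e) by apply: (addr_ iff); exact: pid_mem.
have Kf i : K (f' i) by apply: (addl ie); exact: span_mem.
exists f', K, e; split=> //.
- by split=> //; exact: ideal_add_ideal.
- move=> _ y [x hx [_ [c ->] <-]] Iy; rewrite mulrDl; apply: (idlD iff); first exact: (idlMr _ iff).
  by rewrite -mulrA; apply: (idlM _ iff); exact: he.
move=> P pP KP oP; have [|IP|//] := dP P pP _ oP; first by move=> i; exact: KP.
case: (prime_n1 pP); rewrite -(subrK e 1); apply: (idlD (prime_ideal pP)); [exact: KP|exact: IP].
Qed.
End LocalTheorem.

Section LocalTheorem3.
Variable B : comNzRingType.
Hypothesis nB : noeth B.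
Variable I : set {poly B}.
Hypotheses (iI : is_ideal I) (gI : exists2 g, I g & g \is monic).
Hypothesis jac : forall x, I x%:P -> exists y, (1 - x) * y = 1.
Variable m : nat.
Hypothesis dJ : forall q : set B, is_prime_ideal q -> (forall c, I c%:P -> q c) -> dlt m.+3 q.
Variables (A : comNzRingType) (lam : {rmorphism A -> B}).
Hypothesis lam_surj : forall b, exists x, I (b - lam x)%:P.
Variables (k : fieldType) (kap : {rmorphism k -> A}) (X : seq A) (p : nat).
Hypotheses (gA : alg_gen kap [set` X]) (kclosed : GRing.closed_field_axiom k) (pk : p \in [pchar k]).
Hypothesis kfin : forall x : k, exists2 s, (0 < s)%N & x ^+ (p ^ s) = x.
Variables (f : 'I_m.+3 -> {poly B}) (a : 'I_m.+3 -> B).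
Hypothesis aI : forall x, I x -> ispan a x.[0].
Hypothesis f0 : forall i, (f i).[0] = a i.
Hypothesis fI : forall i, I (f i).
Hypothesis f2 : forall x, I x -> ideal_add (ispan f) (ideal_mul I I) x.

Lemma local_generators_ge3 : exists2 h : 'I_m.+3 -> {poly B}, I = ispan h & forall i, (h i).[0] = a i.
Proof.
have [f' [K [e [[If' f'0 mf' f'2] [iK Kf] [Ie Ke e0] KI dK]]]] := residual_ideal nB iI gI dJ aI f0 fI f2.
have [w Kw wf] := complement_generators nB iI iK jac Kf mf' Ie Ke e0 KI dK.
have [t1 v1 m1] := all_monic mf'.
have iK3 := cube_ideal K.
have [|t2 v2 [m2 [z [wz Iz z0]]]] := shorten_local nB iI gI jac dJ lam_surj gA kclosed pk kfin m1 Ie e0 (w := eops t1 w).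
  by rewrite eops_span // -Kw.
set w2 := eops t2 (eops t1 w) in wz; pose g2 := eops t2 (eops t1 f').
have Kw2 : K = ispan w2 by rewrite /w2 !eops_span.
have g2f : ispan g2 = ispan f' by rewrite /g2 !eops_span.
have KI2 x y : K x -> I y -> ispan g2 (x * y) by rewrite g2f; exact: KI.
have wg2 i : cube K (w2 i - g2 i) by do 2!apply: (eops_lin _ iK3) => {}i.
have [w3 [Kw3 w32 [z' [wz' Iz' z'0]] dw]] := general_tail nB iI Kw2 (m2 _) dJ dK wz Iz z0.
have wg3 i : cube K (g2 i - w3 i).
  by apply: (idlC iK3); apply: (idl_trans iK3 (w32 i)).
have [t3 v3 [h1 h2]] := reduce_row nB iI jac Kw3 wg3 KI2 (m2 _) wz' Iz' dw.
pose g3 := eops t3 g2; have g3f : ispan g3 = ispan g2 by rewrite /g3 eops_span.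
have Ig3 i : I (g3 i) by do 3!apply: (eops_ideal _ iI) => {}i.
have [h [Ih h0]] := subtract iI Kw3 KI2 wz' Iz' g3f Ig3 z'0 h1 h2.
(* The operations act on values at 0 as well, and h has there the values of the transformed f';
   undoing them on h gives the values a. *)
pose t := t1 ++ t2 ++ t3; have vt : evalid t by rewrite /t !evalid_cat v1 v2.
exists (eops (einv t) h); first by rewrite eops_span ?einv_valid.
pose Z := [set x : {poly B} | x.[0] = 0].
have iZ : is_ideal Z.
  split; first exact: horner0.
    by move=> x y h3 h4; rewrite /Z /= hornerD h3 h4 addr0.
  by move=> r x h3; rewrite /Z /= hornerM h3 mulr0.
have g3E : eops t f' = g3 by rewrite /t !eops_cat.
move=> i; apply/eqP; rewrite -f'0 -subr_eq0 -hornerN -hornerD -[in X in _ - X](eopsK f' vt) g3E.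
by apply/eqP; apply: (eops_lin _ iZ) => {}i; rewrite /Z /= hornerD hornerN h0 subrr.
Qed.
End LocalTheorem3.

(** * Quillen patching and the case n = 2 *)

Definition rspan (R : comPzRingType) n (v : 'rV[R]_n) : set R := ispan (v ord0).

Lemma rspan_mul (R : comPzRingType) n q (v : 'rV[R]_n) (M : 'M[R]_(n, q)) i : rspan v ((v *m M) ord0 i).
Proof. by exists (fun j => M j i); rewrite mxE; apply: eq_bigr => j _; rewrite mulrC. Qed.

(** By induction x^j F lies in u^j F modulo H: each factor u in an exponent can be traded for a
    factor x. *)
Lemma absorb (R : comPzRingType) (H F : set R) x u q j : is_ideal H ->
  (forall y, F y -> exists2 z, F z & H (x * y - u * z)) ->
  (forall y, F y -> H (q * u ^+ j * y)) -> forall y, F y -> H (q * x ^+ j * y).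
Proof.
move=> iH h1 h2 y Fy.
have [z Fz hz] : exists2 z, F z & H (x ^+ j * y - u ^+ j * z).
  elim: j {h2} => [|j [z Fz IH]]; first by exists y; rewrite // !expr0 subrr; exact: (idl0 iH).
  have [t Ft ht] := h1 z Fz; exists t => //.
  have -> : x ^+ j.+1 * y - u ^+ j.+1 * t = x * (x ^+ j * y - u ^+ j * z) + u ^+ j * (x * z - u * t).
    by rewrite !exprS; ring.
  by apply: (idlD iH); exact: (idlM _ iH).
have -> : q * x ^+ j * y = q * (x ^+ j * y - u ^+ j * z) + q * u ^+ j * z by ring.
by apply: (idlD iH); [exact: (idlM _ iH)|exact: h2].
Qed.

Lemma comax_powers (R : comPzRingType) (s u : R) a b : s + u = 1 ->
  exists x y, x * s ^+ a + y * u ^+ b = 1.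
Proof.
move=> su; apply: unit2 => P pP /(primeX pP) Ps /(primeX pP) Pu; apply: (prime_n1 pP).
by rewrite -su; apply: (idlD (prime_ideal pP)).
Qed.

Section Patching.
Variables (B : comNzRingType) (n : nat) (f f' : 'rV[{poly B}]_n) (Th Ts : 'M[{poly B}]_n) (s u : B).
Let pi := (s * u)%:P : {poly B}.
Hypotheses (TT : Th *m Ts = (pi ^+ 2)%:M) (TT' : Ts *m Th = (pi ^+ 2)%:M).
Hypothesis fT : f *m Th = pi *: f'.
Hypothesis T0 : forall i j, (Ts i j).[0] = (s * u) *+ (i == j).
Variables b1 b2 : B.
Hypothesis bb : b1 * s ^+ 3 + b2 * u ^+ 3 = 1.

(* Quillen patching: [f'] and [f] are related by [theta = Th / (s u)], equal to
   1 at 0, which factors as [theta(X) theta(cX)^-1 * theta(cX)] where [c] is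
   small at [s] and [1 - c] is small at [u]. *)
Lemma quillen_patch : exists h : 'rV[{poly B}]_n,
  [/\ forall H, is_ideal H -> (forall i, H (f ord0 i)) -> (forall i, H (f' ord0 i)) -> forall i, H (h ord0 i),
      forall a : 'I_n -> B, (forall i, (f ord0 i).[0] = a i) -> (forall i, (f' ord0 i).[0] = a i) ->
        forall i, (h ord0 i).[0] = a i,
      exists N, forall y, rspan f y -> rspan h ((s ^+ N)%:P * y) &
      exists N, forall y, rspan f' y -> rspan h ((u ^+ N)%:P * y)].
Proof.
pose c := b1 * s ^+ 3; pose sg (p : {poly B}) := p \Po (c%:P * 'X).
pose cM (M : 'M[{poly B}]_n) := map_mx sg M.
have cMM M N : cM (M *m N) = cM M *m cM N by exact: (map_mxM (comp_poly (c%:P * 'X))).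
have cC x : cM ((x%:P)%:M) = (x%:P)%:M.
  by rewrite /cM -[sg]/(comp_poly (c%:P * 'X) : _ -> _) map_scalar_mx /= comp_polyC.
have /choice [om hom] : forall ij, exists q, Ts ij.1 ij.2 = pi *+ (ij.1 == ij.2) + q * 'X.
  by move=> [i j] /=; have [q hq] := poly_at0 (Ts i j); exists q; rewrite hq T0 /pi rmorphMn.
have /choice [om' hom'] : forall ij, exists q, Ts ij.1 ij.2 - sg (Ts ij.1 ij.2) = q * ((1 - c)%:P * 'X).
  move=> [i j] /=; have := comp_congr (Ts i j) (pid_ideal ((1 - c)%:P * 'X)) (u := 'X) (v := c%:P * 'X).
  by rewrite comp_polyXr; apply; exists 1; rewrite polyCB polyC1; ring.
pose Om := \matrix_(i, j) om (i, j); pose Om' := \matrix_(i, j) om' (i, j).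
pose S := s%:P : {poly B}; pose U := u%:P : {poly B}; pose e1 := b1%:P : {poly B}; pose e2 := b2%:P : {poly B}.
have SU : pi = S * U by rewrite /pi polyCM.
have eSU : e1 * S ^+ 3 + e2 * U ^+ 3 = 1 by rewrite -!rmorphXn -!polyCM -polyCD bb.
have cE : c%:P = e1 * S ^+ 3 by rewrite /c polyCM rmorphXn.
have c1E : (1 - c)%:P = e2 * U ^+ 3 by rewrite polyCB polyC1 cE -eSU; ring.
have TsE : cM Ts = pi%:M + (e1 * S ^+ 3 * 'X) *: cM Om.
  apply/matrixP => i j; rewrite !mxE /sg (hom (i, j)) /= comp_polyD comp_polyM comp_polyX cE.
  rewrite (_ : (pi *+ (i == j)) \Po _ = pi *+ (i == j)); first by congr (_ + _); ring.
  by rewrite /pi -rmorphMn comp_polyC.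
have TsE' : cM Ts = Ts - (e2 * U ^+ 3 * 'X) *: Om'.
  apply/matrixP => i j; rewrite !mxE -c1E; have := hom' (i, j) => /= h.
  by rewrite -[LHS](subKr (Ts i j)) h; congr (_ - _); ring.
(* The two factors without their denominators: Th(X) Ts(cX) = U^2 G2 and Ts(cX) = S H2. The cubes in
   1 - c = b2 u^3 and c = b1 s^3 leave enough powers for this division. *)
pose G2 := (S ^+ 2)%:M - (e2 * U * 'X) *: (Th *m Om').
pose H2 := U%:M + (e1 * S ^+ 2 * 'X) *: cM Om.
have GE : Th *m cM Ts = U ^+ 2 *: G2.
  rewrite TsE' mulmxBr TT -scalemxAr /G2 scalerBr scalerA; congr (_ - _).
    by rewrite scale_scalar_mx SU; congr (_%:M); ring.
  by congr (_ *: _); ring.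
have HE : cM Ts = S *: H2.
  rewrite TsE /H2 scalerDr scale_scalar_mx scalerA SU; congr (_ + _ *: _); ring.
pose X := f *m G2; pose Y := U *: (f' *m H2).
have XY : U ^+ 2 *: X = S ^+ 2 *: Y.
  rewrite /X scalemxAr -GE mulmxA fT HE -scalemxAl -scalemxAr scalerA /Y scalerA SU; congr (_ *: _); ring.
(* U^2 X = S^2 Y together with e1 S^3 + e2 U^3 = 1 glues X and Y to a row h with S^2 h = X and U^2 h
   = Y. *)
pose h := (e1 * S) *: X + (e2 * U) *: Y.
have glue (V W : 'rV[{poly B}]_n) : U ^+ 2 *: V = S ^+ 2 *: W ->
    S ^+ 2 *: ((e1 * S) *: V + (e2 * U) *: W) = V /\ U ^+ 2 *: ((e1 * S) *: V + (e2 * U) *: W) = W.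
  move=> VW; split.
    rewrite scalerDr !scalerA [X in _ + X *: _]mulrC -(scalerA _ (S ^+ 2)) -VW scalerA -scalerDl.
    by rewrite -[RHS]scale1r; congr (_ *: _); rewrite -eSU; ring.
  rewrite scalerDr !scalerA [X in X *: _ + _]mulrC -(scalerA _ (U ^+ 2)) VW scalerA -scalerDl.
  by rewrite -[RHS]scale1r; congr (_ *: _); rewrite -eSU; ring.
have [hX hY] := glue X Y XY; rewrite -/h in hX hY.
have ih : is_ideal (rspan h) by exact: span_ideal.
have hmem x i : rspan h ((x *: h) ord0 i) by rewrite mxE; apply: (idlM _ ih); exact: span_mem.
have hmul x M i : rspan h ((x *: (h *m M)) ord0 i) by rewrite mxE; apply: (idlM _ ih); exact: rspan_mul.
have spanP (v : 'rV[{poly B}]_n) (W : {poly B} -> Prop) : is_ideal W -> (forall i, W (v ord0 i)) -> forall y, rspan v y -> W y.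
  by move=> iW hv y; apply: span_sub.
exists h; split.
- move=> W iW Wf Wf' i; rewrite mxE; apply: (idlD iW); rewrite mxE.
    by apply: (idlM _ iW); apply: spanP (rspan_mul _ _ _).
  by apply: (idlM _ iW); rewrite mxE; apply: (idlM _ iW); apply: spanP (rspan_mul _ _ _).
- move=> a fa fa' i; have X0 : (X ord0 i).[0] = s ^+ 2 * a i.
    rewrite /X /G2 mulmxBr -scalemxAr mul_mx_scalar !mxE hornerD hornerN !hornerM hornerX fa.
    by rewrite !(hornerM, horner_exp, hornerX, hornerC) !(mulr0, mul0r) subr0.
  have Y0 : (Y ord0 i).[0] = u ^+ 2 * a i.
    rewrite /Y /H2 mulmxDr -scalemxAr mul_mx_scalar !mxE hornerM hornerD !hornerM hornerX fa'.
    by rewrite !(hornerM, horner_exp, hornerX, hornerC) !(mulr0, mul0r) addr0; ring.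
  rewrite /h mxE hornerD [in X in X + _]mxE [in X in _ + X]mxE !hornerM X0 Y0 !hornerC.
  by rewrite -[RHS]mul1r -bb; ring.
(* S^4 U^4 carries (f) into (h), and modulo (h) the row S^2 f lies in U (f). So each of the four
   factors U is exchanged for S^2. The exponent for f' arises likewise from U^3 S^2. *)
- exists (4 + 2 * 4)%N => y fy; rewrite rmorphXn -/S exprD exprM.
  apply: (@absorb _ (rspan h) (rspan f) (S ^+ 2) U (S ^+ 4) 4 ih) y fy => y.
    pose W := [set y | exists2 z, rspan f z & rspan h (S ^+ 2 * y - U * z)].
    have iff : is_ideal (rspan f) by exact: span_ideal.
    apply: (spanP f W) => [|i].
      split; first by exists 0; [exact: (idl0 iff)|rewrite !mulr0 subr0; exact: (idl0 ih)].
        move=> y1 y2 [z1 h1 h2] [z2 h3 h4]; exists (z1 + z2); first exact: (idlD iff).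
        by rewrite !mulrDr; apply: (idl_congD ih).
      move=> r y1 [z1 h1 h2]; exists (r * z1); first exact: (idlM _ iff).
      by rewrite !(mulrCA _ r) -mulrBr; apply: (idlM _ ih).
    exists (e2 * 'X * (f *m (Th *m Om')) ord0 i); first by apply: (idlM _ iff); exact: rspan_mul.
    have := hmem (S ^+ 2) i; rewrite hX /X /G2 mulmxBr -scalemxAr mul_mx_scalar.
    by move: (f *m _) => V; rewrite !mxE; congr (rspan h _); ring.
  pose W := [set y | rspan h (S ^+ 4 * U ^+ 4 * y)].
  apply: (spanP f W) => [|i].
    split; first by rewrite /W /= mulr0; exact: (idl0 ih).
      by move=> y1 y2 h1 h2; rewrite /W /= mulrDr; exact: (idlD ih).
    by move=> r y1 h1; rewrite /W /= mulrCA; exact: (idlM _ ih).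
  have := hmul _ (S ^+ 2 * U ^+ 2) (cM Th *m Ts) i; congr (rspan h _).
  rewrite -scalerA mulmxA.
  have -> : S ^+ 2 *: (U ^+ 2 *: (h *m cM Th *m Ts)) = (U ^+ 2 *: (S ^+ 2 *: h)) *m (cM Th *m Ts).
    by rewrite -!scalemxAl mulmxA !scalerA mulrC.
  rewrite hX /X scalemxAr -GE !mulmxA -(mulmxA (f *m Th)) -cMM TT' -rmorphXn cC rmorphXn -/pi.
  by rewrite mul_mx_scalar -scalemxAl -mulmxA TT mul_mx_scalar !mxE SU; ring.
exists (3 + 2 * 2)%N => y fy; rewrite rmorphXn -/U exprD exprM.
apply: (@absorb _ (rspan h) (rspan f') (U ^+ 2) S (U ^+ 3) 2 ih) y fy => y.
  pose W := [set y | exists2 z, rspan f' z & rspan h (U ^+ 2 * y - S * z)].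
  have iff : is_ideal (rspan f') by exact: span_ideal.
  apply: (spanP f' W) => [|i].
    split; first by exists 0; [exact: (idl0 iff)|rewrite !mulr0 subr0; exact: (idl0 ih)].
      move=> y1 y2 [z1 h1 h2] [z2 h3 h4]; exists (z1 + z2); first exact: (idlD iff).
      by rewrite !mulrDr; apply: (idl_congD ih).
    move=> r y1 [z1 h1 h2]; exists (r * z1); first exact: (idlM _ iff).
    by rewrite !(mulrCA _ r) -mulrBr; apply: (idlM _ ih).
  exists (- (U * e1 * S * 'X) * (f' *m cM Om) ord0 i); first by apply: (idlM _ iff); exact: rspan_mul.
  have := hmem (U ^+ 2) i; rewrite hY /Y /H2 mulmxDr -scalemxAr mul_mx_scalar.
  by move: (f' *m _) => V; rewrite !mxE; congr (rspan h _); ring.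
pose W := [set y | rspan h (U ^+ 3 * S ^+ 2 * y)].
apply: (spanP f' W) => [|i].
  split; first by rewrite /W /= mulr0; exact: (idl0 ih).
    by move=> y1 y2 h1 h2; rewrite /W /= mulrDr; exact: (idlD ih).
  by move=> r y1 h1; rewrite /W /= mulrCA; exact: (idlM _ ih).
have := hmul _ (S * U ^+ 2) (cM Th) i; congr (rspan h _).
have -> : (S * U ^+ 2) *: (h *m cM Th) = (S *: (U ^+ 2 *: h)) *m cM Th.
  by rewrite -!scalemxAl scalerA.
have -> : S *: (U ^+ 2 *: h) = U *: (f' *m cM Ts).
  by rewrite hY /Y HE -scalemxAr !scalerA mulrC.
rewrite -scalemxAl -mulmxA -cMM TT' -rmorphXn cC rmorphXn -/pi mul_mx_scalar scalerA !mxE.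
by rewrite -[LHS]/(U * pi ^+ 2 * f' ord0 i) SU; ring.
Qed.
End Patching.

(** * The case n = 2 *)

Section Matrices2.
Variable R : comNzRingType.
Definition mx2 (a b c d : R) : 'M[R]_2 := \matrix_(i, j) nth 0 (nth [::] [:: [:: a; b]; [:: c; d]] i) j.
Definition rv2 (a b : R) : 'rV[R]_2 := \row_j nth 0 [:: a; b] j.

Lemma mx2M a b c d a' b' c' d' : mx2 a b c d *m mx2 a' b' c' d' =
  mx2 (a * a' + b * c') (a * b' + b * d') (c * a' + d * c') (c * b' + d * d').
Proof.
by apply/matrixP => -[[|[|//]] hi] [[|[|//]] hj]; rewrite !mxE !big_ord_recl big_ord0 !mxE /= addr0.
Qed.

Lemma rv2M a b a' b' c' d' : rv2 a b *m mx2 a' b' c' d' = rv2 (a * a' + b * c') (a * b' + b * d').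
Proof.
by apply/rowP => -[[|[|//]] hj]; rewrite !mxE !big_ord_recl big_ord0 !mxE /= addr0.
Qed.

Lemma mx2_scalar a : mx2 a 0 0 a = a%:M.
Proof. by apply/matrixP => -[[|[|//]] hi] [[|[|//]] hj]; rewrite !mxE. Qed.

Lemma rv2Z x a b : x *: rv2 a b = rv2 (x * a) (x * b).
Proof. by apply/rowP => -[[|[|//]] hj]; rewrite !mxE. Qed.

Lemma rspan2 (v : 'I_2 -> R) : rspan (rv2 (v ord0) (v (lift ord0 ord0))) = ispan v.
Proof.
rewrite /rspan; congr (ispan _); apply/funext => -[[|[|//]] hj]; rewrite mxE /=; congr v; exact: val_inj.
Qed.
End Matrices2.

Section LocalTheorem2.
Variable B : comNzRingType.
Hypothesis nB : noeth B.
Variable I : set {poly B}.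
Hypotheses (iI : is_ideal I) (gI : exists2 g, I g & g \is monic).
Hypothesis jac : forall x, I x%:P -> exists y, (1 - x) * y = 1.
Hypothesis dJ : forall q : set B, is_prime_ideal q -> (forall c, I c%:P -> q c) -> dlt 2 q.
Variables (f : 'I_2 -> {poly B}) (a : 'I_2 -> B).
Hypothesis aI : forall x, I x -> ispan a x.[0].
Hypothesis f0 : forall i, (f i).[0] = a i.
Hypothesis fI : forall i, I (f i).
Hypothesis f2 : forall x, I x -> ideal_add (ispan f) (ideal_mul I I) x.
Let i1 : 'I_2 := lift ord0 ord0.

(** Multiplication by K takes I into (f'), so f' serves over constants 1 - u in the contraction L of
    K. The second pair is moved within X I^2 off the zeros of K over L + J; the constants u with uI
    inside (g) then include one that is 1 modulo L. *)
Lemma two_charts : exists f' x0 u, let x := 'X * x0 in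
    let g := fun i : 'I_2 => if i == ord0 then f' i else f' i + x in
  [/\ forall i, I (f' i), forall i, (f' i).[0] = a i, ideal_mul I I x0,
      forall y, I y -> ispan f' ((1 - u)%:P * y) & forall y, I y -> ispan g (u%:P * y)].
Proof.
have [f' [K [e [[If' f'0 mf' f'2] [iK Kf] [Ie Ke e0] KI dK]]]] := residual_ideal nB iI gI dJ aI f0 fI f2.
have nR : noeth {poly B} by exact: hilbert_basis.
pose I2 := ideal_mul I I; have iI2 : is_ideal I2 by exact: ideal_mul_ideal.
pose b := [set z | exists2 y, I2 y & z = 'X * y]; have ib : is_ideal b by exact: mul_ideal.
pose L := polyC @^-1` K; have iL : is_ideal L := preim_ideal polyC iK.
pose J := polyC @^-1` I; have iJ : is_ideal J := preim_ideal polyC iI.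
have iLJ := polyI_ideal (ideal_add_ideal iL iJ).
pose h := f' ord0; pose H := ideal_add (pid h) (polyI (ideal_add L J)).
have iH : is_ideal H := ideal_add_ideal (pid_ideal h) iLJ.
have [P pP HP _|_ [x0 I2x ->] hx] := @avoid_step _ 0 H b (f' i1) nR iH ib.
  have [|PL PJ] := @sum_over _ L J P iL iJ; first by move=> x hx; apply: HP; apply: addr_ => //; exact: pid_ideal.
  have Ph : P h by apply: HP; apply: (addl iLJ); exact: pid_mem.
  exact: (@dlt_residual _ I K P _ _ iK (Kf ord0) mf' dK pP Ph mf' PL PJ).
pose x := 'X * x0; pose g i := if i == ord0 then f' i else f' i + x.
have bI2 : b `<=` I2 by move=> _ [y hy ->]; exact: (idlM _ iI2).
have I2I : I2 `<=` I := square_sub iI.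
have g0 i : (g i).[0] = a i.
  by rewrite /g; case: eqP => _; rewrite ?hornerD ?hornerM ?hornerX ?mul0r ?addr0.
have gf i : I2 (g i - f' i).
  rewrite /g; case: eqP => _; first by rewrite subrr; exact: (idl0 iI2).
  by rewrite addrAC subrr add0r; apply: bI2; exists x0.
have gP P : is_prime_ideal P -> (forall i, P (g i)) -> (forall c, L c -> P c%:P) -> over_J I P -> I `<=` P.
  move=> pP Pg PL PJ; have iP := prime_ideal pP.
  have [bP|nb] := pselect (b `<=` P); last first.
    exfalso; apply: (hx P pP) => //; last by have := Pg i1.
    apply: add_sub => //; last exact: over_sum.
    by apply: pid_sub => //; have := Pg ord0.
  have [PX|nX] := pselect (P 'X); first exact: (over_X aI g0 iP PX Pg).
  move=> y Iy; have : P ('X * (y * y)) by apply: bP; exists (y * y) => //; exact: ideal_mulP.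
  by move=> /(primeM pP) [//|/(primeM pP) []].
have ig := span_ideal g; pose A := [set y | forall z, I z -> ispan g (y * z)].
have iA : is_ideal A.
  split=> [z _|c d Ac Ad z Iz|c d Ad z Iz]; first by rewrite mul0r; exact: (idl0 ig).
    by rewrite mulrDl; apply: (idlD ig); [exact: Ac|exact: Ad].
  by rewrite -mulrA; apply: (idlM _ ig); exact: Ad.
have Ah : A h by move=> z _; apply: (idlMr _ ig); exact: (span_mem g ord0).
have [r [v Iv]] := nR I iI.
have [i|t [N [It ht]]] := @nakayama _ r v (ispan g) I 1 ig iI.
  have Ii : I (v i) by rewrite Iv; exact: span_mem.
  rewrite mul1r -Iv; have [s0 hs [t It <-]] := f'2 _ Ii.
  apply: (idlD (ideal_add_ideal ig iI2)); last exact: (addr_ ig).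
  by apply: (span_congr iI2 _ hs) => j; exact: (idlC iI2).
have At : A (1 - t) by move=> z Iz; rewrite -(expr1n _ N); apply: ht; rewrite -Iv.
have iH2 : is_ideal (ideal_add A (polyI L)) := ideal_add_ideal iA (polyI_ideal iL).
have H1 : ideal_add A (polyI L) 1.
  apply: (jac_comax iI jac iH2 (addl (polyI_ideal iL) Ah) mf') => P pP HP PJ.
  have iP := prime_ideal pP.
  have AP y : A y -> P y by move=> Ay; apply: HP; exact: (addl (polyI_ideal iL)).
  have IP : I `<=` P.
    apply: gP => // [i|c Lc]; first by apply: AP => z _; apply: (idlMr _ ig); exact: span_mem.
    by apply: HP; apply: (addr_ iA); exact: (polyI_C c iL).2.
  apply: (prime_n1 pP); rewrite -(subrK t 1); apply: (idlD iP); [exact: AP|exact: IP].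
have [u [Au [M [q]]]] := contraction_power iA Ah iL H1.
rewrite (monicP mf') !expr1n mulr1 => uL.
exists f', x0, u; split=> // y Iy; apply: KI => //; exact: (idlC iL).
Qed.

Lemma local_generators_2 : exists2 h : 'I_2 -> {poly B}, I = ispan h & forall i, (h i).[0] = a i.
Proof.
have [f' [x0 [u /= [If' f'0 I2x hs hu]]]] := two_charts.
set x := 'X * x0 in hu; set g := fun i => _ in hu; pose s := 1 - u; rewrite -/s in hs.
pose F1 := f' ord0; pose F2 := f' i1; pose G := F2 + x; pose S := (s ^+ 2)%:P : {poly B}; pose U := u%:P : {poly B}.
(* x0 lies in I^2 and sI in (F1, F2), so s^2 x0 is a quadratic form in F1 and F2. *)
have [al [be [ga hx0]]] : exists al be ga, S * x0 = al * F1 ^+ 2 + be * (F1 * F2) + ga * F2 ^+ 2.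
  pose W := [set y | exists al be ga, S * y = al * F1 ^+ 2 + be * (F1 * F2) + ga * F2 ^+ 2].
  suff : ideal_mul I I `<=` W by move/(_ _ I2x).
  apply: ideal_mul_sub => [|y z Iy Iz].
    split; first by exists 0, 0, 0; rewrite !mul0r mulr0 !addr0.
      move=> y z [a1 [b1 [c1 h1]]] [a2 [b2 [c2 h2]]]; exists (a1 + a2), (b1 + b2), (c1 + c2).
      by rewrite mulrDr h1 h2; ring.
    move=> r y [a1 [b1 [c1 h1]]]; exists (r * a1), (r * b1), (r * c1).
    by rewrite mulrCA h1; ring.
  have [c hc] := hs y Iy; have [d hd] := hs z Iz.
  rewrite !big_ord_recl !big_ord0 -/F1 -/F2 /= in hc hd.
  exists (c ord0 * d ord0), (c ord0 * d i1 + c i1 * d ord0), (c i1 * d i1).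
  have -> : S * (y * z) = (s%:P * y) * (s%:P * z) by rewrite /S rmorphXn; ring.
  by rewrite hc hd; ring.
have [p [q R1]] : exists p q, U * F2 = p * F1 + q * G.
  have [c hc] := hu _ (If' i1); exists (c ord0), (c i1).
  by rewrite /U hc !big_ord_recl big_ord0 addr0.
pose w := 'X * (al * F1 + be * F2); pose y := 'X * ga; pose v := S + y * F2.
have R2 : S * G = w * F1 + v * F2.
  by rewrite /G mulrDr /x mulrCA hx0 /w /v /y; ring.
(* The columns express S U F1 and S U G in F1, F2. The multiples -qy and py of the Koszul relation
   (F2, -F1) are chosen to make the determinant (S U)^2. As w and y are multiples of X, the matrix
   is the scalar S U at X = 0. *)
pose ta := S * U - q * y * F2; pose tb := U * w + y * p * F2; pose tc := q * y * F1; pose td := U * v - y * p * F1.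
have det : ta * td - tb * tc = (S * U) ^+ 2.
  have -> : ta * td - tb * tc = S * U ^+ 2 * v - S * U * y * p * F1 - U * q * y * (w * F1 + v * F2).
    by rewrite /ta /tb /tc /td; ring.
  rewrite -R2; have -> : S * U ^+ 2 * v - S * U * y * p * F1 - U * q * y * (S * G) =
    S * U ^+ 2 * v - S * U * y * (p * F1 + q * G) by ring.
  by rewrite -R1 /v; ring.
have piE : ((s ^+ 2 * u)%:P : {poly B}) = S * U by rewrite polyCM.
have su : s + u = 1 by rewrite subrK.
(* Patching uses s^2 and u, whose cubes are s^6 and u^3. *)
have [b1 [b2 bb]] := comax_powers 6 3 su; rewrite (exprM s 2 3) in bb.
have [|||i j|h [h1 h2 [N1 h3] [N2 h4]]] := @quillen_patch B 2 (rv2 F1 F2) (rv2 F1 G)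
    (mx2 ta tb tc td) (mx2 td (- tb) (- tc) ta) (s ^+ 2) u _ _ _ _ b1 b2 bb.
- by rewrite mx2M piE -mx2_scalar -det; congr mx2; ring.
- by rewrite mx2M piE -mx2_scalar -det; congr mx2; ring.
- rewrite rv2M piE rv2Z; congr rv2; first by rewrite /ta /tc; ring.
  have -> : S * U * G = U * (S * G) by ring. 
  by rewrite R2 /tb /td; ring.
- have [ta0 tb0 tc0 td0] : [/\ ta.[0] = s ^+ 2 * u, tb.[0] = 0, tc.[0] = 0 & td.[0] = s ^+ 2 * u].
    rewrite /ta /tb /tc /td /v /w /y /S /U !(hornerD, hornerN, hornerM, hornerC, hornerX).
    by split; ring.
  case: i j => [[|[|//]] hi] [[|[|//]] hj]; rewrite !mxE /= ?hornerN ?ta0 ?tb0 ?tc0 ?td0 ?oppr0 //.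
exists (fun i => h ord0 i).
  have gE : rspan (rv2 F1 G) = ispan g by rewrite -(rspan2 g).
  have fE : rspan (rv2 F1 F2) = ispan f' by rewrite -(rspan2 f').
  have ih : is_ideal (rspan h) by exact: span_ideal.
  apply/seteqP; split=> [z Iz|]; last first.
    apply: span_sub => // i; apply: h1 => // {}i; case: i => [[|[|//]] hi]; rewrite mxE /=; try exact: If'.
    apply: (idlD iI); first exact: If'.
    by apply: (idlM _ iI); apply: (square_sub iI).
  have [c1 [c2 hc]] := comax_powers (2 * N1).+1 N2.+1 su.
  have -> : z = (c1)%:P * (((s ^+ 2) ^+ N1)%:P * (s%:P * z)) + c2%:P * ((u ^+ N2)%:P * (u%:P * z)).
    have e1 : s ^+ (2 * N1).+1 = (s ^+ 2) ^+ N1 * s by rewrite exprSr exprM.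
    have e2 : u ^+ N2.+1 = u ^+ N2 * u by rewrite exprSr.
    by rewrite -[LHS]mul1r -[1]/(1%:P) -hc e1 e2 polyCD !polyCM; ring.
  apply: (idlD ih); apply: (idlM _ ih); first by apply: h3; rewrite fE; exact: hs.
  by apply: h4; rewrite gE; exact: hu.
apply: h2 => -[[|[|//]] hi]; rewrite mxE /=.
- by rewrite -f'0; congr (f' _).[0]; exact: val_inj.
- by rewrite -f'0; congr (f' _).[0]; exact: val_inj.
- by rewrite -f'0; congr (f' _).[0]; exact: val_inj.
rewrite /G hornerD /x hornerM hornerX mul0r addr0 -f'0; congr (f' _).[0]; exact: val_inj.
Qed.
End LocalTheorem2.

Local Open Scope quotient_scope.

(** * Localization and descent *)

(** Excluding 0 makes the localization a nonzero ring, as [comNzRingType] requires. *)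
Record mult_set (A : comNzRingType) := MultSet {
  denoms : set A;
  denoms1 : denoms 1;
  denomsM : forall x y, denoms x -> denoms y -> denoms (x * y);
  denoms0 : ~ denoms 0 }.

Section Localization.
Variables (A : comNzRingType) (M : mult_set A).
Local Notation S := (denoms M).

(* Pairs with an inadmissible denominator stand for [x.1 / 1]. *)
Definition denom (x : A * A) : A := if `[< S x.2 >] then x.2 else 1.
Lemma denomP x : S (denom x).
Proof. by rewrite /denom; case: asboolP => // _; exact: denoms1. Qed.
Lemma denomE a s : S s -> denom (a, s) = s.
Proof. by move=> Ss; rewrite /denom; case: asboolP. Qed.

Definition loc_eq (x y : A * A) : bool :=
  `[< exists2 t, S t & t * (x.1 * denom y - y.1 * denom x) = 0 >].

Lemma loc_eq_refl : reflexive loc_eq.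
Proof. by move=> x; apply/asboolP; exists 1; [exact: denoms1|rewrite subrr mulr0]. Qed.
Lemma loc_eq_sym : symmetric loc_eq.
Proof.
suff h x y : loc_eq x y -> loc_eq y x by move=> x y; apply/idP/idP; exact: h.
by move=> /asboolP [t St e]; apply/asboolP; exists t; rewrite // -opprB mulrN e oppr0.
Qed.
Lemma loc_eq_trans : transitive loc_eq.
Proof.
move=> y x z /asboolP [t St e] /asboolP [t' St' e']; apply/asboolP.
exists (t * t' * denom y); first exact: (denomsM (denomsM St St') (denomP y)).
transitivity (t' * denom z * (t * (x.1 * denom y - y.1 * denom x)) +
  t * denom x * (t' * (y.1 * denom z - z.1 * denom y))); first by ring.
by rewrite e e' !mulr0 addr0.
Qed.
Canonical loc_equiv := EquivRel loc_eq loc_eq_refl loc_eq_sym loc_eq_trans.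

Definition loc : Type := {eq_quot loc_equiv}.
HB.instance Definition _ := Choice.on loc.
HB.instance Definition _ : EqQuotient (A * A)%type loc_equiv loc := EqQuotient.on loc.

Definition frac (a s : A) : loc := \pi_loc (a, s).
Definition num (u : loc) : A := (repr u).1.
Definition den (u : loc) : A := denom (repr u).

Lemma den_mem u : S (den u). Proof. exact: denomP. Qed.
Lemma frac_eq a s a' s' : S s -> S s' ->
  frac a s = frac a' s' <-> exists2 t, S t & t * (a * s' - a' * s) = 0.
Proof.
move=> Ss Ss'; rewrite /frac; split.
  by move=> /eqP; rewrite eqmodE => /asboolP /=; rewrite !denomE.
by move=> h; apply/eqP; rewrite eqmodE; apply/asboolP; rewrite /= !denomE.
Qed.
Lemma fracK u : frac (num u) (den u) = u.
Proof.
rewrite -[RHS]reprK /frac; apply/eqP; rewrite eqmodE; apply/asboolP.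
exists 1; first exact: denoms1.
by rewrite /= denomE ?subrr ?mulr0 //; exact: denomP.
Qed.
Lemma frac_repr a s : S s -> exists2 t, S t & t * (num (frac a s) * s - a * den (frac a s)) = 0.
Proof. by move=> Ss; apply/frac_eq => //; [exact: den_mem|exact: fracK]. Qed.
Lemma fracP u : exists a s, S s /\ u = frac a s.
Proof. by exists (num u), (den u); split; [exact: den_mem|rewrite fracK]. Qed.

Definition loc_add (u v : loc) := frac (num u * den v + num v * den u) (den u * den v).
Definition loc_mul (u v : loc) := frac (num u * num v) (den u * den v).
Definition loc_opp (u : loc) := frac (- num u) (den u).

Lemma frac_add a s a' s' : S s -> S s' ->
  loc_add (frac a s) (frac a' s') = frac (a * s' + a' * s) (s * s').
Proof.
move=> Ss Ss'; have [t St e] := frac_repr a Ss; have [t' St' e'] := frac_repr a' Ss'.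
move: (den_mem (frac a s)) (den_mem (frac a' s')) e e'; rewrite /loc_add.
move: (num (frac a s)) (den (frac a s)) (num (frac a' s')) (den (frac a' s')) => n d n' d' Sd Sd' e e'.
apply/frac_eq; [exact: denomsM|exact: denomsM|].
exists (t * t'); first exact: denomsM.
transitivity (t' * d' * s' * (t * (n * s - a * d)) + t * d * s * (t' * (n' * s' - a' * d'))); first by ring.
by rewrite e e' !mulr0 addr0.
Qed.
Lemma frac_mul a s a' s' : S s -> S s' -> loc_mul (frac a s) (frac a' s') = frac (a * a') (s * s').
Proof.
move=> Ss Ss'; have [t St e] := frac_repr a Ss; have [t' St' e'] := frac_repr a' Ss'.
move: (den_mem (frac a s)) (den_mem (frac a' s')) e e'; rewrite /loc_mul.
move: (num (frac a s)) (den (frac a s)) (num (frac a' s')) (den (frac a' s')) => n d n' d' Sd Sd' e e'.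
apply/frac_eq; [exact: denomsM|exact: denomsM|].
exists (t * t'); first exact: denomsM.
transitivity (t' * n' * s' * (t * (n * s - a * d)) + t * a * d * (t' * (n' * s' - a' * d'))); first by ring.
by rewrite e e' !mulr0 addr0.
Qed.
Lemma frac_opp a s : S s -> loc_opp (frac a s) = frac (- a) s.
Proof.
move=> Ss; have [t St e] := frac_repr a Ss; move: (den_mem (frac a s)) e; rewrite /loc_opp.
move: (num _) (den _) => n d Sd e; apply/frac_eq => //; exists t => //.
by rewrite -[RHS]oppr0 -e; ring.
Qed.

Lemma frac_ext a s a' s' : S s -> S s' -> a * s' = a' * s -> frac a s = frac a' s'.
Proof. by move=> Ss Ss' e; apply/frac_eq => //; exists 1; [exact: denoms1|rewrite e subrr mulr0]. Qed.

Fact loc_addA : associative loc_add.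
Proof.
move=> u v w; have [a [r [Sr ->]]] := fracP u; have [b [s [Ss ->]]] := fracP v.
have [c [t [St ->]]] := fracP w; have Srs := denomsM Sr Ss; have Sst := denomsM Ss St.
by rewrite !frac_add //; apply: frac_ext; [exact: denomsM|exact: denomsM|ring].
Qed.
Fact loc_addC : commutative loc_add.
Proof.
move=> u v; have [a [r [Sr ->]]] := fracP u; have [b [s [Ss ->]]] := fracP v.
by rewrite !frac_add //; apply: frac_ext; [exact: denomsM|exact: denomsM|ring].
Qed.
Fact loc_add0 : left_id (frac 0 1) loc_add.
Proof.
move=> u; have [a [r [Sr ->]]] := fracP u; have S1 := denoms1 M.
by rewrite !frac_add //; apply: frac_ext; [exact: denomsM| |ring].
Qed.
Fact loc_addN : left_inverse (frac 0 1) loc_opp loc_add.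
Proof.
move=> u; have [a [r [Sr ->]]] := fracP u; have S1 := denoms1 M.
by rewrite frac_opp // frac_add //; apply: frac_ext; [exact: denomsM| |ring].
Qed.
HB.instance Definition _ := GRing.isZmodule.Build loc loc_addA loc_addC loc_add0 loc_addN.

Fact loc_mulA : associative loc_mul.
Proof.
move=> u v w; have [a [r [Sr ->]]] := fracP u; have [b [s [Ss ->]]] := fracP v.
have [c [t [St ->]]] := fracP w; have Srs := denomsM Sr Ss; have Sst := denomsM Ss St.
by rewrite !frac_mul //; apply: frac_ext; [exact: denomsM|exact: denomsM|ring].
Qed.
Fact loc_mulC : commutative loc_mul.
Proof.
move=> u v; have [a [r [Sr ->]]] := fracP u; have [b [s [Ss ->]]] := fracP v.
by rewrite !frac_mul //; apply: frac_ext; [exact: denomsM|exact: denomsM|ring].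
Qed.
Fact loc_mul1 : left_id (frac 1 1) loc_mul.
Proof.
move=> u; have [a [r [Sr ->]]] := fracP u; have S1 := denoms1 M.
by rewrite !frac_mul //; apply: frac_ext; [exact: denomsM| |ring].
Qed.
Fact loc_mulD : left_distributive loc_mul loc_add.
Proof.
move=> u v w; have [a [r [Sr ->]]] := fracP u; have [b [s [Ss ->]]] := fracP v.
have [c [t [St ->]]] := fracP w.
have Srs := denomsM Sr Ss; have Sst := denomsM Ss St; have Srt := denomsM Sr St.
by rewrite !(frac_mul, frac_add) //; apply: frac_ext; [exact: denomsM|exact: denomsM|ring].
Qed.
Fact loc_one_neq0 : frac 1 1 != frac 0 1.
Proof.
have S1 := denoms1 M; apply/eqP => /(frac_eq 1 0 S1 S1) [t St].
by rewrite !mulr1 subr0 mulr1 => t0; apply: (denoms0 (m := M)); rewrite -t0.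
Qed.
HB.instance Definition _ := GRing.Zmodule_isComNzRing.Build loc
  loc_mulA loc_mulC loc_mul1 loc_mulD loc_one_neq0.

Definition loc_in (a : A) : loc := frac a 1.
Fact loc_in_zmod : zmod_morphism loc_in.
Proof.
have S1 := denoms1 M; move=> a b; rewrite /loc_in -[LHS]/(frac _ 1) -[RHS]/(loc_add (frac a 1) (loc_opp (frac b 1))).
by rewrite frac_opp // frac_add //; apply: frac_ext; [|exact: denomsM|ring].
Qed.
Fact loc_in_monoid : monoid_morphism loc_in.
Proof.
have S1 := denoms1 M; split=> // a b; rewrite /loc_in -[RHS]/(loc_mul (frac a 1) (frac b 1)).
by rewrite frac_mul //; apply: frac_ext; [|exact: denomsM|ring].
Qed.
HB.instance Definition _ := GRing.isZmodMorphism.Build A loc loc_in loc_in_zmod.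
HB.instance Definition _ := GRing.isMonoidMorphism.Build A loc loc_in loc_in_monoid.

Lemma loc_unit s : S s -> exists y, loc_in s * y = 1.
Proof.
have S1 := denoms1 M; move=> Ss; exists (frac 1 s); rewrite -[LHS]/(loc_mul (frac s 1) (frac 1 s)).
by rewrite frac_mul //; apply: frac_ext; [exact: denomsM| |ring].
Qed.
Lemma loc_frac u : exists a s, S s /\ u * loc_in s = loc_in a.
Proof.
have S1 := denoms1 M; have [a [s [Ss ->]]] := fracP u; exists a, s; split=> //.
rewrite -[LHS]/(loc_mul (frac a s) (frac s 1)) frac_mul //.
by apply: frac_ext; [exact: denomsM| |ring].
Qed.
Lemma loc_ker a : loc_in a = 0 -> exists2 s, S s & s * a = 0.
Proof.
have S1 := denoms1 M; move=> /(frac_eq a 0 S1 S1) [t St].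
by rewrite mul0r subr0 mulr1; exists t.
Qed.
End Localization.

(** * Polynomials over a localization *)

Section LocalizedPolynomials.
Variables (A : comNzRingType) (M : mult_set A).
Local Notation S := (denoms M).
Local Notation B := (loc M).
Let lam : {rmorphism A -> B} := loc_in M.
Let mp : {rmorphism {poly A} -> {poly B}} := map_poly lam.

Let mpX : mp 'X = 'X. Proof. exact: map_polyX. Qed.
Let mpC c : mp c%:P = (lam c)%:P. Proof. exact: map_polyC. Qed.

Lemma common_denom n (Q : 'I_n -> A -> Prop) : (forall i, exists2 s, S s & Q i s) ->
  (forall i s t, Q i s -> Q i (t * s)) -> exists2 s, S s & forall i, Q i s.
Proof.
move=> h hQ.
have /choice [s hs] : forall i, exists s, S s /\ Q i s by move=> i; have [s S1 S2] := h i; exists s.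
exists (\prod_i s i).
  by apply: (big_ind S) => [|x y|i _]; [exact: denoms1|exact: denomsM|have [] := hs i].
by move=> i; rewrite (bigD1 i) //= mulrC; apply: hQ; have [] := hs i.
Qed.

Lemma poly_frac (F : {poly B}) : exists s G, S s /\ (lam s)%:P * F = mp G.
Proof.
elim/poly_ind: F => [|F c [s [G [Ss e]]]].
  by exists 1, 0; split; [exact: denoms1|rewrite mulr0 rmorph0].
have [a [t [St e']]] := loc_frac c; exists (s * t), (t%:P * G * 'X + (s * a)%:P); split; first exact: denomsM.
have e2 : lam (s * a) = lam s * (c * lam t) by rewrite rmorphM e'.
by rewrite rmorphD !(rmorphM mp) mpX !mpC -e e2 (rmorphM lam) !polyCM; ring.
Qed.

Lemma poly_ker (G : {poly A}) : mp G = 0 -> exists2 s, S s & s%:P * G = 0.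
Proof.
elim/poly_ind: G => [_|G c IH]; first by exists 1; [exact: denoms1|rewrite mulr0].
rewrite rmorphD rmorphM mpX mpC => /polyP e.
have [|s Ss hs] := IH.
  by apply/polyP => i; have := e i.+1; rewrite coefD coefMX coefC /= addr0 !coef0.
have [|t St ht] := @loc_ker _ M c; first by have := e 0%N; rewrite coefD coefMX coefC /= add0r coef0.
exists (s * t); first exact: denomsM.
transitivity (t%:P * 'X * (s%:P * G) + s%:P * (t * c)%:P); first by rewrite !polyCM; ring.
by rewrite hs ht !mulr0 addr0.
Qed.

Lemma noeth_loc : noeth A -> noeth B.
Proof.
move=> nA H iH; have [n [v hv]] := nA _ (preim_ideal lam iH).
exists n, (lam \o v)%FUN; apply/seteqP; split; last first.
  by apply: span_sub => // i; have : (lam @^-1` H) (v i) by rewrite hv; exact: span_mem.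
move=> u Hu; have [a [s [Ss e]]] := loc_frac u; have [y hy] := loc_unit Ss.
have : (lam @^-1` H) a by rewrite /= -[lam a]e; exact: (idlMr _ iH).
rewrite hv => -[c hc]; have iv := span_ideal (lam \o v)%FUN.
have -> : u = y * lam a by rewrite -[lam a]e mulrCA -/lam [y * _]mulrC -[lam s]/(loc_in M s) hy mulr1.
by apply: (idlM _ iv); exists (lam \o c)%FUN; rewrite hc rmorph_sum; apply: eq_bigr => i _; rewrite rmorphM.
Qed.

Lemma dlt_loc d (q : set B) : is_prime_ideal q -> dlt d (lam @^-1` q) -> dlt d q.
Proof.
elim: d q => // d IH q pq h q' pq' [h1 h2]; apply: IH => //; apply: h; first exact: preim_prime.
split=> [x|hx]; first exact: h1.
apply: h2 => u qu; have [a [s [Ss e]]] := loc_frac u; have [y hy] := loc_unit Ss.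
have -> : u = y * lam a by rewrite -[lam a]e mulrCA [y * _]mulrC hy mulr1.
apply: (idlM _ (prime_ideal pq)); apply: hx => /=; rewrite -[lam a]e.
exact: (idlMr _ (prime_ideal pq')).
Qed.

(** The ideal generated by I over the localization: one denominator serves all the coefficients. *)
Definition loc_ext (I : set {poly A}) : set {poly B} :=
  [set F | exists s G, [/\ S s, I G & (lam s)%:P * F = mp G]].

Lemma loc_ext_ideal I : is_ideal I -> is_ideal (loc_ext I).
Proof.
move=> iI; split.
- by exists 1, 0; split; [exact: denoms1|exact: (idl0 iI)|rewrite mulr0 rmorph0].
- move=> F F' [s [G [Ss IG e]]] [s' [G' [Ss' IG' e']]].
  exists (s * s'), (s'%:P * G + s%:P * G'); split; first exact: denomsM.
    by apply: (idlD iI); exact: (idlM _ iI).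
  rewrite rmorphD !(rmorphM mp) !mpC -e -e' rmorphM polyCM; ring.
move=> H F [s [G [Ss IG e]]]; have [t [K [St e']]] := poly_frac H.
exists (t * s), (K * G); split; [exact: denomsM|exact: (idlM _ iI)|].
by rewrite (rmorphM mp) -e -e' (rmorphM lam) polyCM; ring.
Qed.

Lemma loc_ext_map (I : set {poly A}) G : I G -> loc_ext I (mp G).
Proof. by move=> IG; exists 1, G; split; [exact: denoms1| |rewrite rmorph1 mul1r]. Qed.

Lemma loc_ext_sub (I : set {poly A}) (H : set {poly B}) : is_ideal H ->
  (forall G, I G -> H (mp G)) -> loc_ext I `<=` H.
Proof.
move=> iH h F [s [G [Ss IG e]]]; have [y hy] := loc_unit Ss.
have -> : F = y%:P * mp G by rewrite -e mulrA -polyCM [y * _]mulrC hy mul1r.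
by apply: (idlM _ iH); exact: h.
Qed.
End LocalizedPolynomials.

Section GeneratorsUpToUnit.
Variables (A : comNzRingType) (I : set {poly A}).
Hypotheses (nA : noeth A) (iI : is_ideal I) (gI : exists2 g, I g & g \is monic) (nI : ~ I 1).
Variable m : nat.
Hypothesis dJ : forall q : set A, is_prime_ideal q -> (forall c, I c%:P -> q c) -> dlt m.+2 q.
Variables (k : fieldType) (kap : {rmorphism k -> A}) (X : seq A) (p : nat).
Hypotheses (gA : alg_gen kap [set` X]) (kclosed : GRing.closed_field_axiom k) (pk : p \in [pchar k]).
Hypothesis kfin : forall x : k, exists2 s, (0 < s)%N & x ^+ (p ^ s) = x.
Variables (f : 'I_m.+2 -> {poly A}) (a : 'I_m.+2 -> A) (s0 : A).
Hypothesis Is0 : I s0%:P.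
Hypothesis aI : forall x, I x -> ispan a ((1 - s0) * x.[0]).
Hypothesis f0 : forall i, (f i).[0] = a i.
Hypothesis fI : forall i, I (f i).
Hypothesis f2 : forall x, I x -> ideal_add (ispan f) (ideal_mul I I) x.

(** The set 1 + J for the contraction J of I; it omits 0 because I is proper. It is transparent so
    that membership unfolds to a statement about I. *)
Definition one_plus : mult_set A.
Proof.
apply: (@MultSet A [set x | I (x - 1)%:P]) => /=.
- by rewrite subrr; exact: (idl0 iI).
- move=> x y h1 h2; have -> : (x * y - 1)%:P = x%:P * (y - 1)%:P + (x - 1)%:P :> {poly A}.
    by rewrite !polyCB polyCM; ring.
  by apply: (idlD iI) => //; exact: (idlM _ iI).
- by rewrite sub0r => h; apply: nI; rewrite -[1]opprK; apply: (idlN iI); rewrite -[1]/(1%:P) -polyCN.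
Defined.

Lemma generators_up_to_unit : exists (F : 'I_m.+2 -> {poly A}) w q,
  [/\ forall i, I (F i), forall i, (F i).[0] = w * a i, I (w - 1)%:P, I (q - 1)%:P &
      forall x, I x -> ispan F (q%:P * x)].
Proof.
pose M := one_plus; pose S := denoms M; pose B := loc M.
pose lam : {rmorphism A -> B} := loc_in M; pose mp : {rmorphism {poly A} -> {poly B}} := map_poly lam.
have SE x : S x <-> I (x - 1)%:P by [].
pose IB := @loc_ext A M I; have iIB : is_ideal IB := @loc_ext_ideal A M I iI.
have mpC c : mp c%:P = (lam c)%:P by exact: map_polyC.
have mp0 G : (mp G).[0] = lam G.[0] by rewrite -{1}(rmorph0 lam) horner_map.
have IBm G : I G -> IB (mp G) by exact: loc_ext_map.
have gIB : exists2 g, IB g & g \is monic.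
  by have [g Ig mg] := gI; exists (mp g); [exact: IBm|exact: monic_map].
have JB u : IB u%:P -> exists c s, [/\ S s, I c%:P & u * lam s = lam c].
  move=> [s [G [Ss IG e]]]; have [c [s' [Ss' e']]] := loc_frac u.
  have [|t St ht] := @poly_ker _ M ((s * c)%:P - s'%:P * G).
    rewrite rmorphB (rmorphM mp) !mpC -e; apply/eqP; rewrite subr_eq0 -!polyCM; apply/eqP; congr (_%:P).
    by rewrite rmorphM -[lam c]e' -/lam; ring.
  exists (t * (s * c)), (t * (s * s')); split; first by do 2?apply: denomsM.
    rewrite polyCM -[(s * c)%:P](subrK (s'%:P * G)) mulrDr ht add0r.
    by do 2!apply: (idlM _ iI).
  by rewrite !rmorphM -[lam c]e' -/lam; ring.
have jac u : IB u%:P -> exists y, (1 - u) * y = 1.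
  move=> /JB [c [s [Ss Ic e]]].
  have [|y hy] := @loc_unit _ M (s - c); first by apply/SE; rewrite addrAC polyCB; exact: (idlB iI).
  exists (lam s * y); rewrite mulrA mulrBl mul1r e -rmorphB; exact: hy.
have dB q : is_prime_ideal q -> (forall c, IB c%:P -> q c) -> dlt m.+2 q.
  move=> pq hq; apply: (dlt_loc pq); apply: dJ; first exact: preim_prime.
  by move=> c Ic; apply: hq; rewrite -mpC; exact: IBm.
(* A fraction c/s agrees with c modulo the extension of J, since s is 1 modulo J. *)
have lam_surj u : exists x, IB (u - lam x)%:P.
  have [c [s [Ss e]]] := loc_frac u; exists c; rewrite -[lam c]e.
  have e1 : lam (s - 1) = lam s - 1 by rewrite rmorphB rmorph1.
  have -> : (u - u * lam s)%:P = - (u%:P * mp (s - 1)%:P) by rewrite mpC e1 -polyCM -polyCN; congr (_%:P); ring.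
  by apply: (idlN iIB); apply: (idlM _ iIB); apply: IBm.
have [y0 hy0] : exists y, lam (1 - s0) * y = 1.
  by apply: loc_unit; apply/SE; rewrite addrAC subrr add0r polyCN; exact: (idlN iI).
have spanm n (v : 'I_n -> A) x : ispan v x -> ispan (lam \o v)%FUN (lam x).
  by move=> [c ->]; exists (lam \o c)%FUN; rewrite rmorph_sum; apply: eq_bigr => i _; rewrite rmorphM.
have spanmp n (v : 'I_n -> {poly A}) x : ispan v x -> ispan (mp \o v)%FUN (mp x).
  by move=> [c ->]; exists (mp \o c)%FUN; rewrite rmorph_sum; apply: eq_bigr => i _; rewrite rmorphM.
have aIB x : IB x -> ispan (lam \o a)%FUN x.[0].
  have il := span_ideal (lam \o a)%FUN.
  suff : IB `<=` [set x | ispan (lam \o a)%FUN x.[0]] by apply.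
  apply: loc_ext_sub => [|G IG].
    split; first by rewrite /= horner0; exact: (idl0 il).
      by move=> u v h1 h2; rewrite /= hornerD; exact: (idlD il).
    by move=> u v h; rewrite /= hornerM; exact: (idlM _ il).
  rewrite /= mp0 -[lam _]mul1r -hy0 mulrAC mulrC -rmorphM; apply: (idlM _ il).
  by apply: spanm; exact: aI.
have f2B x : IB x -> ideal_add (ispan (mp \o f)%FUN) (ideal_mul IB IB) x.
  have i2 := ideal_mul_ideal IB IB; have il := span_ideal (mp \o f)%FUN.
  have iW := ideal_add_ideal il i2.
  suff : IB `<=` ideal_add (ispan (mp \o f)%FUN) (ideal_mul IB IB) by apply.
  apply: (loc_ext_sub iW) => G IG; have [s hs [t ht <-]] := f2 IG; rewrite rmorphD; apply: (idlD iW).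
    by apply: (addl i2); exact: spanmp.
  apply: (addr_ il); suff : ideal_mul I I `<=` mp @^-1` (ideal_mul IB IB) by apply.
  apply: ideal_mul_sub => [|u v Iu Iv]; first exact: preim_ideal.
  by rewrite /= rmorphM; apply: ideal_mulP; exact: IBm.
have f0B i : ((mp \o f)%FUN i).[0] = (lam \o a)%FUN i by rewrite /= mp0 f0.
have fIB i : IB ((mp \o f)%FUN i) by exact: IBm.
have nB : noeth B by exact: noeth_loc.
have local m' (a' : 'I_m'.+2 -> B) (g : 'I_m'.+2 -> {poly B}) :
    (forall q : set B, is_prime_ideal q -> (forall c, IB c%:P -> q c) -> dlt m'.+2 q) ->
    (forall x, IB x -> ispan a' x.[0]) -> (forall i, (g i).[0] = a' i) -> (forall i, IB (g i)) ->
    (forall x, IB x -> ideal_add (ispan g) (ideal_mul IB IB) x) ->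
    exists2 h : 'I_m'.+2 -> {poly B}, IB = ispan h & forall i, (h i).[0] = a' i.
  case: m' a' g => [|m'] a' g dB' h1 h2 h3 h4; first exact: (local_generators_2 nB iIB gIB jac dB' h1 h2 h3 h4).
  exact: (local_generators_ge3 nB iIB gIB jac dB' lam_surj gA kclosed pk kfin h1 h2 h3 h4).
have [h Ih h0] := local _ _ _ dB aIB f0B fIB f2B.
(* The denominator is enlarged until the value at 0 is s a i in A, and not merely after
   localization. *)
have [||s Ss hs] := @common_denom _ M _ (fun i s => exists G, [/\ I G, (lam s)%:P * h i = mp G & G.[0] = s * a i]).
- move=> i; have [s [G [Ss IG e]]] : IB (h i) by rewrite Ih; exact: span_mem.
  have [|t St ht] := @loc_ker _ M (G.[0] - s * a i).
    rewrite -[loc_in M _]/(lam _) rmorphB rmorphM -mp0 -e hornerM hornerC h0 /= subrr //.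
  exists (t * s); first exact: denomsM.
  exists (t%:P * G); split; first exact: (idlM _ iI).
    by rewrite (rmorphM mp) mpC -e rmorphM polyCM mulrA.
  by rewrite hornerM hornerC; apply/eqP; rewrite -subr_eq0 -mulrA -mulrBr ht.
- move=> i s t [G [IG e e0]]; exists (t%:P * G); split; first exact: (idlM _ iI).
    by rewrite (rmorphM mp) mpC -e rmorphM polyCM mulrA.
  by rewrite hornerM hornerC e0 mulrA.
have /choice [F hF] := hs.
have nR : noeth {poly A} by exact: hilbert_basis.
have [r [v Iv]] := nR I iI; have iF := span_ideal F.
have [||q Sq hq] := @common_denom _ M _ (fun i t => ispan F (t%:P * v i)).
- move=> j; have Ij : I (v j) by rewrite Iv; exact: span_mem.
  have : IB (mp (v j)) by exact: IBm.
  rewrite Ih => -[c hc].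
  have [||t St] := @common_denom _ M _ (fun i t => exists C, (lam t)%:P * c i = mp C).
  + by move=> i; have [t [C [St e]]] := poly_frac (c i); exists t => //; exists C.
  + by move=> i t t' [C e]; exists (t'%:P * C); rewrite (rmorphM mp) mpC -e rmorphM polyCM mulrA.
  move=> /choice [C hC].
  have [|t' St' ht'] := @poly_ker _ M ((t * s)%:P * v j - \sum_i C i * F i).
    rewrite rmorphB (rmorphM mp) mpC -/mp hc rmorph_sum mulr_sumr -sumrB big1 // => i _.
    have [_ e _] := hF i; rewrite (rmorphM mp) -hC -e rmorphM polyCM; ring.
  exists (t' * (t * s)); first by do 2?apply: denomsM.
  exists (fun i => t'%:P * C i); rewrite polyCM -mulrA.
  rewrite -[X in _ * X](subrK (\sum_i C i * F i)) mulrDr ht' add0r mulr_sumr.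
  by apply: eq_bigr => i _; rewrite mulrA.
- by move=> i t t' ht; rewrite polyCM -mulrA; exact: (idlM _ iF).
exists F, s, q; split; rewrite -?SE //; try by move=> i; have [] := hF i.
move=> x; rewrite {1}Iv => -[c ->]; rewrite mulr_sumr; apply: (idl_sum _ iF) => i _.
by rewrite mulrCA; apply: (idlM _ iF); exact: hq.
Qed.
End GeneratorsUpToUnit.

(** * Descent from the localization *)

Section Descent.
Variables (A : comNzRingType) (I1 I2 : set {poly A}) (n : nat) (a : 'I_n -> A) (F : 'I_n -> {poly A}) (w p : A).
Hypotheses (i1 : is_ideal I1) (i2 : is_ideal I2).
Let L : set A := polyC @^-1` I2.
Hypothesis I2L : I2 `<=` polyI L.
Hypothesis La : forall i, L (a i).
Hypothesis Ia : forall x, I1 x -> I2 x -> ispan a x.[0].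
Hypotheses (IF : forall i, I1 (F i)) (F0 : forall i, (F i).[0] = w * a i).
Hypotheses (w1 : I1 (w - 1)%:P) (p1 : I1 (p - 1)%:P) (Lp : L p).
Hypothesis pF : forall x, I1 x -> ispan F (p%:P * x).

(* [h] is the quotient by [w] of F(w p X). *)
Lemma descend : exists h : 'I_n -> {poly A},
  [/\ forall i, (I1 `&` I2) (h i), I1 `&` I2 = ispan h & forall i, (h i).[0] = a i].
Proof.
have iL : is_ideal L := preim_ideal polyC i2.
have /choice [Q hQ] : forall i, exists Q, F i = (w * a i)%:P + Q * 'X.
  by move=> i; have [q hq] := poly_at0 (F i); exists q; rewrite -F0.
pose W := w%:P : {poly A}; pose P := p%:P : {poly A}; pose sg (q : {poly A}) := q \Po ((w * p)%:P * 'X).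
pose h i := (a i)%:P + P * sg (Q i) * 'X.
have hF i : sg (F i) = W * h i.
  rewrite /h {1}/sg hQ comp_polyD comp_polyC comp_polyM comp_polyX -/(sg (Q i)).
  by move: (sg (Q i)) => z; rewrite /W /P !polyCM; ring.
have h0 i : (h i).[0] = a i by rewrite /h hornerD hornerM hornerX mulr0 addr0 hornerC.
have I1W : I1 (W - 1) by rewrite /W -[1]/(1%:P) -polyCB.
have I1P : I1 (P - 1) by rewrite /P -[1]/(1%:P) -polyCB.
have I1WP : I1 (W * P - 1).
  have -> : W * P - 1 = W * (P - 1) + (W - 1) by ring.
  by apply: (idlD i1) => //; exact: (idlM _ i1).
have sgC q (D : set {poly A}) : is_ideal D -> D (W * P - 1) -> D (sg q - q).
  move=> iD hD; rewrite /sg -[X in _ - X]comp_polyXr; apply: (comp_congr _ iD).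
  rewrite -[X in _ - X]mul1r -mulrBl polyCM; exact: (idlMr _ iD).
have hI1 i : I1 (h i).
  have : I1 (W * h i) by rewrite -hF; apply: (idlDl i1 (sgC _ _ i1 I1WP) (IF i)).
  move=> hw; apply: (idlDl i1 _ hw); have -> : h i - W * h i = - ((W - 1) * h i) by ring.
  by apply: (idlN i1); exact: (idlMr _ i1).
have hI2 i : I2 (h i).
  apply: (idlD i2); first exact: La.
  by do 2!apply: (idlMr _ i2); exact: Lp.
have ih := span_ideal h.
have sgF q : ispan F q -> ispan h (sg q).
  move=> [c ->]; rewrite /sg rmorph_sum; apply: (idl_sum _ ih) => i _; rewrite rmorphM /=.
  by rewrite -/(sg _) -/(sg (F i)) hF mulrCA; do 2!apply: (idlM _ ih); exact: span_mem.
have cst c : I1 c%:P -> ispan h (P * c%:P).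
  by move=> Ic; have := sgF _ (pF Ic); rewrite /sg -polyCM comp_polyC.
have h1 : ispan h (P * (1 - P)).
  by rewrite /P -[1]/(1%:P) -polyCB; apply: cst; rewrite -opprB polyCN; exact: (idlN i1).
have h2 : ispan h (P * (W * P - 1)).
  by rewrite /W /P -polyCM -[1]/(1%:P) -polyCB; apply: cst; rewrite polyCB polyCM.
exists h; split=> //; apply/seteqP; split; last by apply: span_sub => //; exact: idlI.
move=> x [I1x I2x].
(* Constants in I1 enter (h) after multiplication by P, among them WP - 1. Modulo P(WP - 1) the
   polynomial P F i equals P F i (wpX) = P W h i. *)
have e1 : ispan h (P ^+ 2 * x).
  have iD : is_ideal [set y | ispan h (P * y)].
    split; first by rewrite /= mulr0; exact: (idl0 ih).
      by move=> y z hy hz; rewrite /= mulrDr; exact: (idlD ih).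
    by move=> r y hy; rewrite /= mulrCA; exact: (idlM _ ih).
  have [c hc] := pF I1x; rewrite expr2 -mulrA hc mulr_sumr; apply: (idl_sum _ ih) => i _.
  rewrite mulrCA; apply: (idlM _ ih); rewrite -(subKr (sg (F i)) (F i)) mulrBr; apply: (idlB ih).
    by rewrite hF mulrCA; do 2!apply: (idlM _ ih); exact: span_mem.
  exact: (sgC (F i) _ iD h2).
(* A coefficient b of x lies in L, and (1 - p)b lies in I1 and I2, so it is a combination of the a
   i. Modulo P(1 - P), which is in (h), (1 - P) a i equals (1 - P) h i. *)
have e2 : ispan h ((1 - P) ^+ 2 * x).
  rewrite -[in X in ispan h X](coefK x) poly_def mulr_sumr; apply: (idl_sum _ ih) => j _.
  rewrite -mul_polyC mulrA; apply: (idlMr _ ih); have Lj := I2L I2x j.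
  set b := x`_j in Lj *.
  have [|c hc] := @Ia ((1 - P) * b%:P) _ (idlM _ i2 Lj).
    by apply: (idlMr _ i1); rewrite -opprB; exact: (idlN i1).
  rewrite hornerM hornerD hornerN /P !hornerC in hc.
  have -> : (1 - P) ^+ 2 * b%:P = (1 - P) * ((1 - p) * b)%:P by rewrite polyCM polyCB /P; ring.
  rewrite hc rmorph_sum mulr_sumr; apply: (idl_sum _ ih) => i _; rewrite rmorphM mulrCA; apply: (idlM _ ih).
  have -> : (1 - P) * (a i)%:P = (1 - P) * h i - P * (1 - P) * (sg (Q i) * 'X) by rewrite /h; ring.
  by apply: (idlB ih); [apply: (idlM _ ih); exact: span_mem|exact: (idlMr _ ih)].
have [|c [d cd]] := @comax_powers _ P (1 - P) 2 2; first by ring.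
have -> : x = c * (P ^+ 2 * x) + d * ((1 - P) ^+ 2 * x) by transitivity ((c * P ^+ 2 + d * (1 - P) ^+ 2) * x); [rewrite cd mul1r|ring].
by apply: (idlD ih); [exact: (idlM _ ih e1)|exact: (idlM _ ih e2)].
Qed.
End Descent.

(** * Krull dimension, Frobenius periods and the theorem *)

Lemma ndlt_chain (R : comPzRingType) d (P : set R) : is_prime_ideal P -> ~ dlt d P ->
  exists c : 'I_d.+1 -> set R, [/\ forall i, is_prime_ideal (c i), forall i, P `<=` c i &
    forall i j : 'I_d.+1, (i < j)%N -> c i `<` c j].
Proof.
elim: d P => [|d IH] P pP h.
  by exists (fun=> P); split=> [//|_ //|i j]; rewrite (ord1 i) (ord1 j).
have [P' [pP' [PP' nP'] nd]] : exists P', [/\ is_prime_ideal P', P `<` P' & ~ dlt d P'].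
  apply: contrapT => n; apply: h => P' pP' PP'; apply: contrapT => nd; apply: n; by exists P'.
have [c [pc Pc cc]] := IH P' pP' nd.
exists (fun i => if unlift ord0 i is Some j then c j else P); split.
- by move=> i; case: unlift.
- by move=> i; case: unlift => [j|] //; exact: subset_trans (Pc j).
move=> i j; case: (unliftP ord0 j) => [j' ->|->]; rewrite ?ltn0 //.
case: (unliftP ord0 i) => [i' ->|->]; first by rewrite !lift0 ltnS; exact: cc.
by move=> _; split; [exact: subset_trans (Pc j')|move=> h'; apply: nP'; exact: subset_trans (Pc j') h'].
Qed.

Lemma dlt_krull (R : comPzRingType) (I : set R) (iI : is_ideal I) d P :
  (krull_dim (quotient_ring iI) <= d%:Z%:E)%E -> is_prime_ideal P -> I `<=` P -> dlt d.+1 P.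
Proof.
move=> /krull_dim_le hd pP IP; apply: contrapT => /(ndlt_chain pP) [c [pc Pc cc]].
pose pr : {rmorphism R -> quotient_ring iI} := @quotient_proj R _ iI.
have prs : forall y, exists x, pr x = y by exact: quotient_proj_surj.
have ker i x : pr x = 0 -> c i x.
  rewrite -(rmorph0 pr) => /quotient_projP; rewrite subr0 => Ix; exact: Pc (IP _ Ix).
suff /hd : prime_chain_length (quotient_ring iI) d.+1 by rewrite ltnn.
exists (fun i => pr @` c i); split=> [i|i j ij]; first exact: (image_prime prs (pc i) (ker i)).
have [h1 h2] := cc i j ij; split; first exact: image_subset.
move=> h; apply: h2 => x cx; rewrite -(preim_image (prime_ideal (pc i)) (ker i)).
by apply: h; exists x.
Qed.

(** The powers X^(p^s) have only finitely many remainders modulo an equation of z over F_p. If those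
    for i < j agree, z^(p^(j-i)) - z has p^i-th power 0. *)
Lemma frobenius_periodic p (k : fieldType) (iota : {rmorphism 'F_p -> k}) z : prime p ->
  algebraicOver iota z -> exists2 s, (0 < s)%N & z ^+ (p ^ s) = z.
Proof.
move=> pp [q q0 /rootP qz].
pose r s := 'X^(p ^ s) %% q.
have zr s : (map_poly iota (r s)).[z] = z ^+ (p ^ s).
  have := congr1 (fun u => (map_poly iota u).[z]) (divp_eq 'X^(p ^ s) q).
  by rewrite rmorphD rmorphM /= hornerD hornerM qz mulr0 add0r map_polyXn hornerXn => ->.
have [i [j [ij /ffunP e]]] := pigeonhole_nat (fun s => [ffun l : 'I_(size q) => (r s)`_l]).
have rij : r i = r j.
  apply/polyP => l; have [lq|ql] := ltnP l (size q); first by have := e (Ordinal lq); rewrite !ffunE.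
  by rewrite !nth_default // (leq_trans _ ql) // ltnW // ltn_modp.
exists (j - i)%N; first by rewrite subn_gt0.
have p0 : p%:R = 0 :> k by rewrite -(rmorph_nat iota) (pcharf0 (pchar_Fp pp)) rmorph0.
have := congr1 (fun u => (map_poly iota u).[z]) rij; rewrite !zr => h.
have /eqP : (z ^+ (p ^ (j - i)) - z) ^+ (p ^ i) = 0.
  by rewrite frobenius_sub // -exprM -expnD subnK ?(ltnW ij) // h subrr.
by rewrite expf_eq0 subr_eq0 => /andP [_ /eqP].
Qed.

Lemma affine_gen (k : fieldType) (A : comAlgType k) : affine_algebra A ->
  exists X : seq A, alg_gen (in_alg A) [set` X].
Proof.
move=> [m [x hx]]; exists (codom x) => S sS Sc SX y; have [q ->] := hx y.
rewrite /mpoly.mmap; apply: (@sub_sum A S _ _ _ _ sS) => i _; apply: (subM sS); first exact: Sc.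
rewrite /mpoly.mmap1; apply: (big_ind S) => [|u v|l _]; [by case: sS|exact: subM|].
by apply: (subX _ sS); apply: SX; exact: codom_f.
Qed.

Theorem theorem6p1 (p : nat) (p_prime : prime p)
    (k : fieldType) (iota : {rmorphism 'F_p -> k})
    (k_closure : is_algebraic_closure iota)
    (A : comAlgType k) (A_affine : affine_algebra A)
    (I1 I2 : set {poly A})
    (I1_ideal : is_ideal I1) (I2_ideal : is_ideal I2)
    (I : set {poly A}) (IE : I = I1 `&` I2)
    (n : nat) (f : 'I_n -> {poly A}) (a : 'I_n -> A) :
  (exists2 g : {poly A}, I1 g & g \is monic) ->
  (forall i, I1 (f i)) ->
  I1 = ideal_add (ideal_gen (range f)) (ideal_mul I1 I1) ->
  (maxe (krull_dim (quotient_ring I1_ideal) + 1) 2 <= n%:Z%:E)%E ->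
  ideal_add I1 I2 = setT ->
  I2 = extension (eval0 I2) ->
  (forall i, eval0 I (a i)) ->
  eval0 I = ideal_gen (range a) ->
  (forall i, ideal_mul (eval0 I1) (eval0 I1) (a i - (f i).[0])) ->
  exists h : 'I_n -> {poly A},
    [/\ forall i, I (h i),
        I = ideal_gen (range h) &
        forall i, (h i).[0] = a i].
Proof.
move=> gI1 If I1E krull sum12 I2E Ia I0E hdiff.
have [kclosed kalg] := k_closure.
have pk : p \in [pchar k] := rmorph_pchar iota (pchar_Fp p_prime).
have kfin x := frobenius_periodic p_prime (kalg x).
have [X gX] := affine_gen A_affine.
have nA : noeth A := noeth_generated gX.
have [n2 kd] : (2 <= n)%N /\ (krull_dim (quotient_ring I1_ideal) <= n.-1%:Z%:E)%E.
  move: krull; rewrite ge_max => /andP [h1 h2]; have n2 : (2 <= n)%N by move: h2; rewrite lee_fin.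
  split=> //; move: h1; rewrite -leeBrDr // -EFinB; congr (_ <= _%:E)%E.
  by case: (n) n2 => // n' _; rewrite /= -addn1 PoszD addrK.
case: n n2 kd f a If I1E {krull} Ia I0E hdiff => [//|[//|m]] _ /= kd f a If I1E Ia I0E hdiff.
rewrite !span_gen in I1E I0E *.
pose L := polyC @^-1` I2; have iL : is_ideal L := preim_ideal polyC I2_ideal.
have evL c : eval0 I2 c -> L c.
  by move=> hc; rewrite /L /= I2E => D [iD hD]; apply: hD; exists c.
have I2L : I2 `<=` polyI L.
  rewrite {1}I2E => x; apply; split; first exact: polyI_ideal.
  by move=> _ [c /evL Lc <-]; exact: (polyI_C c iL).2.
have [g Ig mg] := gI1.
(* I1 is comaximal to the extension of L and contains a monic polynomial, so some constant s0 of I1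
   is 1 modulo L. Then 1 - s0 lies in L, carries I1 into I1 and I2, and becomes a unit when 1 + J is
   inverted. *)
have [s0 [Is0 [M [e]]]] : exists z, I1 z%:P /\ exists M e, L (z - lead_coef g ^+ M * 1 ^+ e).
  apply: (contraction_power I1_ideal Ig iL).
  have [x Ix [y Iy xy]] : ideal_add I1 I2 1 by rewrite sum12.
  by exists x => //; exists y => //; exact: I2L.
rewrite (monicP mg) !expr1n mulr1 => Ls0.
have Ispan x : I1 x -> I2 x -> ispan a x.[0].
  by move=> h1 h2; rewrite -I0E; exists x => //; rewrite IE.
have aI x : I1 x -> ispan a ((1 - s0) * x.[0]).
  move=> Ix; have := Ispan ((1 - s0)%:P * x); rewrite hornerM hornerC; apply; first exact: (idlM _ I1_ideal).
  by apply: (idlMr _ I2_ideal); exact: (idlC iL).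
have i11 : is_ideal (ideal_mul I1 I1) := ideal_mul_ideal I1 I1.
(* The differences lie in I1(0)^2 and lift to I1^2; adding the lifts gives the f i the values a i
   without changing their classes modulo I1^2. *)
have /choice [c hc] : forall i, exists c, ideal_mul I1 I1 c /\ c.[0] = a i - (f i).[0].
  move=> i; suff : ideal_mul (eval0 I1) (eval0 I1) `<=` [set y | exists c, ideal_mul I1 I1 c /\ c.[0] = y] by apply.
  apply: ideal_mul_sub => [|_ _ [x Ix <-] [y Iy <-]]; last by exists (x * y); rewrite hornerM; split=> //; exact: ideal_mulP.
  split; first by exists 0; rewrite horner0; split=> //; exact: (idl0 i11).
    by move=> x y [x' [h1 <-]] [y' [h2 <-]]; exists (x' + y'); rewrite hornerD; split=> //; exact: (idlD i11).
  by move=> r x [x' [h1 <-]]; exists (r%:P * x'); rewrite hornerM hornerC; split=> //; exact: (idlM _ i11).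
pose f' i := f i + c i.
have f'0 i : (f' i).[0] = a i by rewrite hornerD (proj2 (hc i)) addrC subrK.
have If' i : I1 (f' i) by apply: (idlD I1_ideal) => //; apply: (square_sub I1_ideal); exact: (proj1 (hc i)).
have iff := span_ideal f'.
have f'2 x : I1 x -> ideal_add (ispan f') (ideal_mul I1 I1) x.
  rewrite {1}I1E => -[y hy [z hz <-]]; apply: (idlD (ideal_add_ideal iff i11)); last exact: (addr_ iff).
  apply: (span_congr i11 _ hy) => i; rewrite /f' opprD addrA subrr add0r.
  by apply: (idlN i11); exact: (proj1 (hc i)).
have La i : L (a i).
  by have [x Ix <-] := Ia i; apply: evL; exists x => //; move: Ix; rewrite IE => -[].
(* A prime of A over J is the contraction of one over I1; the latter contains a monic polynomial, so
   the coheight bound passes down. *)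
have dJ (q : set A) : is_prime_ideal q -> (forall c, I1 c%:P -> q c) -> dlt m.+2 q.
  move=> pq hq; have [|P [pP IP Pq]] := lying_over I1_ideal Ig pq hq.
    by rewrite (monicP mg); exact: (prime_n1 pq).
  have -> : q = polyC @^-1` P by apply/seteqP; split=> z /Pq.
  exact: (dlt_contract pP (IP _ Ig) mg (dlt_krull kd pP IP)).
have [F [w [q [h1 h2 h3 h4 [h5 h6]]]]] : exists (F : 'I_m.+2 -> {poly A}) w q,
  [/\ forall i, I1 (F i), forall i, (F i).[0] = w * a i, I1 (w - 1)%:P, I1 (q - 1)%:P &
      L q /\ forall x, I1 x -> ispan F (q%:P * x)].
  (* If I1 is everything, 1 + J contains 0 and cannot be inverted. With p = 0 in [descend] the
     constants a i themselves generate. *)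
  have [I11|nI1] := pselect (I1 1).
    have I1T x : I1 x := idl1T I1_ideal I11 x.
    exists (fun i => (a i)%:P), 1, 0; split=> //.
      by move=> i; rewrite hornerC mul1r.
    split=> [|x _]; first exact: (idl0 iL).
    by rewrite mul0r; exact: (idl0 (span_ideal _)).
  have [F [w [q [h1 h2 h3 h4 h5]]]] :=
    generators_up_to_unit nA I1_ideal gI1 nI1 dJ gX kclosed pk kfin Is0 aI f'0 If' f'2.
  have iF := span_ideal F.
  (* The factor 1 - s0 puts the constant into L while it stays 1 modulo J, as [descend] requires. *)
  exists F, w, (q * (1 - s0)); split=> //.
    have -> : (q * (1 - s0) - 1)%:P = (q - 1)%:P - q%:P * s0%:P :> {poly A}.
      by rewrite -polyCM -polyCB; congr (_%:P); ring.
    by apply: (idlB I1_ideal) => //; exact: (idlM _ I1_ideal).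
  split=> [|x Ix]; first by apply: (idlM _ iL); exact: (idlC iL).
  by rewrite polyCM mulrAC; apply: (idlMr _ iF); exact: h5.
have [h [hI Ih h0]] := descend I1_ideal I2_ideal I2L La Ispan h1 h2 h3 h4 h5 h6.
by exists h; rewrite IE span_gen; split.
Qed.
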